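(* Let $0<c<\infty$ and let $(M,\phi)$ be a $c$ log-convergent nuclear $\sigma$-module ordinary at slope zero, with unit root part $(U_0,\phi_0)$ of rank $h_0=1$. Then for any $\varepsilon>0$ and any residue class $S$ of integers modulo $q-1$, endowed with the induced $p$-adic metric $d(k_1,k_2)=|k_1-k_2|_p$, the family of unit root zeta functions $L(\phi_0^k,T)$, $k\in S$, is a strong family in the open disc $|T|_\pi<p^{c-\varepsilon}$.
   Context: Let $p$ be a prime, $q$ a power of $p$, $K/\mathbf Q_p$ finite with residue field $\mathbf F_q$, uniformizer $\pi$, ring of integers $R$, $\mathrm{ord}_\pi\pi=1$, $|\pi|_\pi=1/p$. Fix $n\ge1$; $A_0=\{\sum_{u\in\mathbf Z^n}a_uX^u:a_u\in R,a_u\to0\text{ as }|u|\to\infty\}$ with Gauss norm, $\sigma(X^u)=X^{qu}$ ($R$-linear). A nuclear $\sigma$-module $(M,\phi)$: $M$ = all formal sums $\sum_{i\in I}a_ie_i$ ($a_i\in A_0$, $I\subseteq\mathbf Z_{>0}$ at most countable) with norm $\max\|a_i\|$; $\phi(\sum a_ie_i)=\sum\sigma(a_i)\phi(e_i)$, $\|\phi(e_i)\|\to0$. Matrix $B(X)=\sum_uB_uX^u$ via $\phi(e_j)=\sum_ib_{ij}e_i$; $c$ log-convergent: for some basis $\liminf_{|u|\to\infty}\mathrm{ord}_\pi B_u/\log_q|u|\ge c$. For a closed point $\bar x$ of $\mathbf G_m^n/\mathbf F_q$ of degree $d$ with Teichmüller lift $x$, $B_{\bar x}=B(x)\cdots B(x^{q^{d-1}})$.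 Ordinary at slope zero: for some basis, with $h_0$ the smallest integer with $\phi(e_j)\equiv0\pmod\pi$ for $j>h_0$, every Fredholm determinant $\det(I-B_{\bar x}T)$ has exactly $h_0$ unit reciprocal zeros. For $k\in\mathbf Z$, $L(\phi_0^k,T)=\prod_{\bar x}\prod_\alpha(1-\alpha^kT^{\deg\bar x})^{-1}$ over those unit reciprocal zeros $\alpha$; it lies in $1+TR[[T]]$. For a family $f(k,T)=\sum_{m\ge0}f_m(k)T^m$ ($f_0=1$, $f_m(k)\in R$, $k\in S$): uniformly continuous means each $f_m:S\to R$ is uniformly continuous; uniformly analytic in $|T|_\pi<p^{c'}$ means $\liminf_{m\to\infty}\inf_k\mathrm{ord}_\pi f_m(k)/m\ge c'$; a strong family in $|T|_\pi<p^{c'}$ is a quotient $f_1/f_2$ of two such families each uniformly continuous and uniformly analytic in $|T|_\pi<p^{c'}$. *)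

(* Defs.v *)
From HB Require Import structures.
From mathcomp Require Import all_boot all_order all_algebra finmap.
From mathcomp Require Import all_classical all_reals all_analysis.
From mathcomp Require Import showcase.summability.

Set Implicit Arguments.
Unset Strict Implicit.
Unset Printing Implicit Defensive.

Import Order.TTheory GRing.Theory Num.Theory.
Import numFieldNormedType.Exports.

Local Open Scope classical_set_scope.
Local Open Scope ring_scope.

(* A complete algebraically closed extension of Q_p (such as C_p), with a    *)
(* multiplicative non-archimedean absolute value [pabs] extending a power of *)
(* the p-adic one, together with its residue field [kap].  All p-adic        *)
(* objects below live in it.  The library's normed structures cannot be used *)
(* for [pabs], since they require |x *+ n| = |x| *+ n.                       *)
Record padicField (RR : realType) (p : nat) := PadicField {
  Om :> closedFieldType;
  pabs : Om -> RR;
  pabs_ge0 : forall x, 0 <= pabs x;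
  pabs_eq0 : forall x, pabs x = 0 <-> x = 0;
  pabsM : forall x y, pabs (x * y) = pabs x * pabs y;
  pabsD : forall x y, pabs (x + y) <= Num.max (pabs x) (pabs y);
  Om_char0 : [pchar Om] =i pred0;
  pabs_p : pabs p%:R < 1;
  Om_complete : forall s : nat -> Om,
    (forall e : RR, 0 < e -> exists N : nat, forall i j : nat,
       (N <= i)%N -> (N <= j)%N -> pabs (s i - s j) < e) ->
    exists l : Om, (fun i => pabs (s i - l)) @ \oo --> (0 : RR);
  kap : fieldType;
  (* meaningful on the valuation ring only *)
  red : Om -> kap;
  red1 : red 1 = 1;
  redD : forall x y, pabs x <= 1 -> pabs y <= 1 ->
    red (x + y) = red x + red y;
  redM : forall x y, pabs x <= 1 -> pabs y <= 1 ->
    red (x * y) = red x * red y;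
  red_eq0 : forall x, pabs x <= 1 -> (red x = 0 <-> pabs x < 1);
  red_surj : forall y, exists2 x, pabs x <= 1 & red x = y
}.

Section Ambient.
Variables (RR : realType) (p : nat) (Cp : padicField RR p).

(* Q_p is the completion of Q inside Cp *)
Definition Qp : set Cp :=
  [set x | exists s : nat -> rat,
     (fun i => pabs (ratr (s i) - x)) @ \oo --> (0 : RR)].

Definition subfield (K : set Cp) : Prop :=
  [/\ K 1, forall x y, K x -> K y -> K (x - y)
         & forall x y, K x -> K y -> K (x * y) /\ K (x^-1)].

Definition finite_over_Qp (K : set Cp) : Prop :=
  exists (d : nat) (w : 'I_d -> Cp),
    K = [set x | exists2 c : 'I_d -> Cp, (forall i, Qp (c i))
                                       & x = \sum_(i < d) c i * w i].

Definition ps : Type := nat -> Cp.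

Definition ps1 : ps := fun m => (m == 0)%:R.

Definition psmul (f g : ps) : ps :=
  fun m => \sum_(i < m.+1) f i * g (m - i)%N.

(* (1 - a T^d)^-1, as a geometric series, for 0 < d *)
Definition geomT (a : Cp) (d : nat) : ps :=
  fun m => if (d %| m)%N then a ^+ (m %/ d) else 0.

(* unconditional sums in Cp; junk value 0 if divergent *)
Definition nasum (T : choiceType) (f : T -> Cp) : Cp :=
  xget 0 [set s | (fun F : {fset T} => pabs (\sum_(t <- F) f t - s))
                    @ totally --> (0 : RR)].

(* infinite matrices, indexed by nat *)
Definition imx : Type := nat -> nat -> Cp.

Definition imx1 : imx := fun i j => (i == j)%:R.

Definition imxmul (A B : imx) : imx :=
  fun i j => nasum (fun l : nat => A i l * B l j).

(* det (I - A T): the coefficient of T^m is (-1)^m times the sum of the      *)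
(* principal m x m minors of A.                                              *)
Definition fredholm (A : imx) : ps := fun m =>
  (-1) ^+ m * nasum (fun t : m.-tuple nat =>
    if sorted ltn t then \det (\matrix_(i, j) A (tnth t i) (tnth t j)) else 0).

Definition ps_cvg (f : ps) (x : Cp) : Prop :=
  (fun m => pabs (f m * x ^+ m)) @ \oo --> (0 : RR).

Definition ps_val (f : ps) (x : Cp) : Cp := nasum (fun m : nat => f m * x ^+ m).

(* a is a reciprocal zero of f of multiplicity m (m = 0: not a zero) *)
Definition rzero_mult (f : ps) (a : Cp) (m : nat) : Prop :=
  exists g : ps,
    [/\ f = psmul (fun i => ((1 - a *: 'X) ^+ m : {poly Cp})`_i) g,
        ps_cvg g a^-1 & ps_val g a^-1 != 0].

(* s lists the unit reciprocal zeros of f, with multiplicity *)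
Definition unit_rzeros (f : ps) (s : seq Cp) : Prop :=
  (forall a, a \in s -> pabs a = 1) /\
  (forall a, pabs a = 1 -> rzero_mult f a (count_mem a s)).

End Ambient.

(* A finite extension K of Q_p with residue field F_q; pabs is normalised by *)
(* the uniformizer.                                                          *)
Record localField (RR : realType) (p : nat) (Cp : padicField RR p) (q : nat) :=
LocalField {
  lfK : set Cp;
  lfK_subfield : subfield lfK;
  lfK_Qp : @Qp _ _ Cp `<=` lfK;
  lfK_finite : finite_over_Qp lfK;
  lfpi : Cp;
  lfpi_K : lfK lfpi;
  lfpi_abs : pabs lfpi = p%:R^-1;
  lfpi_gen : forall x, lfK x -> pabs x < 1 ->
    exists2 y, lfK y /\ pabs y <= 1 & x = lfpi * y;
  lf_res : ((@red _ _ Cp) @` [set x | lfK x /\ pabs x <= 1] #= `I_q)%card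
}.

Section SigmaModules.
Variables (RR : realType) (p q : nat) (Cp : padicField RR p).
Variables (K : localField Cp q) (n : nat).

Definition lfR : set Cp := [set x | lfK K x /\ pabs x <= 1].

(* ord_pi, as |pi| = 1/p *)
Definition ordpi (x : Cp) : \bar RR :=
  if x == 0 then +oo%E else (- (ln (pabs x) / ln p%:R))%:E.

Definition expo := 'rV[int]_n.

Definition usize (u : expo) : nat := (\sum_(i < n) `|u ord0 i|)%N.

(* |u| tends to infinity *)
Definition usize_oo : set_system expo :=
  filter_from [set: nat] (fun N => [set u | (N <= usize u)%N]).

Definition laurent : Type := expo -> Cp.

Definition A0 : set laurent :=
  [set a | (forall u, lfR (a u)) /\
           (fun u => pabs (a u)) @ usize_oo --> (0 : RR)].

Definition gauss (a : laurent) : RR := sup (range (fun u => pabs (a u))).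

Definition lmul (a b : laurent) : laurent :=
  fun w => nasum (fun u : expo => a u * b (w - u)).

Definition lsigma (a : laurent) : laurent := fun w =>
  if [forall i, (q%:Z %| w ord0 i)%Z]
  then a (map_mx (fun z : int => (z %/ q%:Z)%Z) w) else 0.

(* x^u, for x with nonzero coordinates *)
Definition monom (x : 'rV[Cp]_n) (u : expo) : Cp := \prod_(i < n) x 0 i ^ u 0 i.

Definition leval (a : laurent) (x : 'rV[Cp]_n) : Cp :=
  nasum (fun u : expo => a u * monom x u).

(* The module of all formal sums over I: coordinate families, set to 0       *)
(* outside I.                                                                *)
Definition vec : Type := nat -> laurent.

Definition formal (I : set nat) : set vec :=
  [set v | (forall i, I i -> A0 (v i)) /\ (forall i, ~ I i -> v i = fun=> 0)].

Definition vnorm (v : vec) : RR := sup (range (fun i => gauss (v i))).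

Definition evec (j : nat) : vec :=
  fun i u => if (i == j) && (u == 0) then 1 else 0.

Record sigmaModule := SigmaModule {
  smI : set nat;
  smI_pos : forall i, smI i -> (0 < i)%N;
  smphi : vec -> vec;
  smphi_M : forall v, formal smI v -> formal smI (smphi v);
  smphi_semilinear : forall v, formal smI v ->
    (fun N => vnorm (fun i u =>
       \sum_(0 <= j < N | j \in smI)
          lmul (lsigma (v j)) (smphi (evec j) i) u - smphi v i u))
      @ \oo --> (0 : RR);
  smphi_nuclear : forall e : RR, 0 < e -> exists N : nat, forall j : nat,
    smI j -> (N <= j)%N -> vnorm (smphi (evec j)) < e
}.

(* v is the formal sum of the a_j f_j: convergence in each coordinate *)
Definition formal_sum (f : nat -> vec) (a : vec) (v : vec) : Prop :=
  forall i, (fun N => gauss (fun u =>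
       \sum_(0 <= j < N) lmul (a j) (f j i) u - v i u)) @ \oo --> (0 : RR).

(* (f_j), j in J, is a basis of M: M consists of all formal sums of the      *)
(* a_j f_j, uniquely, with norm max |a_j|                                    *)
Definition is_basis (M : sigmaModule) (J : set nat) (f : nat -> vec) : Prop :=
  [/\ forall j, J j -> (0 < j)%N /\ formal (smI M) (f j),
      forall a, formal J a -> exists2 v, formal (smI M) v & formal_sum f a v,
      forall v, formal (smI M) v ->
        exists! a, formal J a /\ formal_sum f a v
    & forall a v, formal J a -> formal (smI M) v -> formal_sum f a v ->
        vnorm v = vnorm a].

Definition bmatrix : Type := nat -> nat -> laurent.

(* phi (f_j) = sum_i b_ij f_i for j in J, and b_ij = 0 for j outside J *)
Definition is_matrix (M : sigmaModule) (J : set nat) (f : nat -> vec)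
    (b : bmatrix) : Prop :=
  (forall j, J j -> formal J (fun i => b i j) /\
                    formal_sum f (fun i => b i j) (smphi M (f j))) /\
  (forall j, ~ J j -> forall i, b i j = fun=> 0).

Definition std_matrix (M : sigmaModule) : bmatrix :=
  fun i j => if j \in smI M then smphi M (evec j) i else fun=> 0.

Definition ord_coef (b : bmatrix) (u : expo) : \bar RR :=
  ereal_inf [set ordpi (b ij.1 ij.2 u) | ij in [set: nat * nat]].

Definition log_convergent (M : sigmaModule) (c : RR) : Prop :=
  exists (J : set nat) (f : nat -> vec) (b : bmatrix),
    [/\ is_basis M J f, is_matrix M J f b &
      (c%:E <= limf_einf (fun u : discrete_topology expo =>
         ord_coef b u * ((ln (usize u)%:R / ln q%:R)^-1)%:E) usize_oo)%E].

Definition frob (y : 'rV[kap Cp]_n) : 'rV[kap Cp]_n :=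
  map_mx (fun z => z ^+ q) y.

(* closed points of G_m^n over F_q, as Frobenius orbits of points with       *)
(* coordinates in the algebraic closure of F_q inside kap                    *)
Definition closed_point (P : set 'rV[kap Cp]_n) : Prop :=
  exists y : 'rV[kap Cp]_n,
    [/\ forall i, y 0 i != 0, exists2 m, (0 < m)%N & iter m frob y = y
      & P = range (fun j => iter j frob y)].

Definition cp_deg (P : set 'rV[kap Cp]_n) : nat := #|` fset_set P|.

Definition teichmuller (P : set 'rV[kap Cp]_n) (x : 'rV[Cp]_n) : Prop :=
  P (map_mx (@red _ _ Cp) x) /\
  forall i, pabs (x 0 i) <= 1 /\ x 0 i ^+ (q ^ cp_deg P) = x 0 i.

Definition teich (P : set 'rV[kap Cp]_n) : 'rV[Cp]_n := xget 0 (teichmuller P).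

Definition mat_at (b : bmatrix) (x : 'rV[Cp]_n) : imx Cp :=
  fun i j => leval (b i j) x.

(* B(x) B(x^q) ... B(x^(q^(d-1))) *)
Definition mat_point (b : bmatrix) (P : set 'rV[kap Cp]_n) : imx Cp :=
  foldr (@imxmul _ _ Cp) (imx1 Cp)
    [seq mat_at b (map_mx (fun z => z ^+ (q ^ k)) (teich P))
       | k <- iota 0 (cp_deg P)].

Definition det_point (b : bmatrix) (P : set 'rV[kap Cp]_n) : ps Cp :=
  fredholm (mat_point b P).

(* v = 0 mod pi *)
Definition pi_divides (M : sigmaModule) (v : vec) : Prop :=
  exists2 w, formal (smI M) w & v = fun i u => lfpi K * w i u.

Definition phi0_from (M : sigmaModule) (J : set nat) (f : nat -> vec)
    (h : nat) : Prop :=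
  forall j, J j -> (h < j)%N -> pi_divides M (smphi M (f j)).

Definition ordinary (M : sigmaModule) (h0 : nat) : Prop :=
  exists (J : set nat) (f : nat -> vec) (b : bmatrix),
    [/\ is_basis M J f, is_matrix M J f b,
        phi0_from M J f h0 /\ (forall h, phi0_from M J f h -> (h0 <= h)%N)
      & forall P, closed_point P ->
          exists2 s, unit_rzeros (det_point b P) s & size s = h0].

Definition unit_roots (M : sigmaModule) (P : set 'rV[kap Cp]_n) : seq Cp :=
  xget [::] (unit_rzeros (det_point (std_matrix M) P)).

Definition euler (M : sigmaModule) (k : int) (P : set 'rV[kap Cp]_n) : ps Cp :=
  if pselect (closed_point P) then
    \big[@psmul _ _ Cp/ps1 Cp]_(a <- unit_roots M P)
      geomT (a ^ k) (cp_deg P)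
  else ps1 Cp.

(* infinite product over the closed points, in the T-adic topology: each     *)
(* coefficient is eventually constant along finite products                  *)
Definition unit_root_zeta (M : sigmaModule) (k : int) : ps Cp := fun m =>
  xget 0 [set l | totally [set F : {fset set 'rV[kap Cp]_n} |
    (\big[@psmul _ _ Cp/@ps1 _ _ Cp]_(P <- F) euler M k P) m = l]].

Definition residue_class (r : int) : set int :=
  [set k : int | (k = r %[mod (q%:Z - 1)])%Z].

Definition padic_int (m : int) : RR :=
  if m == 0 then 0 else p%:R ^- logn p `|m|%N.

Definition ps_family (S : set int) (f : int -> ps Cp) : Prop :=
  forall k, S k -> f k 0%N = 1 /\ forall m, lfR (f k m).

Definition uniformly_continuous (S : set int) (f : int -> ps Cp) : Prop :=
  forall (m : nat) (e : RR), 0 < e -> exists2 d : RR, 0 < d &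
    forall k1 k2, S k1 -> S k2 -> padic_int (k1 - k2) < d ->
      pabs (f k1 m - f k2 m) < e.

Definition uniformly_analytic (S : set int) (c : RR) (f : int -> ps Cp) : Prop :=
  (c%:E <= limn_einf (fun m =>
     ereal_inf [set ordpi (f k m) | k in S] * (m%:R^-1)%:E))%E.

(* in the open disc |T| < p^c *)
Definition strong_family (S : set int) (c : RR) (f : int -> ps Cp) : Prop :=
  exists f1 f2 : int -> ps Cp,
    [/\ [/\ ps_family S f1, uniformly_continuous S f1 & uniformly_analytic S c f1],
        [/\ ps_family S f2, uniformly_continuous S f2 & uniformly_analytic S c f2]
      & forall k, S k -> psmul (f k) (f2 k) = f1 k].

End SigmaModules.

(* Main.v *)
(** Two bases of a sigma-module give matrices whose values along a Frobenius orbit have the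
    same Fredholm determinant, since det(I - XY) = det(I - YX).  In a log-convergent basis the
    matrix B is congruent to a matrix of rank one modulo pi, because h_0 = 1, and its trace is
    a unit at all torsion points, hence congruent to a monomial c X^v.  Splitting off the rank
    one part replaces B by c X^v Z, where Z_00 = 1 and all columns of Z but the first vanish
    modulo pi, with the same logarithmic decay.

    The unit root at a torsion point x of degree d is then c^d chi(x) al with al = 1 modulo pi.
    Partial fractions of the reciprocal of the Fredholm determinant of Z express al^k as the
    sum over i >= 1 of (-1)^(i-1) i H al^(k-i) e_i, with e_i the trace of the i-th exterior
    power, and H al^N is the limit, over N running through large integers p-adically close to
    the exponent, of the trace of the N-th symmetric power.  The i-th term is at most
    p^(-(i-1)d), so that finitely many i matter.  By the Dwork trace formula the generating
    series of each of them is a quotient of products of Fredholm determinants of operators on Laurent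
    polynomials, and the weights (1 + delta |u|)^kappa bound these determinants by
    C q^(-kappa m), uniformly in N. *)

From HB Require Import structures.
Require Import Defs.
From mathcomp Require Import all_boot all_order all_algebra finmap.
From mathcomp Require Import all_fingroup cyclic separable cyclotomic.
From mathcomp Require Import all_classical all_reals all_analysis.
From mathcomp Require Import showcase.summability.
From mathcomp Require Import zify ring lra.

Set Implicit Arguments.
Unset Strict Implicit.
Unset Printing Implicit Defensive.

Import Order.TTheory GRing.Theory Num.Theory.
Import numFieldNormedType.Exports.

Local Open Scope classical_set_scope.
Local Open Scope ring_scope.

(** * Non-archimedean sums *)

(** For general k the sums of [al ^ k] over torsion points are not directly traces; symmetric powers
    supply traces only in degrees N tending to infinity, so every bound must be independent of N.
    This works because in a monomial of non-negligible weight only the index 0 can occur with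
    unbounded multiplicity: the weighted column norms satisfy [theta 0 = 1] and theta at most 3/4
    elsewhere. Logarithmic decay excludes exponential weights; (1 + delta|u|)^kappa is
    submultiplicative and gains a factor tending to q^(-kappa) under u -> qu, while a small delta
    keeps it near 1 on the finitely many exponents whose coefficients are not yet small. Splitting
    off a monomial leaves a factor whose k-th power is explicit: chi^(q-1) = 1, so chi^k depends
    only on the class of k modulo q - 1, and one exponent vector serves the whole class S. Traces
    and determinants are computed for finite matrices of Laurent polynomials, and limits are taken
    coefficient by coefficient. The neglected tail of the partial fraction sum is only known to be
    small, so integrality and continuity of the numerator are obtained from the L-series itself. *)

Section Nonarch.
Variables (RR : realType) (p : nat) (Cp : padicField RR p).
Local Notation V := (@pabs _ _ Cp).
Implicit Types (x y z : Cp) (e : RR).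

Lemma pabs0 : V 0 = 0.
Proof. by apply/pabs_eq0. Qed.

Lemma pabs_gt0 x : (0 < V x) = (x != 0).
Proof.
rewrite lt_neqAle pabs_ge0 andbT eq_sym; congr (~~ _).
by apply/eqP/eqP => /pabs_eq0.
Qed.

Lemma pabs1 : V 1 = 1.
Proof.
have h : V 1 != 0 by rewrite gt_eqF // pabs_gt0 oner_eq0.
by apply: (mulfI h); rewrite -pabsM !mulr1.
Qed.

Lemma pabsX x m : V (x ^+ m) = V x ^+ m.
Proof.
by elim: m => [|m IH]; rewrite ?expr0 ?pabs1 // !exprS pabsM IH.
Qed.

Lemma pabsN1 : V (-1) = 1.
Proof.
have h : V (-1) ^+ 2 = 1 by rewrite -pabsX sqrrN expr1n pabs1.
apply/eqP; move/eqP: h; rewrite sqrf_eq1 => /orP[//|/eqP h].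
by have := pabs_ge0 (-1 : Cp); rewrite h; lra.
Qed.

Lemma pabsN x : V (- x) = V x.
Proof. by rewrite -mulN1r pabsM pabsN1 mul1r. Qed.

Lemma pabsBC x y : V (x - y) = V (y - x).
Proof. by rewrite -pabsN opprB. Qed.

Lemma pabsV x : V x^-1 = (V x)^-1.
Proof.
have [->|x0] := eqVneq x 0; first by rewrite invr0 pabs0 invr0.
have vx : V x != 0 by rewrite gt_eqF // pabs_gt0.
by apply: (mulfI vx); rewrite -pabsM !divff // pabs1.
Qed.

Lemma pabs_exprz x (k : int) : V (x ^ k) = V x ^ k.
Proof.
by case: k => m; rewrite ?NegzE -?exprnP -?exprnN ?pabsV pabsX // -exprVn.
Qed.

Lemma pabsD_le x y e : V x <= e -> V y <= e -> V (x + y) <= e.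
Proof. by move=> hx hy; apply: le_trans (pabsD _ _) _; rewrite ge_max hx hy. Qed.

Lemma pabsB_le x y e : V x <= e -> V y <= e -> V (x - y) <= e.
Proof. by move=> hx hy; apply: pabsD_le; rewrite ?pabsN. Qed.

Lemma pabsD_lt x y e : V x < e -> V y < e -> V (x + y) < e.
Proof. by move=> hx hy; apply: le_lt_trans (pabsD _ _) _; rewrite gt_max hx hy. Qed.

Lemma pabsB_lt x y e : V x < e -> V y < e -> V (x - y) < e.
Proof. by move=> hx hy; apply: pabsD_lt; rewrite ?pabsN. Qed.

Lemma pabs_chain y x z e : V (x - y) <= e -> V (y - z) <= e -> V (x - z) <= e.
Proof. by move=> h1 h2; rewrite -(subrK y x) -addrA; apply: pabsD_le. Qed.

Lemma pabs_sum (I : Type) (r : seq I) (P : pred I) (F : I -> Cp) e : 0 <= e ->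
  (forall i, P i -> V (F i) <= e) -> V (\sum_(i <- r | P i) F i) <= e.
Proof.
move=> e0 h; apply: (big_ind (fun x => V x <= e)) => //; first by rewrite pabs0.
by move=> x y; apply: pabsD_le.
Qed.

Lemma pabs_sumr (I : eqType) (r : seq I) (P : pred I) (F : I -> Cp) e : 0 <= e ->
  (forall i, i \in r -> P i -> V (F i) <= e) -> V (\sum_(i <- r | P i) F i) <= e.
Proof.
move=> e0 h; rewrite big_seq_cond; apply: pabs_sum => // i /andP[]; exact: h.
Qed.

Lemma pabs_prod (I : Type) (r : seq I) (P : pred I) (F : I -> Cp) :
  V (\prod_(i <- r | P i) F i) = \prod_(i <- r | P i) V (F i).
Proof. by apply: (big_morph V) => [x y|]; rewrite ?pabsM ?pabs1. Qed.

Lemma pabs_nat m : V m%:R <= 1.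
Proof.
elim: m => [|m IH]; first by rewrite pabs0.
by rewrite -natr1; apply: pabsD_le => //; rewrite pabs1.
Qed.

Lemma pabsM_le x y a b : V x <= a -> V y <= b -> V (x * y) <= a * b.
Proof. by move=> ha hb; rewrite pabsM ler_pM // pabs_ge0. Qed.

Lemma pabsM_le1 x y : V x <= 1 -> V y <= 1 -> V (x * y) <= 1.
Proof. by move=> ha hb; rewrite -(mulr1 1); apply: pabsM_le. Qed.

Lemma pabsMl_le x y e : V x <= 1 -> V y <= e -> V (x * y) <= e.
Proof. by move=> ha hb; rewrite -(mul1r e); apply: pabsM_le. Qed.

Lemma pabsMr_le x y e : V x <= e -> V y <= 1 -> V (x * y) <= e.
Proof. by move=> ha hb; rewrite mulrC; apply: pabsMl_le. Qed.

Lemma pabsX_le1 x m : V x <= 1 -> V (x ^+ m) <= 1.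
Proof. by move=> h; rewrite pabsX exprn_ile1 // pabs_ge0. Qed.

Lemma pabs_prod_le1 (I : Type) (r : seq I) (P : pred I) (F : I -> Cp) :
  (forall i, P i -> V (F i) <= 1) -> V (\prod_(i <- r | P i) F i) <= 1.
Proof. by move=> h; elim/big_ind: _ => //; [rewrite pabs1|exact: pabsM_le1]. Qed.

Lemma pabsB_prod (I : Type) (r : seq I) (P : pred I) (F G : I -> Cp) e : 0 <= e ->
  (forall i, P i -> V (F i) <= 1) -> (forall i, P i -> V (G i) <= 1) ->
  (forall i, P i -> V (F i - G i) <= e) ->
  V (\prod_(i <- r | P i) F i - \prod_(i <- r | P i) G i) <= e.
Proof.
move=> e0 hF hG hFG.
suff : [/\ V (\prod_(i <- r | P i) F i) <= 1, V (\prod_(i <- r | P i) G i) <= 1 &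
   V (\prod_(i <- r | P i) F i - \prod_(i <- r | P i) G i) <= e] by case.
apply: (big_ind2 (fun x y => [/\ V x <= 1, V y <= 1 & V (x - y) <= e]))
  => [|x y z t [h1 h2 h3] [h4 h5 h6]|i Pi].
- by rewrite pabs1 subrr pabs0.
- split; [exact: pabsM_le1|exact: pabsM_le1|].
  have -> : x * z - y * t = x * (z - t) + (x - y) * t by ring.
  by apply: pabsD_le; [exact: pabsMl_le|exact: pabsMr_le].
- by split; [exact: hF|exact: hG|exact: hFG].
Qed.

Lemma pabs_dominant x y : V y < V x -> V (x + y) = V x.
Proof.
move=> h; apply/eqP; rewrite eq_le; apply/andP; split.
  by apply: le_trans (pabsD _ _) _; rewrite max_l // ltW.
rewrite leNgt; apply/negP => h2.
by have := pabsB_lt h2 h; rewrite addrK ltxx.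
Qed.

Lemma pabs_le0_eq x y : (forall e, 0 < e -> V (x - y) <= e) -> x = y.
Proof.
move=> h; apply/eqP; rewrite -subr_eq0 -[_ == 0]negbK -pabs_gt0; apply/negP => h0.
by have := h _ (divr_gt0 h0 (ltr0Sn _ 1)); rewrite leNgt => /negP; apply; lra.
Qed.

Definition pcvg (u : nat -> Cp) (l : Cp) :=
  forall e, 0 < e -> exists N, forall m, (N <= m)%N -> V (u m - l) <= e.

Lemma pcvgP u l : (fun i => V (u i - l)) @ \oo --> (0 : RR) <-> pcvg u l.
Proof.
split=> [/cvgrPdist_le h e e0|h].
  have [N _ hN] := h e e0; exists N => m hm.
  by have := hN m hm; rewrite /= sub0r normrN ger0_norm // pabs_ge0.
apply/cvgrPdist_le => e e0; have [N hN] := h e e0.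
by exists N => // m hm /=; rewrite sub0r normrN ger0_norm ?pabs_ge0 //; apply: hN.
Qed.

Lemma pcauchy_lim (u : nat -> Cp) :
  (forall e, 0 < e -> exists N, forall i j, (N <= i)%N -> (N <= j)%N -> V (u i - u j) <= e) ->
  exists l, pcvg u l.
Proof.
move=> h; have [e e0|l /pcvgP hl] := @Om_complete _ _ Cp u; last by exists l.
have e2 : 0 < e / 2 by rewrite divr_gt0.
have [N hN] := h _ e2; exists N => i j hi hj.
by apply: le_lt_trans (hN i j hi hj) _; lra.
Qed.

Lemma pcvg_uniq u l l' : pcvg u l -> pcvg u l' -> l = l'.
Proof.
move=> h h'; apply: pabs_le0_eq => e e0.
have [N hN] := h e e0; have [N' hN'] := h' e e0.
apply: (@pabs_chain (u (maxn N N'))); first by rewrite pabsBC; apply: hN; rewrite leq_maxl.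
by apply: hN'; rewrite leq_maxr.
Qed.

Lemma pcvg_le u l e : pcvg u l -> (exists N, forall m, (N <= m)%N -> V (u m) <= e) -> V l <= e.
Proof.
move=> h [N hN]; apply/ler_addgt0Pr => d d0.
have [N' hN'] := h d d0.
rewrite -(subKr (u (maxn N N')) l).
have he : 0 <= e by apply: le_trans (hN N (leqnn _)); apply: pabs_ge0.
apply: pabsB_le; first by apply: le_trans (hN _ (leq_maxl _ _)) _; lra.
by apply: le_trans (hN' _ (leq_maxr _ _)) _; lra.
Qed.

(** In a complete non-archimedean field a family is summable exactly when its terms become small
    outside finite sets. *)
Definition pnull (T : choiceType) (f : T -> Cp) :=
  forall e, 0 < e -> exists F : {fset T}, forall t, t \notin F -> V (f t) <= e.

Lemma pabs_bigD_fset (T : choiceType) (f : T -> Cp) (F G : {fset T}) e : 0 <= e ->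
  (forall t, t \notin F -> V (f t) <= e) -> (F `<=` G)%fset ->
  V (\sum_(t <- G) f t - \sum_(t <- F) f t) <= e.
Proof.
move=> e0 h FG.
rewrite (big_fsetID _ (fun t => t \in F) G) /=.
have -> : [fset x in G | x \in F]%fset = F.
  apply/fsetP => x; rewrite !inE /= andbC; case xF: (x \in F) => //=.
  exact: (fsubsetP FG).
rewrite [_ + _ - _]addrC addKr; apply: pabs_sumr => // t; rewrite !inE => /andP[_ tF] _; exact: h.
Qed.

(** Finite sums over two sets outside of which all terms are at most e differ by at most e, as the
    comparison with their union shows. Hence the partial sums converge, and the total differs from
    any such finite sum by at most e. Later estimates of infinite sums rest on this bound. *)
Lemma nasum_sub (T : choiceType) (f : T -> Cp) : pnull f ->
  forall (F : {fset T}) e, 0 <= e -> (forall t, t \notin F -> V (f t) <= e) ->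
  V (nasum f - \sum_(t <- F) f t) <= e.
Proof.
move=> hf.
have tPF : ProperFilter (@totally T) := totally_filter.
have tF : Filter (@totally T) by case: tPF.
pose ee (N : nat) : RR := N.+1%:R^-1.
have ee0 N : 0 < ee N by rewrite invr_gt0.
pose F_ N := projT1 (cid (hf _ (ee0 N))).
have hF N : forall t, t \notin F_ N -> V (f t) <= ee N by rewrite /F_; case: cid.
pose s N := \sum_(t <- F_ N) f t.
have key (F G : {fset T}) e : 0 <= e -> (forall t, t \notin F -> V (f t) <= e) ->
   (forall t, t \notin G -> V (f t) <= e) -> V (\sum_(t <- F) f t - \sum_(t <- G) f t) <= e.
  move=> e0 h1 h2; apply: (@pabs_chain (\sum_(t <- (F `|` G)%fset) f t)).
    by rewrite pabsBC; apply: pabs_bigD_fset => //; apply: fsubsetUl.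
  by apply: pabs_bigD_fset => //; apply: fsubsetUr.
have eeN e : 0 < e -> exists N, forall m, (N <= m)%N -> ee m <= e.
  move=> e0; exists (Num.truncn e^-1) => m hm.
  rewrite /ee -[leRHS]invrK lef_pV2 ?posrE ?invr_gt0 //.
  have /ltW := truncnS_gt (e^-1); move=> h; apply: le_trans h _.
  by rewrite ler_nat ltnS.
have [l hl] : exists l, pcvg s l.
  apply: pcauchy_lim => e e0; have [N hN] := eeN e e0; exists N => i j hi hj.
  by apply: key; rewrite ?(ltW e0) // => t ht; apply: le_trans (hF _ _ ht) _; exact: hN.
have fin (F : {fset T}) e : 0 <= e -> (forall t, t \notin F -> V (f t) <= e) ->
    V (l - \sum_(t <- F) f t) <= e.
  move=> e0 h; apply/ler_addgt0Pr => d d0.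
  have [N hN] := hl d d0; have [N' hN'] := eeN d d0.
  apply: (@pabs_chain (s (maxn N N'))).
    by rewrite pabsBC; apply: le_trans (hN _ (leq_maxl _ _)) _; lra.
  apply: key; first by lra.
    by move=> t ht; apply: le_trans (hF _ _ ht) _; apply: le_trans (hN' _ (leq_maxr _ _)) _; lra.
  by move=> t ht; apply: le_trans (h _ ht) _; lra.
suff -> : nasum f = l by exact: fin.
have P1 : (fun F : {fset T} => V (\sum_(t <- F) f t - l)) @ totally --> (0 : RR).
  apply/cvgrPdist_le => e e0.
  have [F0 hF0] := hf e e0.
  exists F0 => // F /= F0F; rewrite sub0r normrN ger0_norm ?pabs_ge0 // pabsBC.
  apply: fin; rewrite ?(ltW e0) // => t tnF; apply: hF0.
  by apply: contra tnF => tnF; exact: (fsubsetP F0F).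
(* The chosen value agrees with l, because both are limits along the filter of finite sets. *)
rewrite /nasum; case: xgetP => [s0 _ hs0|/(_ l)]; last by move/(_ P1).
apply: pabs_le0_eq => e e0.
have a1 (u : Cp) : (fun F : {fset T} => V (\sum_(t <- F) f t - u)) @ totally --> (0 : RR) ->
    (@totally T) [set F : {fset T} | V (\sum_(t <- F) f t - u) <= e].
  move/cvgrPdist_le => /(_ e e0); apply: filterS => F.
  by rewrite sub0r normrN ger0_norm ?pabs_ge0.
have /filter_ex[F [h1 h2]] := @filterI _ _ tF _ _ (a1 _ hs0) (a1 _ P1).
by apply: (@pabs_chain (\sum_(t <- F) f t)) => //; rewrite pabsBC.
Qed.

Lemma nasum_le (T : choiceType) (f : T -> Cp) e : 0 <= e ->
  pnull f -> (forall t, V (f t) <= e) -> V (nasum f) <= e.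
Proof.
move=> e0 hf h; have := nasum_sub hf e0 (F := fset0) (fun t _ => h t).
by rewrite big_seq_fset0 subr0.
Qed.

Lemma pnull_fin (T : choiceType) (f : T -> Cp) (F : {fset T}) :
  (forall t, t \notin F -> f t = 0) -> pnull f.
Proof. by move=> h e e0; exists F => t /h ->; rewrite pabs0 ltW. Qed.

Lemma nasum_fin (T : choiceType) (f : T -> Cp) (F : {fset T}) :
  (forall t, t \notin F -> f t = 0) -> nasum f = \sum_(t <- F) f t.
Proof.
move=> h; apply/eqP; rewrite -subr_eq0; apply/eqP/pabs_eq0/eqP.
rewrite eq_le pabs_ge0 andbT; apply: nasum_sub => //; first exact: pnull_fin h.
by move=> t /h ->; rewrite pabs0.
Qed.

Lemma pnullD (T : choiceType) (f g : T -> Cp) : pnull f -> pnull g -> pnull (fun t => f t + g t).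
Proof.
move=> hf hg e e0; have [F hF] := hf e e0; have [G hG] := hg e e0.
exists (F `|` G)%fset => t; rewrite inE negb_or => /andP[h1 h2].
by apply: pabsD_le; [exact: hF|exact: hG].
Qed.

Lemma pnullZ (T : choiceType) (f : T -> Cp) (c : T -> Cp) b : (forall t, V (c t) <= b) ->
  pnull f -> pnull (fun t => c t * f t).
Proof.
move=> hc hf e e0.
have b0 : 0 < Num.max b 1 by rewrite lt_max ltr01 orbT.
have [F hF] := hf _ (divr_gt0 e0 b0); exists F => t /hF h.
have -> : e = Num.max b 1 * (e / Num.max b 1) by rewrite mulrC divfK // gt_eqF.
by apply: pabsM_le => //; apply: le_trans (hc t) _; rewrite le_max lexx.
Qed.

Lemma nasumD (T : choiceType) (f g : T -> Cp) : pnull f -> pnull g ->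
  nasum (fun t => f t + g t) = nasum f + nasum g.
Proof.
move=> hf hg; apply: pabs_le0_eq => e e0; have [F hF] := hf e e0; have [G hG] := hg e e0.
set H := (F `|` G)%fset.
have hF' t : t \notin H -> V (f t) <= e by rewrite inE negb_or => /andP[/hF].
have hG' t : t \notin H -> V (g t) <= e by rewrite inE negb_or => /andP[_ /hG].
apply: (@pabs_chain (\sum_(t <- H) (f t + g t))).
  by apply: nasum_sub; rewrite ?(ltW e0) //; [exact: pnullD|move=> t ht; apply: pabsD_le; [exact: hF'|exact: hG']].
rewrite pabsBC big_split /= opprD addrACA; apply: pabsD_le; apply: nasum_sub; rewrite ?(ltW e0) //.
Qed.

Lemma nasumZ (T : choiceType) (f : T -> Cp) (c : Cp) : pnull f ->
  nasum (fun t => c * f t) = c * nasum f.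
Proof.
move=> hf; apply: pabs_le0_eq => e e0.
have b0 : 0 < Num.max (V c) 1 by rewrite lt_max ltr01 orbT.
have [F hF] := hf _ (divr_gt0 e0 b0).
have ec : V c * (e / Num.max (V c) 1) <= e.
  rewrite -[leRHS](@divfK _ (Num.max (V c) 1)) ?gt_eqF // mulrC.
  by rewrite ler_wpM2l ?le_max ?lexx // ltW // divr_gt0.
apply: (@pabs_chain (\sum_(t <- F) c * f t)).
  apply: nasum_sub; rewrite ?(ltW e0) //.
    by apply: pnullZ => // t; apply: lexx.
  by move=> t /hF h; apply: le_trans ec; apply: pabsM_le.
rewrite pabsBC -big_distrr /= -mulrBr; apply: le_trans ec; apply: pabsM_le => //.
by apply: nasum_sub => //; rewrite ltW // divr_gt0.
Qed.

Lemma eq_nasum (T : choiceType) (f g : T -> Cp) : f =1 g -> nasum f = nasum g.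
Proof. by move=> h; congr nasum; apply/funext. Qed.

Lemma nasumB (T : choiceType) (f g : T -> Cp) : pnull f -> pnull g ->
  nasum (fun t => f t - g t) = nasum f - nasum g.
Proof.
move=> hf hg; rewrite -[- nasum g]mulN1r -nasumZ // -nasumD //.
  by apply: eq_nasum => t; rewrite mulN1r.
by apply: pnullZ => // t; apply: lexx.
Qed.

Lemma nasum_close (T : choiceType) (f g : T -> Cp) e : 0 <= e -> pnull f -> pnull g ->
  (forall t, V (f t - g t) <= e) -> V (nasum f - nasum g) <= e.
Proof.
move=> e0 hf hg h; rewrite -nasumB //; apply: nasum_le => //.
have hg' : pnull (fun t => -1 * g t) by apply: pnullZ => // t; apply: lexx.
move=> d d0; have [F hF] := pnullD hf hg' d0; exists F => t /hF.
by rewrite mulN1r.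
Qed.

Lemma nasum_bigr (T : choiceType) (I : Type) (r : seq I) (P : pred I) (f : I -> T -> Cp) :
  (forall i, P i -> pnull (f i)) ->
  pnull (fun t => \sum_(i <- r | P i) f i t) /\
  nasum (fun t => \sum_(i <- r | P i) f i t) = \sum_(i <- r | P i) nasum (f i).
Proof.
move=> h; elim: r => [|i r [IH1 IH2]].
  have h0 t : t \notin (fset0 : {fset T}) -> \sum_(i <- [::] | P i) f i t = 0.
    by move=> _; rewrite big_nil.
  by split; [exact: pnull_fin h0|rewrite (nasum_fin h0) big_seq_fset0 big_nil].
have [Pi|Pi] := boolP (P i).
  have e : (fun t => \sum_(j <- i :: r | P j) f j t) = (fun t => f i t + \sum_(j <- r | P j) f j t).
    by apply/funext => t; rewrite big_cons Pi.
  rewrite e big_cons Pi; split; first by apply: pnullD => //; exact: h.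
  by rewrite nasumD ?IH2 //; exact: h.
have e : (fun t => \sum_(j <- i :: r | P j) f j t) = (fun t => \sum_(j <- r | P j) f j t).
  by apply/funext => t; rewrite big_cons (negbTE Pi).
by rewrite e big_cons (negbTE Pi).
Qed.

Lemma pnull_nat (f : nat -> Cp) :
  (forall e, 0 < e -> exists N, forall m, (N <= m)%N -> V (f m) <= e) -> pnull f.
Proof.
move=> h e e0; have [N hN] := h e e0; exists [fset t in iota 0 N]%fset => t.
by rewrite inE /= mem_iota /= add0n -leqNgt => /hN.
Qed.

Lemma pnull_natP (f : nat -> Cp) : pnull f ->
  (forall e, 0 < e -> exists N, forall m, (N <= m)%N -> V (f m) <= e).
Proof.
move=> h e e0; have [F hF] := h e e0; exists (\max_(i <- F) i).+1 => m hm.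
apply: hF; apply/negP => mF; have := @leq_bigmax_seq _ (enum_fset F) xpredT id m mF isT.
by rewrite leqNgt => /negP; apply.
Qed.

Lemma sum_fset_iota (f : nat -> Cp) N : \sum_(t <- [fset t in iota 0 N]%fset) f t = \sum_(t < N) f t.
Proof.
rewrite -(big_mkord xpredT) /index_iota subn0.
apply: perm_big; apply: uniq_perm; rewrite ?fset_uniq ?iota_uniq //.
by move=> t; rewrite !inE.
Qed.

Lemma nasum_nat_sub (f : nat -> Cp) N e : 0 <= e -> pnull f ->
  (forall m, (N <= m)%N -> V (f m) <= e) -> V (nasum f - \sum_(t < N) f t) <= e.
Proof.
move=> e0 hf h; rewrite -sum_fset_iota; apply: nasum_sub => // t.
by rewrite inE /= mem_iota /= add0n -leqNgt => /h.
Qed.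

Lemma nasum_nat_fin (f : nat -> Cp) N : (forall m, (N <= m)%N -> f m = 0) ->
  nasum f = \sum_(t < N) f t.
Proof.
move=> h; rewrite -sum_fset_iota; apply: nasum_fin => t.
by rewrite inE /= mem_iota /= add0n -leqNgt => /h.
Qed.

Lemma pnull_cvg (f : nat -> Cp) : pnull f -> pcvg (fun N => \sum_(t < N) f t) (nasum f).
Proof.
move=> hf e e0; have [N hN] := pnull_natP hf e0; exists N => m hm.
rewrite pabsBC; apply: nasum_nat_sub => //; first exact: ltW.
by move=> k hk; apply: hN; exact: leq_trans hk.
Qed.

End Nonarch.

(** * Formal exponentials *)

Section PowerSeries.
Variables (RR : realType) (p : nat) (Cp : padicField RR p).
Local Notation V := (@pabs _ _ Cp).
Implicit Types (f g h : ps Cp) (s t : nat -> Cp) (e : RR).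

Local Notation pol m f := (\poly_(i < m.+1) f i).

Lemma psmul_coef f g (P Q : {poly Cp}) m :
  (forall i, (i <= m)%N -> P`_i = f i) -> (forall i, (i <= m)%N -> Q`_i = g i) ->
  psmul f g m = (P * Q)`_m.
Proof.
move=> hP hQ; rewrite coefM; apply: eq_bigr => i _.
by rewrite hP ?hQ ?leq_subr // -ltnS ltn_ord.
Qed.

Lemma coef_pol m f i : (i <= m)%N -> (pol m f)`_i = f i.
Proof. by move=> h; rewrite coef_poly ltnS h. Qed.

Lemma psmulC f g : psmul f g = psmul g f.
Proof.
apply/funext => m.
rewrite (@psmul_coef f g (pol m f) (pol m g)) => [|i|i]; try exact: coef_pol.
rewrite (@psmul_coef g f (pol m g) (pol m f)) => [|i|i]; try exact: coef_pol.
by rewrite mulrC.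
Qed.

Lemma psmulA f g h : psmul f (psmul g h) = psmul (psmul f g) h.
Proof.
apply/funext => m.
rewrite (@psmul_coef f (psmul g h) (pol m f) (pol m g * pol m h)) => [|i|i hi].
- rewrite (@psmul_coef (psmul f g) h (pol m f * pol m g) (pol m h)) ?mulrA //.
    move=> i hi; rewrite -(@psmul_coef f g) // => j hj; apply: coef_pol; exact: leq_trans hi.
  by move=> i; exact: coef_pol.
- exact: coef_pol.
by rewrite -(@psmul_coef g h) // => j hj; apply: coef_pol; exact: leq_trans hi.
Qed.

Lemma psmul1 f : psmul f (@ps1 _ _ Cp) = f.
Proof.
apply/funext => m; rewrite /psmul /ps1 big_ord_recr /= subnn eqxx mulr1.
rewrite big1 ?add0r // => i _; rewrite subn_eq0 leqNgt ltn_ord /= mulr0 //.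
Qed.

Lemma ps1mul f : psmul (@ps1 _ _ Cp) f = f.
Proof. by rewrite psmulC psmul1. Qed.

Lemma psmul0 f g : psmul f g 0 = f 0%N * g 0%N.
Proof. by rewrite /psmul big_ord_recl big_ord0 addr0. Qed.

Lemma psmulD f g h : psmul f (fun m => g m + h m) = (fun m => psmul f g m + psmul f h m).
Proof.
by apply/funext => m; rewrite /psmul -big_split /=; apply: eq_bigr => i _; rewrite mulrDr.
Qed.

HB.instance Definition _ := Monoid.isComLaw.Build (ps Cp) (@ps1 _ _ Cp) (@psmul _ _ Cp)
  psmulA psmulC ps1mul.

Lemma natr_neq0 m : m.+1%:R != 0 :> Cp.
Proof.
rewrite -[_.+1%:R]/(m.+1%:R : Cp); have := @pcharf0P Cp; case=> h _.
by rewrite (h (@Om_char0 _ _ Cp)).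
Qed.

Lemma natr_gt0_neq0 m : (0 < m)%N -> m%:R != 0 :> Cp.
Proof. by case: m => // m _; exact: natr_neq0. Qed.

(** The derivation T d/dT. *)
Definition theta f : ps Cp := fun m => m%:R * f m.

Lemma thetaM f g : theta (psmul f g) = fun m => psmul (theta f) g m + psmul f (theta g) m.
Proof.
apply/funext => m; rewrite /theta /psmul big_distrr -big_split /=.
apply: eq_bigr => i _; have {1}-> : m = (i + (m - i))%N by rewrite subnKC // -ltnS ltn_ord.
by rewrite natrD; ring.
Qed.

(* The formal exponential of [\sum_d s_d T^d / d]; the term [s 0] is ignored. *)
Fixpoint pexp_rec (s : nat -> Cp) (k m : nat) : Cp :=
  if k is k'.+1 then
    if m is m'.+1 then m%:R^-1 * \sum_(d < m) s d.+1 * pexp_rec s k' (m' - d)%N else 1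
  else (m == 0%N)%:R.

Definition pexp (s : nat -> Cp) : ps Cp := fun m => pexp_rec s m m.

Definition cut0 (s : nat -> Cp) : ps Cp := fun d => if d is 0%N then 0 else s d.

Lemma pexp_rec_fuel s k m : (m <= k)%N -> pexp_rec s k m = pexp s m.
Proof.
elim/ltn_ind: m k => m IH [|k]; first by rewrite leqn0 => /eqP ->.
case: m IH => [//|m] IH hk; rewrite /pexp /=; congr (_ * _).
apply: eq_bigr => d _; congr (_ * _).
rewrite (IH _ _ k) ?ltnS ?leq_subr ?(leq_trans (leq_subr _ _)) //.
by rewrite (IH _ _ m) ?ltnS ?leq_subr.
Qed.

Lemma pexp_0 s : pexp s 0 = 1.
Proof. by []. Qed.

Lemma pexpS s m : m.+1%:R * pexp s m.+1 = \sum_(d < m.+1) s d.+1 * pexp s (m - d)%N.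
Proof.
rewrite /pexp /= mulrA divff ?natr_neq0 // mul1r; apply: eq_bigr => d _; congr (_ * _).
by rewrite pexp_rec_fuel // leq_subr.
Qed.

Lemma psmul_cut0 s f m : psmul (cut0 s) f m.+1 = \sum_(d < m.+1) s d.+1 * f (m - d)%N.
Proof. by rewrite /psmul big_ord_recl /= mul0r add0r. Qed.

Lemma theta_pexp s : theta (pexp s) = psmul (cut0 s) (pexp s).
Proof.
apply/funext => -[|m]; first by rewrite /theta mul0r psmul0 /= mul0r.
by rewrite psmul_cut0 /theta pexpS.
Qed.

(** The equation T f' = s f determines each coefficient from the earlier ones, m being invertible in
    characteristic 0. Identities between exponentials are proved by checking this differential
    equation. *)
Lemma pexp_uniq s f : f 0%N = 1 -> theta f = psmul (cut0 s) f -> f = pexp s.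
Proof.
move=> f0 hf; apply/funext; elim/ltn_ind => -[|m] IH; first by rewrite f0.
apply: (mulfI (natr_neq0 m)); rewrite pexpS.
have := congr1 (fun g : ps Cp => g m.+1) hf; rewrite /theta psmul_cut0 => ->.
by apply: eq_bigr => d _; rewrite IH // ltnS leq_subr.
Qed.

Lemma pexpD s t : pexp (fun d => s d + t d) = psmul (pexp s) (pexp t).
Proof.
apply/esym/pexp_uniq; first by rewrite psmul0 !pexp_0 mulr1.
rewrite thetaM !theta_pexp.
have -> : cut0 (fun d => s d + t d) = fun d => cut0 s d + cut0 t d.
  by apply/funext => -[|d] //=; rewrite addr0.
rewrite [RHS]psmulC psmulD; apply/funext => m; congr (_ + _).
  by rewrite -psmulA psmulC.
by rewrite psmulC -!psmulA [psmul (pexp t) (pexp s)]psmulC psmulC -psmulA.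
Qed.

Lemma eq_pexp s t : (forall d, s d.+1 = t d.+1) -> pexp s = pexp t.
Proof.
move=> h; apply: pexp_uniq => //; rewrite theta_pexp; congr psmul.
by apply/funext => -[|d] //=; rewrite h.
Qed.

Lemma eq_pexp_le s t m : (forall d, (0 < d <= m)%N -> s d = t d) -> pexp s m = pexp t m.
Proof.
elim/ltn_ind: m => -[//|m] IH h; apply: (mulfI (natr_neq0 m)); rewrite !pexpS.
apply: eq_bigr => d _; rewrite h ?ltn_ord // IH ?ltnS ?leq_subr // => i /andP[i0 hi].
by apply: h; rewrite i0 (leq_trans hi) // (leq_trans (leq_subr _ _)).
Qed.

Lemma pexp0 s : (forall d, s d.+1 = 0) -> pexp s = @ps1 _ _ Cp.
Proof.
move=> h; apply/esym/pexp_uniq => //; apply/funext => -[|m].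
  by rewrite /theta mul0r psmul0 mul0r.
by rewrite psmul_cut0 /theta /ps1 mulr0 big1 // => i _; rewrite h mul0r.
Qed.

Lemma pexpNK s : psmul (pexp s) (pexp (fun d => - s d)) = @ps1 _ _ Cp.
Proof. by rewrite -pexpD; apply: pexp0 => d; rewrite subrr. Qed.

Lemma pexp_scale s (c : Cp) m : pexp (fun d => c ^+ d * s d) m = c ^+ m * pexp s m.
Proof.
suff <- : (fun m => c ^+ m * pexp s m) = pexp (fun d => c ^+ d * s d) by [].
apply: pexp_uniq; first by rewrite mulr1.
apply/funext => -[|k]; first by rewrite /theta mul0r psmul0 mul0r.
rewrite psmul_cut0 /theta mulrCA pexpS big_distrr /=; apply: eq_bigr => d _.
have {1}-> : k.+1 = (d.+1 + (k - d))%N by rewrite addSn subnKC // -ltnS ltn_ord.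
by rewrite exprD; ring.
Qed.

Lemma pexp_sum (I : Type) (r : seq I) (P : pred I) (s : I -> nat -> Cp) :
  pexp (fun d => \sum_(i <- r | P i) s i d) = \big[@psmul _ _ Cp/@ps1 _ _ Cp]_(i <- r | P i) pexp (s i).
Proof.
elim: r => [|i r IH].
  by rewrite big_nil; apply: pexp0 => d; rewrite big_nil.
rewrite big_cons -IH; case: ifP => Pi; last by congr pexp; apply/funext => d; rewrite big_cons Pi.
by rewrite -pexpD; congr pexp; apply/funext => d; rewrite big_cons Pi.
Qed.

Lemma pabs_fact_gt0 m : 0 < V (m`!)%:R.
Proof. by rewrite pabs_gt0 natr_gt0_neq0 // fact_gt0. Qed.

(** The recursion divides by m at each step, which costs the factor 1/|m!|. *)
Lemma pexp_bound s e m : 0 <= e -> (forall d, (0 < d <= m)%N -> V (s d) <= e ^+ d) ->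
  V (pexp s m) <= e ^+ m / V (m`!)%:R.
Proof.
move=> e0; elim/ltn_ind: m => -[|m] IH h; first by rewrite pexp_0 fact0 !pabs1 divr1.
have mm : 0 < V m.+1%:R by rewrite pabs_gt0 natr_neq0.
rewrite factS natrM pabsM invfM mulrCA ler_pdivlMl // -pabsM pexpS.
apply: pabs_sum => [|d _]; first by rewrite divr_ge0 ?exprn_ge0 ?pabs_ge0.
have -> : e ^+ m.+1 / V (m`!)%:R = e ^+ d.+1 * (e ^+ (m - d) / V (m`!)%:R).
  by rewrite mulrA -exprD addSn subnKC // -ltnS ltn_ord.
apply: pabsM_le; first by apply: h; rewrite ltn_ord.
apply: le_trans (IH _ _ _) _; rewrite ?ltnS ?leq_subr //.
  move=> i /andP[i0 hi]; apply: h; rewrite i0 (leq_trans hi) //.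
  by rewrite (leq_trans (leq_subr _ _)).
rewrite ler_wpM2l ?exprn_ge0 // lef_pV2 ?posrE ?pabs_fact_gt0 //.
have -> : (m`!)%:R = ((m ^_ d)%:R * ((m - d)`!)%:R : Cp).
  by rewrite -natrM ffact_fact // -ltnS ltn_ord.
by rewrite pabsM ler_piMl ?pabs_ge0 ?pabs_nat.
Qed.

(** Continuity of each coefficient in the data s_d; the loss 1/|m!| is harmless because the degree m
    is fixed wherever a limit is taken. *)
Lemma pexp_close s t e m : 0 <= e ->
  (forall d, (0 < d <= m)%N -> V (s d) <= 1) -> (forall d, (0 < d <= m)%N -> V (t d) <= 1) ->
  (forall d, (0 < d <= m)%N -> V (s d - t d) <= e) ->
  V (pexp s m - pexp t m) <= e / V (m`!)%:R.
Proof.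
move=> e0; elim/ltn_ind: m => -[|m] IH hs ht hst.
  by rewrite !pexp_0 subrr pabs0 divr_ge0 ?pabs_ge0.
have mm : 0 < V m.+1%:R by rewrite pabs_gt0 natr_neq0.
rewrite factS natrM pabsM invfM mulrCA ler_pdivlMl // -pabsM mulrBr !pexpS -sumrB.
apply: pabs_sum => [|d _]; first by rewrite divr_ge0 ?pabs_ge0.
have mon i : (i <= m)%N -> (V (i`!)%:R)^-1 <= (V (m`!)%:R)^-1.
  move=> im; rewrite lef_pV2 ?posrE ?pabs_fact_gt0 //.
  have -> : (m`!)%:R = ((m ^_ (m - i))%:R * (i`!)%:R : Cp).
    by rewrite -natrM -{2}(subKn im) ffact_fact // leq_subr.
  by rewrite pabsM ler_piMl ?pabs_ge0 ?pabs_nat.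
have sub i : (0 < i <= m - d)%N -> (0 < i <= m.+1)%N.
  by move=> /andP[-> h] /=; apply: leq_trans h _; apply: leq_trans (leq_subr _ _) _.
have -> : s d.+1 * pexp s (m - d)%N - t d.+1 * pexp t (m - d)%N =
   s d.+1 * (pexp s (m - d)%N - pexp t (m - d)%N) + (s d.+1 - t d.+1) * pexp t (m - d)%N by ring.
apply: pabsD_le.
  apply: pabsMl_le; first by apply: hs; rewrite ltn_ord.
  apply: le_trans (IH _ _ _ _ _) _; rewrite ?ltnS ?leq_subr //.
  - by move=> i /sub; apply: hs.
  - by move=> i /sub; apply: ht.
  - by move=> i /sub; apply: hst.
  by rewrite ler_wpM2l ?mon ?leq_subr.
apply: pabsM_le; first by apply: hst; rewrite ltn_ord.
apply: le_trans (pexp_bound (e := 1) _ _) _ => //.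
  by move=> i /sub h; rewrite expr1n; apply: ht.
by rewrite expr1n mul1r mon ?leq_subr.
Qed.

(** In the differential equation the coefficient of T^m, for m divisible by d, collects m/d equal
    terms, each carrying the factor d. *)
Lemma geomT_pexp (a : Cp) d : (0 < d)%N ->
  geomT a d = pexp (fun m => if (d %| m)%N then d%:R * a ^+ (m %/ d) else 0).
Proof.
move=> d0; apply: pexp_uniq; first by rewrite /geomT dvdn0 div0n expr0.
apply/funext => -[|m]; first by rewrite /theta mul0r psmul0 mul0r.
rewrite /theta psmul_cut0.
have -> : \sum_(j < m.+1) (if (d %| j.+1)%N then d%:R * a ^+ (j.+1 %/ d) else 0) * geomT a d (m - j)%N
   = \sum_(j < m.+1 | (d %| j.+1)%N) (if (d %| m.+1)%N then d%:R * a ^+ (m.+1 %/ d) else 0).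
  rewrite [RHS]big_mkcond; apply: eq_bigr => j _; case: ifP => dj; last by rewrite mul0r.
  have hj : (j.+1 + (m - j) = m.+1)%N by rewrite addSn subnKC // -ltnS ltn_ord.
  have -> : (d %| m.+1)%N = (d %| m - j)%N by rewrite -{1}hj dvdn_addr.
  have -> : (m.+1 %/ d = j.+1 %/ d + (m - j) %/ d)%N by rewrite -{1}hj divnDl.
  rewrite /geomT; case: ifP => dm; last by rewrite mulr0.
  by rewrite -mulrA -exprD.
rewrite big_const_seq iter_addr addr0.
have -> : count (fun j : 'I_m.+1 => (d %| j.+1)%N) (index_enum 'I_m.+1) = (m.+1 %/ d)%N.
  rewrite -sum1_count -(big_mkord (fun j => (d %| j.+1)%N) (fun=> 1%N)).
  have := @big_add1 _ 0%N addn 0 m.+2 (fun j => (d %| j)%N) (fun=> 1%N); move=> /= <-.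
  elim: m.+1 => [|k IH]; first by rewrite div0n big_geq.
  rewrite big_mkcond big_nat_recr //= -big_mkcond IH.
  by rewrite divnS //; case: ifP; rewrite ?addn0 ?addn1.
rewrite /geomT; case: ifP => dm; last by rewrite mulr0 mul0rn.
by rewrite -[RHS]mulr_natl mulrA -natrM divnK.
Qed.

Lemma logn_fact_le m : prime p -> (logn p m`! <= m)%N.
Proof.
move=> pp; rewrite logn_fact //.
(* The remainder m/2^k makes Legendre's sum telescope: m/p^(k+1) + m/2^(k+1) is at most m/2^k. *)
suff h k : (\sum_(1 <= j < k.+1) m %/ p ^ j + m %/ 2 ^ k <= m)%N.
  by apply: leq_trans (h m); rewrite leq_addr.
elim: k => [|k IH]; first by rewrite big_geq // expn0 divn1.
rewrite big_nat_recr //=; apply: leq_trans IH; rewrite -addnA leq_add2l.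
have h1 : (m %/ p ^ k.+1 <= m %/ 2 ^ k.+1)%N.
  by apply: leq_div2l; rewrite ?expn_gt0 // leq_exp2r // prime_gt1.
apply: leq_trans (leq_add h1 (leqnn _)) _.
by rewrite addnn -mul2n expnSr divnMA mulnC leq_trunc_div.
Qed.

Lemma pabs_coprime m : prime p -> coprime p m -> V m%:R = 1.
Proof.
move=> pp cm; apply/eqP; rewrite eq_le pabs_nat /=.
case: (posnP m) cm => [->|m0 cm]; first by rewrite /coprime gcdn0 => /eqP p1; have := prime_gt1 pp; lia.
case: (egcdnP m (prime_gt0 pp)) => km kn h _.
have e : (km * p)%:R = (kn * m)%:R + 1 :> Cp by rewrite h natrD (eqP cm).
rewrite leNgt; apply/negP => lt1.
have : V (1 : Cp) < 1.
  have -> : (1 : Cp) = (km * p)%:R - (kn * m)%:R by rewrite e; ring.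
  by apply: pabsB_lt; rewrite natrM pabsM; apply: le_lt_trans (ler_piMl (pabs_ge0 _) (pabs_nat _ _)) _ => //; exact: pabs_p.
by rewrite pabs1 ltxx.
Qed.

Lemma pabs_fact_ge m : prime p -> V p%:R ^+ m <= V (m`!)%:R.
Proof.
move=> pp; have [k cp ->] := pfactor_coprime pp (fact_gt0 m).
rewrite natrM pabsM (pabs_coprime pp cp) mul1r natrX pabsX.
by apply: ler_wiXn2l; rewrite ?pabs_ge0 ?pabs_nat ?logn_fact_le.
Qed.

(** As |m!| is at least |p|^m, the denominators cost only a geometric factor. Applied to an error
    term of arbitrarily small rate, this gives an exponential of any prescribed rate of decay. *)
Lemma pexp_bound_p s e m : prime p -> 0 <= e ->
  (forall d, (0 < d <= m)%N -> V (s d) <= e ^+ d) -> V (pexp s m) <= (e / V p%:R) ^+ m.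
Proof.
move=> pp e0 h; apply: le_trans (pexp_bound e0 h) _; rewrite exprMn exprVn.
apply: ler_wpM2l; first exact: exprn_ge0.
rewrite lef_pV2 ?posrE ?pabs_fact_gt0 ?pabs_fact_ge //.
by rewrite exprn_gt0 // pabs_gt0 natr_gt0_neq0 // prime_gt0.
Qed.

Lemma psmul_bound f g (e a b : RR) m : 0 <= e -> 0 <= a -> 0 <= b ->
  (forall i, V (f i) <= a * e ^+ i) -> (forall i, V (g i) <= b * e ^+ i) ->
  V (psmul f g m) <= a * b * e ^+ m.
Proof.
move=> e0 a0 b0 hf hg; apply: pabs_sum => [|i _]; first by rewrite !mulr_ge0 ?exprn_ge0.
have -> : a * b * e ^+ m = (a * e ^+ i) * (b * e ^+ (m - i)).
  by rewrite mulrACA -exprD subnKC // -ltnS ltn_ord.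
exact: pabsM_le.
Qed.

End PowerSeries.

(** * Determinants and symmetric powers *)

Section Determinants.
Variable R : comNzRingType.

(** Both sides are the determinant of the block matrix with rows (1, X) and (Y, 1), cleared in two
    ways. *)
Lemma det1B_swap r s (X : 'M[R]_(r, s)) (Y : 'M[R]_(s, r)) :
  \det (1%:M - X *m Y) = \det (1%:M - Y *m X).
Proof.
pose B := block_mx 1%:M X Y 1%:M : 'M[R]_(r + s).
have h1 : block_mx 1%:M 0 (- Y) 1%:M *m B = block_mx 1%:M X 0 (1%:M - Y *m X).
  by rewrite /B mulmx_block !mul1mx !mul0mx ?mulmx1 ?addr0 !mulNmx addNr addrC.
have h2 : block_mx 1%:M (- X) 0 1%:M *m B = block_mx (1%:M - X *m Y) 0 Y 1%:M.
  by rewrite /B mulmx_block !mul1mx !mul0mx ?mulmx1 ?add0r !mulNmx ?mulmx1 subrr.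
have := congr1 determinant h1; rewrite det_mulmx det_lblock !det1 !mul1r det_ublock det1 mul1r => e1.
have := congr1 determinant h2; rewrite det_mulmx det_ublock !det1 !mul1r det_lblock det1 mulr1 => e2.
by rewrite -e1 -e2.
Qed.

End Determinants.

Section Determinants.
Variable R : comNzRingType.

Definition detpoly r (A : 'M[R]_r) : {poly R} := \det (1%:M - 'X *: map_mx polyC A).

Definition detps r (A : 'M[R]_r) : nat -> R := fun m => (detpoly A)`_m.

Lemma detps_swap r s (X : 'M[R]_(r, s)) (Y : 'M[R]_(s, r)) : detps (X *m Y) = detps (Y *m X).
Proof.
apply/funext => m; rewrite /detps /detpoly !map_mxM !scalemxAl; congr _`_m.
by rewrite det1B_swap -scalemxAr scalemxAl.
Qed.

Lemma detps0 r (A : 'M[R]_r) : detps A 0 = 1.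
Proof.
rewrite /detps /detpoly -horner_coef0 -[_.[0]]/(horner_eval 0 _) -det_map_mx.
rewrite [X in \det X](_ : _ = 1%:M) ?det1 //.
by apply/matrixP => i j; rewrite !mxE /= /horner_eval hornerD hornerN hornerM hornerX mul0r subr0 hornerMn hornerC.
Qed.

Definition minor r s m (A : 'M[R]_(r, s)) (S : m.-tuple 'I_r) (T : m.-tuple 'I_s) : R :=
  \det (\matrix_(a < m, b < m) A (tnth S a) (tnth T b)).

Definition incr r (S : seq 'I_r) := sorted (fun i j : 'I_r => (i < j)%N) S.

Lemma incr_uniq r (S : seq 'I_r) : incr S -> uniq S.
Proof. by apply: sorted_uniq => [i j k|i]; [exact: ltn_trans|rewrite /= ltnn]. Qed.

Lemma sort_incr r (S : seq 'I_r) : uniq S -> incr (sort (fun i j : 'I_r => (i <= j)%N) S).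
Proof.
move=> uS; have tot : total (fun i j : 'I_r => (i <= j)%N) by move=> i j; exact: leq_total.
have := sort_sorted tot S; set s := sort _ _ => ss.
have us : uniq s by rewrite sort_uniq.
elim: s ss us => // x s IH /=.
case: s IH => [//|y s] IH /= /andP[xy ss] /andP[xs us].
rewrite ltn_neqAle xy andbT; apply/andP; split.
  by apply: contra xs => /eqP/val_inj ->; rewrite inE eqxx.
exact: IH.
Qed.

Lemma incr_eq r (S T : seq 'I_r) : incr S -> incr T -> perm_eq S T -> S = T.
Proof.
move=> iS iT pST; apply: (irr_sorted_eq (leT := fun i j : 'I_r => (i < j)%N)) => //.
- by move=> i j k; exact: ltn_trans.
- by move=> i; rewrite /= ltnn.
exact: perm_mem.
Qed.

Lemma sum_tuple_ffun (T : finType) m (F : {ffun 'I_m -> T} -> R) :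
  \sum_f F f = \sum_(t : m.-tuple T) F [ffun a => tnth t a].
Proof.
apply: (reindex (fun t : m.-tuple T => [ffun a => tnth t a])); apply: onW_bij.
exists (fun f : {ffun 'I_m -> T} => [tuple f a | a < m]) => [t|f].
  by apply: eq_from_tnth => a; rewrite tnth_mktuple ffunE.
by apply/ffunP => a; rewrite ffunE tnth_mktuple.
Qed.

Lemma sum_perm_tuple (T : finType) m (J : m.-tuple T) (F : m.-tuple T -> R) : uniq J ->
  \sum_(t : m.-tuple T | perm_eq t J) F t = \sum_(s : 'S_m) F [tuple tnth J (s a) | a < m].
Proof.
move=> uJ; rewrite [RHS](partition_big (fun s : 'S_m => [tuple tnth J (s a) | a < m])
  (fun t : m.-tuple T => perm_eq t J)) /=; last first.
  by move=> s _; apply/tuple_permP; exists s.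
apply: eq_bigr => t /tuple_permP[s /val_inj tE].
rewrite (big_pred1 s) ?tE // => s' /=; apply/eqP/eqP => [h|-> //].
apply/permP => a; have := congr1 (fun u => tnth u a) h; rewrite !tnth_mktuple.
by move/tuple_uniqP: uJ => uJ /uJ.
Qed.

(** Cauchy-Binet: expansion gives a sum over all tuples; tuples with a repetition contribute 0, and
    the others are grouped by their sorted rearrangement. *)
Lemma minor_mul r s q m (A : 'M[R]_(r, s)) (B : 'M[R]_(s, q)) (S : m.-tuple 'I_r) (T : m.-tuple 'I_q) :
  minor (A *m B) S T = \sum_(J : m.-tuple 'I_s | incr J) minor A S J * minor B J T.
Proof.
pose X a j := A (tnth S a) j; pose Y j b := B j (tnth T b).
pose dY (t : m.-tuple 'I_s) := \det (\matrix_(a < m, b < m) Y (tnth t a) b).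
have -> : minor (A *m B) S T = \sum_(t : m.-tuple 'I_s) (\prod_a X a (tnth t a)) * dY t.
  rewrite /minor /determinant.
  transitivity (\sum_(s0 : 'S_m) \sum_(f : {ffun 'I_m -> 'I_s}) (-1) ^+ s0 * \prod_a (X a (f a) * Y (f a) (s0 a))).
    apply: eq_bigr => s0 _; rewrite -big_distrr /=; congr (_ * _).
    rewrite -(bigA_distr_bigA (fun a j => X a j * Y j (s0 a))).
    by apply: eq_bigr => a _; rewrite !mxE.
  rewrite exchange_big sum_tuple_ffun /=; apply: eq_bigr => t _.
  rewrite /dY /determinant big_distrr /=; apply: eq_bigr => s0 _.
  rewrite mulrCA -big_split /=; congr (_ * _); apply: eq_bigr => a _.
  by rewrite !ffunE !mxE.
rewrite (bigID (fun t : m.-tuple 'I_s => uniq t)) /= [X in _ + X]big1 ?addr0; last first.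
  move=> t; apply: contraNeq => h; apply/tuple_uniqP => i j ij.
  apply/eqP; apply: contraNT h => nij; rewrite /dY (determinant_alternate nij) ?mulr0 //.
  by move=> b; rewrite !mxE ij.
rewrite (partition_big (fun t : m.-tuple 'I_s => [tuple of sort (fun i j : 'I_s => (i <= j)%N) t])
  (fun t => incr t)) /=; last by move=> t; exact: sort_incr.
apply: eq_bigr => J iJ.
rewrite (eq_bigl (fun t : m.-tuple 'I_s => perm_eq t J)); last first.
  move=> t; apply/andP/idP => [[_ /eqP <-]|pt]; first by rewrite perm_sym perm_sort.
  split; first by rewrite (perm_uniq pt) incr_uniq.
  apply/eqP/val_inj/incr_eq => //; first by rewrite sort_incr // (perm_uniq pt) incr_uniq.
  by rewrite perm_sort.
rewrite sum_perm_tuple ?incr_uniq // {1}/minor /determinant big_distrl /=.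
apply: eq_bigr => s0 _.
have -> : dY [tuple tnth J (s0 a) | a < m] = (-1) ^+ s0 * minor B J T.
  rewrite /dY /minor -det_perm -det_mulmx -row_permE; congr (\det _).
  by apply/matrixP => a b; rewrite !mxE tnth_mktuple.
rewrite mulrA; congr (_ * _); rewrite mulrC; congr (_ * _).
by apply: eq_bigr => a _; rewrite !mxE tnth_mktuple.
Qed.

End Determinants.

(** * Triangular form, characteristic series and exterior powers *)

Section Trigonal.
Variable F : closedFieldType.

(** A left eigenvector becomes the first basis vector, and induction treats the lower right block.
    Triangular form reduces identities between traces and determinants to polynomial identities in
    the diagonal entries. *)
Lemma trigonalize r (A : 'M[F]_r) :
  exists2 P : 'M[F]_r, P \in unitmx & is_trig_mx (P *m A *m invmx P).
Proof.
elim: r A => [|r IH] A; first by exists 1%:M; rewrite ?unitmx1 // [_ *m _]flatmx0 mx0_is_trig.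
have /closed_rootP[a ra] : size (char_poly A) != 1%N by rewrite size_char_poly.
have /eigenvalueP[v /= vA v0] : eigenvalue A a by rewrite eigenvalue_root_char.
pose w : 'M[F]_(1, 1 + r) := v.
(* [row_ebase] completes w to a basis: its first row is w up to the scalar [cc]. *)
pose P : 'M[F]_(1 + r) := row_ebase w.
have uP : P \in unitmx by exact: row_ebase_unit.
have hrk : \rank w = 1%N by apply/eqP; rewrite eqn_leq rank_leq_row lt0n mxrank_eq0.
have := mulmx_ebase w; rewrite hrk => hv.
pose cc := col_ebase w.
have ucc : cc \in unitmx by exact: col_ebase_unit.
pose e0 : 'M[F]_(1, 1 + r) := row_mx 1%:M 0.
have pe : pid_mx 1 = e0 by rewrite /e0 pid_mx_row.
have vAw : w *m A = a *: w := vA.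
have he0 : e0 *m P = invmx cc *m w.
  by rewrite -[in RHS]hv -!mulmxA mulKmx // pe.
pose B : 'M[F]_(1 + r) := P *m A *m invmx P.
have hB : e0 *m B = a *: e0.
  have -> : e0 *m B = e0 *m P *m A *m invmx P by rewrite /B !mulmxA.
  rewrite he0 -(mulmxA _ w) vAw -scalemxAr -scalemxAl -he0.
  by rewrite mulmxK.
have Bu : usubmx B = row_mx a%:M 0.
  rewrite -[B]vsubmxK /e0 mul_row_col mul1mx mul0mx addr0 in hB.
  by rewrite -[B in LHS]vsubmxK col_mxKu hB scale_row_mx scaler0 scalemx1.
have [Q uQ tQ] := IH (drsubmx B).
pose QQ : 'M[F]_(1 + r) := block_mx 1%:M 0 0 Q.
have uQQ : QQ \in unitmx by rewrite unitmxE det_ublock det1 mul1r -unitmxE.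
have iQQ : invmx QQ = block_mx 1%:M 0 0 (invmx Q).
  apply: (can_inj (mulKmx uQQ)); rewrite mulmxV // mulmx_block !mulmx1 !mulmx0 !mul0mx !addr0 !add0r.
  by rewrite mulmxV // -scalar_mx_block.
exists (QQ *m P); first by rewrite unitmx_mul uQQ.
have -> : QQ *m P *m A *m invmx (QQ *m P) = QQ *m B *m invmx QQ.
  have uQP : QQ *m P \in unitmx by rewrite unitmx_mul uQQ.
  have -> : invmx (QQ *m P) = invmx P *m invmx QQ.
    by apply: (can_inj (mulKmx uQP)); rewrite mulmxV // mulmxA mulmxK // mulmxV.
  by rewrite /B !mulmxA.
rewrite iQQ -[B]submxK /QQ !mulmx_block !mulmx1 !mulmx0 !mul0mx !addr0 !add0r !mul1mx.
have Bul : ursubmx B = 0 by rewrite /ursubmx Bu row_mxKr.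
rewrite Bul mul0mx; apply: (etrans (@is_trig_block_mx F 1 r 1 r _ _ _ _ erefl)).
by rewrite eqxx mx11_is_trig.
Qed.

Lemma trig_mulmx r (A B : 'M[F]_r) : is_trig_mx A -> is_trig_mx B ->
  is_trig_mx (A *m B) /\ forall i, (A *m B) i i = A i i * B i i.
Proof.
move=> /is_trig_mxP tA /is_trig_mxP tB; split.
  apply/is_trig_mxP => i j ij; rewrite mxE big1 // => k _.
  have [ik|ki] := ltnP i k; first by rewrite tA // mul0r.
  by rewrite tB ?mulr0 // (leq_ltn_trans ki).
move=> i; rewrite mxE (bigD1 i) //= big1 ?addr0 // => k ki.
have [ik|] := ltnP i k; first by rewrite tA // mul0r.
rewrite leq_eqVlt => /predU1P[/val_inj e|h]; first by rewrite e eqxx in ki.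
by rewrite tB ?mulr0.
Qed.

Lemma trig_expmx r (A : 'M[F]_r) d : is_trig_mx A ->
  is_trig_mx (A ^+ d) /\ forall i, (A ^+ d) i i = A i i ^+ d.
Proof.
move=> tA; elim: d => [|d [t1 t2]].
  by rewrite expr0; split=> [|i]; [exact: scalar_mx_is_trig|rewrite mxE eqxx].
have [h1 h2] := trig_mulmx tA t1.
rewrite exprS; split=> [|i]; first exact: h1.
by rewrite exprS -t2 -h2.
Qed.

Lemma minor_trig r m (U : 'M[F]_r) (S : m.-tuple 'I_r) : is_trig_mx U -> incr S ->
  minor U S S = \prod_a U (tnth S a) (tnth S a).
Proof.
move=> /is_trig_mxP tU iS; rewrite /minor det_trig.
  by apply: eq_bigr => a _; rewrite mxE.
apply/is_trig_mxP => a b ab; rewrite mxE tU //.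
pose x0 := tnth S a.
rewrite [tnth S b](tnth_nth x0) [tnth S a](tnth_nth x0).
have tr : transitive (fun i j : 'I_r => (i < j)%N) by move=> i j k; exact: ltn_trans.
by apply: (sorted_ltn_nth tr x0 iS); rewrite ?inE ?size_tuple.
Qed.

(** The trace of the m-th exterior power of A. *)
Definition esum r m (A : 'M[F]_r) : F := \sum_(S : m.-tuple 'I_r | incr S) minor A S S.

Lemma esum_swap r s m (A : 'M[F]_(r, s)) (B : 'M[F]_(s, r)) : esum m (A *m B) = esum m (B *m A).
Proof.
rewrite /esum; under eq_bigr do rewrite minor_mul.
rewrite exchange_big /=; apply: eq_bigr => S _; rewrite minor_mul.
by apply: eq_bigr => T _; rewrite mulrC.
Qed.

Lemma tr_exp_conj r (A P : 'M[F]_r) d : P \in unitmx ->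
  \tr ((P *m A *m invmx P) ^+ d) = \tr (A ^+ d).
Proof.
move=> uP; have -> : (P *m A *m invmx P) ^+ d = P *m (A ^+ d) *m invmx P.
  elim: d => [|d IH]; first by rewrite !expr0 -[1]/1%:M mulmx1 mulmxV.
  rewrite exprS IH exprS -[_ * _]/(_ *m _) -[A * _]/(_ *m _).
  by rewrite !mulmxA mulmxKV.
by rewrite mxtrace_mulC mulmxA mulVmx // mul1mx.
Qed.

Lemma sum_incr_sets r m (G : 'I_r -> F) :
  \sum_(S : m.-tuple 'I_r | incr S) \prod_a G (tnth S a) =
  \sum_(X : {set 'I_r} | #|X| == m) \prod_(i in X) G i.
Proof.
have ienum (X : {set 'I_r}) : incr (enum X).
  rewrite /incr /enum_mem; apply: sorted_filter; first by move=> i j k; exact: ltn_trans.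
  by rewrite -enumT; have := iota_ltn_sorted 0 r; rewrite -val_enum_ord sorted_map.
rewrite (partition_big (fun S : m.-tuple 'I_r => [set i in S]) (fun X => #|X| == m)) /=; last first.
  by move=> S /incr_uniq/card_uniqP uS; rewrite cardsE uS size_tuple.
apply: eq_bigr => X /eqP cX.
have sX : size (enum X) == m by rewrite -cardE cX.
rewrite (big_pred1 (Tuple sX)) /=; last first.
  move=> S; apply/andP/eqP => [[iS /eqP hS]|->]; last first.
    by split; [exact: ienum|apply/eqP/setP => i; rewrite inE /= mem_enum].
  apply/val_inj/incr_eq => //=; apply: uniq_perm; rewrite ?enum_uniq ?incr_uniq //.
  by move=> i; rewrite mem_enum -hS inE.
by rewrite -(big_tuple _ _ (Tuple sX) xpredT G) /= big_enum.
Qed.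

Lemma detpoly_trig r (U : 'M[F]_r) : is_trig_mx U ->
  detpoly U = \prod_i (1 - U i i *: 'X).
Proof.
move=> /is_trig_mxP tU; rewrite /detpoly det_trig; last first.
  apply/is_trig_mxP => i j ij; rewrite !mxE tU // polyC0 mulr0 subr0.
  by case: eqP ij => // ->; rewrite ltnn.
by apply: eq_bigr => i _; rewrite !mxE eqxx mulrC mul_polyC.
Qed.

Lemma detps_conj r (A P : 'M[F]_r) : P \in unitmx -> detps (P *m A *m invmx P) = detps A.
Proof. by move=> uP; rewrite detps_swap mulmxA mulVmx // mul1mx. Qed.

(** Both sides are invariant under conjugation, the right one by Cauchy-Binet. For a triangular
    matrix they are, up to sign, the elementary symmetric function of the diagonal entries. *)
Lemma detps_minors r (A : 'M[F]_r) m : detps A m = (-1) ^+ m * esum m A.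
Proof.
have [P uP tU] := trigonalize A; set U := (X in is_trig_mx X) in tU.
have -> : esum m A = esum m U by rewrite /U esum_swap mulmxA mulVmx // mul1mx.
rewrite -(detps_conj A uP) -/U /detps detpoly_trig // /esum.
rewrite (eq_bigr (fun S : m.-tuple 'I_r => \prod_a U (tnth S a) (tnth S a))); last first.
  by move=> S iS; rewrite minor_trig.
rewrite (sum_incr_sets m (fun i => U i i)).
have -> : \prod_i (1 - U i i *: 'X) = \sum_(X : {set 'I_r}) ((-1) ^+ #|X| * \prod_(i in X) U i i) *: 'X^#|X| :> {poly F}.
  under eq_bigr do rewrite addrC.
  rewrite bigA_distr; apply: eq_bigr => X _; rewrite -big_mkcond /=.
  rewrite (eq_bigr (fun i => (- U i i)%:P * 'X)); last by move=> i _; rewrite mul_polyC scaleNr.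
  by rewrite big_split /= prodr_const -rmorph_prod prodrN mul_polyC.
rewrite coef_sum [RHS]big_distrr [RHS]big_mkcond /=; apply: eq_bigr => X _.
by rewrite coefZ coefXn eq_sym; case: eqP => [->|_]; rewrite ?mulr1 ?mulr0.
Qed.

End Trigonal.

Section PowerSums.
Variables (RR : realType) (p : nat) (Cp : padicField RR p).

Lemma trace_trig_exp r (U : 'M[Cp]_r) d : is_trig_mx U -> \tr (U ^+ d) = \sum_i U i i ^+ d.
Proof. by move=> tU; apply: eq_bigr => i _; rewrite (trig_expmx d tU).2. Qed.

Lemma pexp_pow (a : Cp) m : pexp (fun d => a ^+ d) m = a ^+ m.
Proof.
suff <- : (fun m => a ^+ m) = pexp (fun d => a ^+ d) :> ps Cp by [].
apply: pexp_uniq => //; apply/funext => -[|k]; first by rewrite /theta mul0r psmul0 mul0r.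
rewrite psmul_cut0 (eq_bigr (fun=> a ^+ k.+1)); last first.
  by move=> d _; rewrite -exprD addSn subnKC // -ltnS ltn_ord.
by rewrite sumr_const card_ord /theta mulr_natl.
Qed.

Lemma pexp_powN (a : Cp) : pexp (fun d => - a ^+ d) = fun m => (1 - a *: 'X : {poly Cp})`_m.
Proof.
have e : psmul (fun m => (1 - a *: 'X : {poly Cp})`_m) (pexp (fun d => a ^+ d)) = @ps1 _ _ Cp.
  apply/funext => -[|m]; rewrite /psmul /ps1.
    by rewrite big_ord_recl big_ord0 addr0 pexp_0 coefB coefZ coefX coef1 mulr0 subr0 mulr1.
  rewrite 2!big_ord_recl big1 ?addr0 /=; last first.
    by move=> i _; rewrite coefB coefZ coefX coef1 /= mulr0 subrr mul0r.
  rewrite !coefB !coefZ !coefX !coef1 /= mulr0 subr0 mul1r mulr1 sub0r subn0 /bump /= subSS subn0.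
  by rewrite !pexp_pow exprS mulNr subrr.
rewrite -[LHS]ps1mul -e -psmulA -pexpD pexp0 ?psmul1 // => d; exact: subrr.
Qed.

Lemma coef_prod_psmul (I : Type) (s : seq I) (P : I -> {poly Cp}) (f : I -> ps Cp) K :
  (forall i m, (m <= K)%N -> (P i)`_m = f i m) ->
  forall m, (m <= K)%N -> (\prod_(i <- s) P i)`_m = (\big[@psmul _ _ Cp/@ps1 _ _ Cp]_(i <- s) f i) m.
Proof.
move=> h; elim: s => [|i s IH] m mK; first by rewrite !big_nil coef1.
rewrite !big_cons (@psmul_coef _ _ _ _ _ (P i) (\prod_(j <- s) P j)) // => j jm.
  by rewrite h // (leq_trans jm).
by rewrite IH // (leq_trans jm).
Qed.

(** For a triangular form the determinant is the product of the factors 1 - aT over the diagonal,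
    each the exponential of - sum a^d T^d / d. Bounds on determinants and formulas for traces meet
    here. *)
Lemma detps_pexp r (A : 'M[Cp]_r) : detps A = pexp (fun d => - \tr (A ^+ d)).
Proof.
have [P uP tU] := trigonalize A; set U := (X in is_trig_mx X) in tU.
rewrite -(detps_conj A uP) -/U; apply/funext => m; rewrite /detps detpoly_trig //.
rewrite (@coef_prod_psmul _ _ _ (fun i => pexp (fun d => - U i i ^+ d)) m) //; last first.
  by move=> i k _; rewrite pexp_powN.
rewrite -pexp_sum; congr (pexp _ m); apply/funext => d.
by rewrite sumrN -(trace_trig_exp d tU) /U tr_exp_conj.
Qed.

End PowerSums.

(** * Traces of symmetric powers *)

Section Symmetric.
Variables (RR : realType) (p : nat) (Cp : padicField RR p).
Variable r : nat.
Implicit Types (A B U : 'M[Cp]_r.+1).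

(** A monomial of degree K in the basis vectors is encoded by its exponents. The type
    [{ffun 'I_r.+1 -> 'I_K.+1}] also contains vectors of other total degree, which [vld] singles
    out. *)
Definition mults K (J : K.-tuple 'I_r.+1) : {ffun 'I_r.+1 -> 'I_K.+1} :=
  [ffun i => inord (count_mem i J)].

Lemma multsE K (J : K.-tuple 'I_r.+1) i : mults J i = count_mem i J :> nat.
Proof. by rewrite ffunE inordK // ltnS -[leqRHS](size_tuple J) count_size. Qed.

Lemma mults_perm K (J J' : K.-tuple 'I_r.+1) : (mults J == mults J') = perm_eq J J'.
Proof.
apply/eqP/idP => [h|/seq.permP h]; last by apply/ffunP => i; apply/val_inj; rewrite /= !multsE h.
by apply/allP => i _ /=; rewrite -!multsE h.
Qed.

Definition repr K (m : {ffun 'I_r.+1 -> 'I_K.+1}) : K.-tuple 'I_r.+1 :=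
  odflt [tuple of nseq K ord0] [pick J | mults J == m].

Definition vld K (m : {ffun 'I_r.+1 -> 'I_K.+1}) := ((\sum_i m i)%N == K).

Lemma mults_vld K (J : K.-tuple 'I_r.+1) : vld (mults J).
Proof.
rewrite /vld -[X in _ == X](size_tuple J) -sum1_size.
rewrite (eq_bigr (fun i => \sum_(j <- J | j == i) 1)%N); last first.
  by move=> i _; rewrite multsE sum1_count.
rewrite (exchange_big_dep predT) //=; apply/eqP/eq_bigr => j _.
by rewrite (big_pred1 j) // => i; rewrite eq_sym.
Qed.

Lemma repr_mults K (m : {ffun 'I_r.+1 -> 'I_K.+1}) : vld m -> mults (repr m) = m.
Proof.
move=> /eqP hm; rewrite /repr; case: pickP => [J /eqP //|/= nJ].
pose s := flatten [seq nseq (m i) i | i <- enum 'I_r.+1].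
have ss : size s == K.
  rewrite size_flatten /shape -map_comp sumnE big_map big_enum /=.
  apply/eqP; rewrite -[RHS]hm; apply: eq_bigr => i _; exact: size_nseq.
suff h : mults (Tuple ss) == m by move: (nJ (Tuple ss)); rewrite h.
apply/eqP/ffunP => i; apply/val_inj; rewrite /= multsE /= /s count_flatten -map_comp sumnE big_map big_enum /=.
rewrite (bigD1 i) //= count_nseq /= eqxx mul1n big1 ?addn0 // => j ji.
by rewrite count_nseq /= (negbTE ji) mul0n.
Qed.

(** The entry of Sym^K(A) at the monomials m and S: the coefficient of m in the product of the
    columns of A listed in S. *)
Definition symp K A (m : {ffun 'I_r.+1 -> 'I_K.+1}) (S : K.-tuple 'I_r.+1) : Cp :=
  \sum_(J | mults J == m) \prod_a A (tnth J a) (tnth S a).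

Lemma symp_junk K A (m : {ffun 'I_r.+1 -> 'I_K.+1}) S : ~~ vld m -> symp A m S = 0.
Proof.
by move=> nm; rewrite /symp big_pred0 // => J; apply: contraNF nm => /eqP <-; exact: mults_vld.
Qed.

Lemma symp_perm K A (m : {ffun 'I_r.+1 -> 'I_K.+1}) S S' : mults S = mults S' ->
  symp A m S = symp A m S'.
Proof.
move=> /eqP; rewrite mults_perm => /tuple_permP[s hs].
rewrite /symp (reindex (fun J : K.-tuple 'I_r.+1 => [tuple tnth J (s a) | a < K])) /=; last first.
  exists (fun J : K.-tuple 'I_r.+1 => [tuple tnth J ((s^-1)%g a) | a < K]) => J _;
  by apply: eq_from_tnth => a; rewrite !tnth_mktuple ?permK ?permKV.
apply: eq_big => [J|J _].
  congr (_ == m); apply/eqP; rewrite mults_perm; apply/tuple_permP; by exists s.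
rewrite [RHS](reindex_inj (@perm_inj _ s)) /=; apply: eq_bigr => a _.
by rewrite tnth_mktuple (tnth_nth ord0 S) hs -tnth_nth tnth_mktuple.
Qed.

Lemma symp_mul K A B (m : {ffun 'I_r.+1 -> 'I_K.+1}) S :
  symp (A *m B) m S = \sum_m' symp A m (repr m') * symp B m' S.
Proof.
transitivity (\sum_(J' : K.-tuple 'I_r.+1) symp A m J' * \prod_a B (tnth J' a) (tnth S a)).
  rewrite /symp; under [RHS]eq_bigr do rewrite big_distrl /=.
  rewrite [RHS]exchange_big /=; apply: eq_bigr => J _.
  under [LHS]eq_bigr do rewrite mxE.
  rewrite (bigA_distr_bigA (fun a j => A (tnth J a) j * B j (tnth S a))) /=.
  rewrite (sum_tuple_ffun (fun f => \prod_a (A (tnth J a) (f a) * B (f a) (tnth S a)))).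
  apply: eq_bigr => J' _; rewrite -big_split /=.
  by apply: eq_bigr => a _; rewrite ffunE.
rewrite (partition_big (@mults K) predT) //=; apply: eq_bigr => m' _.
rewrite {2}/symp big_distrr /=; apply: eq_bigr => J' /eqP hJ'.
congr (_ * _); apply: symp_perm; rewrite repr_mults //.
by rewrite -hJ' mults_vld.
Qed.

(** The trace of Sym^K(A); the terms with m of total degree other than K vanish by [symp_junk]. *)
Definition hsum K A : Cp := \sum_m symp (K := K) A m (repr m).

Lemma hsum_swap K A B : hsum K (A *m B) = hsum K (B *m A).
Proof.
rewrite /hsum; under eq_bigr do rewrite symp_mul.
rewrite exchange_big /=; apply: eq_bigr => m _; rewrite symp_mul.
by apply: eq_bigr => m' _; rewrite mulrC.
Qed.

(** Both sides are invariant under conjugation, and for a triangular matrix both are the complete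
    symmetric function of degree K in the diagonal entries. *)
Lemma hsum_pexp K A : hsum K A = pexp (fun d => \tr (A ^+ d)) K.
Proof.
have [P uP tU] := trigonalize A; set U := (X in is_trig_mx X) in tU.
have -> : hsum K A = hsum K U by rewrite /U hsum_swap mulmxA mulVmx // mul1mx.
rewrite (_ : (fun d => \tr (A ^+ d)) = fun d => \sum_i U i i ^+ d); last first.
  by apply/funext => d; rewrite -(trace_trig_exp d tU) tr_exp_conj.
rewrite pexp_sum -(@coef_prod_psmul _ _ _ _ _ (fun i => \poly_(k < K.+1) U i i ^+ k) _ K) //; last first.
  by move=> i m mK; rewrite coef_poly ltnS mK pexp_pow.
rewrite (eq_bigr (fun i => \sum_(k < K.+1) U i i ^+ k *: 'X^k)); last by move=> i _; rewrite poly_def.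
rewrite (bigA_distr_bigA (fun i (k : 'I_K.+1) => U i i ^+ k *: 'X^k)) /= coef_sum.
apply: eq_bigr => m _.
have -> : \prod_i (U i i ^+ m i *: 'X^(m i)) = (\prod_i U i i ^+ m i) *: 'X^(\sum_i m i)%N :> {poly Cp}.
  rewrite (eq_bigr (fun i => (U i i ^+ m i)%:P * 'X^(m i))); last by move=> i _; rewrite mul_polyC.
  by rewrite big_split /= -rmorph_prod mul_polyC prodrXr.
rewrite coefZ coefXn eq_sym -/(vld m); have [vm|nm] := boolP (vld m); last by rewrite symp_junk // mulr0.
rewrite mulr1 /symp (bigD1 (repr m)) /=; last by rewrite repr_mults.
rewrite [X in _ + X]big1 ?addr0 => [|J /andP[/eqP mJ nJ]].
  rewrite -(big_tuple _ _ (repr m) xpredT (fun i => U i i)) (partition_big id predT) //=.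
  apply: eq_bigr => i _; rewrite (eq_bigr (fun=> U i i)); last by move=> j /eqP ->.
  by rewrite big_const_seq iter_mulr_1 -multsE repr_mults.
(* A nonzero product over J forces J to dominate [repr m] entrywise; being a rearrangement of it, J
   has the same sum of indices and so equals it. *)
apply/eqP; apply: contraNT nJ => /prodf_neq0 nz; move/is_trig_mxP: tU => tU.
have le a : (tnth (repr m) a <= tnth J a)%N.
  by rewrite leqNgt; apply: contra (nz a isT) => /tU ->.
have pJ : perm_eq J (repr m) by rewrite -mults_perm mJ repr_mults.
have : (\sum_a (tnth J a - tnth (repr m) a) == 0)%N.
  rewrite sumnB // -(big_tuple _ _ J xpredT (fun i => nat_of_ord i)).
  by rewrite -(big_tuple _ _ (repr m) xpredT (fun i => nat_of_ord i)) (perm_big _ pJ) subnn.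
rewrite sum_nat_eq0 => /forallP /= h; apply/eqP/eq_from_tnth => a; apply/val_inj/eqP.
by rewrite eqn_leq le andbT -subn_eq0 h.
Qed.

End Symmetric.

(** * Torsion points and the trace formula *)

Section Torsion.
Variables (RR : realType) (p : nat) (Cp : padicField RR p) (n : nat).
Local Notation V := (@pabs _ _ Cp).
Local Notation expo := (expo n).
Implicit Types (x : 'rV[Cp]_n) (u v w : expo).

Definition torus x := forall i, x 0 i != 0.

Definition frb (e : nat) x : 'rV[Cp]_n := map_mx (fun z => z ^+ e) x.

Lemma frb_torus e x : torus x -> torus (frb e x).
Proof. by move=> hx i; rewrite mxE expf_neq0. Qed.

Lemma frbM e f x : frb e (frb f x) = frb (f * e) x.
Proof. by apply/rowP => i; rewrite !mxE exprM. Qed.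

Lemma frb1 x : frb 1 x = x.
Proof. by apply/rowP => i; rewrite mxE expr1. Qed.

Lemma monom0 x : monom x 0 = 1.
Proof. by rewrite /monom big1 // => i _; rewrite mxE expr0z. Qed.

Lemma monomD x u v : torus x -> monom x (u + v) = monom x u * monom x v.
Proof.
by move=> hx; rewrite /monom -big_split; apply: eq_bigr => i _; rewrite mxE expfzDr.
Qed.

Lemma monomN x u : torus x -> monom x (- u) = (monom x u)^-1.
Proof.
move=> hx; rewrite /monom -prodfV; apply: eq_bigr => i _.
by rewrite mxE invr_expz.
Qed.

Lemma monom_frb e x u : monom (frb e x) u = monom x (u *+ e).
Proof.
apply: eq_bigr => i _; rewrite mxE mulmxnE (exprnP _ e) exprz_exp.
by congr (_ ^ _); rewrite -[RHS]mulr_natl natz.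
Qed.

Lemma monom_frbX e x u : monom (frb e x) u = monom x u ^+ e.
Proof.
rewrite /monom -prodrXl; apply: eq_bigr => i _; rewrite mxE.
by rewrite -[_ ^+ e]/(_ ^ (e%:Z)) -[in RHS]/(_ ^ (e%:Z)) !exprz_exp mulrC.
Qed.

Variable q : nat.
Hypothesis q1 : (1 < q)%N.

(** For 0 < d these are the torus points fixed by the q^d-th power map, that is, the Teichmueller
    lifts of the points over the field with q^d elements. *)
Definition tor (d : nat) x := forall i, x 0 i ^+ (q ^ d).-1 = 1.

Lemma qd_gt1 d : (0 < d)%N -> (1 < q ^ d)%N.
Proof. by move=> d0; rewrite -(exp1n d) ltn_exp2r. Qed.

Lemma qd_pred d : (0 < d)%N -> (0 < (q ^ d).-1)%N.
Proof. by move/qd_gt1; case: (q ^ d)%N => [|[]]. Qed.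

Lemma tor_torus d x : (0 < d)%N -> tor d x -> torus x.
Proof.
move=> d0 hx i; apply: contra_eq_neq (hx i) => ->.
by rewrite expr0n gtn_eqF ?qd_pred // eq_sym oner_eq0.
Qed.

Lemma root1_abs (z : Cp) N : (0 < N)%N -> z ^+ N = 1 -> V z = 1.
Proof.
move=> N0 h; apply/eqP; rewrite -(@pexpr_eq1 _ _ N) ?pabs_ge0 //.
by rewrite -pabsX h pabs1.
Qed.

Lemma tor_abs d x : (0 < d)%N -> tor d x -> forall i, V (x 0 i) = 1.
Proof. by move=> d0 hx i; apply: root1_abs (hx i); exact: qd_pred. Qed.

Lemma monom_abs d x u : (0 < d)%N -> tor d x -> V (monom x u) = 1.
Proof.
move=> d0 hx; rewrite pabs_prod big1 // => i _.
by rewrite pabs_exprz (tor_abs d0 hx) exp1rz.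
Qed.

Lemma tor_frb d x : (0 < d)%N -> tor d x -> frb (q ^ d) x = x.
Proof.
move=> d0 hx; apply/rowP => i; rewrite mxE -(ltn_predK (qd_gt1 d0)) exprS.
by rewrite hx mulr1.
Qed.

Lemma frb_tor e d x : tor d x -> tor d (frb e x).
Proof. by move=> hx i; rewrite mxE exprAC hx expr1n. Qed.

Lemma torP d x : (0 < d)%N -> tor d x <-> torus x /\ frb (q ^ d) x = x.
Proof.
move=> d0; split=> [h|[h1 h2] i]; first by split; [exact: tor_torus h|exact: tor_frb].
apply: (mulfI (h1 i)); rewrite -exprS (ltn_predK (qd_gt1 d0)) mulr1.
by have /rowP/(_ i) := h2; rewrite mxE.
Qed.

Lemma tor_mul d l x : tor d x -> tor (d * l) x.
Proof.
move=> hx i; have [e ->] : exists e, (q ^ (d * l)).-1 = ((q ^ d).-1 * e)%N.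
  rewrite expnM; have /dvdnP[k ->] := dvdn_pred_predX (q ^ d) l; exists k; exact: mulnC.
by rewrite exprM hx expr1n.
Qed.

Lemma prim_root_exists N : (0 < N)%N -> exists z : Cp, N.-primitive_root z.
Proof.
move=> N0; pose P : {poly Cp} := 'X^N - 1.
have [r rP] := closed_field_poly_normal P.
have mP : lead_coef P = 1 by rewrite lead_coefDl ?lead_coefXn // size_polyXn size_polyN size_poly1 ltnS.
rewrite mP scale1r in rP.
have ur : uniq r.
  by rewrite -separable_prod_XsubC -rP separable_Xn_sub_1 // natr_gt0_neq0.
have sr : size r = N.
  have := congr1 (fun Q : {poly Cp} => size Q) rP; rewrite size_prod_XsubC size_polyDl ?size_polyXn ?size_polyN ?size_poly1 ?ltnS //.
  by move=> [<-].
have ar : all N.-unity_root r.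
  by apply/allP => z; rewrite -root_prod_XsubC -rP.
have := @has_prim_root Cp N r N0 ar ur; rewrite sr leqnn => /(_ isT)/hasP[z _ hz].
by exists z.
Qed.

Definition zeta d : Cp := xget 1 [set z : Cp | (q ^ d).-1.-primitive_root z].

Lemma zetaP d : (0 < d)%N -> (q ^ d).-1.-primitive_root (zeta d).
Proof.
move=> d0; rewrite /zeta; case: xgetP => [z _ //|].
by have [z hz] := prim_root_exists (qd_pred d0); move/(_ z hz).
Qed.

Definition tpt d (c : {ffun 'I_n -> 'I_(q ^ d).-1}) : 'rV[Cp]_n := \row_i zeta d ^+ c i.

Lemma tpt_tor d (c : {ffun 'I_n -> 'I_(q ^ d).-1}) : (0 < d)%N -> tor d (tpt c).
Proof. by move=> d0 i; rewrite mxE exprAC (prim_expr_order (zetaP d0)) expr1n. Qed.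

Lemma tpt_inj d : (0 < d)%N -> injective (@tpt d).
Proof.
move=> d0 c c' h; apply/ffunP => i; apply/val_inj/eqP.
have /rowP/(_ i) := h; rewrite !mxE => /eqP.
by rewrite (eq_prim_root_expr (zetaP d0)) !modn_small.
Qed.

Lemma tpt_surj d x : (0 < d)%N -> tor d x -> exists c, x = tpt (d := d) c.
Proof.
move=> d0 hx; exists [ffun i => projT1 (prim_rootP (zetaP d0) (hx i))].
apply/rowP => i; rewrite mxE ffunE; by case: prim_rootP.
Qed.

Definition tsum d (f : 'rV[Cp]_n -> Cp) := \sum_(c : {ffun 'I_n -> 'I_(q ^ d).-1}) f (tpt c).

(** Orthogonality of characters: the sum factors over the coordinates, and each factor is a
    geometric sum over roots of unity, equal to q^d - 1 or to 0. *)
Lemma tsum_monom d w : (0 < d)%N ->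
  tsum d (fun x => monom x w) = if [forall i, ((q ^ d).-1%:Z %| w ord0 i)%Z] then (q ^ d).-1%:R ^+ n else 0.
Proof.
move=> d0; set N := (q ^ d).-1; have N0 : (0 < N)%N := qd_pred d0.
have z0 : zeta d != 0 by rewrite (prim_root_eq0 (zetaP d0)) gtn_eqF.
have key (k : int) : \sum_(a < N) (zeta d ^+ a) ^ k = if (N%:Z %| k)%Z then N%:R else 0.
  have -> : \sum_(a < N) (zeta d ^+ a) ^ k = \sum_(a < N) (zeta d ^ k) ^+ a.
    apply: eq_bigr => a _; rewrite -[_ ^+ a]/(_ ^ (a%:Z)) -[in RHS]/(_ ^ (a%:Z)).
    by rewrite !exprz_exp mulrC.
  case: ifP => [/dvdzP[j ->]|nk].
    rewrite (eq_bigr (fun=> 1)) ?sumr_const ?card_ord // => a _.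
    by rewrite mulrC -exprz_exp -exprnP (prim_expr_order (zetaP d0)) exp1rz expr1n.
  have h : zeta d ^ k != 1.
    apply/negP => /eqP h; move: nk; rewrite /dvdz /= => /negP; apply.
    have : zeta d ^+ `|k|%N == 1.
      by case: k h => m; rewrite ?NegzE /= -?exprnN -?exprnP => /eqP //; rewrite invr_eq1.
    by rewrite -(prim_order_dvd (zetaP d0)).
  apply: (mulfI (x := zeta d ^ k - 1)); first by rewrite subr_eq0.
  rewrite -subrX1 mulr0 -[_ ^+ N]/(_ ^ (N%:Z)) exprz_exp mulrC -exprz_exp -exprnP.
  by rewrite (prim_expr_order (zetaP d0)) exp1rz subrr.
rewrite /tsum /monom.
transitivity (\prod_i \sum_(a < N) (zeta d ^+ a) ^ w 0 i).
  rewrite (bigA_distr_bigA (fun i (a : 'I_N) => (zeta d ^+ a) ^ w 0 i)).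
  by apply: eq_bigr => c _; apply: eq_bigr => i _; rewrite mxE.
case: ifP => [/forallP h|/negbT].
  by rewrite (eq_bigr (fun=> N%:R)) ?prodr_const ?card_ord // => i _; rewrite key h.
by rewrite negb_forall => /existsP[i hi]; rewrite (bigD1 i) //= key (negbTE hi) mul0r.
Qed.

Lemma pabs_qd d : V q%:R < 1 -> (0 < d)%N -> V (q ^ d).-1%:R = 1.
Proof.
move=> hq d0; have h : V (q ^ d)%:R < 1.
  by rewrite natrX pabsX exprn_ilt1 ?pabs_ge0 // -lt0n.
have -> : (q ^ d).-1%:R = -1 + (q ^ d)%:R :> Cp.
  by rewrite -{2}(ltn_predK (qd_gt1 d0)) -[in RHS]natr1 addrC addrK.
by rewrite pabs_dominant pabsN pabs1.
Qed.

End Torsion.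

(** * Laurent polynomials and Dwork's operator *)

Section LaurentLists.
Variables (RR : realType) (p : nat) (Cp : padicField RR p) (n : nat).
Local Notation V := (@pabs _ _ Cp).
Local Notation expo := (expo n).
Local Notation llist := (seq (Cp * expo)).
Implicit Types (x : 'rV[Cp]_n) (u v w : expo) (L : llist).

(** Laurent polynomials are unreduced lists of terms (coefficient, exponent), so that sums are
    concatenations and products are lists of pairs, without any normalisation. *)
Definition lev L x : Cp := \sum_(t <- L) t.1 * monom x t.2.

Definition lmulq (Q : nat) L L' : llist :=
  [seq (t.1 * t'.1, t.2 + t'.2 *+ Q) | t <- L, t' <- L'].

Lemma lev_cat L L' x : lev (L ++ L') x = lev L x + lev L' x.
Proof. exact: big_cat. Qed.

Lemma lev_flatten (Ls : seq llist) x : lev (flatten Ls) x = \sum_(L <- Ls) lev L x.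
Proof. exact: big_flatten. Qed.

Lemma lev_mulq Q L L' x : torus x -> lev (lmulq Q L L') x = lev L x * lev L' (frb Q x).
Proof.
move=> hx; rewrite /lev big_allpairs_dep /= big_distrl /=; apply: eq_bigr => t _.
rewrite big_distrr /=; apply: eq_bigr => t' _.
by rewrite monomD // monom_frb mulrACA.
Qed.

(** A matrix entry of Dwork's operator: the coefficient of X^u' in psi_Q(L X^u), where psi_Q keeps
    the exponents divisible by Q and divides them by Q. *)
Definition gam (Q : nat) L u u' : Cp := \sum_(t <- L | t.2 == u' *+ Q - u) t.1.

Definition inbox (D : nat) u := [forall i, `|u ord0 i| <= D%:Z].

Definition boxT (D : nat) := {ffun 'I_n -> 'I_D.*2.+1}.

Definition bx D (c : boxT D) : expo := \row_i ((c i)%:Z - D%:Z).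

Lemma bx_inj D : injective (@bx D).
Proof.
move=> c c' h; apply/ffunP => i; apply/val_inj.
by have /rowP/(_ i) := h; rewrite !mxE => /addIr [].
Qed.

Lemma bx_inbox D (c : boxT D) : inbox D (bx c).
Proof.
apply/forallP => i; rewrite mxE; have := ltn_ord (c i); move: (nat_of_ord (c i)) => k; rewrite -muln2; lia.
Qed.

Lemma bx_surj D u : inbox D u -> exists c, u = bx (D := D) c.
Proof.
move=> /forallP h; have hi i : (absz (u ord0 i + D%:Z)%R < D.*2.+1)%N.
  by have := h i; rewrite -muln2; lia.
exists [ffun i => Ordinal (hi i)]; apply/rowP => i; rewrite mxE ffunE /=.
by have := h i; rewrite (_ : u 0 i = u ord0 i) //; lia.
Qed.

Lemma sum_box_pick D v (F : expo -> Cp) :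
  \sum_(c : boxT D | bx c == v) F (bx c) = if inbox D v then F v else 0.
Proof.
case: ifP => [/bx_surj[c ->]|nv].
  by rewrite (big_pred1 c) // => c' /=; rewrite (inj_eq (@bx_inj D)).
by rewrite big_pred0 // => c; apply/negP => /eqP h; move: nv; rewrite -h bx_inbox.
Qed.

Section GammaMatrix.
Variables (q : nat) (q1 : (1 < q)%N) (Y : finType).
Variable (L : Y -> Y -> llist) (D : nat).
Hypothesis LD : forall y y' t, t \in L y y' -> inbox D t.2.

Definition lmm Q (L' : Y -> Y -> llist) : Y -> Y -> llist := fun y y'' =>
  flatten [seq lmulq Q (L y y') (L' y' y'') | y' <- enum Y].

Fixpoint lpow d : Y -> Y -> llist :=
  if d is d'.+1 then lmm q (lpow d') else fun y y' => if y == y' then [:: (1, 0)] else [::].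

Fixpoint apow (A : 'rV[Cp]_n -> Y -> Y -> Cp) d x y y' : Cp :=
  if d is d'.+1 then \sum_z A x y z * apow A d' (frb q x) z y' else (y == y')%:R.

Lemma lev_lpow d x y y' : torus x -> lev (lpow d y y') x = apow (fun x y y' => lev (L y y') x) d x y y'.
Proof.
elim: d x y y' => [|d IH] x y y' hx /=.
  by case: eqP; rewrite /lev ?big_seq1 ?big_nil // monom0 mulr1.
rewrite /lmm lev_flatten big_map big_enum /=; apply: eq_bigr => z _.
by rewrite lev_mulq // IH //; exact: frb_torus.
Qed.

(** Exponents grow at most like D(1 + q + ... + q^(d-1)); the factor q - 1 on the left avoids a
    division. *)
Lemma lpow_bound d y y' t i : t \in lpow d y y' ->
  `|t.2 ord0 i| * (q.-1)%:Z <= D%:Z * (q ^ d).-1%:Z.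
Proof.
elim: d y y' t => [|d IH] y y' t /=.
  by case: eqP => // _; rewrite inE => /eqP -> /=; rewrite mxE normr0 mul0r mulr0.
move=> /flattenP[l /mapP[z _ ->]] /allpairsP[[t1 t2] /= [h1 h2 ->]] /=.
have /forallP/(_ i) b1 := LD h1; have b2 := IH _ _ _ h2.
rewrite mxE mulmxnE; rewrite expnS.
have q0 := qd_gt1 q1; have e1 : (q ^ d > 0)%N by rewrite expn_gt0 ltnW.
move: b1 b2 e1; set a := t1.2 _ _; set b := t2.2 _ _; move: (q ^ d)%N => Q b1 b2 e1.
have hb : `|b *+ q| = `|b| * q%:Z by rewrite normrMn -mulr_natr natz.
have tri := ler_normD a (b *+ q); rewrite hb in tri.
have hq : (q.-1)%:Z = q%:Z - 1 by lia.
have hQ : (Q.-1)%:Z = Q%:Z - 1 by lia.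
have hqQ : ((q * Q).-1)%:Z = q%:Z * Q%:Z - 1 by rewrite -PoszM; lia.
rewrite hq hQ in b2 *; rewrite hqQ.
have q2 : 1 <= q%:Z by lia.
have b3 : `|a| * (q%:Z - 1) <= D%:Z * (q%:Z - 1) by rewrite ler_wpM2r // subr_ge0.
have b4 : `|b| * (q%:Z - 1) * q%:Z <= D%:Z * (Q%:Z - 1) * q%:Z by rewrite ler_wpM2r // ler0n.
have b5 : `|a + b *+ q| * (q%:Z - 1) <= (`|a| + `|b| * q%:Z) * (q%:Z - 1) by rewrite ler_wpM2r // subr_ge0.
apply: le_trans b5 _.
have -> : (`|a| + `|b| * q%:Z) * (q%:Z - 1) = `|a| * (q%:Z - 1) + `|b| * (q%:Z - 1) * q%:Z by ring.
have -> : D%:Z * (q%:Z * Q%:Z - 1) = D%:Z * (q%:Z - 1) + D%:Z * (Q%:Z - 1) * q%:Z by ring.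
exact: lerD.
Qed.

(** This is the rule L' psi_q(f) = psi_q(L'(X^q) f), in matrix form. The point is that the box of
    radius D already contains all relevant intermediate exponents. *)
Lemma gam_lmm Q (L' : Y -> Y -> llist) u u'' y y'' : inbox D u ->
  \sum_z \sum_(c : boxT D) gam q (L y z) u (bx c) * gam Q (L' z y'') (bx c) u'' =
  gam (q * Q) (lmm q L' y y'') u u''.
Proof.
move=> hu; rewrite /gam /lmm big_flatten big_map big_enum /=; apply: eq_bigr => z _.
transitivity (\sum_(t <- L y z) \sum_(t' <- L' z y'')
   if t.2 + t'.2 *+ q == u'' *+ (q * Q) - u then t.1 * t'.1 else 0); last first.
  by rewrite [RHS]big_mkcond /lmulq big_allpairs_dep.
transitivity (\sum_(c : boxT D) \sum_(t <- L y z) \sum_(t' <- L' z y'')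
   (if (t.2 == bx c *+ q - u) && (t'.2 == u'' *+ Q - bx c) then t.1 * t'.1 else 0)).
  apply: eq_bigr => c _; rewrite big_mkcond big_distrl /=; apply: eq_bigr => t _.
  case: ifP => _; last by rewrite mul0r big1.
  by rewrite big_mkcond big_distrr /=; apply: eq_bigr => t' _; case: ifP => //; rewrite mulr0.
rewrite exchange_big /=; apply: eq_big_seq => t tL; rewrite exchange_big /=.
apply: eq_bigr => t' _; pose v := u'' *+ Q - t'.2.
have e1 c : (t'.2 == u'' *+ Q - bx c) = (bx (D := D) c == v).
  by rewrite /v; apply/eqP/eqP => ->; rewrite opprB addrC subrK.
under eq_bigr do rewrite e1 andbC.
transitivity (\sum_(c : boxT D | bx c == v) if t.2 == bx c *+ q - u then t.1 * t'.1 else 0).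
  by rewrite [RHS]big_mkcond; apply: eq_bigr => c _; case: (bx c == v).
rewrite (sum_box_pick D v (fun w => if t.2 == w *+ q - u then t.1 * t'.1 else 0)).
have e2 : (t.2 == v *+ q - u) = (t.2 + t'.2 *+ q == u'' *+ (q * Q) - u).
  rewrite /v mulrnBl mulnC mulrnA -(inj_eq (addIr (t'.2 *+ q))); congr (_ == _).
  by rewrite addrAC subrK.
rewrite e2; case: ifP => [//|nv]; case: ifP => // h; move: h nv; rewrite -e2 => /eqP h.
case/negP; apply/forallP => i.
have /forallP/(_ i) b1 := LD tL; have /forallP/(_ i) b2 := hu.
have : t.2 ord0 i = v ord0 i * q%:Z - u ord0 i by clearbody v; rewrite h mxE mulmxnE [(- u) _ _]mxE -mulr_natr natz.
move: b1 b2; set a := t.2 _ _; set b := u _ _; set d := v _ _ => b1 b2 h3.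
(* An intermediate exponent d satisfies q|d| <= |a| + |b| <= 2D, and q >= 2 brings it back into the
   box. *)
have h4 : `|d| * q%:Z <= D%:Z * 2.
  have -> : `|d| * q%:Z = `|a + b| by rewrite h3 subrK normrM (@ger0_norm _ q%:Z).
  by apply: le_trans (ler_normD _ _) _; lia.
have h5 : `|d| * 2 <= `|d| * q%:Z by rewrite ler_wpM2l // lez_nat.
lia.
Qed.

Definition gamI := (Y * boxT D)%type.

Definition Gam : 'M[Cp]_#|{: gamI}| := \matrix_(i, j)
  gam q (L (enum_val i).1 (enum_val j).1) (bx (enum_val i).2) (bx (enum_val j).2).

Lemma Gam_exp d i j : (Gam ^+ d) i j =
  gam (q ^ d) (lpow d (enum_val i).1 (enum_val j).1) (bx (enum_val i).2) (bx (enum_val j).2).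
Proof.
elim: d i j => [|d IH] i j.
  rewrite expr0 mxE -(inj_eq enum_val_inj) /gam /=.
  case: (enum_val i) (enum_val j) => [y c] [y' c'] /=; rewrite expn0 mulr1n xpair_eqE.
  case: eqP => _ /=; last by rewrite big_nil.
  by rewrite [RHS]big_mkcond big_seq1 /= [0 == _]eq_sym subr_eq0 (inj_eq (@bx_inj D)) eq_sym; case: eqP.
rewrite exprS -[_ * _]/(_ *m _) mxE.
transitivity (\sum_(s : gamI) gam q (L (enum_val i).1 s.1) (bx (enum_val i).2) (bx s.2) *
   gam (q ^ d) (lpow d s.1 (enum_val j).1) (bx s.2) (bx (enum_val j).2)).
  rewrite (reindex (@enum_val _ (mem {: gamI}))) /=; last exact: onW_bij (@enum_val_bij _).
  by apply: eq_bigr => k _; rewrite mxE IH.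
rewrite -(pair_bigA _ (fun z c => gam q (L (enum_val i).1 z) (bx (enum_val i).2) (bx c) *
   gam (q ^ d) (lpow d z (enum_val j).1) (bx c) (bx (enum_val j).2))) /=.
by rewrite gam_lmm ?expnS //; exact: bx_inbox.
Qed.

(** Dwork's trace formula. The trace picks the terms of the d-fold product whose exponent is (q^d -
    1)u with u in the box; orthogonality picks those whose exponent is divisible by q^d - 1, and
    [lpow_bound] puts the quotient in the box. *)
Lemma Gam_trace d : (0 < d)%N ->
  (q ^ d).-1%:R ^+ n * \tr (Gam ^+ d) =
  tsum q d (fun x => \sum_y apow (fun x y y' => lev (L y y') x) d x y y).
Proof.
move=> d0; pose N := (q ^ d).-1.
have -> : \tr (Gam ^+ d) = \sum_y \sum_(c : boxT D) gam (q ^ d) (lpow d y y) (bx c) (bx c).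
  rewrite pair_big /= (reindex (@enum_val _ (mem {: gamI}))) /=; last exact: onW_bij (@enum_val_bij _).
  by apply: eq_bigr => k _; rewrite Gam_exp.
rewrite /tsum.
transitivity (\sum_y \sum_(c : {ffun 'I_n -> 'I_N}) lev (lpow d y y) (tpt Cp c)); last first.
  rewrite exchange_big /=; apply: eq_bigr => c _; apply: eq_bigr => y _; rewrite lev_lpow //.
  exact: (tor_torus q1 d0 (tpt_tor Cp q1 c d0)).
rewrite big_distrr /=; apply: eq_bigr => y _; rewrite [in RHS]/lev exchange_big /= /gam.
transitivity (\sum_(t <- lpow d y y) \sum_(c : boxT D)
   if t.2 == bx c *+ N then N%:R ^+ n * t.1 else 0).
  rewrite exchange_big /= big_distrr /=; apply: eq_bigr => c _; rewrite big_mkcond big_distrr /=.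
  have -> : bx c *+ q ^ d - bx c = bx c *+ N.
    by rewrite /N -{1}(ltn_predK (qd_gt1 q1 d0)) mulrSr addrK.
  by apply: eq_bigr => t _; case: eqP => // _; rewrite mulr0.
apply: eq_big_seq => t ht; rewrite -big_distrr /=.
have := tsum_monom Cp q1 t.2 d0; rewrite /tsum -/N => ->.
case: ifP => [/forallP hd|nd]; last first.
  rewrite mulr0 big1 // => c _; case: eqP => // h; case/negP: nd; apply/forallP => i.
  by rewrite h mulmxnE -mulr_natr natz dvdz_mull.
pose v : expo := \row_i (t.2 ord0 i %/ N%:Z)%Z.
have hv : t.2 = v *+ N.
  by apply/rowP => i; rewrite mulmxnE mxE -mulr_natr natz divzK.
have N0 : (0 < N)%N by apply: qd_pred.
have e (c : boxT D) : (t.2 == bx c *+ N) = (bx c == v).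
  rewrite hv eq_sym; apply/eqP/eqP => [h|-> //]; apply/rowP => i.
  have hN : N%:Z != 0 by rewrite eqz_nat -lt0n.
  have /rowP/(_ i) := h; rewrite !mulmxnE -[LHS]mulr_natr -[RHS]mulr_natr natz.
  by move/(mulIf hN).
under eq_bigr do rewrite e.
rewrite -big_mkcond (sum_box_pick D v (fun=> N%:R ^+ n * t.1)).
suff -> : inbox D v by rewrite mulrC.
apply/forallP => i; have := lpow_bound i ht; rewrite hv mulmxnE -mulr_natr natz normrM.
rewrite (@ger0_norm _ N%:Z) // -/N mulrAC => h.
have : `|v ord0 i| * (q.-1)%:Z <= D%:Z by rewrite -(ler_pM2r (x := N%:Z)) ?ltz_nat.
apply: le_trans; rewrite ler_peMr // lez_nat; move: q1; case: (q) => [|[]] //.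
Qed.

End GammaMatrix.
End LaurentLists.

Definition subring (RR : realType) (p : nat) (Cp : padicField RR p) (P : set Cp) :=
  [/\ P 1, forall x y, P x -> P y -> P (x - y) & forall x y, P x -> P y -> P (x * y)].

(** * Growth of characteristic series from column bounds *)

Section ColumnBound.
Variables (RR : realType) (p : nat) (Cp : padicField RR p).
Local Notation V := (@pabs _ _ Cp).

(** In a principal minor the factors g i / g j cancel along every permutation, leaving the column
    bounds of the m chosen columns. At most k of these exceed lam, and each of them costs a factor
    C0 / lam. *)
Lemma detps_col_bound N (A : 'M[Cp]_N) (cb g : 'I_N -> RR) (G : {set 'I_N}) (lam C0 : RR) k m :
  0 < lam -> lam <= C0 -> (forall i, 0 < g i) -> (forall i, 0 <= cb i <= C0) ->
  (forall i, i \notin G -> cb i <= lam) -> (#|G| <= k)%N ->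
  (forall i j, V (A i j) <= cb j * (g i / g j)) ->
  V (detps A m) <= (C0 / lam) ^+ k * lam ^+ m.
Proof.
move=> l0 lC g0 hcb hG hk hA.
have C1 : 1 <= C0 / lam by rewrite ler_pdivlMr ?mul1r.
rewrite detps_minors pabsM pabsX pabsN1 expr1n mul1r.
have rhs0 : 0 <= (C0 / lam) ^+ k * lam ^+ m.
  by rewrite mulr_ge0 ?exprn_ge0 ?(le_trans ler01 C1) // ltW.
apply: pabs_sum => // S iS; apply: pabs_sum => // s _.
rewrite pabsM pabsX pabsN1 expr1n mul1r pabs_prod.
apply: (@le_trans _ _ (\prod_a (cb (tnth S (s a)) * (g (tnth S a) / g (tnth S (s a)))))).
  by apply: ler_prod => a _; rewrite pabs_ge0 mxE hA.
have gu : \prod_a g (tnth S a) != 0 by apply/prodf_neq0 => a _; rewrite gt_eqF.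
rewrite big_split /= [X in _ * X]big_split /= prodfV.
have e (F : 'I_N -> RR) : \prod_a F (tnth S (s a)) = \prod_a F (tnth S a).
  by rewrite [RHS](reindex_inj (@perm_inj _ s)).
rewrite !e divff // mulr1.
pose k' := #|[set a | tnth S a \in G]%SET|.
have kk : (k' <= k)%N.
  apply: leq_trans hk; rewrite /k' -(card_in_imset (f := tnth S)); last first.
    by move=> a b _ _; move/tuple_uniqP: (incr_uniq iS); apply.
  by apply/subset_leq_card/fintype.subsetP => i /imsetP[a]; rewrite inE => h ->.
apply: (@le_trans _ _ ((C0 / lam) ^+ k' * lam ^+ m)); last first.
  by rewrite ler_wpM2r ?exprn_ge0 ?(ltW l0) // ler_weXn2l.
have -> : (C0 / lam) ^+ k' * lam ^+ m = \prod_(a < m) ((if tnth S a \in G then C0 / lam else 1) * lam).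
  rewrite big_split /= prodr_const card_ord; congr (_ * _).
  by rewrite -big_mkcond /= /k' -prodr_const; apply: eq_bigl => a; rewrite inE.
apply: ler_prod => a _; have /andP[-> h] := hcb (tnth S a); rewrite /=.
by case: ifPn => [_|/hG]; rewrite ?divfK ?mul1r // gt_eqF.
Qed.

Lemma detps_ring N (A : 'M[Cp]_N) (P : set Cp) m : P 1 ->
  (forall x y, P x -> P y -> P (x - y)) -> (forall x y, P x -> P y -> P (x * y)) ->
  (forall i j, P (A i j)) -> P (detps A m).
Proof.
move=> P1 PB PM hA; have P0 : P 0 by rewrite -(subrr 1); exact: PB.
have PN x : P x -> P (- x) by move=> h; rewrite -sub0r; exact: PB.
have PD x y : P x -> P y -> P (x + y) by move=> h1 h2; rewrite -(opprK y); apply: PB => //; exact: PN.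
have PX x k : P x -> P (x ^+ k) by move=> h; elim: k => [|k IH]; rewrite ?expr0 // exprS; exact: PM.
rewrite detps_minors; apply: (PM); first by apply: PX; exact: PN.
apply: (big_ind P) => // S _; apply: (big_ind P) => // s _.
apply: (PM); first by apply: PX; exact: PN.
by apply: (big_ind P) => // a _; rewrite mxE.
Qed.

End ColumnBound.

(** * Functions represented with weighted bounds *)

Section WeightedLists.

Variables (RR : realType) (p : nat) (Cp : padicField RR p) (n : nat).
Local Notation V := (@pabs _ _ Cp).
Local Notation expo := (expo n).
Variables (kK : set Cp) (W : expo -> RR).
Hypothesis kK_sub : subring kK.
Hypotheses (W0 : W 0 = 1) (Wpos : forall u, 0 < W u) (WD : forall u v, W (u + v) <= W u * W v).
Implicit Types (f g : 'rV[Cp]_n -> Cp) (B : RR).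

Lemma kK1 : kK 1. Proof. by case: kK_sub. Qed.
Lemma kKB x y : kK x -> kK y -> kK (x - y). Proof. by case: kK_sub => _ h _; exact: h. Qed.
Lemma kKM x y : kK x -> kK y -> kK (x * y). Proof. by case: kK_sub => _ _ h; exact: h. Qed.
Lemma kK0 : kK 0. Proof. by rewrite -(subrr 1); apply: kKB; exact: kK1. Qed.
Lemma kKN x : kK x -> kK (- x). Proof. by move=> h; rewrite -sub0r; apply: kKB => //; exact: kK0. Qed.
Lemma kKD x y : kK x -> kK y -> kK (x + y).
Proof. by move=> hx hy; rewrite -(opprK y); apply: kKB => //; exact: kKN. Qed.
Lemma kKX x k : kK x -> kK (x ^+ k).
Proof. by move=> h; elim: k => [|k IH]; rewrite ?expr0 ?exprS; [exact: kK1|exact: kKM]. Qed.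
Lemma kK_sum (I : Type) (r : seq I) (P : pred I) (F : I -> Cp) :
  (forall i, P i -> kK (F i)) -> kK (\sum_(i <- r | P i) F i).
Proof. by move=> h; apply: (big_ind kK) => //; [exact: kK0|exact: kKD]. Qed.
Lemma kK_nat k : kK k%:R.
Proof. by elim: k => [|k IH]; rewrite ?mulrS; [exact: kK0|apply: kKD => //; exact: kK1]. Qed.
Definition lbd B (L : seq (Cp * expo)) := forall t, t \in L -> kK t.1 /\ V t.1 * W t.2 <= B.

(** Some Laurent polynomial with coefficients in kK and terms of weighted size at most B has the
    values f on the torus. The representation is only asserted to exist, so that sums and products
    of such functions need no canonical form. *)
Definition lrep B f := exists2 L, lbd B L & forall x, torus x -> lev L x = f x.

Lemma lrep0 B : lrep B (fun=> 0).
Proof. by exists [::] => // x _; rewrite /lev big_nil. Qed.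

Lemma lrep1 : lrep 1 (fun=> 1).
Proof.
exists [:: (1, 0)] => [t|x _]; last by rewrite /lev big_seq1 monom0 mulr1.
by rewrite inE => /eqP -> /=; rewrite pabs1 W0 mulr1; split => //; exact: kK1.
Qed.

Lemma lrepD B f g : lrep B f -> lrep B g -> lrep B (fun x => f x + g x).
Proof.
move=> [L bL eL] [L' bL' eL']; exists (L ++ L') => [t|x hx].
  by rewrite mem_cat => /orP[/bL|/bL'].
by rewrite lev_cat eL ?eL'.
Qed.

Lemma lrepM B B' f g : lrep B f -> lrep B' g -> lrep (B * B') (fun x => f x * g x).
Proof.
move=> [L bL eL] [L' bL' eL']; exists (lmulq 1 L L') => [t|x hx]; last first.
  by rewrite lev_mulq // frb1 eL ?eL'.
move=> /allpairsP[[t1 t2] /= [/bL[k1 h1] /bL'[k2 h2] ->]] /=; split; first exact: kKM.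
rewrite mulr1n pabsM; apply: (@le_trans _ _ ((V t1.1 * W t1.2) * (V t2.1 * W t2.2))).
  by rewrite mulrACA ler_wpM2l ?mulr_ge0 ?pabs_ge0.
by rewrite ler_pM // mulr_ge0 ?pabs_ge0 // ltW.
Qed.

Lemma lrepZ B c f : kK c -> V c <= 1 -> lrep B f -> lrep B (fun x => c * f x).
Proof.
move=> kc hc [L bL eL]; exists [seq (c * t.1, t.2) | t <- L] => [t|x hx].
  move=> /mapP[s /bL[ks hs] ->] /=; split; first exact: kKM.
  by rewrite pabsM -mulrA; apply: le_trans hs; rewrite ler_piMl ?mulr_ge0 ?pabs_ge0 // ltW.
by rewrite -eL // /lev big_map big_distrr /=; apply: eq_bigr => t _; rewrite mulrA.
Qed.

Lemma lrep_sum B (I : Type) (r : seq I) (P : pred I) (F : I -> 'rV[Cp]_n -> Cp) :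
  (forall i, P i -> lrep B (F i)) -> lrep B (fun x => \sum_(i <- r | P i) F i x).
Proof.
move=> h; elim: r => [|i r IH].
  by rewrite (_ : (fun x => _) = fun=> 0); [exact: lrep0|apply/funext => x; rewrite big_nil].
have [Pi|Pi] := boolP (P i).
  rewrite (_ : (fun x => _) = fun x => F i x + \sum_(i <- r | P i) F i x).
    by apply: lrepD => //; exact: h.
  by apply/funext => x; rewrite big_cons Pi.
rewrite (_ : (fun x => _) = fun x => \sum_(i <- r | P i) F i x) //.
by apply/funext => x; rewrite big_cons (negbTE Pi).
Qed.

Lemma lrep_prod (I : Type) (r : seq I) (F : I -> 'rV[Cp]_n -> Cp) (b : I -> RR) :
  (forall i, lrep (b i) (F i)) -> lrep (\prod_(i <- r) b i) (fun x => \prod_(i <- r) F i x).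
Proof.
move=> h; elim: r => [|i r IH].
  rewrite big_nil (_ : (fun x => _) = fun=> 1); [exact: lrep1|by apply/funext => x; rewrite big_nil].
rewrite big_cons (_ : (fun x => _) = fun x => F i x * \prod_(i <- r) F i x); first exact: lrepM.
by apply/funext => x; rewrite big_cons.
Qed.

Lemma eq_lrep B f g : (forall x, torus x -> f x = g x) -> lrep B f -> lrep B g.
Proof. by move=> h [L bL eL]; exists L => // x hx; rewrite eL ?h. Qed.

End WeightedLists.

(** * Uniform bounds for Fredholm determinants *)

Section WeightCount.
Variables (RR : realType) (theta : nat -> RR) (vth : RR).
Hypotheses (th0 : theta 0 = 1) (th_ge0 : forall j, 0 <= theta j).
Hypotheses (vth1 : vth < 1) (thS : forall j, theta j.+1 <= vth).
Hypothesis th_lim : forall mu, 0 < mu -> exists J, forall j, (J <= j)%N -> theta j <= mu.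

Lemma th_le1 j : theta j <= 1.
Proof. by case: j => [|j]; rewrite ?th0 // (le_trans (thS j)) // ltW. Qed.

Definition wt (g : nat -> RR) r K (m : {ffun 'I_r.+1 -> 'I_K.+1}) := \prod_(i < r.+1) g i ^+ m i.
Definition wtt (g : nat -> RR) r i (S : i.-tuple 'I_r) := \prod_a g (tnth S a).

Lemma wt_le1 r K (m : {ffun 'I_r.+1 -> 'I_K.+1}) : 0 <= wt theta m <= 1.
Proof.
rewrite prodr_ge0 => [|i _]; last by rewrite exprn_ge0.
by rewrite prodr_ile1 // => i _; rewrite exprn_ge0 // exprn_ile1 // th_le1.
Qed.

Lemma wtt_le1 r i (S : i.-tuple 'I_r) : 0 <= wtt theta S <= 1.
Proof.
by rewrite prodr_ge0 //= prodr_ile1 // => a _; rewrite th_ge0 th_le1.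
Qed.

Lemma wt_mults (R : comNzRingType) (g : nat -> R) r K (S : K.-tuple 'I_r.+1) :
  \prod_a g (tnth S a) = \prod_(i < r.+1) g i ^+ mults S i.
Proof.
rewrite -(big_tuple _ _ S xpredT (fun i : 'I_r.+1 => g i)) (partition_big id predT) //=.
apply: eq_bigr => i _; rewrite (eq_bigr (fun=> g i)); last by move=> j /eqP ->.
by rewrite big_const_seq iter_mulr_1 -multsE.
Qed.

(* Uniform in [r] and [K]: a heavy multiset consists of the index 0 and of boundedly many others. *)
Lemma heavy_count (mu : RR) (I : eqType) (s : seq I) : 0 < mu -> exists k : nat,
  forall r K i (B : finType) (b : B -> I) (G : {set ({ffun 'I_r.+1 -> 'I_K.+1} * i.-tuple 'I_r.+1) * B}),
  injective b ->
  (forall y, y \in G -> [/\ vld y.1.1, incr y.1.2, mu < wt theta y.1.1, mu < wtt theta y.1.2 & b y.2 \in s]) ->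
  (#|G| <= k)%N.
Proof.
move=> mu0; have [J hJ] := th_lim mu0.
have [Lx hL] : exists Lx, forall l, (Lx <= l)%N -> vth ^+ l <= mu.
  have [v0|v0] := leP vth 0.
    exists 1%N => -[//|l] _; rewrite (le_trans _ (ltW mu0)) //.
    have := th_ge0 1; move=> h; have -> : vth = 0 by apply/le_anti; rewrite v0 (le_trans h (thS 0)).
    by rewrite expr0n.
  have := cvg_expr (z := vth); rewrite ger0_norm ?(ltW v0) // => /(_ vth1)/cvgrPdist_le/(_ mu mu0)[Lx _ h].
  exists Lx => l hl; have := h l hl; rewrite /= sub0r normrN ger0_norm //.
  by rewrite exprn_ge0 // ltW.
(* The size of T depends neither on r nor on K: it codes the multiplicities at the nonzero indices
   below J, the part of the exterior tuple below J, and the position in s. *)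
pose T := ({ffun 'I_J -> 'I_Lx.+1} * {ffun 'I_J -> bool} * 'I_(size s).+1)%type.
exists #|{: T}| => r K i B b G injb hG.
have small g (x : RR) : 0 <= x <= 1 -> 0 <= g <= 1 -> mu < g * x -> mu < g /\ mu < x.
  move=> /andP[x0 x1] /andP[g0 g1] h; split; apply: lt_le_trans h _.
    by rewrite ler_piMr.
  by rewrite ler_piMl.
have hm (m : {ffun 'I_r.+1 -> 'I_K.+1}) (j : 'I_r.+1) : mu < wt theta m -> mu < theta j ^+ m j.
  rewrite /wt (bigD1 j) //= => h; case: (small _ _ _ _ h) => // .
    rewrite prodr_ge0 => [|l _]; last by rewrite exprn_ge0.
    by rewrite prodr_ile1 // => l _; rewrite exprn_ge0 // exprn_ile1 // th_le1.
  by rewrite exprn_ge0 // exprn_ile1 // th_le1.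
have hm0 (m : {ffun 'I_r.+1 -> 'I_K.+1}) (j : 'I_r.+1) : mu < wt theta m -> (J <= j)%N -> m j = 0%N :> nat.
  move=> /(hm _ j) h Jj; apply/eqP; apply: contraLR h; rewrite -lt0n -leNgt => mj.
  by rewrite -(prednK mj) exprS (le_trans _ (hJ _ Jj)) // ler_piMr // exprn_ile1 // th_le1.
have hmL (m : {ffun 'I_r.+1 -> 'I_K.+1}) (j : 'I_r.+1) : mu < wt theta m -> (0 < j)%N -> (m j < Lx)%N.
  move=> /(hm _ j) h j0; rewrite ltnNge; apply: contraL h => hl; rewrite -leNgt.
  apply: le_trans (hL _ hl); apply: lerXn2r; rewrite ?nnegrE //.
    by apply: le_trans (thS 0) => //; apply: (le_trans (th_ge0 1)).
  by rewrite -(prednK j0).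
have hS (S : i.-tuple 'I_r.+1) (j : 'I_r.+1) : mu < wtt theta S -> j \in S -> (j < J)%N.
  move=> h /tnthP[a ja]; rewrite ltnNge; apply: contraL h => Jj; rewrite -leNgt.
  rewrite /wtt (bigD1 a) //= -ja (le_trans _ (hJ _ Jj)) // ler_piMr //.
  by rewrite prodr_ile1 // => l _; rewrite th_ge0 th_le1.
pose f (y : ({ffun 'I_r.+1 -> 'I_K.+1} * i.-tuple 'I_r.+1) * B) : T :=
  ([ffun j : 'I_J => if (0 < j < r.+1)%N then inord (y.1.1 (inord j)) else ord0],
   [ffun j : 'I_J => (j < r.+1)%N && (inord j \in y.1.2)], inord (index (b y.2) s)).
rewrite -(card_in_imset (f := f)) ?max_card //.
move=> [[m S] c] [[m' S'] c'] /hG /= [vm iS wm wS bs] /hG /= [vm' iS' wm' wS' bs'] [e1 e2 e3].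
have em (j : 'I_r.+1) : (0 < j)%N -> m j = m' j :> nat.
  move=> j0; have [Jj|jJ] := leqP J j; first by rewrite !hm0.
  have /ffunP/(_ (Ordinal jJ)) := e1; rewrite !ffunE /= j0 ltn_ord /= inord_val.
  move/(congr1 val); rewrite /= !inordK // ltnS ltnW //; exact: hmL.
(* The multiplicity of the index 0 is not coded; it is what the other multiplicities leave of the
   total degree K. *)
have m_eq : m = m'.
  apply/ffunP => j; apply/val_inj; case: (posnP j) => [j0|]; last exact: em.
  have {j0}-> : j = ord0 by apply/val_inj.
  have := eqP vm; rewrite -[RHS](eqP vm') (bigD1 ord0) //= [RHS](bigD1 ord0) //=.
  rewrite (eq_bigr (fun j => nat_of_ord (m' j))); last by move=> k k0; apply: em; rewrite lt0n.
  by move/addIn.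
have S_eq : S = S'.
  apply/val_inj/incr_eq => //; apply: uniq_perm; rewrite ?incr_uniq // => j.
  have [Jj|jJ] := leqP J j.
    by apply/idP/idP => h; [have := hS S j wS h|have := hS S' j wS' h]; rewrite ltnNge Jj.
  by have /ffunP/(_ (Ordinal jJ)) := e2; rewrite !ffunE /= ltn_ord /= inord_val.
rewrite m_eq S_eq; congr (_, _); apply: injb.
have := congr1 val e3; rewrite /= !inordK ?ltnS ?index_size //.
by move/(congr1 (nth (b c) s)); rewrite !nth_index.
Qed.

End WeightCount.

(** * Dwork operators of symmetric and exterior powers *)

Section UniformDet.
Variables (RR : realType) (p : nat) (Cp : padicField RR p) (n q : nat).
Local Notation V := (@pabs _ _ Cp).
Local Notation expo := (expo n).
Variables (kK : set Cp) (W : expo -> RR).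
Hypotheses (q1 : (1 < q)%N) (kK_sub : subring kK).
Hypotheses (W0 : W 0 = 1) (Wpos : forall u, 0 < W u) (WD : forall u v, W (u + v) <= W u * W v).

Fixpoint pmx r (Z : 'rV[Cp]_n -> 'M[Cp]_r) d x : 'M[Cp]_r :=
  if d is d'.+1 then Z x *m pmx Z d' (frb q x) else 1%:M.

(** The product of X^a over x, x^q, ..., x^(q^(d-1)), which is the scalar contributed by the factor
    X^a to a d-fold product. *)
Definition chi (a : expo) d (x : 'rV[Cp]_n) := \prod_(j < d) monom (frb (q ^ j) x) a.

Lemma chiS a d x : chi a d.+1 x = monom x a * chi a d (frb q x).
Proof.
rewrite /chi big_ord_recl expn0 frb1; congr (_ * _); apply: eq_bigr => j _.
by rewrite frbM -expnS.
Qed.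

Definition zY r K i := ({ffun 'I_r.+1 -> 'I_K.+1} * i.-tuple 'I_r.+1)%type.

(* The matrix of X^a Sym^K(Z) tensored with the i-th exterior power of Z. *)
Definition zA r K i (Z : 'rV[Cp]_n -> 'M[Cp]_r.+1) (a : expo) x (y y' : zY r K i) : Cp :=
  if [&& vld y.1, vld y'.1, incr y.2 & incr y'.2] then
    monom x a * (symp (Z x) y.1 (repr y'.1) * minor (Z x) y.2 y'.2) else 0.

(** Symmetric and exterior powers are multiplicative, by [symp_mul] and [minor_mul]. At least one
    factor is taken, because the empty product is the identity on all indices, invalid ones
    included. *)
Lemma apow_zA r K i (Z : 'rV[Cp]_n -> 'M[Cp]_r.+1) (a : expo) d x (y y' : zY r K i) :
  apow q (@zA r K i Z a) d.+1 x y y' =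
  if [&& vld y.1, vld y'.1, incr y.2 & incr y'.2] then
    chi a d.+1 x * (symp (pmx Z d.+1 x) y.1 (repr y'.1) * minor (pmx Z d.+1 x) y.2 y'.2) else 0.
Proof.
elim: d x y y' => [|d IH] x y y'.
  rewrite /= (bigD1 y') //= eqxx mulr1 big1 ?addr0 => [|z /negbTE ->]; last by rewrite mulr0.
  by rewrite /zA /chi big_ord_recl big_ord0 mulr1 expn0 frb1 mulmx1.
rewrite -[apow _ _ _ _ _ _]/(\sum_z zA Z a x y z * apow q (@zA r K i Z a) d.+1 (frb q x) z y').
under eq_bigr do rewrite IH.
case: ifPn => [/and4P[v1 v2 i1 i2]|nv]; last first.
  rewrite big1 // => z _; rewrite /zA; case: ifPn => [/and4P[v1 _ i1 _]|_]; last by rewrite mul0r.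
  case: ifPn => [/and4P[_ v2 _ i2]|_]; last by rewrite mulr0.
  by case/negP: nv; rewrite v1 v2 i1 i2.
rewrite [chi a d.+2 x]chiS -[pmx Z d.+2 x]/(Z x *m pmx Z d.+1 (frb q x)) symp_mul minor_mul.
rewrite mulr_suml mulr_sumr.
pose F (m : {ffun 'I_r.+1 -> 'I_K.+1}) (S : i.-tuple 'I_r.+1) := zA Z a x y (m, S) *
   (if [&& vld m, vld y'.1, incr S & incr y'.2] then chi a d.+1 (frb q x) *
     (symp (pmx Z d.+1 (frb q x)) m (repr y'.1) * minor (pmx Z d.+1 (frb q x)) S y'.2) else 0).
rewrite (eq_bigr (fun z => F z.1 z.2)); last by case.
rewrite -(pair_bigA _ F) /F.
apply: eq_bigr => m _; rewrite mulr_sumr mulr_sumr [RHS]big_mkcond; apply: eq_bigr => S _.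
rewrite /zA /= v1 v2 i1 i2 andbT /=; have [vm|nm] := boolP (vld m); last first.
  by rewrite /= mul0r [symp _ m _]symp_junk // mulr0 mul0r !mulr0; case: ifP.
by rewrite /=; case: ifP => _; rewrite ?mul0r //; ring.
Qed.

Lemma trace_zA r K i (Z : 'rV[Cp]_n -> 'M[Cp]_r.+1) (a : expo) d x : (0 < d)%N ->
  \sum_y apow q (@zA r K i Z a) d x y y = chi a d x * (hsum K (pmx Z d x) * esum i (pmx Z d x)).
Proof.
case: d => // d _; under eq_bigr do rewrite apow_zA.
rewrite /hsum /esum mulr_suml mulr_sumr.
rewrite -(pair_bigA _ (fun (m : {ffun 'I_r.+1 -> 'I_K.+1}) (S : i.-tuple 'I_r.+1) =>
  if [&& vld m, vld m, incr S & incr S] then chi a d.+1 x *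
     (symp (pmx Z d.+1 x) m (repr m) * minor (pmx Z d.+1 x) S S) else 0)) /=.
apply: eq_bigr => m _; rewrite mulr_sumr mulr_sumr [RHS]big_mkcond; apply: eq_bigr => S _.
have [vm|nm] := boolP (vld m); last by rewrite symp_junk //= mul0r mulr0; case: ifP.
by rewrite /= andbb.
Qed.

Variables (theta rho : nat -> RR) (vth : RR).
Hypotheses (th0 : theta 0 = 1) (th_ge0 : forall j, 0 <= theta j).
Hypotheses (vth1 : vth < 1) (thS : forall j, theta j.+1 <= vth).
Hypothesis th_lim : forall mu, 0 < mu -> exists J, forall j, (J <= j)%N -> theta j <= mu.
Hypothesis rho_gt0 : forall i, 0 < rho i.
Variables (lam : RR) (a : expo).
Hypotheses (lam0 : 0 < lam).
Hypothesis W_dec : exists s : seq expo, forall u, u \notin s -> W (u + a) / W (u *+ q) <= lam.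

Lemma W_bound : exists2 C0, lam <= C0 & forall u, W (u + a) / W (u *+ q) <= C0.
Proof.
have [s hs] := W_dec.
exists (lam + \sum_(u <- s) W (u + a) / W (u *+ q)).
  by rewrite lerDl sumr_ge0 // => u _; rewrite divr_ge0 // ltW.
have nn (r : seq expo) : 0 <= \sum_(v <- r) W (v + a) / W (v *+ q).
  by rewrite sumr_ge0 // => v _; rewrite divr_ge0 // ltW.
move=> u; have [us|/hs h] := boolP (u \in s); last first.
  by apply: le_trans h _; rewrite lerDl.
by rewrite (big_rem u us) /= addrCA lerDl addr_ge0 ?nn // ltW.
Qed.

(** Along any permutation the factors [rho] of rows and columns multiply to those of the two tuples,
    so that all terms of the minor obey the same bound. *)
Lemma lrep_minor r i (Z : 'rV[Cp]_n -> 'M[Cp]_r.+1) (S S' : i.-tuple 'I_r.+1) :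
  (forall k l : 'I_r.+1, lrep kK W (rho k / rho l * theta l) (fun x => Z x k l)) ->
  lrep kK W (wtt rho S / wtt rho S' * wtt theta S') (fun x => minor (Z x) S S').
Proof.
move=> hZ; apply: (lrep_sum) => s _.
apply: lrepZ => //; first by apply: kKX => //; apply: kKN => //; exact: kK1.
  by rewrite pabsX pabsN1 expr1n.
have -> : wtt rho S / wtt rho S' * wtt theta S' =
   \prod_b (rho (tnth S b) / rho (tnth S' (s b)) * theta (tnth S' (s b))).
  rewrite !big_split /= prodfV /wtt; congr (_ / _ * _); by rewrite [LHS](reindex_inj (@perm_inj _ s)).
apply: (eq_lrep (f := fun x => \prod_b Z x (tnth S b) (tnth S' (s b)))).
  by move=> x _; apply: eq_bigr => b _; rewrite mxE.
exact: lrep_prod.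
Qed.

Lemma lrep_symp r K (Z : 'rV[Cp]_n -> 'M[Cp]_r.+1) (m m' : {ffun 'I_r.+1 -> 'I_K.+1}) : vld m' ->
  (forall k l : 'I_r.+1, lrep kK W (rho k / rho l * theta l) (fun x => Z x k l)) ->
  lrep kK W (wt rho m / wt rho m' * wt theta m') (fun x => symp (Z x) m (repr m')).
Proof.
move=> vm' hZ; apply: lrep_sum => J /eqP mJ.
have -> : wt rho m / wt rho m' * wt theta m' =
   \prod_b (rho (tnth J b) / rho (tnth (repr m') b) * theta (tnth (repr m') b)).
  by rewrite !big_split /= prodfV !wt_mults repr_mults // mJ.
exact: lrep_prod.
Qed.

(** The constant C is uniform in the size r and in the degree K. In the weights [rho] and W the
    growth depends only on the number of columns whose bound exceeds lam, and [heavy_count] bounds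
    this number. *)
Lemma uniform_det i : exists C, 0 <= C /\ forall r K (Z : 'rV[Cp]_n -> 'M[Cp]_r.+1),
  (forall k l : 'I_r.+1, lrep kK W (rho k / rho l * theta l) (fun x => Z x k l)) ->
  exists N (G : 'M[Cp]_N), [/\ forall m, kK (detps G m),
    forall m, V (detps G m) <= C * lam ^+ m &
    forall d, (0 < d)%N -> (q ^ d).-1%:R ^+ n * \tr (G ^+ d) =
       tsum q d (fun x => chi a d x * (hsum K (pmx Z d x) * esum i (pmx Z d x)))].
Proof.
have [C0 lC0 hC0] := W_bound; have [s hs] := W_dec.
have C00 : 0 < C0 by exact: lt_le_trans lC0.
(* A column bound is a product of two theta-weights at most 1 and a factor at most C0; if it exceeds
   lam, both weights exceed lam / C0. *)
have [k hk] := heavy_count th0 th_ge0 vth1 thS th_lim s (divr_gt0 lam0 C00).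
exists ((C0 / lam) ^+ k); split; first by rewrite exprn_ge0 // divr_ge0 // ltW.
move=> r K Z hZ.
pose R u := W (u + a) / W (u *+ q).
have R0 u : 0 <= R u by rewrite divr_ge0 // ltW.
have hA (y y' : zY r K i) : exists L : seq (Cp * expo), [/\ forall t, t \in L -> kK t.1,
    forall t, t \in L -> [&& vld y.1, vld y'.1, incr y.2 & incr y'.2] /\
      V t.1 * W (t.2 - a) <= wt rho y.1 / wt rho y'.1 * wt theta y'.1 *
         (wtt rho y.2 / wtt rho y'.2 * wtt theta y'.2) &
    forall x, torus x -> lev L x = zA Z a x y y'].
  have [/and4P[v1 v2 i1 i2]|nv] := boolP [&& vld y.1, vld y'.1, incr y.2 & incr y'.2]; last first.
    by exists [::]; split=> // x _; rewrite /lev big_nil /zA (negbTE nv).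
  have [L hL eL] := lrepM kK_sub Wpos WD (lrep_symp y.1 v2 hZ) (lrep_minor y.2 y'.2 hZ).
  exists [seq (t.1, t.2 + a) | t <- L]; split.
  - by move=> t /mapP[t' /hL[? _] ->].
  - by move=> t /mapP[t' /hL[_ h] ->] /=; rewrite addrK.
  move=> x hx; rewrite /zA v1 v2 i1 i2 /= -eL // /lev big_map big_distrr /=; apply: eq_bigr => t _.
  by rewrite monomD // mulrA mulrC.
pose L y y' := projT1 (cid (hA y y')).
have LK y y' t : t \in L y y' -> kK t.1 by have [h _ _] := projT2 (cid (hA y y')); exact: h.
have LB y y' t : t \in L y y' -> [&& vld y.1, vld y'.1, incr y.2 & incr y'.2] /\
      V t.1 * W (t.2 - a) <= wt rho y.1 / wt rho y'.1 * wt theta y'.1 *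
         (wtt rho y.2 / wtt rho y'.2 * wtt theta y'.2).
  by have [_ h _] := projT2 (cid (hA y y')); exact: h.
have LE y y' x : torus x -> lev (L y y') x = zA Z a x y y'.
  by have [_ _ h] := projT2 (cid (hA y y')); exact: h.
have [D hD] : exists D, forall y y' t, t \in L y y' -> inbox D t.2.
  exists (\max_(y : zY r K i * zY r K i) \max_(t <- L y.1 y.2) \max_j `|t.2 ord0 j|)%N.
  move=> y y' t ht; apply/forallP => j; rewrite -abszE lez_nat.
  apply: leq_trans (leq_bigmax (F := fun y : zY r K i * zY r K i => \max_(t <- L y.1 y.2) \max_j `|t.2 ord0 j|)%N (y, y')).
  apply: leq_trans (leq_bigmax_seq (F := fun t : Cp * expo => \max_j `|t.2 ord0 j|)%N _ ht isT).
  exact: (leq_bigmax (F := fun j => `|t.2 ord0 j|%N)).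
exists _, (Gam q L D); split; last 1 first.
- move=> d d0; rewrite Gam_trace //; apply: eq_bigr => c _.
  rewrite -(trace_zA K i Z a _ d0); apply: eq_bigr => y _.
  have := tor_torus q1 d0 (tpt_tor Cp q1 c d0); move: (tpt Cp c) => x.
  suff : forall y' : zY r K i, torus x ->
    apow q (fun x0 y0 y' => lev (L y0 y') x0) d x y y' = apow q (zA Z a) d x y y' by exact.
  elim: d {c d0} x y => [//|d IH] x y0 y1 hx /=; apply: eq_bigr => z _.
  by rewrite LE // IH //; exact: frb_torus.
- move=> m; apply: detps_ring; [exact: kK1|exact: kKB|exact: kKM|].
  move=> k0 l0; rewrite mxE; rewrite /gam big_seq_cond; apply: kK_sum => // t /andP[/LK].
  by [].
move=> m.
pose yv (k0 : 'I_#|{: gamI n (zY r K i) D}|) := enum_val k0.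
pose ok (y : zY r K i) := vld y.1 && incr y.2.
(* The factor X^a is absorbed into the weights: with W(u + a) in [g], the operator contributes W(u'
   + a) / W(q u') to the column of u'. Columns of invalid indices are zero. *)
pose cb k0 := if ok (yv k0).1 then wt theta (yv k0).1.1 * wtt theta (yv k0).1.2 * R (bx (yv k0).2) else 0.
pose g k0 := wt rho (yv k0).1.1 * wtt rho (yv k0).1.2 * W (bx (yv k0).2 + a).
have wr0 (f : {ffun 'I_r.+1 -> 'I_K.+1}) : 0 < wt rho f by rewrite prodr_gt0 // => j _; rewrite exprn_gt0.
have wtr0 (S : i.-tuple 'I_r.+1) : 0 < wtt rho S by rewrite prodr_gt0.
have hb u (y : zY r K i) : wt theta y.1 * wtt theta y.2 * R u <= R u.
  have /andP[a1 a2] := wt_le1 th0 th_ge0 vth1 thS y.1.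
  have /andP[a3 a4] := wtt_le1 th0 th_ge0 vth1 thS y.2.
  by rewrite ler_piMl // mulr_ile1.
have hb0 u (y : zY r K i) : 0 <= wt theta y.1 * wtt theta y.2 * R u.
  have /andP[a1 a2] := wt_le1 th0 th_ge0 vth1 thS y.1.
  have /andP[a3 a4] := wtt_le1 th0 th_ge0 vth1 thS y.2.
  by apply: mulr_ge0 => //; exact: mulr_ge0.
apply: (@detps_col_bound _ _ _ _ _ cb g [set k0 | lam < cb k0]%SET) => //.
- by move=> k0; rewrite !mulr_gt0.
- move=> k0; rewrite /cb; case: ifP => _; last by rewrite lexx ltW.
  by rewrite hb0 (le_trans (hb _ _)) // hC0.
- by move=> k0; rewrite inE -leNgt.
- pose G' := [set yv k0 | k0 in [set k0 | lam < cb k0]%SET]%SET.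
  have -> : #|[set k0 | lam < cb k0]%SET| = #|G'|.
    by rewrite card_imset //; exact: enum_val_inj.
  apply: (hk r K i _ (@bx n D) G' (@bx_inj n D)) => y /imsetP[k0]; rewrite inE => hh ->.
  move: hh; rewrite /cb; case: ifP => [/andP[v1 i1] hh|_ hh]; last by have := lt_trans lam0 hh; rewrite ltxx.
  have /andP[a1 a2] := wt_le1 th0 th_ge0 vth1 thS (yv k0).1.1.
  have /andP[a3 a4] := wtt_le1 th0 th_ge0 vth1 thS (yv k0).1.2.
  have hR := hC0 (bx (yv k0).2); rewrite -/(R _) in hR.
  split=> //.
  + rewrite ltr_pdivrMr //; apply: lt_le_trans hh _; rewrite -mulrA ler_wpM2l //.
    by apply: le_trans hR; rewrite ler_piMl.
  + rewrite ltr_pdivrMr //; apply: lt_le_trans hh _; rewrite -mulrA mulrCA ler_wpM2l //.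
    by apply: le_trans hR; rewrite ler_piMl.
  + apply: contraLR (lt_le_trans hh (hb _ _)) => /hs; by rewrite -leNgt.
move=> k0 l0; rewrite mxE -/(yv k0) -/(yv l0) /gam big_seq_cond.
have [/andP[v1 i1]|nok] := boolP (ok (yv l0).1); last first.
  rewrite big1 ?pabs0; last first.
    by move=> t /andP[/LB[/and4P[_ v _ ii] _] _]; case/negP: nok; rewrite /ok v ii.
  by rewrite /cb (negbTE nok) mul0r.
rewrite /cb /ok v1 i1 /= /g.
have gpos (y : zY r K i) u : 0 < wt rho y.1 * wtt rho y.2 * W u by rewrite !mulr_gt0.
apply: pabs_sum => [|t /andP[/LB[_ h] /eqP ht]].
  by rewrite mulr_ge0 // ?divr_ge0 // ltW // gpos.
set u := bx (yv k0).2 in ht *; set u' := bx (yv l0).2 in ht *.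
have hw : W (u' *+ q) <= W (t.2 - a) * W (u + a).
  by rewrite (_ : u' *+ q = t.2 - a + (u + a)) ?WD // ht addrACA addNr addr0 subrK.
set wr := wt rho _ in h *; set wr' := wt rho _ in h *; set wi := wtt rho _ in h *; set wi' := wtt rho _ in h *.
have e : wt theta (yv l0).1.1 * wtt theta (yv l0).1.2 * R u' * (wr * wi * W (u + a) / (wr' * wi' * W (u' + a))) =
   wr / wr' * wt theta (yv l0).1.1 * (wi / wi' * wtt theta (yv l0).1.2) * (W (u + a) / W (u' *+ q)).
  rewrite /R; field; rewrite !gt_eqF //; by rewrite ?wr0 ?wtr0.
rewrite e; apply: (@le_trans _ _ (V t.1 * W (t.2 - a) * (W (u + a) / W (u' *+ q)))).
  rewrite -mulrA ler_peMr ?pabs_ge0 //.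
  by rewrite mulrA ler_pdivlMr // mul1r.
by rewrite ler_wpM2r // divr_ge0 // ltW.
Qed.

End UniformDet.

(** * The unit root of a power series *)

Section LogDerivative.
Variables (RR : realType) (p : nat) (Cp : padicField RR p).
Local Notation V := (@pabs _ _ Cp).
Implicit Types (f g : ps Cp) (e : RR).

Fixpoint pinv_rec f (k m : nat) : Cp :=
  if k is k'.+1 then
    if m is m'.+1 then - \sum_(d < m) f d.+1 * pinv_rec f k' (m' - d)%N else 1
  else (m == 0%N)%:R.

Definition pinv f : ps Cp := fun m => pinv_rec f m m.

Lemma pinv_rec_fuel f k m : (m <= k)%N -> pinv_rec f k m = pinv f m.
Proof.
elim/ltn_ind: m k => m IH [|k]; first by rewrite leqn0 => /eqP ->.
case: m IH => [//|m] IH hk; rewrite /pinv /=; congr (- _).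
apply: eq_bigr => d _; congr (_ * _).
rewrite (IH _ _ k) ?ltnS ?leq_subr ?(leq_trans (leq_subr _ _)) //.
by rewrite (IH _ _ m) ?ltnS ?leq_subr.
Qed.

Lemma pinvS f m : pinv f m.+1 = - \sum_(d < m.+1) f d.+1 * pinv f (m - d)%N.
Proof.
rewrite {1}/pinv /=; congr (- _); apply: eq_bigr => d _; congr (_ * _).
by rewrite pinv_rec_fuel // leq_subr.
Qed.

Lemma psmul_pinv f : f 0%N = 1 -> psmul f (pinv f) = @ps1 _ _ Cp.
Proof.
move=> f0; apply/funext => -[|m]; first by rewrite psmul0 f0 mul1r.
rewrite /psmul big_ord_recl /= subn0 f0 mul1r pinvS /ps1 /=.
by rewrite addrC; apply/eqP; rewrite subr_eq0.
Qed.

Lemma pinv_uniq f g : f 0%N = 1 -> psmul f g = @ps1 _ _ Cp -> g = pinv f.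
Proof. by move=> f0 h; rewrite -[LHS]ps1mul -(psmul_pinv f0) [psmul f _]psmulC -psmulA h psmul1. Qed.

(** The logarithmic derivative T f'/f, inverse to [pexp] on series with constant term 1. For a
    determinant its coefficients are minus the traces of the powers. *)
Definition plog f : ps Cp := psmul (theta f) (pinv f).

Lemma plog0 f : plog f 0%N = 0.
Proof. by rewrite /plog psmul0 /theta mul0r mul0r. Qed.

Lemma pexp_plog f : f 0%N = 1 -> pexp (plog f) = f.
Proof.
move=> f0; apply/esym/pexp_uniq => //.
have -> : cut0 (plog f) = plog f by apply/funext => -[|d] //=; rewrite plog0.
by rewrite /plog -psmulA [psmul (pinv f) f]psmulC psmul_pinv // psmul1.
Qed.

Lemma plog_uniq s f : f = pexp s -> forall d, (0 < d)%N -> plog f d = s d.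
Proof.
move=> fE; rewrite /plog fE theta_pexp -psmulA psmul_pinv // psmul1.
by case=> [//|d] _.
Qed.

Lemma plogM f g d : f 0%N = 1 -> g 0%N = 1 -> (0 < d)%N -> plog (psmul f g) d = plog f d + plog g d.
Proof.
move=> f0 g0; apply: (plog_uniq (s := fun d => plog f d + plog g d)).
by rewrite pexpD !pexp_plog.
Qed.

Lemma pinv_bound f e : 0 <= e -> (forall m, V (f m) <= e ^+ m) -> forall m, V (pinv f m) <= e ^+ m.
Proof.
move=> e0 h m; elim/ltn_ind: m => -[|m] IH; first by rewrite pabs1.
rewrite pinvS pabsN; apply: pabs_sum => [|d _]; first by rewrite exprn_ge0.
have -> : e ^+ m.+1 = e ^+ d.+1 * e ^+ (m - d).
  by rewrite -exprD addSn subnKC // -ltnS ltn_ord.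
by apply: pabsM_le => //; apply: IH; rewrite ltnS leq_subr.
Qed.

Lemma plog_bound f e : 0 <= e -> (forall m, V (f m) <= e ^+ m) -> forall m, V (plog f m) <= e ^+ m.
Proof.
move=> e0 h m; rewrite -[e ^+ m]mul1r -[1]mulr1; apply: psmul_bound => // i; rewrite mul1r.
  by rewrite /theta; apply: pabsMl_le => //; exact: pabs_nat.
exact: pinv_bound.
Qed.

Lemma psmul_close f g f' g' e m : 0 <= e ->
  (forall j, (j <= m)%N -> V (f j) <= 1) -> (forall j, (j <= m)%N -> V (g' j) <= 1) ->
  (forall j, (j <= m)%N -> V (f j - f' j) <= e) -> (forall j, (j <= m)%N -> V (g j - g' j) <= e) ->
  V (psmul f g m - psmul f' g' m) <= e.
Proof.
move=> e0 hf hg' h1 h2; rewrite /psmul -sumrB; apply: pabs_sum => // i _.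
have im : (i <= m)%N by rewrite -ltnS ltn_ord.
have -> : f i * g (m - i)%N - f' i * g' (m - i)%N =
  f i * (g (m - i)%N - g' (m - i)%N) + (f i - f' i) * g' (m - i)%N by ring.
apply: pabsD_le; first by apply: pabsMl_le; [exact: hf|apply: h2; exact: leq_subr].
by apply: pabsMr_le; [exact: h1|apply: hg'; exact: leq_subr].
Qed.

Lemma pinv_close f g e m : 0 <= e -> (forall j, (j <= m)%N -> V (f j) <= 1) ->
  (forall j, (j <= m)%N -> V (g j) <= 1) -> (forall j, (j <= m)%N -> V (f j - g j) <= e) ->
  V (pinv f m - pinv g m) <= e.
Proof.
move=> e0; elim/ltn_ind: m => -[|m] IH hf hg hfg; first by rewrite subrr pabs0.
rewrite !pinvS -opprD pabsN -sumrN -big_split /=; apply: pabs_sum => // d _.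
have dm : (d < m.+1)%N by [].
have sub j : (j <= m - d)%N -> (j <= m.+1)%N by move=> h; lia.
have -> : f d.+1 * pinv f (m - d)%N - g d.+1 * pinv g (m - d)%N =
  f d.+1 * (pinv f (m - d)%N - pinv g (m - d)%N) + (f d.+1 - g d.+1) * pinv g (m - d)%N by ring.
apply: pabsD_le.
  apply: pabsMl_le; first exact: hf.
  by apply: IH => [|j /sub|j /sub|j /sub]; rewrite ?ltnS ?leq_subr //; [exact: hf|exact: hg|exact: hfg].
apply: pabsMr_le; first exact: hfg.
have hb k : (k <= m)%N -> V (pinv g k) <= 1.
  elim/ltn_ind: k => -[|k] IHk km; first by rewrite pabs1.
  rewrite pinvS pabsN; apply: pabs_sum => // l _; have lk := ltn_ord l.
  by apply: pabsM_le1; [apply: hg; lia|apply: IHk; lia].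
by apply: hb; rewrite leq_subr.
Qed.

Lemma plog_close f g e m : 0 <= e -> (forall j, V (f j) <= 1) ->
  (forall j, V (g j) <= 1) -> (forall j, (j <= m)%N -> V (f j - g j) <= e) ->
  V (plog f m - plog g m) <= e.
Proof.
move=> e0 hf hg hfg; apply: psmul_close => // j jm.
- by rewrite /theta; apply: pabsM_le1 => //; exact: pabs_nat.
- have h1 k : V (g k) <= 1 ^+ k by rewrite expr1n.
  by have := pinv_bound ler01 h1 j; rewrite expr1n.
- by rewrite /theta -mulrBr; apply: pabsMl_le; [exact: pabs_nat|exact: hfg].
by apply: pinv_close => // k kj; apply: hfg; exact: leq_trans jm.
Qed.

End LogDerivative.

(** * The unit root, its cofactor and its partial fraction coefficient *)

Section UnitRoot.
Variables (RR : realType) (p : nat) (Cp : padicField RR p).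
Local Notation V := (@pabs _ _ Cp).
Variable w : RR.
Hypotheses (w0 : 0 <= w) (w1 : w < 1).

(* Exactly one reciprocal zero is a unit, and it is congruent to 1. *)
Definition unitlike (D : ps Cp) :=
  [/\ D 0%N = 1, V (D 1%N + 1) <= w & forall m, V (D m.+1) <= w ^+ m].

Lemma w_small e : 0 < e -> exists N, forall m, (N <= m)%N -> w ^+ m <= e.
Proof.
move=> e0; have := cvg_expr (z := w); rewrite ger0_norm // => /(_ w1)/cvgrPdist_le/(_ e e0)[N _ h].
by exists N => m /h /=; rewrite sub0r normrN ger0_norm // exprn_ge0.
Qed.

Lemma pabsB_exp (y z : Cp) m : V y <= 1 -> V z <= 1 -> V (y ^+ m - z ^+ m) <= V (y - z).
Proof.
move=> hy hz; rewrite subrXX pabsM ler_piMr ?pabs_ge0 //.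
by apply: pabs_sum => // i _; apply: pabsM_le1; exact: pabsX_le1.
Qed.

Variable D : ps Cp.
Hypothesis hD : unitlike D.

Lemma ul_le1 m : V (D m) <= 1.
Proof.
case: hD => h0 _ h; case: m => [|m]; first by rewrite h0 pabs1.
by apply: le_trans (h m) _; rewrite exprn_ile1 // ltW.
Qed.

Lemma ul_pnull (c : nat -> Cp) : (forall m, V (c m) <= 1) -> pnull (fun m => D m * c m).
Proof.
case: hD => h0 _ h hc; apply: pnull_nat => e e0; have [N hN] := w_small e0.
exists N.+1 => -[//|m] hm; apply: pabsMr_le => //; apply: le_trans (h m) _; exact: hN.
Qed.

(** The fixed points of this map are the zeros of D, and as D is 1 - T up to small terms, the map is
    nearly constant on the unit disc. *)
Let Phi z := z + ps_val D z.

(** The linear term of D cancels z up to the coefficient D_1 + 1, which is at most w, and so are the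
    coefficients of higher degree. *)
Lemma ul_contract y z : V y <= 1 -> V z <= 1 -> V (Phi y - Phi z) <= w * V (y - z).
Proof.
move=> hy hz; rewrite /Phi opprD addrACA /ps_val -nasumB; last first.
- by apply: ul_pnull => m; exact: pabsX_le1.
- by apply: ul_pnull => m; exact: pabsX_le1.
have e : (fun m => D m * y ^+ m - D m * z ^+ m) =
   (fun m => (if m == 1%N then - (y - z) else 0) +
             (if m == 1%N then D 1%N + 1 else if m == 0%N then 0 else D m) * (y ^+ m - z ^+ m)).
  apply/funext => -[|[|m]] /=.
  - by rewrite !expr0 subrr mul0r addr0.
  - by rewrite !expr1; ring.
  - by rewrite add0r mulrBr.
have n1 : pnull (fun m : nat => if m == 1%N then - (y - z) else 0).
  by apply: (pnull_fin (F := [fset 1%N]%fset)) => m; rewrite inE => /negbTE ->.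
case: hD => h0 h1 hm.
have n2 : pnull (fun m : nat => (if m == 1%N then D 1%N + 1 else if m == 0%N then 0 else D m) * (y ^+ m - z ^+ m)).
  apply: pnull_nat => d d0; have [N hN] := w_small d0.
  exists N.+2 => -[|[|m]] // hNm /=; apply: pabsMr_le; first by apply: le_trans (hm m.+1) _; apply: hN; lia.
  by apply: pabsB_le; exact: pabsX_le1.
rewrite e nasumD // addrA (nasum_nat_fin (N := 2)); last by case=> [|[]].
rewrite !big_ord_recl big_ord0 /= add0r addr0 subrr add0r.
apply: nasum_le => // [|m]; first by rewrite mulr_ge0 ?pabs_ge0.
case: m => [|[|m]] /=; first by rewrite mul0r pabs0 mulr_ge0 ?pabs_ge0.
  by rewrite !expr1; apply: pabsM_le.
apply: pabsM_le; last exact: pabsB_exp.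
apply: le_trans (hm m.+1) _; rewrite exprS ler_piMr // exprn_ile1 // ltW //.
Qed.

Lemma ul_Phi z : V z <= 1 -> V (Phi z - 1) <= w.
Proof.
move=> hz; have P0 : Phi 0 = 1.
  case: hD => h0 _ _; rewrite /Phi add0r /ps_val (nasum_nat_fin (N := 1)) => [|[|m] //]; last by rewrite expr0n mulr0.
  by rewrite big_ord_recl big_ord0 addr0 expr0 h0 mulr1.
rewrite -{1}P0; apply: le_trans (ul_contract hz _) _; first by rewrite pabs0.
by rewrite subr0 ler_piMr.
Qed.

Lemma ul_Phi_le1 z : V z <= 1 -> V (Phi z) <= 1.
Proof.
by move=> hz; rewrite -(subrK 1 (Phi z)); apply: pabsD_le; rewrite ?pabs1 // (le_trans (ul_Phi hz)) // ltW.
Qed.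

(** The contraction is iterated from 0; its fixed point is a zero of D, whose inverse is the
    reciprocal zero. *)
Lemma unit_root_exists : exists a, [/\ V (a - 1) <= w, V a = 1 & ps_val D a^-1 = 0].
Proof.
pose z m := iter m Phi 0.
have z1 m : V (z m) <= 1 by elim: m => [|m IH]; rewrite ?pabs0 //=; exact: ul_Phi_le1.
have step m : V (z m.+1 - z m) <= w ^+ m.
  elim: m => [|m IH]; first by rewrite expr0; apply: pabsB_le.
  by rewrite exprS; have := ul_contract (z1 m.+1) (z1 m); move/le_trans; apply; rewrite ler_wpM2l.
have far N k : V (z (N + k)%N - z N) <= w ^+ N.
  elim: k => [|k IH]; first by rewrite addn0 subrr pabs0 exprn_ge0.
  rewrite addnS; apply: pabs_chain IH; apply: le_trans (step _) _.
  by apply: ler_wiXn2l; rewrite ?leq_addr // ltW.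
have [l hl] : exists l, pcvg z l.
  apply: pcauchy_lim => e e0; have [N hN] := w_small e0; exists N => i j hi hj.
  apply: (@pabs_chain _ _ _ (z N)); last rewrite pabsBC.
    by rewrite -(subnKC hi); apply: le_trans (far _ _) _; exact: hN.
  by rewrite -(subnKC hj); apply: le_trans (far _ _) _; exact: hN.
have l1 : V l <= 1 by apply: pcvg_le hl _; exists 0%N.
have fix_l : Phi l = l.
  apply: (@pcvg_uniq _ _ _ (fun m => z m.+1)) => e e0; have [N hN] := hl e e0.
    exists N => m hm; apply: le_trans (ul_contract (z1 m) l1) _.
    by apply: le_trans (hN m hm); rewrite ler_piMl ?pabs_ge0 // ltW.
  by exists N => m hm; apply: hN; exact: leq_trans hm _.
have lw : V (l - 1) <= w by rewrite -{1}fix_l; exact: ul_Phi.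
have lu : V l = 1.
  by rewrite -(subrK 1 l) addrC pabs_dominant pabs1 // (le_lt_trans lw).
exists l^-1; rewrite invrK; split.
- have l0 : l != 0 by rewrite -(pabs_gt0 l) lu.
  have -> : l^-1 - 1 = - (l^-1 * (l - 1)) by rewrite mulrBr mulVf // mulr1 opprB.
  by rewrite pabsN pabsM pabsV lu invr1 mul1r.
- by rewrite pabsV lu invr1.
by have := fix_l; rewrite /Phi => h; apply: (addrI l); rewrite h addr0.
Qed.

Lemma unit_root_unique a b : V a = 1 -> V b = 1 -> ps_val D a^-1 = 0 -> ps_val D b^-1 = 0 -> a = b.
Proof.
move=> ha hb ra rb; apply: invr_inj; apply/eqP; rewrite -subr_eq0.
have := @ul_contract a^-1 b^-1; rewrite !pabsV ha hb invr1 /Phi ra rb !addr0 => /(_ (lexx _) (lexx _)) h.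
rewrite -[_ == 0]negbK -pabs_gt0; apply/negP => h0.
by move: h; rewrite leNgt => /negP; apply; rewrite gtr_pMl.
Qed.

Variable al : Cp.
Hypotheses (al1 : V al = 1) (al_root : ps_val D al^-1 = 0).

Let al0 : al != 0. Proof. by rewrite -(pabs_gt0 al) al1. Qed.
Let alV m : V (al^-1 ^+ m) = 1. Proof. by rewrite pabsX pabsV al1 invr1 expr1n. Qed.

(** The series D(T/al), whose unit zero is moved to 1. *)
Definition dt : ps Cp := fun m => D m * al^-1 ^+ m.

Let dt_le m : V (dt m.+1) <= w ^+ m.
Proof. by case: hD => _ _ h; rewrite /dt pabsM alV mulr1. Qed.

Let dt0 : dt 0%N = 1. Proof. by case: hD => h _ _; rewrite /dt h mulr1. Qed.

Let dt_null : pnull dt. Proof. by apply: ul_pnull => m; rewrite alV. Qed.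

(** The cofactor D(T/al) / (1 - T). Its coefficients are partial sums of a series with sum 0, hence
    negatives of tails, and this gives [gt_le]. *)
Definition gt : ps Cp := fun m => \sum_(j < m.+1) dt j.

Lemma gt_le m : V (gt m) <= w ^+ m.
Proof.
have -> : gt m = - (ps_val D al^-1 - \sum_(j < m.+1) dt j) by rewrite al_root sub0r opprK.
rewrite pabsN; apply: nasum_nat_sub => //; first by rewrite exprn_ge0.
move=> -[//|k] hk; apply: le_trans (dt_le k) _.
by apply: ler_wiXn2l; rewrite // ltW.
Qed.

Let gt0_ : gt 0%N = 1. Proof. by rewrite /gt big_ord_recl big_ord0 addr0 dt0. Qed.

Let one1 : ps Cp := fun=> 1.
Let omT : ps Cp := pexp (fun=> -1).

Let omT_one1 : psmul one1 omT = @ps1 _ _ Cp.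
Proof.
have -> : one1 = pexp (fun=> 1).
  apply/funext => m; rewrite -(_ : pexp (fun d => 1 ^+ d) = pexp (fun=> 1)) ?pexp_pow ?expr1n //.
  by congr pexp; apply/funext => d; rewrite expr1n.
exact: pexpNK.
Qed.

Let plog_omT j : (0 < j)%N -> plog omT j = -1.
Proof. exact: (plog_uniq (s := fun=> -1)). Qed.

Let omT0 : omT 0%N = 1. Proof. by []. Qed.

Let dtE : dt = psmul gt omT.
Proof.
have -> : gt = psmul dt one1.
  by apply/funext => m; rewrite /gt /psmul; apply: eq_bigr => i _; rewrite mulr1.
by rewrite -psmulA omT_one1 psmul1.
Qed.

(* The limit of [al ^- N] times the [N]-th coefficient of [1 / D]. *)
Definition hlim : Cp := nasum (pinv gt).

Let pig_null : pnull (pinv gt).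
Proof.
apply: pnull_nat => e e0; have [N hN] := w_small e0; exists N => m hm.
by apply: le_trans (pinv_bound w0 gt_le m) _; exact: hN.
Qed.

Lemma hlim_le1 : V hlim <= 1.
Proof.
apply: nasum_le => // m; apply: le_trans (pinv_bound w0 gt_le m) _.
by rewrite exprn_ile1 // ltW.
Qed.

Let pinv_dt N : pinv dt N = \sum_(j < N.+1) pinv gt j.
Proof.
have -> : pinv dt = psmul (pinv gt) one1.
  apply/esym/pinv_uniq => //; rewrite dtE.
  rewrite [psmul (pinv gt) _]psmulC psmulA -[psmul (psmul gt omT) one1]psmulA [psmul omT _]psmulC.
  by rewrite omT_one1 psmul1 psmul_pinv.
by rewrite /psmul; apply: eq_bigr => i _; rewrite mulr1.
Qed.

Let pinv_D N : pinv D N * al^-1 ^+ N = pinv dt N.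
Proof.
suff <- : (fun N => pinv D N * al^-1 ^+ N) = pinv dt by [].
apply: pinv_uniq => //; apply/funext => m; case: hD => h0 _ _.
have := congr1 (fun f : ps Cp => f m) (psmul_pinv h0); rewrite /psmul /ps1 => h.
rewrite -[RHS]mulr1 -[in RHS](_ : (m == 0%N)%:R * al^-1 ^+ m = (m == 0%N)%:R); last first.
  by case: m {h} => [|m]; rewrite ?mulr1 ?mul0r.
rewrite mulr1 -h big_distrl /=; apply: eq_bigr => i _.
by rewrite /dt mulrACA -exprD subnKC // -ltnS ltn_ord.
Qed.

(** The coefficients of 1/D(T/al) are the partial sums of those of the inverse of the cofactor,
    whose total is [hlim]; the error is a tail of this series. *)
Lemma hlimP N : V (pinv D N - al ^+ N * hlim) <= w ^+ N.+1.
Proof.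
have -> : pinv D N - al ^+ N * hlim = - (al ^+ N * (hlim - pinv dt N)).
  by rewrite -pinv_D mulrBr opprB mulrCA -exprMn divff // expr1n mulr1.
rewrite pabsN pabsM pabsX al1 expr1n mul1r pinv_dt.
apply: nasum_nat_sub => //; first by rewrite exprn_ge0.
move=> m hm; apply: le_trans (pinv_bound w0 gt_le m) _.
by apply: ler_wiXn2l; rewrite // ltW.
Qed.

(** The logarithmic derivative of D is that of 1 - al T plus that of the cofactor, whose
    coefficients have size at most w^j. *)
Lemma plog_unit j : (0 < j)%N -> V (plog D j + al ^+ j) <= w ^+ j.
Proof.
move=> j0; have e1 : plog dt j = plog gt j - 1.
  by rewrite dtE plogM // plog_omT.
have e2 : plog dt j = plog D j * al^-1 ^+ j.
  have h0 : D 0%N = 1 by case: hD.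
  rewrite (plog_uniq (s := fun d => al^-1 ^+ d * plog D d)) //; first exact: mulrC.
  apply/funext => m; rewrite pexp_scale pexp_plog // mulrC //.
have -> : plog D j + al ^+ j = al ^+ j * plog gt j.
  have -> : plog gt j = plog D j * al^-1 ^+ j + 1 by rewrite -e2 e1 subrK.
  by rewrite mulrDr mulr1 mulrCA -exprMn divff // expr1n mulr1.
by rewrite pabsM pabsX al1 expr1n mul1r; exact: (plog_bound w0 gt_le).
Qed.

Lemma hook_null : pnull (fun i : nat => - i%:R * dt i).
Proof. by apply: pnullZ dt_null => i; rewrite pabsN; exact: pabs_nat. Qed.

(** As dt = (1 - T) gt, the value gt(1) = 1/[hlim] is also -dt'(1) = - sum i dt_i. The proof
    compares coefficients of -T dt'/dt: they tend to 1, since the cofactor contributes a null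
    sequence, and they tend to [hlim] times the sum. *)
Lemma hook_identity : hlim * nasum (fun i : nat => - i%:R * dt i) = 1.
Proof.
apply: pabs_le0_eq => e e0; have [N hN] := w_small e0.
have n1 := hook_null.
have e1 : \sum_(i < N.+2) (- i%:R * dt i) * pinv dt (N.+1 - i)%N = - plog dt N.+1.
  rewrite /plog /psmul -sumrN; apply: eq_bigr => i _; by rewrite /theta !mulNr.
have h1 : V (- plog dt N.+1 - 1) <= e.
  have -> : - plog dt N.+1 - 1 = - plog gt N.+1.
    by rewrite dtE plogM // plog_omT // opprD opprK addrK.
  rewrite pabsN; apply: le_trans (plog_bound w0 gt_le _) _; exact: hN.
apply: pabs_chain h1; rewrite -e1.
apply: (@pabs_chain _ _ _ (hlim * \sum_(i < N.+2) (- i%:R * dt i))).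
  rewrite -mulrBr; apply: pabsMl_le; first exact: hlim_le1.
  apply: nasum_nat_sub => //; first exact: ltW.
  move=> -[//|m] hm; rewrite mulNr pabsN; apply: pabsMl_le; first exact: pabs_nat.
  by apply: le_trans (dt_le m) _; apply: hN; lia.
rewrite mulr_sumr -sumrB; apply: pabs_sum; first exact: ltW.
move=> i _; rewrite [hlim * _]mulrC -mulrBr.
case: (nat_of_ord i) (ltn_ord i) => [|k] hk.
  by rewrite oppr0 mul0r mul0r pabs0 ltW.
apply: (@le_trans _ _ (w ^+ k * w ^+ (N.+1 - k))); last first.
  by rewrite -exprD; apply: hN; lia.
apply: pabsM_le; first by rewrite mulNr pabsN; apply: pabsMl_le; [exact: pabs_nat|exact: dt_le].
have {1}-> : pinv dt (N.+1 - k.+1)%N = \sum_(j < (N.+1 - k)%N) pinv gt j.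
  by rewrite pinv_dt subSS subSn //; lia.
apply: nasum_nat_sub => //; first by rewrite exprn_ge0.
move=> m hm; apply: le_trans (pinv_bound w0 gt_le m) _.
by apply: ler_wiXn2l; rewrite // ltW.
Qed.

End UnitRoot.

(** * Unit roots of limits of finite matrices *)

Section Approximation.
Variables (RR : realType) (p : nat) (Cp : padicField RR p) (n q : nat).
Local Notation V := (@pabs _ _ Cp).
Hypothesis q1 : (1 < q)%N.
Variable w : RR.
Hypotheses (w0 : 0 <= w) (w1 : w < 1).

(** Up to errors of size w, the corner is 1 and all columns but the first vanish; this shape is
    stable under products. *)
Definition zshape r (A : 'M[Cp]_r.+1) :=
  [/\ forall k l, V (A k l) <= 1, V (A 0 0 - 1) <= w & forall k l, l != 0 -> V (A k l) <= w].

Lemma zshape_mul r (A B : 'M[Cp]_r.+1) : zshape A -> zshape B -> zshape (A *m B).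
Proof.
move=> [a1 a2 a3] [b1 b2 b3]; split=> [k l||k l l0].
- by rewrite mxE; apply: pabs_sum => // j _; exact: pabsM_le1.
- rewrite mxE (bigD1 ord0) //=.
  have -> : A 0 ord0 * B ord0 0 + \sum_(j | j != ord0) A 0 j * B j 0 - 1 =
     A 0 ord0 * (B ord0 0 - 1) + (A 0 ord0 - 1) + \sum_(j | j != ord0) A 0 j * B j 0 by ring.
  apply: pabsD_le; first by apply: pabsD_le => //; apply: pabsMl_le.
  by apply: pabs_sum => // j j0; apply: pabsMr_le => //; exact: a3.
- by rewrite mxE; apply: pabs_sum => // j _; apply: pabsMl_le => //; exact: b3.
Qed.

(** At most the first of the m + 1 increasing column indices is 0; each of the other m columns
    contributes a factor at most w to every permutation term. *)
Lemma zshape_minor r m (A : 'M[Cp]_r.+1) (S S' : m.+1.-tuple 'I_r.+1) : zshape A -> incr S' ->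
  V (minor A S S') <= w ^+ m.
Proof.
move=> [a1 a2 a3] iS; apply: pabs_sum => [|s _]; first exact: exprn_ge0.
rewrite pabsM pabsX pabsN1 expr1n mul1r pabs_prod.
have -> : w ^+ m = \prod_(a < m.+1) (if s a == ord0 then 1 else w).
  transitivity (\prod_(b < m.+1) (if b == ord0 then 1 else w)).
    by rewrite big_ord_recl /= mul1r prodr_const card_ord.
  exact: (reindex_inj (@perm_inj _ s)).
apply: ler_prod => a _; rewrite pabs_ge0 mxE /=; case: eqP => [_|/eqP sa]; first exact: a1.
apply: a3; have h0 : (tnth S' ord0 < tnth S' (s a))%N.
  have x0 : 'I_r.+1 by exact: ord0.
  rewrite !(tnth_nth x0).
  have tr : transitive (fun i j : 'I_r.+1 => (i < j)%N) by move=> i j k; exact: ltn_trans.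
  by apply: (sorted_ltn_nth tr _ iS); rewrite ?inE ?size_tuple //= lt0n.
by apply: contraTneq h0 => ->; rewrite ltn0.
Qed.

Lemma pmxS r (Z : 'rV[Cp]_n -> 'M[Cp]_r) d x : pmx q Z d.+1 x = pmx q Z d x *m Z (frb (q ^ d) x).
Proof.
elim: d x => [|d IH] x; first by rewrite /= expn0 frb1 mulmx1 mul1mx.
by rewrite -[LHS]/(Z x *m pmx q Z d.+1 (frb q x)) IH mulmxA frbM -expnS.
Qed.

Lemma pmxD r (Z : 'rV[Cp]_n -> 'M[Cp]_r) d e x :
  pmx q Z (d + e) x = pmx q Z d x *m pmx q Z e (frb (q ^ d) x).
Proof.
elim: d x => [|d IH] x; first by rewrite /= expn0 frb1 mul1mx.
by rewrite addSn /= IH mulmxA frbM -expnS.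
Qed.

Lemma pmx_pow r (Z : 'rV[Cp]_n -> 'M[Cp]_r) d l x : (0 < d)%N -> tor q d x ->
  pmx q Z (d * l) x = pmx q Z d x ^+ l.
Proof.
move=> d0 hx; elim: l => [|l IH]; first by rewrite muln0.
by rewrite mulnS pmxD (tor_frb q1 d0 hx) IH exprS.
Qed.

Lemma detps_frb r (Z : 'rV[Cp]_n -> 'M[Cp]_r) d x : (0 < d)%N -> tor q d x ->
  detps (pmx q Z d (frb q x)) = detps (pmx q Z d x).
Proof.
move=> d0 hx; have e := tor_frb q1 d0 hx; case: d d0 {hx} e => [|d] d0 e.
  by rewrite ltnn in d0.
by rewrite pmxS frbM -expnS e detps_swap.
Qed.

Lemma pmx_shape r (Z : 'rV[Cp]_n -> 'M[Cp]_r.+1) d x : (forall j, zshape (Z (frb (q ^ j) x))) ->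
  zshape (pmx q Z d.+1 x).
Proof.
move=> h; elim: d => [|d IH]; last by rewrite pmxS; exact: zshape_mul.
by rewrite /= mulmx1 -(frb1 x) -(expn0 q).
Qed.

(** Cauchy-Binet multiplies the bounds of the d factors. This decay in d is what later makes the
    tail of the partial fraction sum negligible in all degrees at once. *)
Lemma pmx_minor r (Z : 'rV[Cp]_n -> 'M[Cp]_r.+1) d m x (S S' : m.+1.-tuple 'I_r.+1) :
  (forall j, zshape (Z (frb (q ^ j) x))) -> incr S' -> V (minor (pmx q Z d x) S S') <= (w ^+ m) ^+ d.
Proof.
move=> h; elim: d S S' => [|d IH] S S' iS.
  rewrite expr0; apply: pabs_sum => // s _; rewrite pabsM pabsX pabsN1 expr1n mul1r.
  by apply: pabs_prod_le1 => a _; rewrite !mxE; exact: pabs_nat.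
rewrite pmxS minor_mul exprSr; apply: pabs_sum => [|J iJ]; first by rewrite mulr_ge0 ?exprn_ge0.
by apply: pabsM_le; [exact: IH|exact: zshape_minor].
Qed.

Lemma detps1 r (A : 'M[Cp]_r) : detps A 1%N = - \tr A.
Proof.
have := pexpS (fun d => - \tr (A ^+ d)) 0; rewrite -detps_pexp mul1r big_ord_recl big_ord0 addr0.
by rewrite /= expr1 detps0 mulr1.
Qed.

Lemma detps_shape r (Z : 'rV[Cp]_n -> 'M[Cp]_r.+1) d x : (0 < d)%N ->
  (forall j, zshape (Z (frb (q ^ j) x))) ->
  [/\ detps (pmx q Z d x) 0%N = 1, V (detps (pmx q Z d x) 1%N + 1) <= w &
      forall m, V (detps (pmx q Z d x) m.+1) <= (w ^+ m) ^+ d].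
Proof.
move=> d0 h; split; first exact: detps0.
  case: d d0 => // d _; have [h1 h2 h3] := pmx_shape d h.
  rewrite detps1 /mxtrace (bigD1 ord0) //=; set P := pmx q Z d.+1 x in h1 h2 h3 *.
  have -> : - (P ord0 ord0 + \sum_(i | i != ord0) P i i) + 1 = - \sum_(i | i != ord0) P i i - (P ord0 ord0 - 1) by ring.
  apply: pabsB_le => //; rewrite pabsN; apply: pabs_sum => // i i0; exact: h3.
move=> m; rewrite detps_minors pabsM pabsX pabsN1 expr1n mul1r.
by apply: pabs_sum => [|S iS]; [rewrite !exprn_ge0|exact: pmx_minor].
Qed.

Variables (kR : set Cp) (W : expo n -> RR) (theta rho : nat -> RR).
Variable D : 'rV[Cp]_n -> nat -> ps Cp.

Definition level r (Z : 'rV[Cp]_n -> 'M[Cp]_r.+1) :=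
  (forall k l : 'I_r.+1, lrep kR W (rho k / rho l * theta l) (fun x => Z x k l)) /\
  (forall d x, (0 < d)%N -> tor q d x -> zshape (Z x)).

(** The series D x d stand for Fredholm determinants of infinite matrices. They are approximated by
    finite Laurent polynomial matrices for finitely many degrees and coefficients at a time, but
    with weights W, theta and rho that do not depend on the approximation. *)
Definition approximable := forall d0 N e, 0 < e ->
  exists r (Z : 'rV[Cp]_n -> 'M[Cp]_r.+1), level Z /\
    forall d x m, (0 < d <= d0)%N -> tor q d x -> (m <= N)%N ->
      V (detps (pmx q Z d x) m - D x d m) <= e.

Hypothesis happ : approximable.

Lemma level_frb r (Z : 'rV[Cp]_n -> 'M[Cp]_r.+1) d x : level Z -> (0 < d)%N -> tor q d x ->
  forall j, zshape (Z (frb (q ^ j) x)).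
Proof. by move=> [_ h] d0 hx j; apply: (h d) => //; exact: frb_tor. Qed.

Lemma D_shape d x : (0 < d)%N -> tor q d x ->
  [/\ D x d 0%N = 1, V (D x d 1%N + 1) <= w & forall m, V (D x d m.+1) <= (w ^+ m) ^+ d].
Proof.
move=> d0 hx.
have key m (P : Cp -> Prop) (b : RR) (c : Cp) :
    (forall r (Z : 'rV[Cp]_n -> 'M[Cp]_r.+1), level Z -> V (detps (pmx q Z d x) m - c) <= b) ->
    V (D x d m - c) <= b.
  move=> h; apply/ler_addgt0Pr => e e0.
  have [r [Z [lZ hZ]]] := happ d m e0.
  have b0 : 0 <= b by apply: le_trans (h _ _ lZ); exact: pabs_ge0.
  apply: (@pabs_chain _ _ _ (detps (pmx q Z d x) m)).
    by rewrite pabsBC; apply: le_trans (hZ d x m _ hx _) _; rewrite ?d0 ?leqnn // lerDr.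
  by apply: le_trans (h _ _ lZ) _; rewrite lerDl ltW.
split.
- apply/eqP; rewrite -subr_eq0; apply/eqP/pabs_eq0/eqP; rewrite eq_le pabs_ge0 andbT.
  by apply: (key _ (fun=> True)) => r Z lZ; rewrite detps0 subrr pabs0.
- rewrite -[1 in X in V (_ + X)]opprK; apply: (key _ (fun=> True)) => r Z lZ; rewrite opprK.
  by have [_ h _] := detps_shape d0 (level_frb lZ d0 hx).
- move=> m; rewrite -[D _ _ _]subr0; apply: (key _ (fun=> True)) => r Z lZ; rewrite subr0.
  by have [_ _ h] := detps_shape d0 (level_frb lZ d0 hx).
Qed.

Lemma D_unitlike d x : (0 < d)%N -> tor q d x -> unitlike w (D x d).
Proof.
move=> d0 hx; have [h0 h1 h] := D_shape d0 hx; split=> // m.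
apply: le_trans (h m) _; rewrite -exprM; apply: ler_wiXn2l; rewrite ?leq_pmulr // ltW //.
Qed.

Lemma D_frb d x : (0 < d)%N -> tor q d x -> D (frb q x) d = D x d.
Proof.
move=> d0 hx; apply/funext => m; apply: pabs_le0_eq => e e0.
have [r [Z [lZ hZ]]] := happ d m e0.
apply: (@pabs_chain _ _ _ (detps (pmx q Z d x) m)); last by apply: hZ; rewrite ?d0 /=.
rewrite -(detps_frb Z d0 hx) pabsBC; apply: hZ; rewrite ?d0 ?leqnn //; exact: frb_tor.
Qed.

Lemma plog_detps r (A : 'M[Cp]_r) j : (0 < j)%N -> plog (detps A) j = - \tr (A ^+ j).
Proof. exact: (plog_uniq (detps_pexp A)). Qed.

(** At a point fixed by the d-th Frobenius power the product of d l factors is the l-th power of the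
    product of d factors. Traces of powers express this without mention of eigenvalues, and the
    logarithmic derivative carries it to the limit. *)
Lemma D_pow d l x j : (0 < d)%N -> (0 < l)%N -> tor q d x -> (0 < j)%N ->
  plog (D x (d * l)) j = plog (D x d) (l * j).
Proof.
move=> d0 l0 hx j0; apply: pabs_le0_eq => e e0.
have dl0 : (0 < d * l)%N by rewrite muln_gt0 d0.
have hx' : tor q (d * l) x by exact: tor_mul.
have [r [Z [lZ hZ]]] := happ (d * l)%N (l * j)%N e0.
have le1 d' : (0 < d')%N -> tor q d' x -> forall m, V (detps (pmx q Z d' x) m) <= 1.
  move=> d'0 hx0 [|m]; first by rewrite detps0 pabs1.
  have [_ _ h] := detps_shape d'0 (level_frb lZ d'0 hx0).
  by apply: le_trans (h m) _; rewrite -exprM exprn_ile1 // ltW.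
apply: (@pabs_chain _ _ _ (plog (detps (pmx q Z (d * l) x)) j)).
  rewrite pabsBC; apply: plog_close; first exact: ltW.
  - exact: le1.
  - exact: (ul_le1 w0 w1 (D_unitlike dl0 hx')).
  by move=> i ij; apply: hZ; rewrite ?dl0 /= // (leq_trans ij) // leq_pmull.
have -> : plog (detps (pmx q Z (d * l) x)) j = plog (detps (pmx q Z d x)) (l * j).
  by rewrite !plog_detps ?muln_gt0 ?l0 // pmx_pow // exprM.
apply: plog_close; first exact: ltW.
- exact: le1.
- exact: (ul_le1 w0 w1 (D_unitlike d0 hx)).
by move=> i ij; apply: hZ; rewrite ?d0 //= leq_pmulr.
Qed.

Definition al x d : Cp := xget 1 [set a : Cp | [/\ V (a - 1) <= w, V a = 1 & ps_val (D x d) a^-1 = 0]].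

Lemma alP d x : (0 < d)%N -> tor q d x ->
  [/\ V (al x d - 1) <= w, V (al x d) = 1 & ps_val (D x d) (al x d)^-1 = 0].
Proof.
move=> d0 hx; rewrite /al; case: xgetP => [a _ //|].
have [a ha] := unit_root_exists w0 w1 (D_unitlike d0 hx).
by move/(_ a ha).
Qed.

Lemma al_unique d x a : (0 < d)%N -> tor q d x -> V a = 1 -> ps_val (D x d) a^-1 = 0 -> a = al x d.
Proof.
move=> d0 hx ha ra; have [_ h1 h2] := alP d0 hx.
exact: (unit_root_unique w0 w1 (D_unitlike d0 hx)).
Qed.

Lemma al_frb d x : (0 < d)%N -> tor q d x -> al (frb q x) d = al x d.
Proof. by move=> d0 hx; rewrite /al D_frb. Qed.

(** By [plog_unit] for both series, the j-th powers of the two candidates differ by at most w^j for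
    every j > 0. Two consecutive large j force the candidates to be equal. *)
Lemma al_pow d l x : (0 < d)%N -> (0 < l)%N -> tor q d x -> al x (d * l) = al x d ^+ l.
Proof.
move=> d0 l0 hx; have dl0 : (0 < d * l)%N by rewrite muln_gt0 d0.
have hx' : tor q (d * l) x by exact: tor_mul.
have [_ a1 a2] := alP d0 hx; have [_ b1 b2] := alP dl0 hx'.
set a := al x d in a1 a2 *; set b := al x (d * l) in b1 b2 *.
have b0 : b != 0 by rewrite -(pabs_gt0 b) b1.
have key j : (0 < j)%N -> V ((a ^+ l) ^+ j - b ^+ j) <= w ^+ j.
  move=> j0; have h1 := plog_unit w0 w1 (D_unitlike dl0 hx') b1 b2 j0.
  have lj0 : (0 < l * j)%N by rewrite muln_gt0 l0.
  have h2 := plog_unit w0 w1 (D_unitlike d0 hx) a1 a2 lj0.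
  rewrite (D_pow d0 l0 hx j0) in h1.
  have -> : (a ^+ l) ^+ j - b ^+ j = (plog (D x d) (l * j) + a ^+ (l * j)) - (plog (D x d) (l * j) + b ^+ j).
    by rewrite -exprM; ring.
  apply: pabsB_le => //; apply: le_trans h2 _.
  by apply: ler_wiXn2l; rewrite ?leq_pmull // ltW.
apply: pabs_le0_eq => e e0; have [N hN] := w_small w0 w1 e0.
have h1 := key N.+1 isT; have h2 := key N.+2 isT.
have -> : b - a ^+ l = (b * ((a ^+ l) ^+ N.+1 - b ^+ N.+1) - ((a ^+ l) ^+ N.+2 - b ^+ N.+2)) / (a ^+ l) ^+ N.+1.
  have c0 : a ^+ l != 0 by rewrite expf_neq0 // -(pabs_gt0 a) a1.
  by rewrite [_ ^+ N.+2]exprS [b ^+ N.+2]exprS; field; rewrite expf_neq0.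
rewrite pabsM pabsV !pabsX a1 !expr1n invr1 mulr1; apply: pabsB_le.
  by rewrite pabsM b1 mul1r; apply: le_trans h1 _; apply: hN.
by apply: le_trans h2 _; apply: hN; lia.
Qed.

End Approximation.

(** * The family of L-series in normal form *)

Section Core.
Variables (RR : realType) (p : nat) (Cp : padicField RR p) (n a q : nat).
Local Notation V := (@pabs _ _ Cp).
Hypotheses (pp : prime p) (a0 : (0 < a)%N) (hq : q = (p ^ a)%N).

Lemma q_gt1 : (1 < q)%N.
Proof. by rewrite hq -(exp1n a) ltn_exp2r // prime_gt1. Qed.
Let q1 := q_gt1.

Lemma pabs_q_lt1 : V q%:R < 1.
Proof.
by rewrite hq natrX pabsX exprn_ilt1 ?pabs_ge0 // -?lt0n //; exact: pabs_p.
Qed.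

Variable w : RR.
Hypotheses (w0 : 0 <= w) (w1 : w < 1).

Lemma pabsB1_exprz (y : Cp) (t : int) : V y = 1 -> V (y ^ t - 1) <= V (y - 1).
Proof.
move=> hy; have h m : V (y ^+ m - 1) <= V (y - 1).
  by rewrite -{1}(expr1n _ m); apply: pabsB_exp; rewrite ?hy ?pabs1.
case: t => m; first exact: h.
rewrite NegzE -exprnN; have y0 : y ^+ m.+1 != 0 by rewrite expf_neq0 // -(pabs_gt0 y) hy.
have -> : y ^- m.+1 - 1 = - (y ^- m.+1 * (y ^+ m.+1 - 1)) by rewrite mulrBr mulVf // mulr1 opprB.
by rewrite pabsN pabsM pabsV pabsX hy expr1n invr1 mul1r.
Qed.

Lemma near1_unit (y : Cp) : V (y - 1) <= w -> V y = 1.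
Proof. by move=> h; rewrite -(subrK 1 y) addrC pabs_dominant pabs1 // (le_lt_trans h). Qed.

(** A p-th power brings an element near 1 nearer by the factor r, the larger of w and |p|. Hence
    exponents divisible by a high power of p act almost trivially, uniformly in y. *)
Lemma pow_near e : 0 < e -> exists N, forall y : Cp, V (y - 1) <= w ->
  forall t : int, ((p ^ N)%:Z %| t)%Z -> V (y ^ t - 1) <= e.
Proof.
move=> e0; pose r := Num.max w (V p%:R).
have r0 : 0 <= r by rewrite le_max w0.
have r1 : r < 1 by rewrite gt_max w1; exact: pabs_p.
have [N hN] := w_small r0 r1 e0; exists N => y hy t /dvdzP[s ->].
have hy1 := near1_unit hy.
have key k : V (y ^+ (p ^ k) - 1) <= r ^+ k.+1.
  elim: k => [|k IH]; first by rewrite expn0 !expr1 (le_trans hy) // le_max lexx.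
  rewrite expnSr exprM; set z := y ^+ (p ^ k) in IH *.
  have z1 : V z = 1 by rewrite pabsX hy1 expr1n.
  rewrite -{1}(expr1n _ p) subrXX exprSr; apply: pabsM_le => //.
  have -> : \sum_(i < p) z ^+ (p.-1 - i) * 1 ^+ i = p%:R + \sum_(i < p) (z ^+ (p.-1 - i) - 1).
    rewrite sumrB sumr_const card_ord addrC subrK; by apply: eq_bigr => i _; rewrite expr1n mulr1.
  apply: pabsD_le; first by rewrite le_max lexx orbT.
  apply: pabs_sum => // i _; have := @pabsB1_exprz z (p.-1 - i)%N z1; move/le_trans; apply.
  by apply: le_trans IH _; rewrite exprS ler_piMr // exprn_ile1 // ltW.
rewrite mulrC -exprz_exp; apply: le_trans (pabsB1_exprz _ _) _.
  by rewrite pabs_exprz hy1 exp1rz.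
by apply: le_trans (key N) _; apply: hN.
Qed.

Variables (kR : set Cp).
Hypotheses (kR_sub : subring kR) (kR_le1 : forall x, kR x -> V x <= 1).
Hypothesis kR_lim : forall u l, (forall m : nat, kR (u m)) -> pcvg u l -> kR l.

Variables (gam_ : Cp) (v : expo n) (r0 : int).
Hypotheses (gR : kR gam_) (gVR : kR gam_^-1) (g0 : gam_ != 0) (gq : V (gam_ ^+ q.-1 - 1) <= w).

Lemma gam_abs : V gam_ = 1.
Proof.
have h : V gam_ ^+ q.-1 = 1 by rewrite -pabsX near1_unit.
apply/eqP; rewrite -(@pexpr_eq1 _ _ q.-1) ?pabs_ge0 ?h //.
by move: q1; case: (q) => [|[]].
Qed.

Lemma chi_abs (u : expo n) d (x : 'rV[Cp]_n) : (0 < d)%N -> tor q d x -> V (chi q u d x) = 1.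
Proof.
move=> d0 hx; rewrite pabs_prod big1 // => j _.
by apply: (monom_abs q1 u d0); exact: frb_tor.
Qed.

Lemma chi_frb (u : expo n) d (x : 'rV[Cp]_n) : (0 < d)%N -> tor q d x -> chi q u d (frb q x) = chi q u d x.
Proof.
move=> d0 hx; have e := tor_frb q1 d0 hx; case: d d0 {hx} e => [|d] d0 e.
  by rewrite ltnn in d0.
rewrite [RHS]chiS {1}/chi big_ord_recr /= frbM -expnS e mulrC; congr (_ * _).
Qed.

Lemma chi_X (u : expo n) d (x : 'rV[Cp]_n) : chi q u d (frb q x) = chi q u d x ^+ q.
Proof.
by rewrite /chi -prodrXl; apply: eq_bigr => j _; rewrite !frbM mulnC -frbM monom_frbX.
Qed.

Lemma chiD (u : expo n) d e (x : 'rV[Cp]_n) : chi q u (d + e) x = chi q u d x * chi q u e (frb (q ^ d) x).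
Proof.
elim: d x => [|d IH] x; first by rewrite /chi big_ord0 mul1r expn0 frb1.
by rewrite addSn !chiS IH mulrA frbM -expnS.
Qed.

Lemma chi_mul (u : expo n) d l (x : 'rV[Cp]_n) : (0 < d)%N -> tor q d x -> chi q u (d * l) x = chi q u d x ^+ l.
Proof.
move=> d0 hx; elim: l => [|l IH]; first by rewrite muln0 /chi big_ord0.
by rewrite mulnS chiD (tor_frb q1 d0 hx) IH exprS.
Qed.

(** Replacing x by x^q permutes the factors cyclically, but also raises the value to the power q. *)
Lemma chi_order (u : expo n) d (x : 'rV[Cp]_n) : (0 < d)%N -> tor q d x -> chi q u d x ^+ q.-1 = 1.
Proof.
move=> d0 hx; have h : chi q u d x != 0 by rewrite -(pabs_gt0 (chi q u d x)) chi_abs.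
by apply: (mulfI h); rewrite mulr1 -exprS (ltn_predK q1) -chi_X chi_frb.
Qed.

Lemma prod_exprz (I : Type) (s : seq I) (F : I -> Cp) (k : int) :
  (\prod_(i <- s) F i) ^ k = \prod_(i <- s) F i ^ k.
Proof. by apply: (big_morph (fun y : Cp => y ^ k)) => [x y|]; rewrite ?expfzMl ?exp1rz. Qed.

Definition res (k : int) := exists t : int, k = r0 + (q.-1)%:Z * t.

Definition va : expo n := \row_i (v ord0 i * r0).

(** By [chi_order] only the class of k modulo q - 1 matters. The factor chi^k thus comes from one
    exponent vector [va], so that a single monomial and a single constant serve the whole class. *)
Lemma chi_res k d (x : 'rV[Cp]_n) : res k -> (0 < d)%N -> tor q d x -> chi q v d x ^ k = chi q va d x.
Proof.
move=> [t ->] d0 hx.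
have h : chi q v d x != 0 by rewrite -(pabs_gt0 (chi q v d x)) chi_abs.
rewrite expfzDr // -exprz_exp -exprnP chi_order // exp1rz mulr1.
rewrite /chi prod_exprz; apply: eq_bigr => j _; rewrite /monom prod_exprz.
by apply: eq_bigr => i _; rewrite exprz_exp [va _ _]mxE.
Qed.

Variables (W : expo n -> RR) (theta rho : nat -> RR) (vth : RR).
Hypotheses (W0 : W 0 = 1) (Wpos : forall u, 0 < W u) (WD : forall u v, W (u + v) <= W u * W v).
Hypotheses (th0 : theta 0 = 1) (th_ge0 : forall j, 0 <= theta j).
Hypotheses (vth1 : vth < 1) (thS : forall j, theta j.+1 <= vth).
Hypothesis th_lim : forall mu, 0 < mu -> exists J, forall j, (J <= j)%N -> theta j <= mu.
Hypothesis rho_gt0 : forall i, 0 < rho i.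
Variables (lam : RR).
Hypotheses (lam0 : 0 < lam).
Hypothesis W_dec : forall a : expo n, exists s : seq (expo n), forall u, u \notin s -> W (u + a) / W (u *+ q) <= lam.
Variable D : 'rV[Cp]_n -> nat -> ps Cp.
Hypothesis happ : approximable q w kR W theta rho D.

Local Notation al := (al w D).

Definition uroot x d : Cp := gam_ ^+ d * chi q v d x * al x d.
(* By [hook_identity], [\sum_(i >= 1) (-1)^(i-1) i tau_i = 1]. *)
Definition tau i x d : Cp := (al x d)^-1 ^+ i * hlim (D x d) (al x d) * ((-1) ^+ i * D x d i).
Definition powsum (k : int) d : Cp := tsum q d (fun x => uroot x d ^ k).
(** The factor (q^d - 1)^(-n) turns the sum over torsion points into a limit of traces, as
    prescribed by [Gam_trace]. *)
Definition sI i (k : int) d : Cp := (((q ^ d).-1%:R)^-1) ^+ n * tsum q d (fun x => uroot x d ^ k * tau i x d).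

Lemma uroot_abs d x : (0 < d)%N -> tor q d x -> V (uroot x d) = 1.
Proof.
move=> d0 hx; have [_ h _] := alP w0 w1 happ d0 hx.
by rewrite /uroot !pabsM pabsX gam_abs expr1n chi_abs // h !mulr1.
Qed.

Lemma uroot_near d x : (0 < d)%N -> tor q d x -> V (uroot x d ^+ q.-1 - 1) <= w.
Proof.
move=> d0 hx; have [h1 h2 _] := alP w0 w1 happ d0 hx.
rewrite /uroot !exprMn chi_order // mulr1 -exprM mulnC exprM.
have hg := gq; set y := gam_ ^+ q.-1 in hg *; have hy := near1_unit hg.
have -> : y ^+ d * al x d ^+ q.-1 - 1 = y ^+ d * (al x d ^+ q.-1 - 1) + (y ^+ d - 1) by ring.
apply: pabsD_le.
  rewrite pabsM pabsX hy expr1n mul1r; apply: le_trans (pabsB1_exprz q.-1 h2) h1.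
by apply: le_trans (pabsB1_exprz d hy) hg.
Qed.

Lemma uroot_frb d x : (0 < d)%N -> tor q d x -> uroot (frb q x) d = uroot x d.
Proof. by move=> d0 hx; rewrite /uroot chi_frb // (al_frb q1 happ). Qed.

Lemma uroot_pow d l x : (0 < d)%N -> (0 < l)%N -> tor q d x -> uroot x (d * l) = uroot x d ^+ l.
Proof.
by move=> d0 l0 hx; rewrite /uroot chi_mul // (al_pow q1 w0 w1 happ) // !exprMn exprM.
Qed.

Lemma tau_le1 i d x : (0 < d)%N -> tor q d x -> V (tau i x d) <= 1.
Proof.
move=> d0 hx; have [_ h1 h2] := alP w0 w1 happ d0 hx; have ul := D_unitlike w0 w1 happ d0 hx.
apply: pabsM_le1; last by rewrite pabsM pabsX pabsN1 expr1n mul1r; exact: (ul_le1 w0 w1 ul).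
apply: pabsM_le1; last exact: (hlim_le1 w0 w1 ul h1 h2).
by rewrite pabsX pabsV h1 invr1 expr1n.
Qed.

Lemma tsum_abs d (f : 'rV[Cp]_n -> Cp) e : 0 <= e -> (0 < d)%N -> (forall x, tor q d x -> V (f x) <= e) -> V (tsum q d f) <= e.
Proof. by move=> e0 d0 h; apply: pabs_sum => // c _; apply: h; exact: tpt_tor. Qed.

Lemma qd_abs d : (0 < d)%N -> V ((((q ^ d).-1%:R)^-1) ^+ n) = 1.
Proof. by move=> d0; rewrite pabsX pabsV (pabs_qd q1 pabs_q_lt1) // invr1 expr1n. Qed.

Lemma sI_le1 i k d : (0 < d)%N -> V (sI i k d) <= 1.
Proof.
move=> d0; rewrite /sI pabsM qd_abs // mul1r; apply: tsum_abs => // x hx.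
by rewrite pabsM pabs_exprz uroot_abs // exp1rz mul1r; exact: tau_le1.
Qed.

Lemma natural_rep (k : int) N b : exists K : nat, (b <= K)%N /\ ((p ^ N)%:Z %| k - K%:Z)%Z.
Proof.
have P0 : (0 < p ^ N)%N by rewrite expn_gt0 prime_gt0.
exists (absz (k + (p ^ N)%:Z * (absz k + b)%:Z)); split.
  have h : 1 <= (p ^ N)%:Z by rewrite lez_nat.
  have : (absz k + b)%:Z <= (p ^ N)%:Z * (absz k + b)%:Z by rewrite ler_peMl.
  lia.
have h : 1 <= (p ^ N)%:Z by rewrite lez_nat.
have : (absz k + b)%:Z <= (p ^ N)%:Z * (absz k + b)%:Z by rewrite ler_peMl.
move=> h2; have -> : (absz (k + (p ^ N)%:Z * (absz k + b)%:Z))%:Z = k + (p ^ N)%:Z * (absz k + b)%:Z by lia.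
by apply/dvdzP; exists (- (absz k + b)%:Z); ring.
Qed.

(** This is [sI] without the constant (gam_^k)^d, which amounts to a rescaling of T by a unit, and
    with chi^k rewritten as the character of [va]. *)
Definition sI' i (k : int) d : Cp := (((q ^ d).-1%:R)^-1) ^+ n *
  tsum q d (fun x => chi q va d x * (al x d ^ k * tau i x d)).

Lemma sIE i k d : res k -> (0 < d)%N -> sI i k d = (gam_ ^ k) ^+ d * sI' i k d.
Proof.
move=> hk d0; rewrite /sI /sI' mulrCA; congr (_ * _).
rewrite /tsum mulr_sumr; apply: eq_bigr => c _.
rewrite /uroot !expfzMl chi_res //; last exact: tpt_tor.
have -> : gam_ ^+ d ^ k = (gam_ ^ k) ^+ d by rewrite (exprnP gam_ d) (exprnP _ d) !exprz_exp mulrC.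
by rewrite !mulrA.
Qed.

(** Traces on Sym^M tensored with the i-th exterior power approximate [sI'] when M + i is a large
    integer p-adically close to k. Membership in the ring and the bound C lam^m hold for each
    approximation with the same C, and both pass to the limit. *)
Lemma det_limit i : exists2 C, 0 <= C & forall k m, res k ->
  kR (pexp (fun d => - sI i k d) m) /\ V (pexp (fun d => - sI i k d) m) <= C * lam ^+ m.
Proof.
have [C [C0 hC]] := uniform_det q1 kR_sub W0 Wpos WD th0 th_ge0 vth1 thS th_lim rho_gt0 lam0 (W_dec va) i.
exists C => // k m hk.
have kRX (x : Cp) l : kR x -> kR (x ^+ l) by exact: kKX.
have gk : kR (gam_ ^ k) by case: (k) => l; [exact: kRX|rewrite NegzE -exprnN -exprVn; exact: kRX].
have gkV : V (gam_ ^ k) = 1 by rewrite pabs_exprz gam_abs exp1rz.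
have e1 : pexp (fun d => - sI i k d) m = (gam_ ^ k) ^+ m * pexp (fun d => - sI' i k d) m.
  rewrite -pexp_scale; apply: eq_pexp_le => d /andP[d0 _].
  by rewrite sIE // mulrN.
suff [h1 h2] : kR (pexp (fun d => - sI' i k d) m) /\ V (pexp (fun d => - sI' i k d) m) <= C * lam ^+ m.
  rewrite e1; split; first by apply: kKM => //; exact: kRX.
  by rewrite pabsM pabsX gkV expr1n mul1r.
suff key e : 0 < e -> exists y, [/\ kR y, V y <= C * lam ^+ m & V (y - pexp (fun d => - sI' i k d) m) <= e].
  have ee l : 0 < (l.+1%:R^-1 : RR) by rewrite invr_gt0.
  pose u l := projT1 (cid (key _ (ee l))).
  have hu l : [/\ kR (u l), V (u l) <= C * lam ^+ m & V (u l - pexp (fun d => - sI' i k d) m) <= l.+1%:R^-1].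
    exact: (projT2 (cid (key _ (ee l)))).
  have cu : pcvg u (pexp (fun d => - sI' i k d) m).
    move=> e e0; exists (Num.truncn e^-1) => l hl; have [_ _ h] := hu l; apply: le_trans h _.
    rewrite -[leRHS]invrK lef_pV2 ?posrE ?invr_gt0 //.
    by apply: le_trans (ltW (truncnS_gt (e^-1))) _; rewrite ler_nat ltnS.
  split; first by apply: (kR_lim _ cu) => l; have [] := hu l.
  by apply: (pcvg_le cu); exists 0%N => l _; have [] := hu l.
(* The factor |m!| compensates the loss in [pexp_close]. *)
move=> e0; pose d1 := Num.min (e * V (m`!)%:R) 1.
have d10 : 0 < d1 by rewrite lt_min ltr01 andbT mulr_gt0 // pabs_fact_gt0.
have [N hN] := pow_near d10; have [N' hN'] := w_small w0 w1 d10.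
(* The exponent of al in the i-th term is k - i. A natural number K near k is therefore split as M +
   i, with M large enough for [hlimP]. *)
have [K [bK dK]] := natural_rep k N (i + N')%N.
pose M := (K - i)%N.
have hK : K = (M + i)%N by rewrite /M subnK // (leq_trans (leq_addr _ _) bK).
have hM : (N' <= M.+1)%N by rewrite leqW // -(leq_add2l i) (leq_trans bK) // hK addnC.
have [r [Z [lZ hZ]]] := happ m (maxn M i) d10.
have [NN [G [G1 G2 G3]]] := hC r M Z lZ.1.
exists (detps G m); split=> //.
have trG d : (0 < d)%N -> \tr (G ^+ d) = (((q ^ d).-1%:R)^-1) ^+ n *
    tsum q d (fun x => chi q va d x * (hsum M (pmx q Z d x) * esum i (pmx q Z d x))).
  move=> d0; rewrite -G3 // exprVn mulKf // expf_neq0 // -(pabs_gt0 ((q ^ d).-1%:R : Cp)).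
  by rewrite (pabs_qd q1 pabs_q_lt1).
have clo d : (0 < d <= m)%N -> V (\tr (G ^+ d) - sI' i k d) <= d1.
  move=> /andP[d0 dm]; rewrite trG // /sI' -mulrBr pabsM qd_abs // mul1r /tsum -sumrB.
  apply: pabs_sum => [|c _]; first exact: ltW.
  have hx := tpt_tor Cp q1 c d0; move: (tpt Cp c) hx => x hx.
  rewrite -mulrBr pabsM chi_abs // mul1r.
  have [h1 h2 h3] := alP w0 w1 happ d0 hx; have ul := D_unitlike w0 w1 happ d0 hx.
  have [s0 _ s2] := detps_shape w0 d0 (level_frb lZ d0 hx).
  have det_le j : V (detps (pmx q Z d x) j) <= 1.
    case: j => [|j]; first by rewrite s0 pabs1.
    by apply: le_trans (s2 j) _; rewrite -exprM exprn_ile1 // ltW.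
  have hdet j : (j <= maxn M i)%N -> V (detps (pmx q Z d x) j - D x d j) <= d1.
    by move=> hj; apply: hZ; rewrite ?d0.
  have hh : V (hsum M (pmx q Z d x) - al x d ^ k * ((al x d)^-1 ^+ i * hlim (D x d) (al x d))) <= d1.
    have -> : hsum M (pmx q Z d x) = pinv (detps (pmx q Z d x)) M.
      rewrite hsum_pexp; congr (_ M); apply: pinv_uniq => //.
      by rewrite detps_pexp psmulC pexpNK.
    apply: (@pabs_chain _ _ _ (pinv (D x d) M)).
      apply: pinv_close; [exact: ltW|by []|by move=> j _; exact: (ul_le1 w0 w1 ul)|].
      by move=> j jM; apply: hdet; rewrite leq_max jM.
    apply: (@pabs_chain _ _ _ (al x d ^+ M * hlim (D x d) (al x d))).
      apply: le_trans (hlimP w0 w1 ul h2 h3 M) _; exact: hN'.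
    have a_n0 : al x d != 0 by rewrite -(pabs_gt0 (al x d)) h2.
    have -> : al x d ^+ M * hlim (D x d) (al x d) - al x d ^ k * ((al x d)^-1 ^+ i * hlim (D x d) (al x d)) =
       - ((al x d ^ (k - K%:Z) - 1) * (al x d ^+ M * hlim (D x d) (al x d))).
      have -> : al x d ^ k = al x d ^ (k - K%:Z) * (al x d ^+ M * al x d ^+ i).
        by rewrite -exprD -hK exprnP -expfzDr // subrK.
      by rewrite exprVn; field; rewrite expf_neq0.
    rewrite pabsN; apply: pabsMr_le; first exact: hN.
    by apply: pabsM_le1; [rewrite pabsX h2 expr1n|exact: (hlim_le1 w0 w1 ul h2 h3)].
  have he : V (esum i (pmx q Z d x) - (-1) ^+ i * D x d i) <= d1.
    have -> : esum i (pmx q Z d x) = (-1) ^+ i * detps (pmx q Z d x) i.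
      by rewrite detps_minors mulrA -exprD addnn -mul2n exprM sqrrN !expr1n mul1r.
    by rewrite -mulrBr pabsM pabsX pabsN1 expr1n mul1r; apply: hdet; rewrite leq_maxr.
  rewrite /tau mulrA; set A := hsum _ _ in hh *; set B := esum _ _ in he *; set A' := _ * (_ * _) in hh *.
  set B' := _ * D x d i in he *.
  have -> : A * B - A' * B' = (A - A') * B + A' * (B - B') by ring.
  apply: pabsD_le.
    apply: pabsMr_le => //; rewrite -(subrK B' B); apply: pabsD_le.
      by apply: le_trans he _; rewrite ge_min lexx orbT.
    by rewrite pabsM pabsX pabsN1 expr1n mul1r; exact: (ul_le1 w0 w1 ul).
  apply: pabsMl_le => //; rewrite pabsM pabs_exprz h2 exp1rz mul1r.
  by apply: pabsM_le1; [rewrite pabsX pabsV h2 invr1 expr1n|exact: (hlim_le1 w0 w1 ul h2 h3)].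
have s'le d : (0 < d <= m)%N -> V (- sI' i k d) <= 1.
  move=> /andP[d0 _]; rewrite pabsN; have := sI_le1 i k d0; rewrite sIE // pabsM pabsX gkV expr1n mul1r.
  by [].
rewrite detps_pexp; apply: le_trans (pexp_close (ltW d10) _ s'le _) _.
- move=> d hd; rewrite pabsN -(subrK (sI' i k d) (\tr _)); apply: pabsD_le.
    by apply: le_trans (clo d hd) _; rewrite ge_min lexx orbT.
  by have := s'le d hd; rewrite pabsN.
- by move=> d hd; rewrite -opprD pabsN; exact: clo.
by rewrite ler_pdivrMr ?pabs_fact_gt0 // ge_min lexx.
Qed.

(** * The L-series as a quotient *)

Section Family.
Variable I : nat.

(** The factor i comes from the partial fractions, the binomial coefficient from expanding (q^d -
    1)^n. *)
Definition mlt i j := (i * 'C(n, j))%N.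

(** The terms of positive sign for b false, of negative sign for b true. Multiplicities are written
    as repeated sums so that the exponential becomes a product of series; the factor q^(jd) is the
    substitution of q^j T for T. *)
Definition Spl (b : bool) (k : int) d : Cp :=
  \sum_(i < I.+1) \sum_(j < n.+1) \sum_(l < if odd (i.+1 + n + j) == b then mlt i j else 0)
    (q%:R ^+ j) ^+ d * sI i k d.

Definition serr (k : int) d : Cp :=
  tsum q d (fun x => uroot x d ^ k * (1 - \sum_(i < I.+1) (-1) ^+ i.+1 * i%:R * tau i x d)).

Lemma powsum_split k d : (0 < d)%N -> powsum k d = Spl false k d - Spl true k d + serr k d.
Proof.
move=> d0; pose N := (q ^ d).-1; have N0 : (N%:R : Cp) != 0.
  by rewrite -(pabs_gt0 (N%:R : Cp)) (pabs_qd q1 pabs_q_lt1).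
have eN : (N%:R : Cp) ^+ n = \sum_(j < n.+1) (-1) ^+ (n + j) * ('C(n, j))%:R * (q%:R ^+ j) ^+ d.
  have -> : (N%:R : Cp) = -1 + q%:R ^+ d.
    by rewrite -natrX -[in RHS](ltn_predK (qd_gt1 q1 d0)) -natr1 addrC addrK.
  rewrite exprDn; apply: eq_bigr => j _; rewrite -mulr_natr mulrAC -exprM mulnC exprM.
  congr (_ * _ * _); have jn : (j <= n)%N by rewrite -ltnS.
  have -> : (n + j = n - j + (j + j))%N by lia.
  by rewrite exprD addnn -mul2n exprM sqrrN !expr1n mulr1.
have -> : serr k d = powsum k d - \sum_(i < I.+1) (-1) ^+ i.+1 * i%:R * (N%:R ^+ n * sI i k d).
  have eI i : N%:R ^+ n * sI i k d = tsum q d (fun x => uroot x d ^ k * tau i x d).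
    by rewrite /sI mulrA -exprMn divff // expr1n mul1r.
  rewrite /serr /powsum.
  under [in RHS]eq_bigr => i _ do rewrite eI /tsum mulr_sumr.
  rewrite exchange_big /= /tsum -sumrB; apply: eq_bigr => c _.
  rewrite mulrBr mulr1 mulr_sumr; congr (_ - _); apply: eq_bigr => i _; ring.
suff -> : Spl false k d - Spl true k d = \sum_(i < I.+1) (-1) ^+ i.+1 * i%:R * (N%:R ^+ n * sI i k d).
  by rewrite addrC subrK.
rewrite /Spl -sumrB; apply: eq_bigr => i _; rewrite -sumrB eN mulr_suml mulr_sumr.
apply: eq_bigr => j _; rewrite !sumr_const !card_ord.
have -> : (-1) ^+ i.+1 * i%:R * ((-1) ^+ (n + j) * 'C(n, j)%:R * (q%:R ^+ j) ^+ d * sI i k d) =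
  (-1) ^+ (i.+1 + n + j) * (((q%:R ^+ j) ^+ d * sI i k d) *+ mlt i j) :> Cp.
  rewrite -addnA [_ ^+ (i.+1 + _)]exprD /mlt -[X in _ = _ * X]mulr_natr natrM.
  by ring.
rewrite -signr_odd; case: odd; rewrite /= ?mulr0n ?expr1 ?expr0 ?mul1r ?subr0 //.
by rewrite sub0r mulN1r.
Qed.

(** By [hook_identity] the error at a point is [hlim] times a tail of a series whose i-th term has
    size at most w^((i-1)d), and the tail starts at i = I + 1. *)
Lemma hook_tail k d : (0 < d)%N -> V (serr k d) <= (w ^+ I) ^+ d.
Proof.
move=> d0; apply: tsum_abs => //; first by rewrite !exprn_ge0.
move=> x hx; have [h1 h2 h3] := alP w0 w1 happ d0 hx; have ul := D_unitlike w0 w1 happ d0 hx.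
rewrite pabsM pabs_exprz uroot_abs // exp1rz mul1r.
have [_ _ hD] := D_shape w0 happ d0 hx.
have hh := hook_identity w0 w1 ul h2 h3.
have -> : \sum_(i < I.+1) (-1) ^+ i.+1 * i%:R * tau i x d =
   hlim (D x d) (al x d) * \sum_(i < I.+1) (- i%:R * dt (D x d) (al x d) i).
  rewrite mulr_sumr; apply: eq_bigr => i _; rewrite /tau /dt exprS.
  have -> : -1 * (-1) ^+ i * i%:R * ((al x d)^-1 ^+ i * hlim (D x d) (al x d) * ((-1) ^+ i * D x d i)) =
    - ((-1) ^+ i * (-1) ^+ i) * (i%:R * ((al x d)^-1 ^+ i * hlim (D x d) (al x d) * D x d i)) :> Cp by ring.
  by rewrite -exprMn mulrNN mulr1 expr1n; ring.
rewrite -[X in V (X - _)]hh -mulrBr; apply: pabsMl_le; first exact: (hlim_le1 w0 w1 ul h2 h3).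
apply: nasum_nat_sub; first by rewrite !exprn_ge0.
  exact: (hook_null w0 w1 ul h2).
move=> -[//|m] hm; rewrite mulNr pabsN; apply: pabsMl_le; first exact: pabs_nat.
rewrite /dt pabsM pabsX pabsV h2 invr1 expr1n mulr1; apply: le_trans (hD m) _.
by rewrite lerXn2r ?nnegrE ?exprn_ge0 // ler_wiXn2l // ltW.
Qed.

Lemma Spl_le1 b k d : (0 < d)%N -> V (Spl b k d) <= 1.
Proof.
move=> d0; apply: pabs_sum => // i _; apply: pabs_sum => // j _; apply: pabs_sum => // l _.
apply: pabsM_le1; last exact: sI_le1.
by apply: pabsX_le1; apply: pabsX_le1; exact: pabs_nat.
Qed.

Definition tame (f : int -> ps Cp) := exists2 C, 0 <= C & forall k m, res k ->
  kR (f k m) /\ V (f k m) <= C * lam ^+ m.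

Lemma tame_mul f g : tame f -> tame g -> tame (fun k => psmul (f k) (g k)).
Proof.
move=> [C C0 hf] [C' C0' hg]; exists (C * C'); first exact: mulr_ge0.
move=> k m hk; split.
  by apply: kK_sum => // i _; apply: kKM => //; [have [] := hf k i hk|have [] := hg k (m - i)%N hk].
by apply: psmul_bound => //; [exact: ltW|move=> i; have [] := hf k i hk|move=> i; have [] := hg k i hk].
Qed.

Lemma tame_1 : tame (fun=> @ps1 _ _ Cp).
Proof.
exists 1 => // k m _; rewrite /ps1; split; first exact: kK_nat.
by case: m => [|m]; rewrite /= ?pabs1 ?pabs0 ?expr0 mul1r // exprn_ge0 // ltW.
Qed.

Lemma tame_prod (T : Type) (s : seq T) (F : T -> int -> ps Cp) : (forall t, tame (F t)) ->
  tame (fun k => \big[@psmul _ _ Cp/@ps1 _ _ Cp]_(t <- s) F t k).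
Proof.
move=> h; elim: s => [|t s IH].
  by rewrite (_ : (fun k => _) = fun=> @ps1 _ _ Cp); [exact: tame_1|apply/funext => k; rewrite big_nil].
rewrite (_ : (fun k => _) = fun k => psmul (F t k) (\big[@psmul _ _ Cp/@ps1 _ _ Cp]_(t <- s) F t k)).
  exact: tame_mul.
by apply/funext => k; rewrite big_cons.
Qed.

Lemma tame_Spl b : tame (fun k => pexp (fun d => - Spl b k d)).
Proof.
have e k : pexp (fun d => - Spl b k d) = \big[@psmul _ _ Cp/@ps1 _ _ Cp]_(i < I.+1)
   \big[@psmul _ _ Cp/@ps1 _ _ Cp]_(j < n.+1)
   \big[@psmul _ _ Cp/@ps1 _ _ Cp]_(l < if odd (i.+1 + n + j) == b then mlt i j else 0)
     pexp (fun d => (q%:R ^+ j) ^+ d * - sI i k d).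
  under eq_bigr => i _. under eq_bigr => j _ do rewrite -pexp_sum. rewrite -pexp_sum. over.
  rewrite -pexp_sum; congr pexp; apply/funext => d; rewrite /Spl -sumrN; apply: eq_bigr => i _.
  rewrite -sumrN; apply: eq_bigr => j _; rewrite -sumrN; apply: eq_bigr => l _; by rewrite mulrN.
rewrite (funext e).
apply: tame_prod => i; apply: tame_prod => j; apply: tame_prod => l.
have [C C0 hC] := det_limit i; exists C => // k m hk; have [h1 h2] := hC k m hk.
rewrite pexp_scale; split.
  by apply: kKM => //; rewrite -exprM; apply: kKX => //; exact: kK_nat.
apply: pabsMl_le h2; by apply: pabsX_le1; apply: pabsX_le1; exact: pabs_nat.
Qed.

End Family.

Lemma pinv_ring f m : f 0%N = 1 -> (forall m, kR (f m)) -> kR (pinv f m).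
Proof.
move=> f0 h; elim/ltn_ind: m => -[|m] IH; first exact: kK1.
rewrite pinvS; apply: kKN => //; apply: kK_sum => // d _; apply: kKM => //; apply: IH.
by rewrite ltnS leq_subr.
Qed.

Definition Lser k := pexp (powsum k).

Lemma Lser_split I k : Lser k =
  psmul (psmul (pinv (pexp (fun d => - Spl I false k d))) (pexp (fun d => - Spl I true k d))) (pexp (serr I k)).
Proof.
have -> : Lser k = pexp (fun d => Spl I false k d - Spl I true k d + serr I k d).
  by apply: eq_pexp => d; exact: powsum_split.
rewrite !pexpD; congr (psmul (psmul _ _) _).
by apply: pinv_uniq => //; rewrite psmulC pexpNK.
Qed.

(** The number of terms is chosen with w^I <= e|p|, the factor |p| paying for the denominators m! of
    the exponential. *)
Lemma serr_small e : 0 < e -> exists I, forall k m, V (pexp (serr I k) m) <= e ^+ m.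
Proof.
move=> e0; have Vp : 0 < V p%:R by rewrite pabs_gt0 natr_gt0_neq0 // prime_gt0.
have [I hI] := w_small w0 w1 (mulr_gt0 e0 Vp); exists I => k m.
apply: le_trans (pexp_bound_p (e := w ^+ I) pp _ _) _; first exact: exprn_ge0.
  by move=> d /andP[d0 _]; exact: hook_tail.
rewrite lerXn2r ?nnegrE ?divr_ge0 ?exprn_ge0 ?(ltW e0) ?(ltW Vp) //.
by rewrite ler_pdivrMr // hI.
Qed.

(** For each I the part without the error factor has coefficients in the ring, and the error factor
    tends to 1 coefficientwise as I grows; the ring is closed. *)
Lemma Lser_kR k m : res k -> kR (Lser k m).
Proof.
move=> hk; pose ee (j : nat) : RR := j.+2%:R^-1.
have e0 j : 0 < ee j by rewrite invr_gt0.
have e1 j : ee j <= 1 by rewrite invf_le1 // ler1n.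
pose I j := projT1 (cid (serr_small (e0 j))).
have hI j : forall k m, V (pexp (serr (I j) k) m) <= ee j ^+ m.
  exact: (projT2 (cid (serr_small (e0 j)))).
pose X j := psmul (pinv (pexp (fun d => - Spl (I j) false k d))) (pexp (fun d => - Spl (I j) true k d)).
have kX j i : kR (X j i).
  have [C C0 h1] := tame_Spl (I j) false; have [C' C0' h2] := tame_Spl (I j) true.
  apply: kK_sum => // l _; apply: kKM => //; last by have [] := h2 k (i - l)%N hk.
  by apply: pinv_ring => // l'; have [] := h1 k l' hk.
apply: (kR_lim (u := fun j => X j m)) => [j|]; first exact: kX.
move=> e e_0; exists (Num.truncn e^-1) => j hj; rewrite (Lser_split (I j)) -/(X j).
rewrite /psmul big_ord_recr /= subnn pexp_0 mulr1 opprD addrCA subrr addr0 pabsN.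
apply: (@le_trans _ _ (ee j)).
  apply: pabs_sum => [|i _]; first exact: ltW.
  apply: pabsMl_le; first by apply: kR_le1.
  apply: le_trans (hI j k _) _; have im := ltn_ord i.
  have -> : (m - i = (m - i).-1.+1)%N by lia.
  by rewrite exprS ler_piMr // ?(ltW (e0 j)) // exprn_ile1 // ltW.
rewrite -[leRHS]invrK lef_pV2 ?posrE ?invr_gt0 //.
apply: le_trans (ltW (truncnS_gt (e^-1))) _; by rewrite ler_nat ltnS leqW.
Qed.

(** Within the class k1 - k2 = (q - 1)(t1 - t2), and q - 1 is prime to p, so p^N divides t1 - t2.
    The power [uroot x d ^+ q.-1] is close to 1, and [pow_near] applies to it. *)
Lemma uroot_close e : 0 < e -> exists N, forall k1 k2 d x, res k1 -> res k2 ->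
  ((p ^ N)%:Z %| k1 - k2)%Z -> (0 < d)%N -> tor q d x -> V (uroot x d ^ k1 - uroot x d ^ k2) <= e.
Proof.
move=> e0; have [N hN] := pow_near e0; exists N => k1 k2 d x [t1 ->] [t2 ->] hd d0 hx.
have r1 := uroot_abs d0 hx; have rn : uroot x d != 0 by rewrite -(pabs_gt0 (uroot x d)) r1.
have hd2 : ((p ^ N)%:Z %| t1 - t2)%Z.
  have e1 : r0 + (q.-1)%:Z * t1 - (r0 + (q.-1)%:Z * t2) = (q.-1)%:Z * (t1 - t2) by ring.
  rewrite e1 Gauss_dvdzr // in hd.
  rewrite coprimezE /= coprimeXl // prime_coprime //.
  apply/negP => h; have : (p %| q)%N by rewrite hq -(prednK a0) expnS dvdn_mulr.
  rewrite -(ltn_predK q1) -addn1 dvdn_addr // dvdn1 => /eqP p1.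
  by have := prime_gt1 pp; rewrite {1}p1.
have -> : uroot x d ^ (r0 + (q.-1)%:Z * t1) - uroot x d ^ (r0 + (q.-1)%:Z * t2) =
   uroot x d ^ (r0 + (q.-1)%:Z * t2) * ((uroot x d ^+ q.-1) ^ (t1 - t2) - 1).
  rewrite mulrBr mulr1 exprnP exprz_exp -expfzDr //; congr (_ ^ _ - _); ring.
rewrite pabsM pabs_exprz r1 exp1rz mul1r; apply: hN => //; exact: uroot_near.
Qed.

Definition ucont (f : int -> ps Cp) := forall m e, 0 < e -> exists N, forall k1 k2, res k1 -> res k2 ->
  ((p ^ N)%:Z %| k1 - k2)%Z -> V (f k1 m - f k2 m) <= e.

Lemma ucont_pexp (s : int -> nat -> Cp) : (forall k d, (0 < d)%N -> V (s k d) <= 1) ->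
  (forall e, 0 < e -> exists N, forall k1 k2 d, res k1 -> res k2 -> ((p ^ N)%:Z %| k1 - k2)%Z ->
     (0 < d)%N -> V (s k1 d - s k2 d) <= e) ->
  ucont (fun k => pexp (s k)).
Proof.
move=> hs hc m e e0; have e1 : 0 < e * V (m`!)%:R by rewrite mulr_gt0 // pabs_fact_gt0.
have [N hN] := hc _ e1; exists N => k1 k2 h1 h2 hd.
apply: le_trans (pexp_close (ltW e1) _ _ _) _ => [d /andP[d0 _]|d /andP[d0 _]|d /andP[d0 _]|].
- exact: hs.
- exact: hs.
- exact: hN.
by rewrite mulfK // gt_eqF // pabs_fact_gt0.
Qed.

Lemma powsum_le1 k d : (0 < d)%N -> V (powsum k d) <= 1.
Proof. by move=> d0; apply: tsum_abs => // x hx; rewrite pabs_exprz uroot_abs // exp1rz. Qed.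

Lemma ucont_L : ucont Lser.
Proof.
apply: ucont_pexp => [k d|e e0]; first exact: powsum_le1.
have [N hN] := uroot_close e0; exists N => k1 k2 d h1 h2 hd d0.
rewrite /powsum /tsum -sumrB; apply: pabs_sum => [|c _]; first exact: ltW.
by apply: hN => //; exact: tpt_tor.
Qed.

Lemma ucont_Spl I b : ucont (fun k => pexp (fun d => - Spl I b k d)).
Proof.
apply: ucont_pexp => [k d d0|e e0]; first by rewrite pabsN; exact: Spl_le1.
have [N hN] := uroot_close e0; exists N => k1 k2 d h1 h2 hd d0.
rewrite -opprD pabsN /Spl -sumrB; apply: pabs_sum => [|i _]; first exact: ltW.
rewrite -sumrB; apply: pabs_sum => [|j _]; first exact: ltW.
rewrite -sumrB; apply: pabs_sum => [|l _]; first exact: ltW.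
rewrite -mulrBr; apply: pabsMl_le.
  by apply: pabsX_le1; apply: pabsX_le1; exact: pabs_nat.
rewrite /sI -mulrBr pabsM qd_abs // mul1r /tsum -sumrB; apply: pabs_sum => [|c _]; first exact: ltW.
have hx := tpt_tor Cp q1 c d0; rewrite -mulrBl; apply: pabsMr_le; [exact: hN|exact: tau_le1].
Qed.

Lemma ucont_mul f g : (forall k m, res k -> kR (f k m)) -> (forall k m, res k -> kR (g k m)) ->
  ucont f -> ucont g -> ucont (fun k => psmul (f k) (g k)).
Proof.
move=> kf kg cf cg m e e0.
have [N hN] : exists N, forall k1 k2, res k1 -> res k2 -> ((p ^ N)%:Z %| k1 - k2)%Z ->
   forall j, (j < m.+1)%N -> V (f k1 j - f k2 j) <= e /\ V (g k1 j - g k2 j) <= e.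
  elim: m.+1 => [|M [N IH]]; first by exists 0%N.
  have [N1 h1] := cf M e e0; have [N2 h2] := cg M e e0.
  have dv k1 k2 (z : int) : (k1 <= k2)%N -> ((p ^ k2)%:Z %| z)%Z -> ((p ^ k1)%:Z %| z)%Z.
    move=> h; apply: dvdz_trans; rewrite /dvdz /=; exact: dvdn_exp2l.
  exists (maxn N (maxn N1 N2)) => k1 k2 r1 r2 hd j; rewrite ltnS leq_eqVlt => /predU1P[->|hj].
    split; [apply: h1 => //|apply: h2 => //]; apply: dv hd => //.
      by rewrite !leq_max leqnn orbT.
    by rewrite !leq_max leqnn !orbT.
  by apply: IH => //; apply: dv hd => //; rewrite leq_maxl.
exists N => k1 k2 r1 r2 hd; have h := hN k1 k2 r1 r2 hd.
apply: psmul_close => [|j jm|j jm|j jm|j jm]; first exact: ltW.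
- by apply: kR_le1; exact: kf.
- by apply: kR_le1; exact: kg.
- by have [] := h j jm.
- by have [] := h j jm.
Qed.

(** The denominator is built from the terms of positive sign. The numerator is the L-series times
    it, so integrality and continuity are inherited from these two; its growth comes from the
    factorisation into the terms of negative sign and the error factor. *)
Theorem core_family : exists f2 : int -> ps Cp,
  [/\ forall k, f2 k 0%N = 1, tame f2, ucont f2,
      tame (fun k => psmul (Lser k) (f2 k)) & ucont (fun k => psmul (Lser k) (f2 k))].
Proof.
have [I hI] := serr_small lam0.
exists (fun k => pexp (fun d => - Spl I false k d)).
have t1 := tame_Spl I false; have t2 := tame_Spl I true.
have kf k m : res k -> kR (pexp (fun d => - Spl I false k d) m).
  by move=> hk; have [C _ h] := t1; have [] := h k m hk.
split => //; first exact: ucont_Spl; last first.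
  apply: ucont_mul => //; [exact: Lser_kR|exact: ucont_L|exact: ucont_Spl].
have e k : psmul (Lser k) (pexp (fun d => - Spl I false k d)) =
   psmul (pexp (fun d => - Spl I true k d)) (pexp (serr I k)).
  rewrite (Lser_split I) psmulC !psmulA psmul_pinv // ps1mul //.
have [C C0 h] := t2; exists C => // k m hk; split.
  by apply: kK_sum => // i _; apply: kKM => //; [exact: Lser_kR|exact: kf].
rewrite e -[C]mulr1; apply: psmul_bound => //; first exact: ltW.
  by move=> i; have [] := h k i hk.
by move=> i; rewrite mul1r; exact: hI.
Qed.

End Core.

(** * Infinite matrices *)

Section InfiniteMatrices.
Variables (RR : realType) (p : nat) (Cp : padicField RR p).
Local Notation V := (@pabs _ _ Cp).
Implicit Types (A B C F W : imx Cp) (e : RR).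

Definition bnd A := forall i j, V (A i j) <= 1.
(** Entries tend to 0 along each row separately, as for change of basis matrices; this is enough for
    products to converge. The stronger [cnull], with columns tending to 0 uniformly, is
    nuclearity. *)
Definition rnull A := bnd A /\ forall i, pnull (A i).
Definition cnull A := bnd A /\
  forall e, 0 < e -> exists N, forall i j, (N <= j)%N -> V (A i j) <= e.

Lemma cnull_rnull A : cnull A -> rnull A.
Proof.
move=> [bA cA]; split=> // i; apply: pnull_nat => e e0; have [N hN] := cA e e0.
by exists N => m hm; exact: hN.
Qed.

Lemma mul_null A B i j : rnull A -> bnd B -> pnull (fun l => A i l * B l j).
Proof.
move=> [bA rA] bB; have -> : (fun l => A i l * B l j) = (fun l => B l j * A i l).
  by apply/funext => l; rewrite mulrC.
by apply: (pnullZ (b := 1)).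
Qed.

Lemma bnd_mul A B : rnull A -> bnd B -> bnd (imxmul A B).
Proof.
move=> rA bB i j; apply: nasum_le => //; first exact: mul_null.
by move=> l; apply: pabsM_le1; [case: rA|].
Qed.

Lemma imx1_bnd : bnd (@imx1 _ _ Cp).
Proof. by move=> i j; exact: pabs_nat. Qed.

Lemma imx1_rnull : rnull (@imx1 _ _ Cp).
Proof.
split; first exact: imx1_bnd.
move=> i; apply: (pnull_fin (F := [fset i]%fset)) => j; rewrite inE /imx1 eq_sym.
by move/negbTE ->.
Qed.

Lemma mulx1 A : imxmul A (@imx1 _ _ Cp) = A.
Proof.
apply/funext => i; apply/funext => j; rewrite /imxmul.
rewrite (nasum_fin (F := [fset j]%fset)) => [|l]; last first.
  by rewrite inE /imx1 => /negbTE ->; rewrite mulr0.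
by rewrite big_seq_fset1 /imx1 eqxx mulr1.
Qed.

Lemma mul1x A : imxmul (@imx1 _ _ Cp) A = A.
Proof.
apply/funext => i; apply/funext => j; rewrite /imxmul.
rewrite (nasum_fin (F := [fset i]%fset)) => [|l]; last first.
  by rewrite inE /imx1 eq_sym => /negbTE ->; rewrite mul0r.
by rewrite big_seq_fset1 /imx1 eqxx mul1r.
Qed.

Lemma row_cut A e : rnull A -> 0 < e -> forall i, exists N, forall l, (N <= l)%N -> V (A i l) <= e.
Proof. by move=> [_ rA] e0 i; exact: (pnull_natP (rA i) e0). Qed.

Lemma mul_cut A B N e i j : rnull A -> bnd B -> 0 <= e -> (forall l, (N <= l)%N -> V (A i l) <= e) ->
  V (imxmul A B i j - \sum_(l < N) A i l * B l j) <= e.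
Proof.
move=> rA bB e0 h; apply: nasum_nat_sub => //; first exact: mul_null.
by move=> l hl; apply: pabsMr_le => //; exact: h.
Qed.

Lemma rnull_mul A B : rnull A -> rnull B -> rnull (imxmul A B).
Proof.
move=> rA rB; split; first by apply: bnd_mul => //; case: rB.
move=> i; apply: pnull_nat => e e0; have [N hN] := row_cut rA e0 i.
have [M hM] : exists M, forall l, (l < N)%N -> forall j, (M <= j)%N -> V (B l j) <= e.
  elim: N {hN} => [|N [M hM]]; first by exists 0%N.
  have [M' hM'] := row_cut rB e0 N; exists (maxn M M') => l.
  rewrite ltnS leq_eqVlt => /predU1P[->|hl] j; rewrite geq_max => /andP[h1 h2]; first exact: hM'.
  exact: hM.
exists M => j hj; rewrite -(subrK (\sum_(l < N) A i l * B l j) (imxmul A B i j)).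
apply: pabsD_le; first by apply: mul_cut => //; [case: rB|exact: ltW].
apply: pabs_sum => [|l _]; first exact: ltW.
by apply: pabsMl_le; [case: rA|exact: hM].
Qed.

Lemma cnull_mulr A B : rnull A -> cnull B -> cnull (imxmul A B).
Proof.
move=> rA [bB cB]; split; first exact: bnd_mul.
move=> e e0; have [N hN] := cB e e0; exists N => i j hj; apply: nasum_le; first exact: ltW.
  exact: mul_null.
by move=> l; apply: pabsMl_le; [case: rA|exact: hN].
Qed.

Lemma cnull_mull A B : cnull A -> rnull B -> cnull (imxmul A B).
Proof.
move=> cA rB; have rA := cnull_rnull cA; split; first by apply: bnd_mul => //; case: rB.
move=> e e0; have [N hN] := cA.2 e e0.
have [M hM] : exists M, forall l, (l < N)%N -> forall j, (M <= j)%N -> V (B l j) <= e.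
  elim: N {hN} => [|N [M hM]]; first by exists 0%N.
  have [M' hM'] := row_cut rB e0 N; exists (maxn M M') => l.
  rewrite ltnS leq_eqVlt => /predU1P[->|hl] j; rewrite geq_max => /andP[h1 h2]; first exact: hM'.
  exact: hM.
exists M => i j hj; rewrite -(subrK (\sum_(l < N) A i l * B l j) (imxmul A B i j)).
apply: pabsD_le; first by apply: mul_cut => //; [case: rB|exact: ltW|move=> l; exact: hN].
apply: pabs_sum => [|l _]; first exact: ltW.
by apply: pabsMl_le; [case: rA|exact: hM].
Qed.

Lemma mulxA A B C : rnull A -> rnull B -> bnd C -> imxmul A (imxmul B C) = imxmul (imxmul A B) C.
Proof.
move=> rA rB bC; apply/funext => i; apply/funext => j; apply: pabs_le0_eq => e e0.
have [N hN] := row_cut rA e0 i; have e0' := ltW e0.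
have bB : bnd B by case: rB.
apply: (@pabs_chain _ _ _ (\sum_(l < N) A i l * imxmul B C l j)).
  by apply: mul_cut => //; exact: bnd_mul.
have h l : pnull (fun m => A i l * (B l m * C m j)).
  by apply: (pnullZ (b := 1)); [move=> m; case: rA|exact: mul_null].
have [n1 n2] := @nasum_bigr _ _ _ _ _ (index_enum 'I_N) xpredT (fun (l : 'I_N) m => A i l * (B l m * C m j)) (fun l _ => h l).
have -> : \sum_(l < N) A i l * imxmul B C l j = nasum (fun m => \sum_(l < N) A i l * (B l m * C m j)).
  by rewrite n2; apply: eq_bigr => l _; rewrite /imxmul -nasumZ //; exact: mul_null.
apply: nasum_close => //; first by apply: mul_null => //; exact: rnull_mul.
move=> m; have -> : \sum_(l < N) A i l * (B l m * C m j) = (\sum_(l < N) A i l * B l m) * C m j.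
  by rewrite big_distrl /=; apply: eq_bigr => l _; rewrite mulrA.
rewrite -mulrBl; apply: pabsMr_le => //; rewrite pabsBC; exact: mul_cut.
Qed.

(** Rows beyond r are left free in the first r columns: a principal minor involving an index at
    least r contains a small column in any case. *)
Definition apx e r A (B : 'M[Cp]_r) :=
  (forall i j : 'I_r, V (A i j - B i j) <= e) /\ (forall i j, (r <= j)%N -> V (A i j) <= e).

Lemma apx_mul e r A C (B D : 'M[Cp]_r) : 0 <= e -> rnull A -> bnd C -> (forall i j, V (D i j) <= 1) ->
  apx e A B -> apx e C D -> apx e (imxmul A C) (B *m D).
Proof.
move=> e0 rA bC bD [h1 h2] [h3 h4]; split=> [i j|i j hj].
  rewrite mxE; apply: (@pabs_chain _ _ _ (\sum_(l < r) A i l * C l j)).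
    by apply: mul_cut => // l hl; exact: h2.
  rewrite -sumrB; apply: pabs_sum => // l _.
  have -> : A i l * C l j - B i l * D l j = A i l * (C l j - D l j) + (A i l - B i l) * D l j by ring.
  by apply: pabsD_le; [apply: pabsMl_le => //; case: rA|apply: pabsMr_le].
apply: nasum_le => //; first exact: mul_null.
by move=> l; apply: pabsMl_le; [case: rA|exact: h4].
Qed.

Lemma pabs_det_col m (A : 'M[Cp]_m) j e : 0 <= e -> (forall i j, V (A i j) <= 1) ->
  (forall i, V (A i j) <= e) -> V (\det A) <= e.
Proof.
move=> e0 h hj; apply: pabs_sum => // s _; rewrite pabsM pabsX pabsN1 expr1n mul1r.
rewrite (bigD1 ((s^-1)%g j)) //= permKV; apply: pabsMr_le => //; exact: pabs_prod_le1.
Qed.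

Lemma pabs_det_close m (A B : 'M[Cp]_m) e : 0 <= e -> (forall i j, V (A i j) <= 1) ->
  (forall i j, V (B i j) <= 1) -> (forall i j, V (A i j - B i j) <= e) -> V (\det A - \det B) <= e.
Proof.
move=> e0 hA hB h; rewrite /determinant -sumrB; apply: pabs_sum => // s _.
rewrite -mulrBr pabsM pabsX pabsN1 expr1n mul1r; exact: pabsB_prod.
Qed.

Definition minort A m (t : m.-tuple nat) : Cp :=
  if sorted ltn t then \det (\matrix_(i, j) A (tnth t i) (tnth t j)) else 0.

Definition tval_ r m : {fset m.-tuple nat} :=
  [fset map_tuple (@nat_of_ord r) t | t in {: m.-tuple 'I_r}]%fset.

Lemma tval_out r m (t : m.-tuple nat) : t \notin tval_ r m -> exists i, (r <= tnth t i)%N.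
Proof.
move=> nt; apply: contrapT => h; case/negP: nt.
have h' i : (tnth t i < r)%N by rewrite ltnNge; apply/negP => hi; apply: h; exists i.
apply/imfsetP; exists [tuple Ordinal (h' i) | i < m] => //.
by apply: eq_from_tnth => i; rewrite tnth_map tnth_mktuple.
Qed.

Lemma minort_null A m : cnull A -> pnull (@minort A m).
Proof.
move=> [bA cA] e e0; have [N hN] := cA e e0; exists (tval_ N m) => t /tval_out[i hi].
rewrite /minort; case: ifP => _; last by rewrite pabs0 ltW.
by apply: (@pabs_det_col _ _ i); rewrite ?(ltW e0) // => *; rewrite mxE //; exact: hN.
Qed.

Lemma fredholm_apx A r (B : 'M[Cp]_r) e m : cnull A -> (forall i j, V (B i j) <= 1) -> 0 <= e ->
  apx e A B -> V (fredholm A m - detps B m) <= e.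
Proof.
move=> cA bB e0 [h1 h2]; have bA := cA.1.
rewrite detps_minors /fredholm -mulrBr pabsM pabsX pabsN1 expr1n mul1r.
rewrite -[nasum _]/(nasum (@minort A m)).
apply: (@pabs_chain _ _ _ (\sum_(t <- tval_ r m) minort A t)).
  apply: nasum_sub => //; first exact: minort_null.
  move=> t /tval_out[i hi]; rewrite /minort; case: ifP => _; last by rewrite pabs0.
  by apply: (@pabs_det_col _ _ i) => // *; rewrite mxE //; exact: h2.
rewrite big_imfset /=; last first.
  move=> t t' _ _ /(congr1 val) /= h; apply/val_inj; exact: (inj_map (@ord_inj r) h).
rewrite big_enum /= /esum [X in _ - X]big_mkcond -sumrB; apply: pabs_sum => // t _.
have -> : incr t = sorted ltn (map_tuple (@nat_of_ord r) t) by rewrite /incr /= sorted_map.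
rewrite /minort; case: ifP => _; last by rewrite subrr pabs0.
by apply: pabs_det_close => // i j; rewrite !mxE ?tnth_map.
Qed.

Lemma fredholm_0 A : cnull A -> fredholm A 0%N = 1.
Proof.
move=> cA; apply: pabs_le0_eq => e e0; have [N hN] := cA.2 e e0.
have := @fredholm_apx A N (\matrix_(i, j) A i j) e 0%N cA; rewrite detps0; apply.
- by move=> i j; rewrite mxE; exact: cA.1.
- exact: ltW.
by split=> [i j|i j]; [rewrite mxE subrr pabs0 ltW|exact: hN].
Qed.

(** The cut r is chosen from the columns of W, then s from the first r rows of F. Both products are
    thereby approximated by products of the same two finite blocks, to which [detps_swap]
    applies. *)
Lemma fredholm_swap F W : rnull F -> cnull W -> fredholm (imxmul F W) = fredholm (imxmul W F).
Proof.
move=> rF cW; have rW := cnull_rnull cW; have bF := rF.1; have bW := cW.1.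
apply/funext => m; apply: pabs_le0_eq => e e0; have e0' := ltW e0.
have [r hr] := cW.2 e e0.
have [s hs] : exists s, forall l, (l < r)%N -> forall j, (s <= j)%N -> V (F l j) <= e.
  elim: r {hr} => [|N [M hM]]; first by exists 0%N.
  have [M' hM'] := row_cut rF e0 N; exists (maxn M M') => l.
  rewrite ltnS leq_eqVlt => /predU1P[->|hl] j; rewrite geq_max => /andP[h1 h2]; first exact: hM'.
  exact: hM.
pose X : 'M[Cp]_(r, s) := \matrix_(i, j) F i j.
pose Y : 'M[Cp]_(s, r) := \matrix_(i, j) W i j.
have bXY i j : V ((X *m Y) i j) <= 1.
  by rewrite mxE; apply: pabs_sum => // l _; rewrite !mxE; exact: pabsM_le1.
have bYX i j : V ((Y *m X) i j) <= 1.
  by rewrite mxE; apply: pabs_sum => // l _; rewrite !mxE; exact: pabsM_le1.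
apply: (@pabs_chain _ _ _ (detps (X *m Y) m)).
  apply: fredholm_apx => //; first exact: cnull_mulr.
  split=> [i j|i j hj].
    rewrite mxE; under eq_bigr do rewrite !mxE.
    by apply: mul_cut => // l hl; exact: hs.
  apply: nasum_le => //; first exact: mul_null.
  by move=> l; apply: pabsMl_le => //; exact: hr.
rewrite detps_swap pabsBC; apply: fredholm_apx => //; first exact: cnull_mull.
split=> [i j|i j hj].
  rewrite mxE; under eq_bigr do rewrite !mxE.
  by apply: mul_cut => // l hl; exact: hr.
rewrite -(subrK (\sum_(l < r) W i l * F l j) (imxmul W F i j)); apply: pabsD_le.
  by apply: mul_cut => // l hl; exact: hr.
by apply: pabs_sum => // l _; apply: pabsMl_le => //; exact: hs.
Qed.

Lemma fredholm_scale A (c : Cp) m : cnull A -> V c <= 1 ->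
  fredholm (fun i j => c * A i j) m = c ^+ m * fredholm A m.
Proof.
move=> cA hc; rewrite /fredholm mulrCA; congr (_ * _).
rewrite -nasumZ; last exact: minort_null.
apply: eq_nasum => t; case: ifP => _; last by rewrite mulr0.
rewrite -detZ; congr (\det _); by apply/matrixP => i j; rewrite !mxE.
Qed.

Section Chains.
Variables (n q : nat) (q1 : (1 < q)%N).
Local Notation pt := 'rV[Cp]_n.

Fixpoint chain (G : pt -> imx Cp) d x : imx Cp :=
  if d is d'.+1 then imxmul (G x) (chain G d' (frb q x)) else @imx1 _ _ Cp.

Definition tors (x : pt) := exists2 d, (0 < d)%N & tor q d x.

Lemma tors_frb (e : nat) (x : pt) : tors x -> tors (frb e x).
Proof. by move=> [d d0 hx]; exists d => //; exact: frb_tor. Qed.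

Lemma chain_rnull G d x : (forall x, tors x -> rnull (G x)) -> tors x -> rnull (chain G d x).
Proof.
move=> h; elim: d x => [|d IH] x hx /=; first exact: imx1_rnull.
by apply: rnull_mul; [exact: h|apply: IH; exact: tors_frb].
Qed.

Lemma chain_cnull G d x : (forall x, tors x -> cnull (G x)) -> tors x -> (0 < d)%N -> cnull (chain G d x).
Proof.
move=> h hx; case: d => // d _ /=; apply: cnull_mull; first exact: h.
by apply: chain_rnull; [move=> y hy; apply: cnull_rnull; exact: h|exact: tors_frb].
Qed.

(** With A = F Y and B(x) = Y(x) F(x^q), the product of A along the orbit is a cyclic rearrangement
    of that of B. It closes up because x^(q^d) = x, and [fredholm_swap] moves the remaining
    factor. *)
Lemma chain_swap (F Y A B : pt -> imx Cp) d (x : pt) :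
  (forall x, tors x -> rnull (F x)) -> (forall x, tors x -> cnull (Y x)) ->
  (forall x, tors x -> A x = imxmul (F x) (Y x)) ->
  (forall x, tors x -> B x = imxmul (Y x) (F (frb q x))) ->
  (0 < d)%N -> tor q d x -> fredholm (chain A d x) = fredholm (chain B d x).
Proof.
move=> rF cY hA hB d0 hx.
have rY y : tors y -> rnull (Y y) by move/cY/cnull_rnull.
have rA y : tors y -> rnull (A y).
  by move=> hy; rewrite hA //; apply: rnull_mul; [exact: rF|exact: rY].
have rB y : tors y -> rnull (B y).
  by move=> hy; rewrite hB //; apply: rnull_mul; [exact: rY|apply: rF; exact: tors_frb].
have key (e : nat) y : tors y -> imxmul (F y) (chain B e y) = imxmul (chain A e y) (F (frb (q ^ e) y)).
  elim: e y => [|e IH] y hy /=; first by rewrite mulx1 mul1x expn0 frb1.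
  have hy' := tors_frb q hy.
  have cA := chain_rnull e rA hy'; have cB := chain_rnull e rB hy'.
  have rFq : rnull (F (frb (q ^ e.+1) y)) by apply: rF; exact: tors_frb.
  rewrite -mulxA //; [|exact: rA|by case: rFq].
  rewrite expnS -frbM -IH // hA // hB //.
  rewrite -[in RHS]mulxA; [|exact: rF|exact: rY|].
    rewrite -[in LHS]mulxA; [|exact: rY|exact: rF|by case: cB].
    by [].
  by apply: bnd_mul; [exact: rF|case: cB].
case: d d0 hx => // d d0 hx.
have tx : tors x by exists d.+1.
have tx' := tors_frb q tx.
have cA := chain_rnull d rA tx'; have cB := chain_rnull d rB tx'.
pose W := imxmul (Y x) (chain A d (frb q x)).
have -> : chain A d.+1 x = imxmul (F x) W.
  by rewrite /= hA // /W mulxA //; [exact: rF|exact: rY|case: cA].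
rewrite fredholm_swap; [|exact: rF|by apply: cnull_mull => //; exact: cY].
congr fredholm; rewrite /W /= -mulxA //; [|exact: rY|by case: (rF x tx)].
have e : F x = F (frb (q ^ d) (frb q x)) by rewrite frbM -expnS (tor_frb q1 d0 hx).
rewrite {1}e -key // hB // mulxA //; [exact: rY|exact: rF|by case: cB].
Qed.

(** One factor at least is needed, since the columns of the infinite identity matrix do not become
    small. *)
Lemma chain_apx e r (G : pt -> imx Cp) (Z : pt -> 'M[Cp]_r) d x : 0 <= e ->
  (forall x, tors x -> rnull (G x)) -> (forall x, tors x -> forall i j, V (Z x i j) <= 1) ->
  (forall x, tors x -> apx e (G x) (Z x)) -> tors x ->
  apx e (chain G d.+1 x) (pmx q Z d.+1 x) /\ forall i j, V (pmx q Z d.+1 x i j) <= 1.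
Proof.
move=> e0 rG bZ h; elim: d x => [|d IH] x hx.
  by rewrite /= mulx1 mulmx1; split; [exact: h|exact: bZ].
have hx' := tors_frb q hx; have [h1 h2] := IH _ hx'.
rewrite -[chain G d.+2 x]/(imxmul (G x) (chain G d.+1 (frb q x))) -[pmx q Z d.+2 x]/(Z x *m pmx q Z d.+1 (frb q x)).
split; last by move=> i j; rewrite mxE; apply: pabs_sum => // l _; apply: pabsM_le1; [exact: bZ|exact: h2].
apply: apx_mul => //; [exact: rG|by case: (chain_rnull d.+1 rG hx')|exact: h].
Qed.

Lemma chain_scale (G : pt -> imx Cp) (c : pt -> Cp) d x : (forall x, tors x -> rnull (G x)) ->
  (forall x, tors x -> V (c x) <= 1) -> tors x ->
  chain (fun x i j => c x * G x i j) d x = fun i j => (\prod_(j < d) c (frb (q ^ j) x)) * chain G d x i j.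
Proof.
move=> rG hc; elim: d x => [|d IH] x hx /=.
  by apply/funext => i; apply/funext => j; rewrite big_ord0 mul1r.
have hx' := tors_frb q hx; rewrite IH //; apply/funext => i; apply/funext => j.
rewrite big_ord_recl expn0 frb1 /imxmul.
have -> : \prod_(i0 < d) c (frb (q ^ lift ord0 i0) x) = \prod_(i0 < d) c (frb (q ^ i0) (frb q x)).
  by apply: eq_bigr => l _; rewrite frbM -expnS.
set P := \prod_(i0 < d) _; rewrite -nasumZ; last first.
  by apply: mul_null; [exact: rG|case: (chain_rnull d rG hx')].
by apply: eq_nasum => l; rewrite mulrACA.
Qed.

End Chains.
End InfiniteMatrices.

(** * Local fields *)

Section LocalFields.
Variables (RR : realType) (p q : nat) (Cp : padicField RR p).
Local Notation V := (@pabs _ _ Cp).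

Definition pclosed (P : set Cp) := forall u l, (forall m : nat, P (u m)) -> pcvg u l -> P l.

Definition span (F : set Cp) d (w : 'I_d -> Cp) : set Cp :=
  [set x | exists2 c : 'I_d -> Cp, (forall i, F (c i)) & x = \sum_(i < d) c i * w i].

Lemma inv_small e : (0 : RR) < e -> exists N, forall m, (N <= m)%N -> m.+1%:R^-1 <= e.
Proof.
move=> e0; exists (Num.truncn e^-1) => m hm.
have e1 : e^-1 < m.+1%:R.
  by apply: lt_le_trans (truncnS_gt _) _; rewrite ler_nat ltnS.
by rewrite -[leRHS]invrK lef_pV2 ?posrE ?invr_gt0 // ltW.
Qed.

Section ClosedSpan.
Variable F : set Cp.
Hypotheses (FK : subfield F) (Fcl : pclosed F).

Let F1 : F 1. Proof. by case: FK. Qed.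
Let FB x y : F x -> F y -> F (x - y). Proof. by case: FK => _ h _; exact: h. Qed.
Let FM x y : F x -> F y -> F (x * y). Proof. by case: FK => _ _ h hx hy; case: (h _ _ hx hy). Qed.
Let FV x : F x -> F x^-1. Proof. by case: FK => _ _ h hx; case: (h _ _ hx hx). Qed.
Let F0 : F 0. Proof. by rewrite -(subrr 1); exact: FB. Qed.

(* If w_d is not in the closed span of the others, its distance to that span bounds
   the last coefficient, so the coefficients of a Cauchy sequence are Cauchy. *)
Lemma span_closed d (w : 'I_d -> Cp) : pclosed (span F w).
Proof.
elim: d w => [|d IH] w u l hu hl.
  exists (fun i => 0) => [[]//|]; rewrite big_ord0.
  apply: pcvg_uniq hl _ => e e0; exists 0%N => m _.
  by have [c _ ->] := hu m; rewrite big_ord0 subrr pabs0 ltW.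
pose w' (i : 'I_d) := w (widen_ord (leqnSn d) i); pose z := w ord_max.
have dec x : span F w x -> exists c, F c /\ span F w' (x - c * z).
  move=> [c hc ->]; exists (c ord_max); split=> //.
  exists (fun i => c (widen_ord (leqnSn d) i)) => // ; by rewrite big_ord_recr /= addrK.
have inc x c : F c -> span F w' x -> span F w (x + c * z).
  move=> hc [b hb ->]; exists (fun i => if unlift ord_max i is Some j then b j else c).
    by move=> i; case: unliftP.
  rewrite big_ord_recr /= unlift_none; congr (_ + _); apply: eq_bigr => i _.
  have -> : widen_ord (leqnSn d) i = lift ord_max i.
    by apply/val_inj; rewrite /= /bump leqNgt ltn_ord.
  rewrite liftK; congr (_ * w _); by apply/val_inj; rewrite /= /bump leqNgt ltn_ord.
have spB x y : span F w' x -> span F w' y -> span F w' (x - y).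
  move=> [b hb ->] [c hc ->]; exists (fun i => b i - c i) => [i|]; first exact: FB.
  by rewrite -sumrB; apply: eq_bigr => i _; rewrite mulrBl.
have spZ c x : F c -> span F w' x -> span F w' (c * x).
  move=> hc [b hb ->]; exists (fun i => c * b i) => [i|]; first exact: FM.
  by rewrite big_distrr /=; apply: eq_bigr => i _; rewrite mulrA.
have [c hc] := choice (fun m => dec _ (hu m)).
have sp0 : span F w' 0.
  by exists (fun=> 0) => //; rewrite big1 // => i _; rewrite mul0r.
have [zin|zout] := pselect (span F w' z).
  have hu' m : span F w' (u m).
    have [h1 h2] := hc m; have -> : u m = (u m - c m * z) - (0 - c m * z) by ring.
    by apply: (spB) => //; apply: (spB) => //; exact: spZ.
  rewrite -[l]addr0 -(mul0r z); apply: inc => //; exact: IH hu' hl.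
have [de de0 hde] : exists2 de : RR, 0 < de & forall x, span F w' x -> de <= V (z - x).
  apply: contrapT => hn; apply: zout.
  have hx m : exists x, span F w' x /\ V (z - x) < m.+1%:R^-1.
    apply: contrapT => h; apply: hn; exists m.+1%:R^-1; first by rewrite invr_gt0.
    move=> x hx; rewrite leNgt; apply/negP => h2; apply: h; by exists x.
  have [x hx'] := choice hx; apply: (IH w' x) => [m|e e0]; first by case: (hx' m).
  have [N hN] := inv_small e0; exists N => m hm; rewrite pabsBC.
  by apply: ltW; apply: lt_le_trans (hN m hm); case: (hx' m).
have lowc b x : F b -> span F w' x -> V b * de <= V (x + b * z).
  move=> hb hx; have [->|b0] := eqVneq b 0; first by rewrite pabs0 mul0r pabs_ge0.
  have -> : x + b * z = b * (z - (- b^-1) * x).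
    by rewrite mulrBr addrC !mulNr mulrN opprK mulVKf.
  rewrite pabsM ler_wpM2l ?pabs_ge0 //; apply: hde; apply: spZ => //.
  by rewrite -[- _]add0r; apply: FB => //; exact: FV.
have cauc e : 0 < e -> exists N, forall i j, (N <= i)%N -> (N <= j)%N -> V (c i - c j) <= e.
  move=> e0; have [N hN] := hl _ (mulr_gt0 e0 de0); exists N => i j hi hj.
  have [h1 h2] := hc i; have [h3 h4] := hc j.
  rewrite -(ler_pM2r de0); have := lowc _ _ (FB h1 h3) (spB _ _ h2 h4).
  move/le_trans; apply.
  have -> : u i - c i * z - (u j - c j * z) + (c i - c j) * z = (u i - l) - (u j - l) by ring.
  by apply: pabsB_le; exact: hN.
have [b hb] := pcauchy_lim cauc.
have Fb : F b by apply: Fcl hb => m; case: (hc m).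
rewrite -(subrK (b * z) l); apply: inc => //.
apply: (IH w' (fun m => u m - c m * z)) => [m|e e0]; first by case: (hc m).
have V0 : 0 < Num.max (V z) 1 by rewrite lt_max ltr01 orbT.
have [N1 hN1] := hl e e0; have [N2 hN2] := hb _ (divr_gt0 e0 V0).
exists (maxn N1 N2) => m; rewrite geq_max => /andP[m1 m2].
have -> : u m - c m * z - (l - b * z) = (u m - l) - (c m - b) * z by ring.
apply: pabsB_le; first exact: hN1.
rewrite pabsM; apply: le_trans (ler_pM (pabs_ge0 _) (pabs_ge0 _) (hN2 m m2) (_ : V z <= Num.max (V z) 1)) _.
  by rewrite le_max lexx.
by rewrite divfK // gt_eqF.
Qed.
End ClosedSpan.

Definition quots : set Cp := [set x | exists a b : int, b != 0 /\ x = a%:~R / b%:~R].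

Hypothesis pp : prime p.

Lemma intr_neq0 (b : int) : b != 0 -> b%:~R != 0 :> Cp.
Proof.
case: b => m hm; last by rewrite NegzE mulrNz oppr_eq0; exact: natr_neq0.
by case: m hm => // m _; exact: natr_neq0.
Qed.

Lemma ratr_quots (r : rat) : quots (ratr r).
Proof. by exists (numq r), (denq r); split=> //; exact: denq_neq0. Qed.

Lemma quots_ratr x : quots x -> exists r : rat, x = ratr r.
Proof.
move=> [a [b [b0 ->]]]; exists (a%:~R / b%:~R); rewrite /ratr.
set r : rat := _ / _; have e : numq r * b = a * denq r.
  have d0 : (denq r)%:~R != 0 :> rat by rewrite intr_eq0 denq_neq0.
  have b0' : b%:~R != 0 :> rat by rewrite intr_eq0.
  apply: (intr_inj (R := rat)); rewrite !rmorphM /=.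
  apply: (mulIf (invr_neq0 b0')); rewrite mulfK // mulrAC -/r.
  by apply: (mulIf (invr_neq0 d0)); rewrite mulfK // divq_num_den.
have db : (denq r)%:~R != 0 :> Cp by apply: intr_neq0; exact: denq_neq0.
have bb := intr_neq0 b0.
apply: (mulIf bb); rewrite divfK // mulrAC; apply: (mulIf db); rewrite divfK //.
by rewrite -!rmorphM e.
Qed.

Lemma quots_sub : subfield quots.
Proof.
split.
- by exists 1, 1; split=> //; rewrite divr1.
- move=> x y [a [b [b0 ->]]] [c [d [d0 ->]]]; exists (a * d - c * b), (b * d).
  split; first by rewrite mulf_neq0.
  rewrite !rmorphB !rmorphM /=; field; by rewrite !intr_neq0.
- move=> x y [a [b [b0 ->]]] [c [d [d0 ->]]]; split.
    by exists (a * c), (b * d); rewrite mulf_neq0 // !rmorphM /= mulf_div.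
  have [->|a0] := eqVneq a 0; first by exists 0, 1; rewrite mul0r invr0 mul0r.
  by exists b, a; rewrite invf_div.
Qed.

Lemma QpP x : @Qp _ _ Cp x <-> exists2 s, (forall m : nat, quots (s m)) & pcvg s x.
Proof.
split=> [[s /pcvgP hs]|[s hs hx]].
  by exists (fun m => ratr (s m)) => // m; exact: ratr_quots.
have [r hr] := choice (fun m => quots_ratr (hs m)); exists r; apply/pcvgP.
by move=> e e0; have [N hN] := hx e e0; exists N => m hm; rewrite -hr; exact: hN.
Qed.

Lemma Qp_closed : pclosed (@Qp _ _ Cp).
Proof.
move=> u l hu hl.
have h m : exists s, quots s /\ V (s - u m) <= m.+1%:R^-1.
  have [s hs hx] := (QpP _).1 (hu m).
  have [N hN] := hx m.+1%:R^-1 (ltac:(by rewrite invr_gt0)).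
  by exists (s N); split=> //; exact: hN.
have [s hs] := choice h; apply/QpP; exists s => [m|e e0]; first by case: (hs m).
have [N1 hN1] := hl e e0; have [N2 hN2] := inv_small e0.
exists (maxn N1 N2) => m; rewrite geq_max => /andP[m1 m2].
apply: (@pabs_chain _ _ _ (u m)); last exact: hN1.
by apply: le_trans (hN2 m m2); case: (hs m).
Qed.

Lemma pcvgM (u u' : nat -> Cp) (l l' : Cp) : pcvg u l -> pcvg u' l' -> pcvg (fun m => u m * u' m) (l * l').
Proof.
move=> hu hu' e e0.
have b0 : 0 < Num.max (Num.max (V l) (V l')) 1 by rewrite lt_max ltr01 orbT.
set b := Num.max _ _ in b0 *.
have [N1 hN1] := hu _ (divr_gt0 e0 b0); have [N2 hN2] := hu' _ (divr_gt0 e0 b0).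
have [N3 hN3] := hu b b0.
exists (maxn N1 (maxn N2 N3)) => m; rewrite !geq_max => /and3P[m1 m2 m3].
have eb : e = e / b * b by rewrite divfK // gt_eqF.
have -> : u m * u' m - l * l' = u m * (u' m - l') + (u m - l) * l' by ring.
apply: pabsD_le; rewrite eb; last first.
  by apply: pabsM_le; [exact: hN1|rewrite /b !le_max lexx orbT].
rewrite [u m * _]mulrC; apply: pabsM_le; first exact: hN2.
by rewrite -(subrK l (u m)); apply: pabsD_le; [exact: hN3|rewrite /b !le_max lexx].
Qed.

Lemma pcvgV (u : nat -> Cp) (l : Cp) : l != 0 -> pcvg u l -> pcvg (fun m => (u m)^-1) l^-1.
Proof.
move=> l0 hu e e0; have v0 : 0 < V l by rewrite pabs_gt0.
have [N1 hN1] := hu (V l / 2) (ltac:(by rewrite divr_gt0)).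
have [N2 hN2] := hu (e * V l ^+ 2) (ltac:(by rewrite mulr_gt0 // exprn_gt0)).
exists (maxn N1 N2) => m; rewrite geq_max => /andP[m1 m2].
have e1 : V (u m) = V l.
  rewrite -(subrK l (u m)) addrC pabs_dominant //; apply: le_lt_trans (hN1 m m1) _.
  by rewrite ltr_pdivrMr // ltr_pMr // ltr1n.
have u0 : u m != 0 by rewrite -(pabs_gt0 (u m)) e1.
have -> : (u m)^-1 - l^-1 = (l - u m) / (u m * l) by field; rewrite l0 u0.
rewrite pabsM pabsV pabsM e1 pabsBC ler_pdivrMr ?mulr_gt0 // -expr2; exact: hN2.
Qed.

Lemma Qp_sub : subfield (@Qp _ _ Cp).
Proof.
have [q1 q2 q3] := quots_sub; split.
- by apply/QpP; exists (fun=> 1) => // e e0; exists 0%N => m _; rewrite subrr pabs0 ltW.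
- move=> x y /QpP[s hs hx] /QpP[t ht hy]; apply/QpP; exists (fun m => s m - t m) => [m|e e0]; first exact: q2.
  have [N1 hN1] := hx e e0; have [N2 hN2] := hy e e0.
  exists (maxn N1 N2) => m; rewrite geq_max => /andP[m1 m2].
  have -> : s m - t m - (x - y) = (s m - x) - (t m - y) by ring.
  by apply: pabsB_le; [exact: hN1|exact: hN2].
move=> x y /QpP[s hs hx] /QpP[t ht hy]; split.
  apply/QpP; exists (fun m => s m * t m); last exact: pcvgM.
  by move=> m; case: (q3 _ _ (hs m) (ht m)).
have [->|x0] := eqVneq x 0.
  apply/QpP; exists (fun=> 0) => [m|e e0]; last by exists 0%N => m _; rewrite invr0 subrr pabs0 ltW.
  by rewrite -(subrr 1); exact: q2.
apply/QpP; exists (fun m => (s m)^-1); last exact: pcvgV.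
by move=> m; case: (q3 _ _ (hs m) (hs m)).
Qed.

Variable K : localField Cp q.
Local Notation kR := (lfR K).

Lemma lfR_sub : subring kR.
Proof.
have [k1 k2 k3] := lfK_subfield K; split.
- by split=> //; rewrite pabs1.
- by move=> x y [hx ax] [hy ay]; split; [exact: k2|exact: pabsB_le].
- by move=> x y [hx ax] [hy ay]; split; [case: (k3 _ _ hx hy)|exact: pabsM_le1].
Qed.

Lemma lfR_le1 x : kR x -> V x <= 1.
Proof. by case. Qed.

(** K is spanned by finitely many elements over the closed subfield Q_p, and is therefore closed by
    [span_closed]. *)
Lemma lfR_closed : pclosed kR.
Proof.
have [d [w e]] := lfK_finite K.
move=> u l hu hl; split.
  have := @span_closed _ Qp_sub Qp_closed d w u l; rewrite /span -e; apply=> //.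
  by move=> m; case: (hu m).
by apply: pcvg_le hl _; exists 0%N => m _; case: (hu m).
Qed.

Lemma lfR_lt1 x : kR x -> V x < 1 -> V x <= p%:R^-1.
Proof.
move=> [hx _] h; have [y [_ hy] ->] := lfpi_gen hx h.
by rewrite pabsM lfpi_abs ler_piMr // invr_ge0.
Qed.

Lemma lfR_V x : kR x -> V x = 1 -> kR x^-1.
Proof.
move=> [hx _] h; have [_ _ k3] := lfK_subfield K.
by split; [case: (k3 _ _ hx hx)|rewrite pabsV h invr1].
Qed.

Lemma p1 : (p%:R^-1 : RR) < 1.
Proof. by rewrite invf_lt1 ?ltr1n ?ltr0n ?prime_gt1 ?prime_gt0. Qed.

(** Fermat's theorem in the residue field: multiplication by the residue of x permutes the q - 1
    nonzero residues, and their product is cancelled. *)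
Lemma residue_pow x : kR x -> V x = 1 -> V (x ^+ q.-1 - 1) <= p%:R^-1.
Proof.
move=> hx vx; apply: lfR_lt1; have [r1 r2 r3] := lfR_sub.
  apply: r2 => //; elim: q.-1 => [|m IH]; first by rewrite expr0.
  by rewrite exprS; exact: r3.
have X1 m : V (x ^+ m) <= 1 by apply: pabsX_le1; rewrite vx.
apply/red_eq0; first by apply: pabsB_le; rewrite ?pabs1.
pose S := (@red _ _ Cp) @` [set x | lfK K x /\ V x <= 1].
have fS : finite_set S by exists q; exact: lf_res.
have cS : #|` fset_set S| = q by apply: card_fset_set; exact: lf_res.
have red0 : @red _ _ Cp 0 = 0 by apply/red_eq0; rewrite pabs0.
have redN y : V y <= 1 -> @red _ _ Cp (- y) = - red y.
  by move=> hy; apply/eqP; rewrite -addr_eq0 -redD ?pabsN // addNr red0.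
have redX m : red (x ^+ m) = red x ^+ m.
  by elim: m => [|m IH]; [rewrite !expr0 red1|rewrite !exprS redM ?IH ?vx].
have S0 : (0 : kap Cp) \in fset_set S.
  rewrite in_fset_set // inE; exists 0; last exact: red0.
  split; last by rewrite pabs0.
  by have [_ k2 _] := lfK_subfield K; rewrite -(subrr x); apply: k2; case: hx.
pose T := (fset_set S `\ (0 : kap Cp))%fset.
have cT : #|` T| = q.-1 by have := cardfsD1 0 (fset_set S); rewrite S0 cS /T add1n => ->.
have rx0 : red x != 0.
  by apply/eqP => /(red_eq0 (lfR_le1 hx)); rewrite vx ltxx.
have mT : [fset red x * s | s in T]%fset = T.
  have inj := mulfI rx0; apply/eqP; rewrite eqEfcard (card_imfset _ _ inj) /= cardfE -cardfE.
  rewrite leqnn andbT; apply/fsubsetP => y /imfsetP[s /=].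
  move=> /fsetD1P[s0]; rewrite in_fset_set // => /set_mem[z [kz hz] ez] ->.
  apply/fsetD1P; split; first by rewrite mulf_neq0.
  rewrite in_fset_set //; apply/mem_set; exists (x * z); last by rewrite redM ?ez // lfR_le1.
  by have := r3 _ _ hx (conj kz hz).
have P0 : \prod_(s <- T) s != 0.
  rewrite prodf_seq_neq0; apply/allP => s; rewrite /T !inE => /andP[] //.
have : \prod_(s <- T) s = red x ^+ q.-1 * \prod_(s <- T) s.
  rewrite -{1}mT big_imfset /=; last by move=> ? ? _ _; exact: mulfI.
  by rewrite big_split /= big_const_seq count_predT -cT iter_mulr_1 cardfE.
move/(congr1 (fun z => z / \prod_(s <- T) s)); rewrite mulfK // divff // => e.
rewrite redD // ?pabsN ?pabs1 // redN ?pabs1 // red1 redX -e subrr //.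
Qed.
End LocalFields.

(** * Evaluation of sigma-modules at torsion points *)

Section SumReindex.
Variables (RR : realType) (p : nat) (Cp : padicField RR p).
Local Notation V := (@pabs _ _ Cp).

Lemma pnull_inj (T T' : choiceType) (h : T' -> T) (f : T -> Cp) : injective h -> pnull f -> pnull (f \o h).
Proof.
move=> hi hf e e0; have [F hF] := hf e e0.
pose g t := xget None [set s : option T' | omap h s = Some t].
have hg s : g (h s) = Some s.
  rewrite /g; case: xgetP => [[s'|] _ /=|/(_ (Some s)) /(_ erefl)] //.
  by move=> [/hi ->].
exists [fset s in pmap g F]%fset => s; rewrite inE /= => hs; apply: hF; apply: contra hs => hs.
by rewrite mem_pmap; apply/mapP; exists (h s).
Qed.

Lemma nasum_inj (T T' : choiceType) (h : T' -> T) (f : T -> Cp) : injective h -> pnull f ->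
  (forall t, (forall s, h s != t) -> f t = 0) -> nasum f = nasum (f \o h).
Proof.
move=> hi hf f0; apply: pabs_le0_eq => e e0; have e0' := ltW e0.
have [F hF] := hf e e0; have hfh := pnull_inj hi hf; have [F' hF'] := hfh e e0.
pose H := (F' `|` [fset s in pmap (fun t => xget None [set s : option T' | omap h s = Some t]) F])%fset.
pose G := [fset h s | s in H]%fset.
have tail s : s \notin H -> V (f (h s)) <= e.
  by rewrite inE negb_or => /andP[/hF'].
apply: (@pabs_chain _ _ _ (\sum_(t <- G) f t)); last first.
  by rewrite big_imfset /=; [rewrite pabsBC; apply: nasum_sub|move=> ? ? _ _; exact: hi].
apply: nasum_sub => // t nt.
have [[s hs]|ns] := pselect (exists s, h s = t); last first.
  by rewrite f0 ?pabs0 // => s; apply/eqP => hs; apply: ns; exists s.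
rewrite -hs; apply: tail; apply: contra nt => hs'; rewrite -hs; exact: in_imfset.
Qed.

Lemma pnull_bound (T : choiceType) (f : T -> Cp) : pnull f -> exists2 b, 1 <= b & forall t, V (f t) <= b.
Proof.
move=> hf; have [F hF] := hf 1 ltr01.
exists (\big[Num.max/1]_(t <- F) V (f t)) => [|t].
  exact: bigmax_ge_id.
have [tF|/hF h] := boolP (t \in F); first exact: (@Order.TotalTheory.le_bigmax_seq _ _ _ (enum_fset F) 1 t xpredT (fun t => V (f t)) tF isT).
by apply: le_trans h _; exact: bigmax_ge_id.
Qed.

Lemma pnull_approx (T : choiceType) (f : T -> Cp) :
  (forall e, 0 < e -> exists2 g, pnull g & forall t, V (f t - g t) <= e) -> pnull f.
Proof.
move=> h e e0; have [g hg hfg] := h e e0; have [F hF] := hg e e0; exists F => t /hF ht.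
by rewrite -(subrK (g t) (f t)); apply: pabsD_le.
Qed.

Lemma nasum_in (T : choiceType) (P : set Cp) (f : T -> Cp) :
  P 0 -> (forall x y, P x -> P y -> P (x + y)) -> pclosed P -> (forall t, P (f t)) -> pnull f -> P (nasum f).
Proof.
move=> P0 PD Pc hP hf.
have [F hF] := choice (fun m => hf m.+1%:R^-1 (ltac:(by rewrite invr_gt0))).
apply: (Pc (fun m => \sum_(t <- F m) f t)) => [m|e e0].
  by elim/big_ind: _.
have [N hN] := inv_small e0; exists N => m hm; rewrite pabsBC.
by apply: le_trans (hN m hm); apply: nasum_sub => //; exact: hF.
Qed.
End SumReindex.

Section Evaluation.
Variables (RR : realType) (p : nat) (Cp : padicField RR p) (n q : nat).
Local Notation V := (@pabs _ _ Cp).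
Local Notation laurent := (laurent Cp n).
Local Notation expo := (expo n).
Hypotheses (q1 : (1 < q)%N) (hVq : V q%:R < 1).
Implicit Types (a b : laurent) (u v w : expo) (x : 'rV[Cp]_n).

Definition nul a := pnull a.

Lemma usize_small N : exists F : {fset expo}, forall u, (usize u < N)%N -> u \in F.
Proof.
exists [fset u in [seq bx c | c : boxT n N]]%fset => u hu; rewrite inE /=.
have hb : inbox N u.
  apply/forallP => i; rewrite -abszE lez_nat; apply: leq_trans (ltnW hu).
  by rewrite /usize (bigD1 i) //= leq_addr.
by have [c ->] := bx_surj hb; apply/mapP; exists c; rewrite ?mem_enum.
Qed.

Lemma usize_fset (F : {fset expo}) : exists N, forall u, u \in F -> (usize u < N)%N.
Proof.
exists (\max_(u <- F) usize u).+1 => u hu; rewrite ltnS.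
exact: (@leq_bigmax_seq _ (enum_fset F) xpredT (@usize n) u hu isT).
Qed.

Lemma nul_usize a : nul a <->
  forall e, 0 < e -> exists N, forall u, (N <= usize u)%N -> V (a u) <= e.
Proof.
split=> h e e0; have [F hF] := h e e0.
  have [N hN] := usize_fset F; exists N => u hu; apply: hF; apply/negP => /hN.
  by rewrite ltnNge hu.
have [G hG] := usize_small F; exists G => u hu; apply: hF; rewrite leqNgt.
by apply: contra hu; exact: hG.
Qed.

Lemma usize_ooP (f : expo -> RR) : (forall u, 0 <= f u) ->
  f u @[u --> @usize_oo n] --> (0 : RR) <->
  forall e, 0 < e -> exists N, forall u, (N <= usize u)%N -> f u <= e.
Proof.
move=> f0; have FF : Filter (@usize_oo n).
  apply: filter_from_filter; first by exists 0%N.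
  move=> i j _ _; exists (maxn i j) => // u /=; rewrite geq_max => /andP[h1 h2]; by split.
split=> [/cvgrPdist_le h e e0|h].
  have [N _ hN] := h e e0; exists N => u hu; have := hN u hu.
  by rewrite /= sub0r normrN ger0_norm.
apply/cvgrPdist_le => e e0; have [N hN] := h e e0; exists N => // u hu.
by rewrite /= sub0r normrN ger0_norm // hN.
Qed.

Lemma monom_tors x u : tors q x -> V (monom x u) = 1.
Proof. by move=> [d d0 hx]; exact: (monom_abs q1 u d0 hx). Qed.

Lemma tors_torus x : tors q x -> torus x.
Proof. by move=> [d d0 hx]; exact: (tor_torus q1 d0 hx). Qed.

Lemma nul_mon a x : nul a -> tors q x -> pnull (fun u => a u * monom x u).
Proof.
move=> ha hx; have -> : (fun u => a u * monom x u) = (fun u => monom x u * a u).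
  by apply/funext => u; rewrite mulrC.
by apply: (pnullZ (b := 1)) => // u; rewrite monom_tors.
Qed.

Lemma leval_le a x e : 0 <= e -> nul a -> tors q x -> (forall u, V (a u) <= e) -> V (leval a x) <= e.
Proof.
move=> e0 ha hx h; apply: nasum_le => //; first exact: nul_mon.
by move=> u; rewrite pabsM monom_tors // mulr1.
Qed.

Lemma levalB a b x : nul a -> nul b -> tors q x -> leval (fun u => a u - b u) x = leval a x - leval b x.
Proof.
move=> ha hb hx; rewrite /leval -nasumB; try exact: nul_mon.
by apply: eq_nasum => u; rewrite mulrBl.
Qed.

Lemma leval_sum (I : Type) (r : seq I) (P : pred I) (F : I -> laurent) x :
  (forall i, P i -> nul (F i)) -> tors q x ->
  nul (fun u => \sum_(i <- r | P i) F i u) /\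
  leval (fun u => \sum_(i <- r | P i) F i u) x = \sum_(i <- r | P i) leval (F i) x.
Proof.
move=> hF hx; split; first by have [] := nasum_bigr r hF.
have h i : P i -> pnull (fun u => F i u * monom x u) by move=> /hF hi; exact: nul_mon.
have [_ <-] := nasum_bigr r h; apply: eq_nasum => u; by rewrite big_distrl.
Qed.

Lemma leval0 x : leval (fun=> 0) x = 0.
Proof. by rewrite /leval (nasum_fin (F := fset0)) ?big_seq_fset0 // => u _; rewrite mul0r. Qed.

Lemma nul0 : nul (fun=> 0).
Proof. by move=> e e0; exists fset0 => u _; rewrite pabs0 ltW. Qed.

Definition lmon c v : laurent := fun u => if u == v then c else 0.

Lemma nul_lmon c v : nul (lmon c v).
Proof. by apply: (pnull_fin (F := [fset v]%fset)) => u; rewrite inE /lmon => /negbTE ->. Qed.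

Lemma leval_lmon c v x : leval (lmon c v) x = c * monom x v.
Proof.
rewrite /leval (nasum_fin (F := [fset v]%fset)) => [|u].
  by rewrite big_seq_fset1 /lmon eqxx.
by rewrite inE /lmon => /negbTE ->; rewrite mul0r.
Qed.

Lemma shift_inj (u : expo) : injective (fun w => w - u).
Proof. exact: addIr. Qed.

Lemma subr_inj w : injective (fun u : expo => w - u).
Proof. by move=> u v /addrI/oppr_inj. Qed.

Lemma lmul_null a b w : nul a -> nul b -> pnull (fun u => a u * b (w - u)).
Proof.
move=> ha hb; have [B _ hB] := pnull_bound ha; apply: (pnullZ (b := B)) => //.
exact: (pnull_inj (@subr_inj w) hb).
Qed.

Lemma lmul_cut a b (F : {fset expo}) e B : 0 <= e -> nul a -> nul b -> (forall u, V (b u) <= B) ->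
  (forall u, u \notin F -> V (a u) <= e) ->
  forall w, V (lmul a b w - \sum_(u <- F) a u * b (w - u)) <= e * B.
Proof.
move=> e0 ha hb hB hF w; apply: nasum_sub; first exact: lmul_null.
  by rewrite mulr_ge0 // (le_trans (pabs_ge0 _) (hB 0)).
by move=> u /hF h; apply: pabsM_le.
Qed.

Lemma nul_shift b u : nul b -> nul (fun w => b (w - u)).
Proof. exact: (pnull_inj (@shift_inj u)). Qed.

Lemma nul_cutsum a b (F : {fset expo}) : nul b -> nul (fun w => \sum_(u <- F) a u * b (w - u)).
Proof.
move=> hb; have h u : true -> pnull (fun w => a u * b (w - u)).
  by move=> _; apply: (pnullZ (b := V (a u))) => //; exact: nul_shift.
by have [] := nasum_bigr (enum_fset F) h.
Qed.

Lemma nul_lmul a b : nul a -> nul b -> nul (lmul a b).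
Proof.
move=> ha hb; apply: pnull_approx => e e0; have [B B1 hB] := pnull_bound hb.
have B0 : 0 < B by exact: lt_le_trans B1.
have [F hF] := ha _ (divr_gt0 e0 B0).
exists (fun w => \sum_(u <- F) a u * b (w - u)); first exact: nul_cutsum.
have -> : e = e / B * B by rewrite divfK // gt_eqF.
by apply: lmul_cut => //; rewrite divr_ge0 // ltW.
Qed.

(** Cutting a to finitely many terms turns the product into a finite sum of shifts of b, whose
    evaluation is a change of summation index. *)
Lemma leval_lmul a b x : nul a -> nul b -> tors q x -> leval (lmul a b) x = leval a x * leval b x.
Proof.
move=> ha hb hx; apply: pabs_le0_eq => e e0; have [B B1 hB] := pnull_bound hb.
have B0 : 0 < B by exact: lt_le_trans B1.
have [F hF] := ha _ (divr_gt0 e0 B0).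
have e0' : 0 <= e / B by rewrite divr_ge0 // ltW.
have eB : e = e / B * B by rewrite divfK // gt_eqF.
have h u : true -> nul (fun w => a u * b (w - u)).
  by move=> _; apply: (pnullZ (b := V (a u))) => //; exact: nul_shift.
apply: (@pabs_chain _ _ _ (leval (fun w => \sum_(u <- F) a u * b (w - u)) x)).
  rewrite -levalB //; [|exact: nul_lmul|exact: nul_cutsum].
  apply: leval_le => //; first exact: ltW.
    move=> d d0; have [G hG] := nul_lmul ha hb d0; have [G' hG'] := nul_cutsum a F hb d0.
    exists (G `|` G')%fset => u; rewrite inE negb_or => /andP[h1 h2].
    by apply: pabsB_le; [exact: hG|exact: hG'].
  by rewrite eB; exact: lmul_cut.
have [_ ->] := leval_sum (enum_fset F) h hx.
have -> : \sum_(i <- F) leval (fun u => a i * b (u - i)) x = (\sum_(u <- F) a u * monom x u) * leval b x.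
  rewrite big_distrl /=; apply: eq_bigr => u _; rewrite /leval -[RHS]nasumZ; last exact: nul_mon.
  have hu := nul_mon (h u isT) hx.
  rewrite (nasum_inj (h := fun w => w + u)) //; first last.
    by move=> t /(_ (t - u)); rewrite subrK eqxx.
  - exact: addIr.
  apply: eq_nasum => w /=; rewrite addrK monomD; first by ring.
  exact: tors_torus.
rewrite -mulrBl eB mulrC; rewrite [e / B * B]mulrC; apply: pabsM_le.
  by apply: leval_le => //; exact: ltW.
rewrite pabsBC; apply: nasum_sub => //; first exact: nul_mon.
by move=> u /hF hu; rewrite pabsM monom_tors // mulr1.
Qed.

Definition qmul u : expo := u *+ q.

Lemma qmulE u i : qmul u ord0 i = u ord0 i * q%:Z.
Proof. by rewrite /qmul mulmxnE -mulr_natr natz. Qed.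

Lemma q_neq0 : q%:Z != 0.
Proof. by case: q q1. Qed.

Lemma qmul_inj : injective qmul.
Proof.
move=> u v h; apply/rowP => i; have := congr1 (fun m : expo => m ord0 i) h.
by rewrite !qmulE => /(mulIf q_neq0).
Qed.

Lemma lsigma_qmul a u : lsigma q a (qmul u) = a u.
Proof.
rewrite /lsigma; have -> : [forall i, (q%:Z %| qmul u ord0 i)%Z].
  by apply/forallP => i; rewrite qmulE dvdz_mull.
congr a; apply/rowP => i; by rewrite mxE [X in (X %/ _)%Z]qmulE mulzK // q_neq0.
Qed.

Lemma lsigma_out a w : (forall u, qmul u != w) -> lsigma q a w = 0.
Proof.
move=> h; rewrite /lsigma; case: forallP => // hd; exfalso.
have := h (map_mx (fun z : int => (z %/ q%:Z)%Z) w); apply/negP; rewrite negbK; apply/eqP.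
by apply/rowP => i; rewrite qmulE mxE divzK.
Qed.

Lemma nul_lsigma a : nul a -> nul (lsigma q a).
Proof.
move=> ha e e0; have [F hF] := ha e e0; exists [fset qmul u | u in F]%fset => w hw.
have [[u hu]|nu] := pselect (exists u, qmul u = w).
  rewrite -hu lsigma_qmul; apply: hF; apply: contra hw => hu'; rewrite -hu; exact: in_imfset.
rewrite lsigma_out ?pabs0 ?ltW // => u; by apply/eqP => hu; apply: nu; exists u.
Qed.

Lemma leval_lsigma a x : nul a -> tors q x -> leval (lsigma q a) x = leval a (frb q x).
Proof.
move=> ha hx; rewrite /leval (nasum_inj qmul_inj).
- by apply: eq_nasum => u /=; rewrite lsigma_qmul monom_frb.
- by apply: nul_mon => //; exact: nul_lsigma.
by move=> t h; rewrite lsigma_out // mul0r.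
Qed.

(* Fourier inversion on the (q^d - 1)-torsion points, for d so large that the finitely
   many relevant exponents are distinct modulo q^d - 1. *)
Lemma A0_le_pt a e : 0 <= e -> nul a -> (forall x, tors q x -> V (leval a x) <= e) ->
  forall u, V (a u) <= e.
Proof.
move=> e0 ha h u; apply/ler_addgt0Pr => d d0.
have [F hF] := ha d d0; pose G := (u |` F)%fset.
have [N hN] := usize_fset G.
(* With this D the number q^D - 1 exceeds every entry of w - u for w in G, so that divisibility by
   it forces w = u. *)
pose D := (usize u + N).+1.
have D0 : (0 < D)%N by [].
have tor_w w : w \in G -> [forall i, ((q ^ D).-1%:Z %| (w - u) ord0 i)%Z] -> w = u.
  move=> wG /forallP hd; apply/eqP; rewrite -subr_eq0; apply/eqP/rowP => i; rewrite [RHS]mxE.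
  apply/eqP; rewrite -absz_eq0; apply: contraT; rewrite -lt0n => hp.
  have := dvdn_leq hp (hd i); rewrite leqNgt => /negP[].
  have h1 : (`|(w - u : expo)%R ord0 i| <= usize w + usize u)%N.
    apply: leq_trans (_ : `|w ord0 i| + `|u ord0 i| <= _)%N.
      have -> : (w - u : expo)%R ord0 i = w ord0 i - u ord0 i by rewrite !mxE.
      by lia.
    apply: leq_add; by rewrite /usize (bigD1 i) //= leq_addr.
  have := hN w wG; have q2 : (D.+1 <= q ^ D)%N by exact: ltn_expl.
  move=> hw; rewrite absz_nat; apply: leq_ltn_trans h1 _; rewrite /D in q2 *; lia.
have key : V (tsum q D (fun x => leval a x * monom x (- u)) - (q ^ D).-1%:R ^+ n * a u) <= d.
  have -> : (q ^ D).-1%:R ^+ n * a u = tsum q D (fun x => (\sum_(w <- G) a w * monom x w) * monom x (- u)).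
    rewrite /tsum; under [in RHS]eq_bigr => c _ do rewrite big_distrl /=.
    rewrite exchange_big /= (bigD1_seq u) ?fset_uniq ?fset1U1 //= [X in _ + X]big1_seq.
      rewrite addr0 -[LHS]mulr1; under eq_bigr => c _.
        rewrite -mulrA -monomD; last by apply: (tor_torus q1 D0); exact: tpt_tor.
        rewrite subrr monom0 mulr1; over.
      rewrite sumr_const cardT -cardE card_ffun !card_ord mulr1 mulrC -[a u *+ _]mulr_natr natrX //.
    move=> w /andP[wu wG]; have := @tsum_monom _ _ Cp n q q1 D (w - u) D0.
    case: ifP => [/(tor_w _ wG) e1|_]; first by rewrite e1 eqxx in wu.
    rewrite /tsum => e1; rewrite -[RHS](mulr0 (a w)) -[X in _ = _ * X]e1 big_distrr /=.
    apply: eq_bigr => c _; rewrite -mulrA monomD //.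
    by apply: (tor_torus q1 D0); exact: tpt_tor.
  rewrite /tsum -sumrB; apply: pabs_sum => [|c _]; first exact: ltW.
  have hx : tors q (tpt Cp c) by exists D => //; exact: tpt_tor.
  rewrite -mulrBl; apply: pabsMr_le; last by rewrite monom_tors.
  apply: nasum_sub; [exact: nul_mon|exact: ltW|].
  move=> w; rewrite inE negb_or => /andP[_ /hF hw].
  by rewrite pabsM monom_tors // mulr1.
have -> : V (a u) = V ((q ^ D).-1%:R ^+ n * a u).
  by rewrite pabsM pabsX (pabs_qd q1 hVq D0) expr1n mul1r.
rewrite -[_ * a u](subKr (tsum q D (fun x => leval a x * monom x (- u)))).
apply: pabsB_le; last by apply: le_trans key _; rewrite lerDr.
apply: le_trans (_ : e <= _); last by rewrite lerDl ltW.
apply: pabs_sum => // c _; have hx : tors q (tpt Cp c) by exists D => //; exact: tpt_tor.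
by apply: pabsMr_le; [exact: h|rewrite monom_tors].
Qed.

End Evaluation.

(** * Bases and matrices of sigma-modules *)

Section SigmaModuleBases.
Variables (RR : realType) (p q a n : nat) (Cp : padicField RR p) (K : localField Cp q).
Local Notation V := (@pabs _ _ Cp).
Local Notation laurent := (laurent Cp n).
Local Notation expo := (expo n).
Local Notation vec := (vec Cp n).
Local Notation pt := 'rV[Cp]_n.
Hypotheses (pp : prime p) (a0 : (0 < a)%N) (hq : q = (p ^ a)%N).
Let q1 : (1 < q)%N := q_gt1 pp a0 hq.
Let hVq : V q%:R < 1 := pabs_q_lt1 Cp a0 hq.
Local Notation A0 := (@A0 _ _ _ _ K n).
Local Notation kR := (lfR K).
Local Notation tors := (tors q).

Lemma kR0 : kR 0.
Proof. by have [h1 h2 _] := lfR_sub K; rewrite -(subrr 1); exact: h2. Qed.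

Lemma kRD x y : kR x -> kR y -> kR (x + y).
Proof.
have [h1 h2 _] := lfR_sub K => hx hy; rewrite -[y]opprK; apply: (h2) => //.
by rewrite -[- y]add0r; apply: (h2) => //; exact: kR0.
Qed.

Lemma A0P f : A0 f <-> (forall u, kR (f u)) /\ nul f.
Proof.
split=> [[h1 h2]|[h1 h2]]; split=> //.
  by apply/nul_usize; apply: (usize_ooP (fun u => pabs_ge0 (f u))).1 h2.
by apply: (usize_ooP (fun u => pabs_ge0 (f u))).2; exact/nul_usize.
Qed.

Lemma A0_nul f : A0 f -> nul f. Proof. by move/A0P => []. Qed.

Lemma A0_le1 f : A0 f -> forall u, V (f u) <= 1.
Proof. by move/A0P => [h _] u; case: (h u). Qed.

Lemma A0_0 : A0 (fun=> 0).
Proof. by apply/A0P; split; [move=> u; exact: kR0|exact: nul0]. Qed.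

Lemma nulB (f g : laurent) : nul f -> nul g -> nul (fun u => f u - g u).
Proof.
move=> hf hg e e0; have [F hF] := hf e e0; have [G hG] := hg e e0.
exists (F `|` G)%fset => t; rewrite inE negb_or => /andP[h1 h2].
by apply: pabsB_le; [exact: hF|exact: hG].
Qed.

Lemma A0B f g : A0 f -> A0 g -> A0 (fun u => f u - g u).
Proof.
move=> /A0P[h1 h2] /A0P[h3 h4]; apply/A0P; split; last exact: nulB.
by move=> u; have [_ h _] := lfR_sub K; exact: h.
Qed.

Lemma A0_sum (I : Type) (r : seq I) (P : pred I) (F : I -> laurent) :
  (forall i, P i -> A0 (F i)) -> A0 (fun u => \sum_(i <- r | P i) F i u).
Proof.
move=> h; apply/A0P; split=> [u|].
  elim/big_ind: _ => [|x y|i /h /A0P[] //]; [exact: kR0|exact: kRD].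
have h' i : P i -> pnull (F i) by move/h/A0_nul.
by have [] := nasum_bigr r h'.
Qed.

Lemma A0_lmul f g : A0 f -> A0 g -> A0 (lmul f g).
Proof.
move=> /A0P[h1 h2] /A0P[h3 h4]; apply/A0P; split; last exact: nul_lmul.
move=> w; apply: nasum_in; [exact: kR0|exact: kRD|exact: lfR_closed| |exact: lmul_null].
by move=> u; have [_ _ h] := lfR_sub K; exact: h.
Qed.

Lemma A0_lsigma f : A0 f -> A0 (lsigma q f).
Proof.
move=> /A0P[h1 h2]; apply/A0P; split; last exact: (nul_lsigma q1).
by move=> w; rewrite /lsigma; case: ifP => // _; exact: kR0.
Qed.

Lemma A0_lmon c v : kR c -> A0 (lmon c v).
Proof.
move=> hc; apply/A0P; split; last exact: nul_lmon.
by move=> u; rewrite /lmon; case: ifP => // _; exact: kR0.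
Qed.

(** The Gauss norm is the supremum norm over torsion points. Elements of A0 can thus be compared
    through their values, where multiplication and Frobenius become pointwise operations. *)
Lemma A0_pt_le f e : 0 <= e -> A0 f -> (forall u, V (f u) <= e) <-> (forall x, tors x -> V (leval f x) <= e).
Proof.
move=> e0 hf; split=> h; last by apply: (A0_le_pt q1 hVq) => //; exact: A0_nul.
by move=> x hx; apply: (leval_le q1) => //; exact: A0_nul.
Qed.

Lemma leval_le1 f x : A0 f -> tors x -> V (leval f x) <= 1.
Proof. by move=> hf hx; apply: (leval_le q1) => //; [exact: A0_nul|exact: A0_le1]. Qed.

Lemma sup_rangeP (T : Type) (t0 : T) (f : T -> RR) e : (forall t, f t <= 1) ->
  sup (range f) <= e <-> forall t, f t <= e.
Proof.
move=> h1; split=> [h t|h].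
  by apply: le_trans h; apply: ub_le_sup; [exists 1 => _ [s _ <-]|exists t].
by apply: ge_sup; [exists (f t0), t0|move=> _ [s _ <-]].
Qed.

Lemma gaussP f e : A0 f -> gauss f <= e <-> forall u, V (f u) <= e.
Proof. by move=> hf; apply: (sup_rangeP (0 : expo)) => u; exact: A0_le1. Qed.

Lemma gauss_ge0 f : A0 f -> 0 <= gauss f.
Proof.
by move=> hf; apply: le_trans (pabs_ge0 (f 0)) _; exact: (gaussP _ hf).1 (lexx _) 0.
Qed.

Lemma vnormP (v : vec) e : (forall i, A0 (v i)) -> vnorm v <= e <-> forall i u, V (v i u) <= e.
Proof.
move=> hv; have h i : gauss (v i) <= 1 by apply/gaussP => // u; exact: A0_le1.
rewrite /vnorm (sup_rangeP 0%N) //; split=> hh i.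
  by move=> u; move: u; apply/gaussP.
by apply/gaussP.
Qed.

Lemma vnorm_ge0 (v : vec) : (forall i, A0 (v i)) -> 0 <= vnorm v.
Proof.
move=> hv; apply: le_trans (pabs_ge0 (v 0%N 0)) _.
by move: 0%N (0 : expo); apply/vnormP.
Qed.

Lemma cvg0P (u : nat -> RR) : (forall N, 0 <= u N) -> (u N @[N --> \oo] --> (0 : RR)) <->
  forall e, 0 < e -> exists N0, forall N, (N0 <= N)%N -> u N <= e.
Proof.
move=> u0; split=> [/cvgrPdist_le h e e0|h].
  have [N _ hN] := h e e0; exists N => m hm.
  by have := hN m hm; rewrite /= sub0r normrN ger0_norm.
apply/cvgrPdist_le => e e0; have [N hN] := h e e0; exists N => // m hm.
by rewrite /= sub0r normrN ger0_norm // hN.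
Qed.

Lemma formal_A0 I (v : vec) : formal K I v -> forall i, A0 (v i).
Proof.
move=> [h1 h2] i; have [/h1//|/h2 ->] := pselect (I i); exact: A0_0.
Qed.

Lemma lsum_ev (N : nat) (f g : nat -> laurent) x : (forall j, A0 (f j)) -> (forall j, A0 (g j)) -> tors x ->
  leval (fun u => \sum_(0 <= j < N) lmul (f j) (g j) u) x = \sum_(j < N) leval (f j) x * leval (g j) x.
Proof.
move=> hf hg hx; have h j : true -> nul (lmul (f j) (g j)).
  by move=> _; apply: nul_lmul; exact: A0_nul.
have [_ ->] := leval_sum q1 (index_iota 0 N) h hx.
by rewrite big_mkord; apply: eq_bigr => j _; rewrite (leval_lmul q1) //; exact: A0_nul.
Qed.

Lemma A0_lsum (N : nat) (f g : nat -> laurent) : (forall j, A0 (f j)) -> (forall j, A0 (g j)) ->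
  A0 (fun u => \sum_(0 <= j < N) lmul (f j) (g j) u).
Proof. by move=> hf hg; apply: A0_sum => j _; exact: A0_lmul. Qed.

Variable M : sigmaModule K n.
Local Notation frm := (formal K (smI M)).

Section Basis.
Variables (J : set nat) (f : nat -> vec).
Hypothesis hB : is_basis M J f.

Definition bas (j : nat) : vec := if j \in J then f j else fun _ _ => 0.

Lemma bas_A0 j i : A0 (bas j i).
Proof.
rewrite /bas; case: ifP => [/set_mem hj|_]; last exact: A0_0.
by have [h _ _ _] := hB; have [_ h2] := h j hj; exact: formal_A0 h2 i.
Qed.

Definition bmat (x : pt) : imx Cp := fun i j => leval (bas j i) x.

(** Convergence in the Gauss norm becomes convergence at torsion points, uniform in the point. *)
Lemma formal_sumP (c v : vec) : formal K J c -> (forall i, A0 (v i)) -> formal_sum f c v <->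
  forall i e, 0 < e -> exists N0, forall N, (N0 <= N)%N -> forall x, tors x ->
    V (\sum_(j < N) leval (c j) x * bmat x i j - leval (v i) x) <= e.
Proof.
move=> hc hv; have cA := formal_A0 hc.
have e1 i N u : \sum_(0 <= j < N) lmul (c j) (f j i) u = \sum_(0 <= j < N) lmul (c j) (bas j i) u.
  apply: eq_bigr => j _; rewrite /bas; case: ifP => // hj.
  have -> : c j = fun=> 0 by case: hc => _; apply => /mem_set; rewrite hj.
  by rewrite /lmul; apply: eq_nasum => w; rewrite !mul0r.
pose g i N : laurent := fun u => \sum_(0 <= j < N) lmul (c j) (bas j i) u - v i u.
have gA i N : A0 (g i N) by apply: A0B => //; apply: A0_lsum => // j; exact: bas_A0.
have eN i : (fun N => gauss (fun u => \sum_(0 <= j < N) lmul (c j) (f j i) u - v i u)) = (fun N => gauss (g i N)).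
  by apply/funext => N; congr gauss; apply/funext => u; rewrite e1.
have -> : formal_sum f c v <-> forall i, (fun N => gauss (g i N)) @ \oo --> (0 : RR).
  by split=> h i; [rewrite -eN|rewrite eN]; exact: h.
have ev i N x : tors x -> leval (g i N) x = \sum_(j < N) leval (c j) x * bmat x i j - leval (v i) x.
  move=> hx; rewrite (levalB q1) //; [|by apply: A0_nul; apply: A0_lsum => // j; exact: bas_A0|exact: A0_nul].
  by rewrite lsum_ev // => j; exact: bas_A0.
split=> h i.
  move=> e e0; have /(cvg0P (fun N => gauss_ge0 (gA i N))) h' := h i.
  have [N0 hN] := h' e e0; exists N0 => N hNN x hx; rewrite -ev //.
  by move: x hx; apply/(A0_pt_le (ltW e0) (gA i N))/gaussP => //; exact: hN.
apply/(cvg0P (fun N => gauss_ge0 (gA i N))) => e e0; have [N0 hN] := h i e e0.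
exists N0 => N hNN; apply/gaussP => //; apply/(A0_pt_le (ltW e0) (gA i N)) => x hx.
by rewrite ev //; exact: hN.
Qed.

(* The formal sum of all basis vectors exists, so that they tend to 0 in each coordinate. *)
Lemma bmat_null i e : 0 < e -> exists N, forall j, (N <= j)%N -> forall x, tors x -> V (bmat x i j) <= e.
Proof.
move=> e0; pose c : vec := fun j => if j \in J then lmon 1 0 else fun=> 0.
have hc : formal K J c.
  split=> j hj; rewrite /c; first by rewrite mem_set //; apply: A0_lmon; case: (lfR_sub K).
  by rewrite memNset.
have [_ h2 _ _] := hB; have [v hv hs] := h2 c hc.
have /(formal_sumP hc (formal_A0 hv))/(_ i e e0)[N0 hN] := hs.
exists N0 => j hj x hx; rewrite /bmat.
have [jJ|jJ] := boolP (j \in J); last by rewrite /bas (negbTE jJ) leval0 pabs0 ltW.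
have := hN j hj x hx; have := hN j.+1 (leqW hj) x hx; rewrite big_ord_recr /=.
rewrite /c jJ leval_lmon mul1r monom0 mul1r -/(bmat x i j).
set S := \sum_(_ < _) _; set w := leval (v i) x => h3 h4.
have -> : bmat x i j = (S + bmat x i j - w) - (S - w) by ring.
exact: pabsB_le.
Qed.

Lemma bmat_rnull x : tors x -> rnull (bmat x).
Proof.
move=> hx; split=> [i j|i]; first by apply: leval_le1 => //; exact: bas_A0.
by apply: pnull_nat => e e0; have [N hN] := bmat_null i e0; exists N => m hm; exact: hN.
Qed.

(** The pointwise relation v(x) = F(x) c(x). By [coordP] it is equivalent to the formal sum, because
    the entries in each row of F tend to 0 uniformly in x. *)
Definition coord (c v : vec) := forall i x, tors x ->
  leval (v i) x = nasum (fun j => bmat x i j * leval (c j) x).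

Lemma coordP (c v : vec) : formal K J c -> (forall i, A0 (v i)) -> formal_sum f c v <-> coord c v.
Proof.
move=> hc hv; have cA := formal_A0 hc; rewrite formal_sumP //.
have eqs N i x : \sum_(j < N) leval (c j) x * bmat x i j = \sum_(j < N) bmat x i j * leval (c j) x.
  by apply: eq_bigr => j _; rewrite mulrC.
have pn i x : tors x -> pnull (fun j => bmat x i j * leval (c j) x).
  move=> hx; have -> : (fun j => bmat x i j * leval (c j) x) = (fun j => leval (c j) x * bmat x i j).
    by apply/funext => j; rewrite mulrC.
  apply: (pnullZ (b := 1)) => [j|]; first exact: leval_le1.
  by case: (bmat_rnull hx).
split=> h i.
  move=> x hx; apply: (@pcvg_uniq _ _ _ (fun N => \sum_(j < N) bmat x i j * leval (c j) x)); last first.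
    by apply: pnull_cvg; exact: pn.
  by move=> e e0; have [N0 hN] := h i e e0; exists N0 => N hNN; rewrite -eqs; exact: hN.
move=> e e0; have [N0 hN] := bmat_null i e0; exists N0 => N hNN x hx.
rewrite h // eqs pabsBC; apply: nasum_nat_sub; [exact: ltW|exact: pn|].
move=> j hj; apply: pabsMr_le; last exact: leval_le1.
by apply: hN => //; exact: leq_trans hj.
Qed.

Lemma coord_iso c v e : 0 <= e -> formal K J c -> frm v -> coord c v ->
  (forall i u, V (v i u) <= e) -> forall j u, V (c j u) <= e.
Proof.
move=> e0 hc hv h hle; have [_ _ _ iso] := hB.
have hs : formal_sum f c v by apply/coordP => //; exact: formal_A0 hv.
apply/vnormP; first exact: formal_A0 hc.
by rewrite -(iso c v hc hv hs); apply/vnormP => //; exact: formal_A0 hv.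
Qed.

Lemma coord_exists v : frm v -> exists c, formal K J c /\ coord c v.
Proof.
move=> hv; have [_ _ h _] := hB; have [c [[hc hs] _]] := h v hv.
by exists c; split=> //; apply/coordP => //; exact: formal_A0 hv.
Qed.

Lemma formalB I (v w : vec) : formal K I v -> formal K I w -> formal K I (fun i u => v i u - w i u).
Proof.
move=> [h1 h2] [h3 h4]; split=> i hi; first by apply: A0B; [exact: h1|exact: h3].
by rewrite h2 // h4 // subrr.
Qed.

Lemma formal_lcomb I (r : seq nat) (v : nat -> vec) (g : nat -> laurent) : (forall m, formal K I (v m)) ->
  (forall m, A0 (g m)) -> formal K I (fun i u => \sum_(m <- r) lmul (v m i) (g m) u).
Proof.
move=> hv hg; split=> i hi.
  by apply: A0_sum => m _; apply: A0_lmul => //; exact: formal_A0 (hv m) i.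
apply/funext => u; rewrite big1 // => m _; have [_ h] := hv m; rewrite h //.
by rewrite /lmul (nasum_fin (F := fset0)) ?big_seq_fset0 // => w _; rewrite mul0r.
Qed.

Lemma lcomb_ev (r : seq nat) (v : nat -> laurent) (g : nat -> laurent) x : (forall m, A0 (v m)) ->
  (forall m, A0 (g m)) -> tors x ->
  leval (fun u => \sum_(m <- r) lmul (v m) (g m) u) x = \sum_(m <- r) leval (v m) x * leval (g m) x.
Proof.
move=> hv hg hx; have h m : true -> nul (lmul (v m) (g m)).
  by move=> _; apply: nul_lmul; exact: A0_nul.
have [_ ->] := leval_sum q1 r h hx.
by apply: eq_bigr => m _; rewrite (leval_lmul q1) //; exact: A0_nul.
Qed.

Lemma coord_pnull c x i : formal K J c -> tors x -> pnull (fun j => bmat x i j * leval (c j) x).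
Proof.
move=> /formal_A0 cA hx.
have -> : (fun j => bmat x i j * leval (c j) x) = (fun j => leval (c j) x * bmat x i j).
  by apply/funext => j; rewrite mulrC.
apply: (pnullZ (b := 1)) => [j|]; first exact: leval_le1.
by case: (bmat_rnull hx).
Qed.

Lemma coordB c c' v v' : formal K J c -> formal K J c' -> frm v -> frm v' -> coord c v -> coord c' v' ->
  coord (fun i u => c i u - c' i u) (fun i u => v i u - v' i u).
Proof.
move=> hc hc' hv hv' h h' i x hx.
rewrite (levalB q1) //; [|exact/A0_nul/(formal_A0 hv)|exact/A0_nul/(formal_A0 hv')].
rewrite h // h' // -nasumB; [|exact: coord_pnull|exact: coord_pnull].
apply: eq_nasum => j; rewrite (levalB q1) ?mulrBr //; [exact/A0_nul/(formal_A0 hc)|exact/A0_nul/(formal_A0 hc')].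
Qed.

Lemma coord_lcomb (r : seq nat) (c v : nat -> vec) (g : nat -> laurent) :
  (forall m, formal K J (c m)) -> (forall m, frm (v m)) -> (forall m, A0 (g m)) ->
  (forall m, coord (c m) (v m)) ->
  coord (fun i u => \sum_(m <- r) lmul (c m i) (g m) u) (fun i u => \sum_(m <- r) lmul (v m i) (g m) u).
Proof.
move=> hc hv hg h i x hx; rewrite lcomb_ev // => [|m]; last exact: formal_A0 (hv m) i.
have hn m : true -> pnull (fun j => leval (g m) x * (bmat x i j * leval (c m j) x)).
  by move=> _; apply: (pnullZ (b := 1)) => [j|]; [exact: leval_le1|exact: coord_pnull].
have [_ e] := nasum_bigr r hn.
transitivity (\sum_(m <- r) nasum (fun j => leval (g m) x * (bmat x i j * leval (c m j) x))).
  by apply: eq_bigr => m _; rewrite nasumZ; [rewrite h // mulrC|exact: coord_pnull].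
rewrite -e; apply: eq_nasum => j; rewrite lcomb_ev // => [|m]; last exact: formal_A0 (hc m) j.
by rewrite big_distrr /=; apply: eq_bigr => m _; ring.
Qed.
End Basis.

Local Notation std := (std_matrix M).

Lemma evec_formal j : smI M j -> frm (@evec _ _ Cp n j).
Proof.
move=> hj; split=> i hi; rewrite /evec.
  have [_|_] := eqVneq i j; last exact: A0_0.
  rewrite -[X in A0 X]/(lmon 1 0); apply: A0_lmon; by case: (lfR_sub K).
by apply/funext => u; case: eqP => // e; move: hi; rewrite e.
Qed.

Lemma phi_evec j : smI M j -> frm (smphi M (@evec _ _ Cp n j)).
Proof. by move=> hj; apply: smphi_M; exact: evec_formal. Qed.

Lemma std_formal j : frm (fun i => std i j).
Proof.
split=> i hi; rewrite /std_matrix; last by case: ifP => // /set_mem hj; case: (phi_evec hj) => _; apply.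
by case: ifP => [/set_mem hj|_]; [apply: formal_A0; exact: phi_evec|exact: A0_0].
Qed.

Lemma std_A0 i j : A0 (std i j). Proof. exact: (formal_A0 (std_formal j)). Qed.

Lemma std_null e : 0 < e -> exists N, forall j, (N <= j)%N -> forall i u, V (std i j u) <= e.
Proof.
move=> e0; have [N hN] := @smphi_nuclear _ _ _ _ _ _ M e e0; exists N => j hj.
have [jI|jI] := boolP (j \in smI M); last first.
  by move=> i u; rewrite /std_matrix (negbTE jI) pabs0 ltW.
have jI' := set_mem jI; have := ltW (hN j jI' hj).
move/(vnormP _ (formal_A0 (phi_evec jI'))) => h i u.
by rewrite /std_matrix jI.
Qed.

Lemma std_cnull x : tors x -> cnull (mat_at std x).
Proof.
move=> hx; split=> [i j|e e0]; first by apply: leval_le1 => //; exact: std_A0.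
have [N hN] := std_null e0; exists N => i j hj.
by apply: (leval_le q1) => //; [exact: ltW|exact/A0_nul/std_A0|exact: hN].
Qed.

Lemma phi_eval v i x : frm v -> tors x ->
  leval (smphi M v i) x = nasum (fun j => mat_at std x i j * leval (v j) (frb q x)).
Proof.
move=> hv hx; have vA := formal_A0 hv; have sA := formal_A0 (smphi_M hv).
have hx' : tors (frb q x) by exact: tors_frb.
have pn : pnull (fun j => mat_at std x i j * leval (v j) (frb q x)).
  by apply: (@mul_null _ _ _ (mat_at std x) (fun j _ => leval (v j) (frb q x)) i 0%N);
    [exact/cnull_rnull/std_cnull|move=> ? ?; exact: leval_le1].
pose g N : vec := fun i u => \sum_(0 <= j < N) lmul (lsigma q (v j)) (std i j) u - smphi M v i u.
have gA N k : A0 (g N k).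
  by apply: A0B => //; apply: A0_lsum => j; [exact: A0_lsigma|exact: std_A0].
have h : (fun N => vnorm (g N)) @ \oo --> (0 : RR).
  have -> : (fun N => vnorm (g N)) = (fun N => vnorm (fun i u =>
       \sum_(0 <= j < N | j \in smI M)
          lmul (lsigma q (v j)) (smphi M (evec Cp j) i) u - smphi M v i u)).
    apply/funext => N; congr vnorm; apply/funext => k; apply/funext => u.
    rewrite /g [in RHS]big_mkcond; congr (_ - _).
    apply: eq_bigr => j _; rewrite /std_matrix; case: ifP => // _.
    rewrite /lmul (nasum_fin (F := fset0)) ?big_seq_fset0 // => w _; by rewrite mulr0.
  exact: smphi_semilinear.
have {}h := (cvg0P (fun N => vnorm_ge0 (gA N))).1 h.
apply: (@pcvg_uniq _ _ _ (fun N => \sum_(j < N) mat_at std x i j * leval (v j) (frb q x))); last exact: pnull_cvg.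
move=> e e0; have [N0 hN] := h e e0; exists N0 => N hNN.
have hle : forall u, V (g N i u) <= e by move=> u; have := (vnormP e (gA N)).1 (hN N hNN); exact.
have := (A0_pt_le (ltW e0) (gA N i)).1 hle x hx.
rewrite (levalB q1) //; [|by apply: A0_nul; apply: A0_lsum => j; [exact: A0_lsigma|exact: std_A0]|exact: A0_nul].
rewrite lsum_ev // => [|j|j]; [|exact: A0_lsigma|exact: std_A0].
by under eq_bigr => j _ do rewrite mulrC (leval_lsigma q1 (A0_nul (vA j)) hx).
Qed.

Section Matrix.
Variables (J : set nat) (f : nat -> vec) (b : bmatrix Cp n).
Hypotheses (hB : is_basis M J f) (hb : is_matrix M J f b).
Local Notation F := (bmat J f).

Lemma bmat_formal j : formal K J (fun i => b i j).
Proof.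
have [h1 h2] := hb; have [hj|hj] := pselect (J j); first by have [] := h1 j hj.
by split=> i hi; rewrite h2 //; exact: A0_0.
Qed.

Lemma b_A0 i j : A0 (b i j). Proof. exact: (formal_A0 (bmat_formal j)). Qed.

Lemma f_formal j : J j -> frm (f j).
Proof. by move=> hj; have [h _ _ _] := hB; case: (h j hj). Qed.

Lemma basE j : J j -> bas J f j = f j.
Proof. by move=> hj; rewrite /bas mem_set. Qed.

Lemma bas0 j : ~ J j -> bas J f j = fun _ _ => 0.
Proof. by move=> hj; rewrite /bas memNset. Qed.

Lemma bas_formal j : frm (bas J f j).
Proof.
have [hj|hj] := pselect (J j); first by rewrite basE //; exact: f_formal.
by rewrite bas0 //; split=> // i _; exact: A0_0.
Qed.

Lemma b_coord j : J j -> coord J f (fun i => b i j) (smphi M (f j)).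
Proof.
move=> hj; have [h1 _] := hb; have [h2 h3] := h1 j hj.
apply/(coordP hB) => //; exact: formal_A0 (smphi_M (f_formal hj)).
Qed.

Lemma coords_exist : exists Y : bmatrix Cp n,
  (forall m, formal K J (fun i => Y i m)) /\ forall m, coord J f (fun i => Y i m) (fun i => std i m).
Proof.
have h m : exists c : vec, formal K J c /\ coord J f c (fun i => std i m).
  exact: (coord_exists hB (std_formal m)).
have [Y hY] := choice h; exists (fun i m => Y m i); by split=> m; case: (hY m).
Qed.

(** The columns of Y are the coordinates of phi(e_m) in the basis f, whence std = F Y. Moreover
    phi(f_l) is the sum over m of sigma(f_lm) phi(e_m); finite parts of this sum have coordinates
    given by Y, and the isometry of the basis controls the rest, whence b = Y F(x^q). This avoids
    inverting F. *)
Lemma b_factor : exists Y : pt -> imx Cp,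
  [/\ forall x, tors x -> cnull (Y x),
      forall x, tors x -> mat_at std x = imxmul (F x) (Y x)
    & forall x, tors x -> mat_at b x = imxmul (Y x) (F (frb q x))].
Proof.
have [Y [fY cY]] := coords_exist.
have YA i m : A0 (Y i m) by exact: (formal_A0 (fY m)).
have Yn e : 0 < e -> exists N, forall m, (N <= m)%N -> forall i u, V (Y i m u) <= e.
  move=> e0; have [N hN] := std_null e0; exists N => m hm.
  exact: (coord_iso hB (ltW e0) (fY m) (std_formal m) (cY m) (hN m hm)).
have Yc x : tors x -> cnull (mat_at Y x).
  move=> hx; split=> [i j|e e0]; first exact: leval_le1.
  have [N hN] := Yn e e0; exists N => i j hj.
  by apply: (leval_le q1) => //; [exact: ltW|exact: A0_nul|exact: hN].
exists (mat_at Y); split=> // x hx.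
  by apply/funext => i; apply/funext => m; exact: cY.
apply/funext => i; apply/funext => l; have hx' : tors (frb q x) by exact: tors_frb.
have [hl|hl] := pselect (J l); last first.
  have [_ h2] := hb; rewrite /mat_at h2 // leval0 /imxmul (nasum_fin (F := fset0)) ?big_seq_fset0 //.
  by move=> m _; rewrite /bmat bas0 // leval0 mulr0.
pose g m := lsigma q (f l m).
have fA := formal_A0 (f_formal hl).
have gA m : A0 (g m) by exact: A0_lsigma.
pose c N : vec := fun i u => \sum_(m <- index_iota 0 N) lmul (Y i m) (g m) u.
pose v N : vec := fun i u => \sum_(m <- index_iota 0 N) lmul (std i m) (g m) u.
have cf N : formal K J (c N) by exact: (formal_lcomb _ (v := fun m i => Y i m)).
have vf N : frm (v N) by apply: (formal_lcomb _ (v := fun m i => std i m)) => // m; exact: std_formal.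
have cv N : coord J f (c N) (v N).
  by apply: (coord_lcomb hB _ (c := fun m i => Y i m) (v := fun m i => std i m)) => // m; exact: std_formal.
have pf := smphi_M (f_formal hl); have pA := formal_A0 pf.
apply: pabs_le0_eq => e e0; have e0' := ltW e0.
have [N1 hN1] := std_null e0; have [N2 hN2] := Yn e e0; pose N := maxn N1 N2.
have gE y m : tors y -> leval (g m) y = F (frb q y) m l.
  by move=> hy; rewrite (leval_lsigma q1) //; [rewrite /bmat basE|exact/A0_nul].
have close k u : V (smphi M (f l) k u - v N k u) <= e.
  have hA := A0B (pA k) (formal_A0 (vf N) k).
  move: u; apply/(A0_pt_le e0' hA) => y hy; have hy' : tors (frb q y) by exact: tors_frb.
  rewrite (levalB q1) //; [|exact: A0_nul|exact/A0_nul/(formal_A0 (vf N))].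
  rewrite phi_eval //; last exact: f_formal.
  rewrite lcomb_ev // => [|m]; last exact: std_A0.
  rewrite big_mkord; under eq_bigr => m _ do rewrite gE // /bmat basE //.
  apply: nasum_nat_sub => //.
    apply: (@mul_null _ _ _ (mat_at std y) (fun j _ => leval (f l j) (frb q y)) k 0%N).
      exact/cnull_rnull/std_cnull.
    by move=> ? ?; exact: leval_le1.
  move=> m hm; apply: pabsMr_le; last exact: leval_le1.
  apply: (leval_le q1) => //; first exact/A0_nul/std_A0.
  by apply: hN1; apply: leq_trans hm; rewrite leq_maxl.
have cB := coordB hB (bmat_formal l) (cf N) pf (vf N) (b_coord hl) (cv N).
have iso := coord_iso hB e0' (formalB (bmat_formal l) (cf N)) (formalB pf (vf N)) cB close.
have cA := formal_A0 (cf N) i.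
apply: (@pabs_chain _ _ _ (leval (c N i) x)).
  rewrite /mat_at -(levalB q1) //; [|exact/A0_nul/b_A0|exact: A0_nul].
  apply: (leval_le q1) => //; apply: nulB; [exact/A0_nul/b_A0|exact: A0_nul].
rewrite lcomb_ev // big_mkord pabsBC; under eq_bigr => m _ do rewrite gE //.
apply: mul_cut => //; [exact/cnull_rnull/Yc|by case: (bmat_rnull hB hx')|].
move=> m hm; apply: (leval_le q1) => //; first exact: A0_nul.
by apply: hN2; apply: leq_trans hm; rewrite leq_maxr.
Qed.

Lemma b_cnull x : tors x -> cnull (mat_at b x).
Proof.
move=> hx; have [Y [h1 _ h3]] := b_factor; rewrite h3 //; apply: cnull_mull; first exact: h1.
by apply: (bmat_rnull hB); exact: tors_frb.
Qed.

Lemma fredholm_basis d x : (0 < d)%N -> tor q d x ->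
  fredholm (chain q (mat_at std) d x) = fredholm (chain q (mat_at b) d x).
Proof.
move=> d0 hx; have [Y [h1 h2 h3]] := b_factor.
by apply: (chain_swap q1 (F := F) (Y := Y)) => // y; exact: (bmat_rnull hB).
Qed.
End Matrix.
End SigmaModuleBases.

(** * Closed points *)

Section ClosedPoints.
Variables (RR : realType) (p q a n : nat) (Cp : padicField RR p).
Local Notation V := (@pabs _ _ Cp).
Local Notation red := (@red _ _ Cp).
Local Notation pt := 'rV[Cp]_n.
Local Notation kpt := 'rV[kap Cp]_n.
Hypotheses (pp : prime p) (a0 : (0 < a)%N) (hq : q = (p ^ a)%N).
Let q1 : (1 < q)%N := q_gt1 pp a0 hq.
Let hVq : V q%:R < 1 := pabs_q_lt1 Cp a0 hq.
Local Notation tors := (@tors _ _ Cp n q).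
Local Notation frob := (@frob _ _ q Cp n).
Local Notation cp_deg := (@cp_deg _ _ Cp n).
Local Notation teich := (@teich _ _ q Cp n).
Local Notation closed_point := (@closed_point _ _ q Cp n).

Lemma red_0 : red 0 = 0.
Proof. by apply/red_eq0; rewrite pabs0. Qed.

Lemma red_N x : V x <= 1 -> red (- x) = - red x.
Proof. by move=> hx; apply/eqP; rewrite -addr_eq0 -redD ?pabsN // addNr red_0. Qed.

Lemma red_B x y : V x <= 1 -> V y <= 1 -> red (x - y) = red x - red y.
Proof. by move=> hx hy; rewrite redD ?pabsN // red_N. Qed.

Lemma red_X x m : V x <= 1 -> red (x ^+ m) = red x ^+ m.
Proof.
by move=> hx; elim: m => [|m IH]; [rewrite !expr0 red1|rewrite !exprS redM ?IH ?pabsX_le1].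
Qed.

Lemma red_sum (I : Type) (r : seq I) (P : pred I) (F : I -> Cp) : (forall i, P i -> V (F i) <= 1) ->
  red (\sum_(i <- r | P i) F i) = \sum_(i <- r | P i) red (F i).
Proof.
move=> h; elim: r => [|i r IH]; first by rewrite !big_nil red_0.
rewrite !big_cons; case: ifP => // Pi; rewrite redD ?IH //; first exact: h.
exact: pabs_sum.
Qed.

Lemma red_eq x y : V x <= 1 -> V y <= 1 -> red x = red y <-> V (x - y) < 1.
Proof.
move=> hx hy; rewrite -red_eq0; last exact: pabsB_le.
by rewrite red_B //; split=> [->|/eqP]; [rewrite subrr|rewrite subr_eq0 => /eqP].
Qed.

Lemma red_neq0 x : V x = 1 -> red x != 0.
Proof. by move=> h; have h' : V x <= 1 by [rewrite h]; apply/eqP => /(red_eq0 h'); rewrite h ltxx. Qed.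

Definition redv (x : pt) : kpt := map_mx red x.

Lemma tors_abs x i : tors x -> V (x 0 i) = 1.
Proof. by move=> [d d0 hx]; exact: (tor_abs q1 d0 hx). Qed.

Lemma redv_frb e x : tors x -> redv (frb e x) = map_mx (fun z => z ^+ e) (redv x).
Proof. by move=> hx; apply/rowP => i; rewrite !mxE red_X // tors_abs. Qed.

Lemma iter_frob j (y : kpt) : iter j frob y = map_mx (fun z => z ^+ (q ^ j)) y.
Proof.
elim: j => [|j IH]; first by apply/rowP => i; rewrite !mxE expn0 expr1.
by rewrite iterS IH; apply/rowP => i; rewrite !mxE -exprM -expnSr.
Qed.

Lemma redv_iter j x : tors x -> redv (frb (q ^ j) x) = iter j frob (redv x).
Proof. by move=> hx; rewrite redv_frb // iter_frob. Qed.

(* 1 + z + ... + z^(N-1) = 0 while N is a unit, so z is not close to 1. *)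
Lemma root1_far d (z : Cp) : (0 < d)%N -> z ^+ (q ^ d).-1 = 1 -> V (z - 1) < 1 -> z = 1.
Proof.
move=> d0 hz h; have z1 := root1_abs (qd_pred q1 d0) hz.
apply/eqP; rewrite -subr_eq0; apply: contraT => nz.
have : (z - 1) * \sum_(i < (q ^ d).-1) z ^+ i = 0 by rewrite -subrX1 hz subrr.
move/eqP; rewrite mulf_eq0 (negbTE nz) /= => /eqP s0.
have := pabs_qd q1 hVq d0.
have -> : (q ^ d).-1%:R = - \sum_(i < (q ^ d).-1) (z ^+ i - 1).
  by rewrite sumrB s0 sub0r opprK sumr_const card_ord.
move=> e; suff : V (- \sum_(i < (q ^ d).-1) (z ^+ i - 1)) < 1 by rewrite e ltxx.
rewrite pabsN; apply: le_lt_trans h; apply: pabs_sum => [|i _]; first exact: pabs_ge0.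
by rewrite -{1}(expr1n _ i); apply: pabsB_exp; rewrite ?z1 ?pabs1.
Qed.

(** The quotient of two coordinates with equal reductions is a root of unity of order dividing some
    q^d - 1 and close to 1, hence equal to 1. *)
Lemma redv_inj x x' : tors x -> tors x' -> redv x = redv x' -> x = x'.
Proof.
move=> tx tx'; case: (tx) (tx') => [d d0 hx] [d' d0' hx'] e; apply/rowP => i.
have D0 : (0 < d * d')%N by rewrite muln_gt0 d0.
have x0 : x' 0 i != 0 by exact: (tor_torus q1 d0').
have h : V (x 0 i - x' 0 i) < 1.
  by apply/red_eq; rewrite ?tors_abs //; have /rowP/(_ i) := e; rewrite !mxE.
suff : x 0 i / x' 0 i = 1 by move/divr1_eq.
apply: (root1_far D0).
  have t1 := tor_mul d' hx; have := tor_mul d hx'; rewrite mulnC => t2.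
  by rewrite exprMn exprVn t1 t2 invr1 mulr1.
by rewrite -[X in _ - X](divff x0) -mulrBl pabsM pabsV tors_abs // invr1 mulr1.
Qed.

(** In the factorisation of z^N - 1 over the N-th roots of unity some factor must have absolute
    value below 1. *)
Lemma near_root1 d (z : Cp) : (0 < d)%N -> V z = 1 -> V (z ^+ (q ^ d).-1 - 1) < 1 ->
  exists2 w, w ^+ (q ^ d).-1 = 1 & V (z - w) < 1.
Proof.
move=> d0 hz h; have pz := zetaP Cp q1 d0; set N := (q ^ d).-1 in h pz *.
have e : z ^+ N - 1 = \prod_(0 <= i < N) (z - zeta Cp q d ^+ i).
  have := congr1 (fun P : {poly Cp} => P.[z]) (factor_Xn_sub_1 pz).
  rewrite /= hornerD hornerXn hornerN hornerC => <-; rewrite horner_prod.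
  by apply: eq_bigr => i _; rewrite hornerXsubC.
apply: contrapT => hn; move: h; rewrite e pabs_prod big1_seq ?ltxx // => i _.
apply/eqP; rewrite eq_le; apply/andP; split.
  by apply: pabsB_le; rewrite ?hz // pabsX (root1_abs (qd_pred q1 d0) (prim_expr_order pz)) expr1n.
rewrite leNgt; apply/negP => hh; apply: hn; exists (zeta Cp q d ^+ i) => //.
by rewrite exprAC (prim_expr_order pz) expr1n.
Qed.

Lemma lift_point m (y : kpt) : (0 < m)%N -> (forall i, y 0 i != 0) -> iter m frob y = y ->
  exists x, tor q m x /\ redv x = y.
Proof.
move=> m0 y0 hy.
have h i : exists w, w ^+ (q ^ m).-1 = 1 /\ red w = y 0 i.
  have [z hz ez] := red_surj (y 0 i).
  have z1 : V z = 1.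
    apply/eqP; rewrite eq_le hz leNgt; apply/negP => /(red_eq0 hz) e0.
    by move: (y0 i); rewrite -ez e0 eqxx.
  have e : red (z ^+ (q ^ m).-1) = red 1.
    rewrite red1 red_X // ez; apply: (mulfI (y0 i)).
    rewrite -exprS (ltn_predK (qd_gt1 q1 m0)) mulr1.
    by have /rowP/(_ i) := hy; rewrite iter_frob mxE.
  have [|w w1 hw] := near_root1 m0 z1.
    by apply/red_eq; rewrite ?pabs1 // pabsX_le1.
  exists w; split=> //; rewrite -ez; apply/esym/red_eq => //.
  by rewrite (root1_abs (qd_pred q1 m0) w1).
have [w hw] := choice h; exists (\row_i w i); split=> [i|]; first by rewrite mxE; case: (hw i).
by apply/rowP => i; rewrite !mxE; case: (hw i).
Qed.

Definition orb (y : kpt) : set kpt := range (fun j => iter j frob y).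

Lemma orb_self y : orb y y. Proof. by exists 0%N. Qed.

Lemma iter_mod d y j : iter d frob y = y -> iter j frob y = iter (j %% d) frob y.
Proof.
move=> h; rewrite {1}(divn_eq j d) addnC iterD; congr (iter _ _ _).
by elim: (j %/ d)%N => [|l IH]; rewrite ?mul0n // mulSn iterD IH h.
Qed.

Lemma orb_eq y z m : (0 < m)%N -> iter m frob y = y -> orb y z -> orb z = orb y.
Proof.
move=> m0 hy [j _ <-]; apply/seteqP; split=> _ [i _ <-]; first by exists (i + j)%N; rewrite ?iterD.
exists (i + (m - j %% m))%N => //; rewrite iterD.
have -> : iter (m - j %% m) frob (iter j frob y) = y; last by [].
by rewrite (iter_mod j hy) -iterD subnK // ltnW // ltn_mod.
Qed.

(** The degree, defined as the number of points of the orbit, is also the period of Frobenius on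
    it. *)
Lemma cp_degP y m : (0 < m)%N -> iter m frob y = y ->
  [/\ (0 < cp_deg (orb y))%N, finite_set (orb y)
    & forall j, iter j frob y = y <-> (cp_deg (orb y) %| j)%N].
Proof.
move=> m0 hy.
have ex : exists d, (0 < d)%N && (iter d frob y == y) by exists m; rewrite m0 hy eqxx.
have [d /andP[d0 /eqP hd] dmin] := ex_minnP ex.
have min i j : (i < j)%N -> (j < d)%N -> iter i frob y <> iter j frob y.
  move=> ij jd e; have : (d <= j - i)%N.
    apply: dmin; rewrite subn_gt0 ij /=; apply/eqP.
    have e1 : y = iter (d - i) frob (iter j frob y).
      by rewrite -e -iterD subnK // ltnW // (ltn_trans ij).
    have e2 : (d - i + j = (j - i) + d)%N by lia.
    by rewrite -iterD e2 iterD hd in e1.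
  by move: ij jd; lia.
have inj : {in iota 0 d &, injective (fun j => iter j frob y)}.
  move=> i j; rewrite !mem_iota !add0n /= => hi hj e.
  by case: (ltngtP i j) => // h; [case: (min _ _ h hj e)|case: (min _ _ h hi (esym e))].
have oE : orb y = [set` [fset iter j frob y | j in iota 0 d]%fset].
  apply/seteqP; split=> [z [j _ <-]|z].
    rewrite (iter_mod j hd) /=; apply/imfsetP; exists (j %% d)%N => //=.
    by rewrite mem_iota add0n ltn_mod d0.
  by move=> /imfsetP[j _ ->]; exists j.
have cE : cp_deg (orb y) = d.
  by rewrite /Defs.cp_deg oE set_fsetK card_in_imfset //= undup_id ?iota_uniq // size_iota.
rewrite cE; split=> //; first by rewrite oE; exact: finite_fset.
move=> j; split=> [e|/dvdnP[l ->]]; last by rewrite (iter_mod _ hd) modnMl.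
rewrite /dvdn; apply: contraT; rewrite -lt0n => jm.
have := dmin (j %% d)%N; rewrite jm -(iter_mod j hd) e eqxx => /(_ isT).
by rewrite leqNgt ltn_mod d0.
Qed.

Lemma tors_iter x : tors x -> exists2 m, (0 < m)%N & iter m frob (redv x) = redv x.
Proof. by move=> hx; have [m m0 h] := hx; exists m => //; rewrite -redv_iter // (tor_frb q1 m0 h). Qed.

Lemma orb_closed x : tors x -> closed_point (orb (redv x)).
Proof.
move=> hx; exists (redv x); split=> // [i|]; first by rewrite mxE red_neq0 // tors_abs.
exact: tors_iter.
Qed.

Lemma tor_deg x j : tors x -> (0 < j)%N -> tor q j x <-> (cp_deg (orb (redv x)) %| j)%N.
Proof.
move=> hx j0; have [m m0 hm] := tors_iter hx; have [_ _ h] := cp_degP m0 hm.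
rewrite -h -redv_iter //; split=> [/(tor_frb q1 j0) -> //|e].
apply/(torP q1 _ j0); split; first exact: (tors_torus q1).
by apply: redv_inj => //; exact: tors_frb.
Qed.

Lemma closed_pointP P : closed_point P -> exists x, [/\ tors x, tor q (cp_deg P) x, P = orb (redv x) & (0 < cp_deg P)%N].
Proof.
move=> [y [y0 [m m0 hy] ->]]; have [d0 _ hd] := cp_degP m0 hy.
have [x [hx e]] := lift_point d0 y0 ((hd _).2 (dvdnn _)).
by exists x; rewrite e; split=> //; exists (cp_deg (orb y)).
Qed.

(** Any choice made by [teich] is a torsion point: its coordinates satisfy z^(q^d) = z and are
    nonzero because the reduction lies in the orbit of a torus point. *)
Lemma teichP P : closed_point P -> [/\ tors (teich P), tor q (cp_deg P) (teich P), P = orb (redv (teich P)) & (0 < cp_deg P)%N].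
Proof.
move=> hP; have [x [tx hx e d0]] := closed_pointP hP.
have ex : teichmuller q P x.
  split; first by rewrite e; exact: orb_self.
  move=> i; rewrite tors_abs //; split=> //.
  by have /rowP/(_ i) := tor_frb q1 d0 hx; rewrite mxE.
rewrite /Defs.teich; case: xgetP => [z _ [zP hz]|]; last by move/(_ x).
have [m m0 hm] := tors_iter tx.
have [j _ ej] : orb (redv x) (redv z) by rewrite -e.
have z0 i : z 0 i != 0.
  apply/eqP => h; have /rowP/(_ i) := ej; rewrite iter_frob !mxE h red_0.
  by move/eqP; apply/negP; rewrite expf_neq0 // red_neq0 // tors_abs.
have tz : tor q (cp_deg P) z.
  apply/(torP q1 _ d0); split=> //; apply/rowP => i; rewrite mxE; by case: (hz i).
split=> //; first by exists (cp_deg P).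
by rewrite {1}e; apply/esym/(orb_eq m0 hm); exists j.
Qed.

Lemma orb_frb x x' : tors x -> tors x' -> orb (redv x) (redv x') -> exists j, x' = frb (q ^ j) x.
Proof.
move=> hx hx' [j _ e]; exists j; apply: redv_inj => //; first exact: tors_frb.
by rewrite redv_iter.
Qed.

Definition torset j : {fset pt} := [fset tpt Cp c | c in {: {ffun 'I_n -> 'I_(q ^ j).-1}}]%fset.

Lemma torsetP j x : (0 < j)%N -> (x \in torset j) <-> tor q j x.
Proof.
move=> j0; split=> [/imfsetP[c _ ->]|hx]; first exact: tpt_tor.
by have [c ->] := tpt_surj q1 j0 hx; apply: in_imfset.
Qed.

Definition cpset j : {fset set kpt} := [fset orb (redv x) | x in torset j]%fset.

Lemma cpsetP j P : (0 < j)%N -> (P \in cpset j) <-> closed_point P /\ (cp_deg P %| j)%N.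
Proof.
move=> j0; split=> [/imfsetP[x /= /(torsetP _ j0) hx ->]|[hP dP]].
  have tx : tors x by exists j.
  by split; [exact: orb_closed|exact: (tor_deg tx j0).1].
have [tx hx e _] := teichP hP; rewrite e; apply: in_imfset => /=.
by apply/(torsetP _ j0)/(tor_deg tx j0); rewrite -e.
Qed.

(** Torsion points are grouped by the Frobenius orbits of their reductions; f is constant on each
    group, which has as many elements as the degree of the closed point. *)
Lemma tsum_orbits j (f : pt -> Cp) : (0 < j)%N -> (forall x, tor q j x -> f (frb q x) = f x) ->
  tsum q j f = \sum_(P <- cpset j) (cp_deg P)%:R * f (teich P).
Proof.
move=> j0 hf.
have -> : tsum q j f = \sum_(x <- torset j) f x.
  rewrite big_imfset /=; last by move=> ? ? _ _; exact: (tpt_inj q1 j0).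
  by rewrite big_enum.
have hf' i x : tor q j x -> f (frb (q ^ i) x) = f x.
  move=> hx; elim: i => [|i IH]; first by rewrite expn0 frb1.
  by rewrite expnSr -frbM hf //; exact: frb_tor.
rewrite (partition_big_imfset _ (fun x => orb (redv x))) /=.
apply: eq_big_seq => P /(cpsetP _ j0)[hP dP]; have [tt ht e d0] := teichP hP.
have htj : tor q j (teich P) by apply/(tor_deg tt j0); rewrite -e.
have [m m0 hm] := tors_iter tt; have [_ fin _] := cp_degP m0 hm; rewrite -e in fin.
pose A := [fset x in torset j | orb (redv x) == P]%fset.
have AP x : x \in A <-> tor q j x /\ P (redv x).
  rewrite !inE; split=> [/andP[/(torsetP _ j0) hx /eqP <-]|[hx Px]]; first by split=> //; exact: orb_self.
  apply/andP; split; first exact/(torsetP _ j0).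
  by rewrite [X in _ == X]e (orb_eq m0 hm) // -e.
transitivity (\sum_(x <- A) f (teich P)).
  rewrite big_fset_condE /=; apply: eq_big_seq => x /AP[hx Px].
  have tx : tors x by exists j.
  have [i ->] := orb_frb tt tx (ltac:(by rewrite -e)); exact: hf'.
suff e2 : #|` A| = cp_deg P by rewrite big_const_seq count_predT iter_addr_0 -e2 mulr_natl.
rewrite /Defs.cp_deg; have -> : fset_set P = [fset redv x | x in A]%fset.
  apply/fsetP => y; rewrite in_fset_set //; apply/idP/imfsetP => [/set_mem Py|[x /= /AP[_ Px] ->]]; last exact/mem_set.
  have [i _ ei] : orb (redv (teich P)) y by rewrite -e.
  have tf : tors (frb (q ^ i) (teich P)) by exact: tors_frb.
  exists (frb (q ^ i) (teich P)); last by rewrite redv_iter.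
  by apply/AP; split; [exact: frb_tor|rewrite redv_iter // ei].
apply/esym; rewrite card_in_imfset //= => x x' /AP[hx _] /AP[hx' _]; apply: redv_inj; by exists j.
Qed.

End ClosedPoints.

(** * Ordinary modules with unit root part of rank one *)

Section ReciprocalZeros.
Variables (RR : realType) (p : nat) (Cp : padicField RR p).
Local Notation V := (@pabs _ _ Cp).
Implicit Types (f g : ps Cp) (a : Cp).

Definition ppow a k : ps Cp := fun i => ((1 - a *: 'X) ^+ k : {poly Cp})`_i.

Lemma ppow0 a : ppow a 0 = @ps1 _ _ Cp.
Proof. by apply/funext => i; rewrite /ppow expr0 coef1. Qed.

Lemma ppowS a k : ppow a k.+1 = psmul (ppow a 1) (ppow a k).
Proof.
by apply/funext => i; rewrite [RHS](@psmul_coef _ _ _ _ _ ((1 - a *: 'X) ^+ 1) ((1 - a *: 'X) ^+ k)) // -exprD.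
Qed.

Lemma ppow_0 a k : ppow a k 0%N = 1.
Proof.
elim: k => [|k IH]; first by rewrite ppow0.
by rewrite ppowS psmul0 IH mulr1 /ppow expr1 coefB coef1 coefZ coefX mulr0 subr0.
Qed.

Lemma ppow1_mul a g m : psmul (ppow a 1) g m.+1 = g m.+1 - a * g m.
Proof.
rewrite /psmul 2!big_ord_recl /= ppow_0 mul1r subn0 big1 ?addr0 => [|i _]; last first.
  by rewrite /ppow expr1 coefB coef1 coefZ coefX mulr0 subrr mul0r.
rewrite /ppow expr1 coefB coef1 coefZ coefX /bump /= mulr1 sub0r mulNr.
by rewrite /= addn0 subn1.
Qed.

Lemma ps_cvgP f x : ps_cvg f x <-> pnull (fun m => f m * x ^+ m).
Proof.
rewrite /ps_cvg; split=> [/cvgrPdist_le h|h].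
  apply: pnull_nat => e e0; have [N _ hN] := h e e0; exists N => m hm.
  by have := hN m hm; rewrite /= sub0r normrN ger0_norm // pabs_ge0.
apply/cvgrPdist_le => e e0; have [N hN] := pnull_natP h e0; exists N => // m hm.
by rewrite /= sub0r normrN ger0_norm ?pabs_ge0 // hN.
Qed.

(** The partial sums of (1 - aT) g at 1/a telescope to a single term of g, and these terms tend to
    0. *)
Lemma ppow1_val a g : a != 0 -> ps_cvg g a^-1 ->
  ps_cvg (psmul (ppow a 1) g) a^-1 /\ ps_val (psmul (ppow a 1) g) a^-1 = 0.
Proof.
move=> an /ps_cvgP hg.
have e m : psmul (ppow a 1) g m.+1 * a^-1 ^+ m.+1 = g m.+1 * a^-1 ^+ m.+1 - g m * a^-1 ^+ m.
  rewrite ppow1_mul mulrBl; congr (_ - _); rewrite exprS; field.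
  by rewrite an.
have s N : \sum_(m < N.+1) psmul (ppow a 1) g m * a^-1 ^+ m = g N * a^-1 ^+ N.
  elim: N => [|N IH]; first by rewrite big_ord_recl big_ord0 addr0 psmul0 ppow_0 mul1r.
  by rewrite big_ord_recr /= IH e addrC subrK.
have hn : pnull (fun m => psmul (ppow a 1) g m * a^-1 ^+ m).
  apply: pnull_nat => d d0; have [N hN] := pnull_natP hg d0; exists N.+1 => -[//|m] hm.
  by rewrite e; apply: pabsB_le; apply: hN => //; exact: leqW.
split; first exact/ps_cvgP.
apply: (pcvg_uniq (pnull_cvg hn)) => d d0; have [N hN] := pnull_natP hg d0.
by exists N.+1 => -[//|m] hm; rewrite s subr0; exact: hN.
Qed.

Lemma ppow_cvg a g k : a != 0 -> ps_cvg g a^-1 -> ps_cvg (psmul (ppow a k) g) a^-1.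
Proof.
move=> an hg; elim: k => [|k IH]; first by rewrite ppow0 ps1mul.
by rewrite ppowS -psmulA; case: (ppow1_val an IH).
Qed.

Lemma rzero_val f a k : a != 0 -> rzero_mult f a k.+1 -> ps_val f a^-1 = 0.
Proof.
move=> an [g [-> hg _]]; rewrite -/(ppow a k.+1) ppowS -psmulA.
by case: (ppow1_val an (ppow_cvg k an hg)).
Qed.

Lemma psmul_cancel f g h : f 0%N = 1 -> psmul f g = psmul f h -> g = h.
Proof.
move=> f0 e; rewrite -[g]ps1mul -[h]ps1mul -(psmul_pinv f0) [psmul f _]psmulC -!psmulA.
by rewrite e.
Qed.

(** With two multiplicities k < l, the cofactor for k would still be divisible by 1 - aT and so
    vanish at 1/a. *)
Lemma rzero_mult_uniq f a k l : a != 0 -> rzero_mult f a k -> rzero_mult f a l -> k = l.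
Proof.
move=> an; wlog kl : k l / (k < l)%N => [hw|].
  by move=> h1 h2; case: (ltngtP k l) => // kl; [exact: hw|apply/esym; exact: hw].
move=> [g [eg hg g0]] [h [eh hh _]]; case/eqP: g0.
have [m em] : exists m, l = (k + m.+1)%N by exists (l - k).-1; rewrite prednK ?subn_gt0 // subnKC // ltnW.
have add i j : ppow a (i + j) = psmul (ppow a i) (ppow a j).
  elim: i => [|i IH]; first by rewrite ppow0 ps1mul.
  by rewrite addSn ppowS IH psmulA -ppowS.
have eg' : g = psmul (ppow a m.+1) h.
  by apply: (@psmul_cancel (ppow a k)); rewrite ?ppow_0 // psmulA -add -em -[LHS]eg eh.
by rewrite eg' ppowS -psmulA; case: (ppow1_val an (ppow_cvg m an hh)).
Qed.

Lemma small_no_zero f a e : e < 1 -> f 0%N = 1 -> (forall m, V (f m.+1) <= e) -> V a = 1 ->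
  rzero_mult f a 1 -> False.
Proof.
move=> e1 f0 hf ha h; have an : a != 0 by rewrite -(pabs_gt0 a) ha.
have e0 : 0 <= e by apply: le_trans (hf 0%N); exact: pabs_ge0.
have v0 := rzero_val an h; case: h => g [eg /(ppow1_val an)[+ _] _].
rewrite -[psmul _ _]eg => /ps_cvgP hn.
have := nasum_nat_sub e0 hn (N := 1) _; rewrite -/(ps_val f a^-1) v0 big_ord_recl big_ord0 f0 mul1r expr0 addr0.
rewrite sub0r pabsN pabs1 => h; suff : 1 <= e by rewrite leNgt e1.
apply: h => -[//|m] _; rewrite pabsM pabsX pabsV ha invr1 expr1n mulr1; exact: hf.
Qed.
End ReciprocalZeros.

Section RankOne.
Variables (RR : realType) (p : nat) (Cp : padicField RR p) (n q : nat).
Hypothesis q1 : (1 < q)%N.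
Local Notation pt := 'rV[Cp]_n.

Lemma detps_mx11 (A : 'M[Cp]_1) m : detps A m.+2 = 0.
Proof.
rewrite /detps /detpoly det_mx11 !mxE eqxx mulr1n coefB coef1 /= coefXM coefC /=.
by rewrite subrr.
Qed.

(** Inside the product each row meets the next column in a scalar, so the product along the orbit is
    a scalar times one rank one matrix; the swap reduces its determinant to a 1 by 1 matrix. *)
Lemma detps_pmx_rank1 r (W : pt -> 'cV[Cp]_r) (L : pt -> 'rV[Cp]_r) d x : (0 < d)%N -> tor q d x ->
  let Z := fun y => W y *m L (frb q y) in let g := fun y => (L y *m W y) 0 0 in
  detps (pmx q Z d x) 1%N = - \prod_(k < d) g (frb (q ^ k) x) /\
  forall m, detps (pmx q Z d x) m.+2 = 0.
Proof.
move=> d0 hx Z g.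
have key e y : pmx q Z e.+1 y = (\prod_(k < e) g (frb (q ^ k.+1) y)) *: (W y *m L (frb (q ^ e.+1) y)).
  elim: e y => [|e IH] y; first by rewrite big_ord0 scale1r expn1 /= mulmx1.
  rewrite -[pmx q Z e.+2 y]/(Z y *m pmx q Z e.+1 (frb q y)) IH -scalemxAr /Z.
  rewrite -mulmxA [L _ *m _]mulmxA [L (frb q y) *m W _]mx11_scalar mul_scalar_mx -scalemxAr scalerA.
  rewrite frbM -expnS big_ord_recl mulrC /= expn1; congr ((_ * _) *: _).
  by apply: eq_bigr => k _; rewrite frbM -expnS.
case: d d0 hx => // d d0 hx; rewrite key (tor_frb q1 d0 hx) scalemxAl.
have e m : detps ((\prod_(k < d) g (frb (q ^ k.+1) x)) *: W x *m L x) m =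
  detps (L x *m ((\prod_(k < d) g (frb (q ^ k.+1) x)) *: W x)) m by rewrite detps_swap.
split=> [|m]; last by rewrite e detps_mx11.
rewrite e detps1 trace_mx11 -scalemxAr mxE -/(g x).
by rewrite [in RHS]big_ord_recl expn0 frb1 mulrC.
Qed.
End RankOne.

(** * The rank one part modulo the uniformizer *)

Section Ordinary.
Variables (RR : realType) (p q a n : nat) (Cp : padicField RR p) (K : localField Cp q).
Local Notation V := (@pabs _ _ Cp).
Local Notation laurent := (laurent Cp n).
Local Notation vec := (vec Cp n).
Local Notation pt := 'rV[Cp]_n.
Hypotheses (pp : prime p) (a0 : (0 < a)%N) (hq : q = (p ^ a)%N).
Let q1 : (1 < q)%N := q_gt1 pp a0 hq.
Local Notation A0 := (@A0 _ _ _ _ K n).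
Local Notation tors := (@tors _ _ Cp n q).
Variable M : sigmaModule K n.
Local Notation std := (std_matrix M).
Local Notation w := (p%:R^-1 : RR).

Lemma mat_pointE (b : bmatrix Cp n) P : mat_point q b P = chain q (mat_at b) (cp_deg P) (teich q P).
Proof.
have h x d s : foldr (@imxmul _ _ Cp) (@imx1 _ _ Cp)
    [seq mat_at b (map_mx (fun z => z ^+ (q ^ k)) x) | k <- iota s d] = chain q (mat_at b) d (frb (q ^ s) x).
  by elim: d s => //= d IH s; rewrite IH frbM -expnSr.
by rewrite /mat_point h expn0 frb1.
Qed.

Lemma det_pointE (b : bmatrix Cp n) P : det_point q b P = fredholm (chain q (mat_at b) (cp_deg P) (teich q P)).
Proof. by rewrite /det_point mat_pointE. Qed.

Lemma pi_dividesP v : pi_divides M v -> forall i u, V (v i u) <= w.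
Proof.
move=> [z hz ->] i u; rewrite pabsM lfpi_abs ler_piMr // ?invr_ge0 //.
exact: A0_le1 (formal_A0 hz i) u.
Qed.

Variables (J : set nat) (f : nat -> vec) (b : bmatrix Cp n).
Hypotheses (hB : is_basis M J f) (hb : is_matrix M J f b).
Variables (Jo : set nat) (fo : nat -> vec) (bo : bmatrix Cp n).
Hypotheses (hBo : is_basis M Jo fo) (hbo : is_matrix M Jo fo bo).
Hypothesis hphi : phi0_from M Jo fo 1.
Hypothesis hord : forall P, closed_point q P -> exists2 s, unit_rzeros (det_point q bo P) s & size s = 1%N.

(** Modulo pi, phi kills every vector of the ordinary basis but the first. Hence phi(f_j) is
    congruent to sigma(lam_j) phi(fo_1), where lam_j is the first coordinate of f_j in the ordinary
    basis, and wv lists the coordinates of phi(fo_1) in the basis f. *)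
Lemma b_rank1 : exists wv lam : nat -> laurent, [/\ forall i, A0 (wv i), forall j, A0 (lam j)
  & forall i j u, V (b i j u - lmul (wv i) (lsigma q (lam j)) u) <= w].
Proof.
have w0 : 0 <= w by rewrite invr_ge0.
pose z1 := smphi M (bas Jo fo 1).
have bf := bas_formal hBo.
have z1f : formal K (smI M) z1 := smphi_M (bf 1%N).
have [wv [wf wc]] := coord_exists pp a0 hq hB z1f.
have h j : exists c : vec, formal K Jo c /\ coord q Jo fo c (bas J f j).
  exact: (coord_exists pp a0 hq hBo (bas_formal hB j)).
have [lc hlc] := choice h; pose lam j := lc j 1%N.
have lA j i : A0 (lc j i) by case: (hlc j) => /formal_A0.
exists wv, lam; split; [exact: formal_A0 wf|by move=> j; exact: lA|].
move=> i j; have [hj|hj] := pselect (J j); last first.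
  have l0 : lam j = fun=> 0.
    have [_ _ hu _] := hBo.
    have lz : formal K Jo (fun _ _ => 0 : Cp) by split=> // k _; exact: A0_0.
    have := coord_iso pp a0 hq hBo (lexx 0) (hlc j).1 (bas_formal hB j) (hlc j).2.
    move=> /(_ _ 1%N) hz; apply/funext => u; apply/eqP; rewrite -[_ == 0]negbK -pabs_gt0 -leNgt.
    by apply: hz => i' u'; rewrite bas0 // pabs0.
  have [_ h2] := hb; move=> u; rewrite h2 // l0 sub0r pabsN.
  rewrite /lmul (nasum_fin (F := fset0)) ?big_seq_fset0 ?pabs0 // => v _.
  by rewrite /lsigma; case: ifP => _; rewrite mulr0.
move: i; have fj := f_formal hB hj; have pf := smphi_M fj.
pose r := [:: 0%N]; pose g (m : nat) := lsigma q (lam j).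
have gA m : A0 (g m) by apply: (A0_lsigma pp a0 hq); exact: lA.
have lcf : formal K J (fun i u => \sum_(m <- r) lmul (wv i) (g m) u).
  by apply: (formal_lcomb r (v := fun _ => wv)).
have lvf : formal K (smI M) (fun i u => \sum_(m <- r) lmul (z1 i) (g m) u).
  by apply: (formal_lcomb r (v := fun _ => z1)).
have lcc : coord q J f (fun i u => \sum_(m <- r) lmul (wv i) (g m) u) (fun i u => \sum_(m <- r) lmul (z1 i) (g m) u).
  exact: (coord_lcomb pp a0 hq hB r (c := fun _ => wv) (v := fun _ => z1)).
have cB := coordB pp a0 hq hB (bmat_formal hb j) lcf pf lvf (b_coord pp a0 hq hB hb hj) lcc.
have key := coord_iso pp a0 hq hB w0 (formalB (bmat_formal hb j) lcf) (formalB pf lvf) cB _.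
suff small : forall i u, V (smphi M (f j) i u - \sum_(m <- r) lmul (z1 i) (g m) u) <= w.
  by move=> i u; have := key small i u; rewrite big_seq1.
move=> i; have dA := A0B (formal_A0 pf i) (formal_A0 lvf i).
apply/(A0_pt_le pp a0 hq w0 dA) => x hx.
have hx' : tors (frb q x) by exact: tors_frb.
have zA := formal_A0 z1f.
rewrite (levalB q1) //; [|exact: (A0_nul (formal_A0 pf i))|exact: (A0_nul (formal_A0 lvf i))].
rewrite (lcomb_ev (K := K) pp a0 hq r (v := fun _ => z1 i)) // big_seq1.
rewrite (leval_lsigma q1) //; last exact: (A0_nul (lA j 1%N)).
have rA := cnull_rnull (std_cnull pp a0 hq M hx).
have rF := bmat_rnull pp a0 hq hBo hx'.
have fE l : leval (f j l) (frb q x) = nasum (fun k => bmat Jo fo (frb q x) l k * leval (lc j k) (frb q x)).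
  by have [_ hc] := hlc j; have := hc l _ hx'; rewrite basE.
have phiE : leval (smphi M (f j) i) x = imxmul (imxmul (mat_at std x) (bmat Jo fo (frb q x))) (fun k (_ : nat) => leval (lc j k) (frb q x)) i 0%N.
  rewrite -mulxA //; last by move=> ? ?; exact: (leval_le1 pp a0 hq).
  by rewrite (phi_eval pp a0 hq) // /imxmul; apply: eq_nasum => l; rewrite fE.
pose T k := imxmul (mat_at std x) (bmat Jo fo (frb q x)) i k.
have TE k : T k = leval (smphi M (bas Jo fo k) i) x.
  by rewrite (phi_eval pp a0 hq) //; exact: bf.
have Tn : pnull (fun k => T k * leval (lc j k) (frb q x)).
  apply: (@mul_null _ _ _ (fun _ => T) (fun k _ => leval (lc j k) (frb q x)) 0%N 0%N).
    have [h1 h2] := rnull_mul rA rF; split; first by move=> ? ?; exact: h1.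
    by move=> _; exact: h2.
  by move=> ? ?; exact: (leval_le1 pp a0 hq).
rewrite phiE -TE.
(* Only the index 1 is kept; the other terms contain some phi(fo_k) with k different from 1,
   divisible by pi. *)
have := nasum_sub Tn w0 (F := [fset 1%N]%fset); rewrite big_seq_fset1; apply=> k.
rewrite inE => /eqP k1; apply: pabsMr_le; last exact: (leval_le1 pp a0 hq).
rewrite TE; have pA := formal_A0 (smphi_M (bf k)) i.
move: x hx {hx' rA rF fE phiE T TE Tn}; apply/(A0_pt_le pp a0 hq w0 pA).
have [hk|hk] := pselect (Jo k).
  rewrite basE //; apply: pi_dividesP; apply: hphi => //.
  by have [h1 _ _ _] := hBo; have [k0 _] := h1 k hk; case: k k1 k0 {pA hk} => [|[|]].
apply/(A0_pt_le pp a0 hq w0 pA) => x hx; rewrite (phi_eval pp a0 hq) //.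
rewrite (nasum_fin (F := fset0)) ?big_seq_fset0 ?pabs0 // => l _.
by rewrite bas0 // leval0 mulr0.
Qed.

(** If the trace of the rank one part were a non-unit at x, the Fredholm determinant along the orbit
    of x would be congruent to 1 modulo the maximal ideal and have no unit reciprocal zero, against
    ordinarity. *)
Lemma ordinary_unit (r : nat) (wv lam : nat -> laurent) : (forall i, A0 (wv i)) -> (forall j, A0 (lam j)) ->
  (forall i j u, V (b i j u - lmul (wv i) (lsigma q (lam j)) u) <= w) ->
  (forall i j u, (r <= j)%N -> V (b i j u) <= w) ->
  forall x, tors x -> V (\sum_(j < r) leval (lam j) x * leval (wv j) x) = 1.
Proof.
move=> wA lA hbw hbr x tx; have w0 : 0 <= w by rewrite invr_ge0.
have w1 : w < 1 := p1 RR pp.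
pose W (y : pt) : 'cV[Cp]_r := \col_i leval (wv i) y.
pose L (y : pt) : 'rV[Cp]_r := \row_i leval (lam i) y.
pose Z y := W y *m L (frb q y).
pose g y := (L y *m W y) 0 0.
have gE y : g y = \sum_(j < r) leval (lam j) y * leval (wv j) y.
  by rewrite /g mxE; apply: eq_bigr => j _; rewrite !mxE.
have g1 y : tors y -> V (g y) <= 1.
  move=> hy; rewrite gE; apply: pabs_sum => // j _.
  by apply: pabsM_le1; exact: (leval_le1 pp a0 hq).
rewrite -gE; apply/eqP; rewrite eq_le g1 //= leNgt; apply/negP => gx.
have bA i j : A0 (b i j) := b_A0 hb i j.
have Zb y : tors y -> forall i j, V (Z y i j) <= 1.
  move=> hy i j; rewrite !mxE big_ord_recl big_ord0 addr0 !mxE.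
  by apply: pabsM_le1; apply: (leval_le1 pp a0 hq) => //; exact: tors_frb.
have Za y : tors y -> apx w (mat_at b y) (Z y).
  move=> hy; split=> [i j|i j hj]; last first.
    by apply: (leval_le q1) => //; [exact/A0_nul|move=> u; exact: hbr].
  rewrite !mxE big_ord_recl big_ord0 addr0 !mxE.
  have hA : A0 (lmul (wv i) (lsigma q (lam j))) by apply: A0_lmul => //; exact: (A0_lsigma pp a0 hq).
  have := leval_le q1 w0 (A0_nul (A0B (bA i j) hA)) hy (hbw i j).
  rewrite (levalB q1) //; [|exact: (A0_nul (bA i j))|exact: (A0_nul hA)].
  rewrite (leval_lmul q1) //; [|exact: (A0_nul (wA i))|exact: (A0_nul (A0_lsigma pp a0 hq (lA j)))].
  by rewrite (leval_lsigma q1) //; exact: (A0_nul (lA j)).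
have cP := orb_closed pp a0 hq tx; set P := orb q (redv x) in cP.
have [ty hy eP d0] := teichP pp a0 hq cP; set y := teich q P in ty hy eP.
have [j ej] : exists j, x = frb (q ^ j) y.
  by apply: (orb_frb pp a0 hq) => //; rewrite -eP; exact: orb_self.
have [s [hs1 hs2] ss] := hord cP; case: s ss hs1 hs2 => [|al [|]] // _ hs1 hs2.
have al1 : V al = 1 by apply: hs1; rewrite inE.
have := hs2 al al1; rewrite /= eqxx addn0 det_pointE -/y.
rewrite -(fredholm_basis pp a0 hq hBo hbo d0 hy) (fredholm_basis pp a0 hq hB hb d0 hy).
set D := fredholm _ => hz.
pose e := Num.max w (V (g x)).
have cb := chain_cnull (fun y hy => b_cnull pp a0 hq hB hb hy) ty d0.
have [ap bp] : apx w (chain q (mat_at b) (cp_deg P) y) (pmx q Z (cp_deg P) y) /\ forall i j, V (pmx q Z (cp_deg P) y i j) <= 1.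
  rewrite -(prednK d0); apply: chain_apx => // z hz'.
  exact/cnull_rnull/(b_cnull pp a0 hq hB hb).
apply: (@small_no_zero _ _ _ D al e) => //; first by rewrite gt_max w1.
  exact: fredholm_0.
move=> m; rewrite -(subrK (detps (pmx q Z (cp_deg P) y) m.+1) (D m.+1)); apply: pabsD_le.
  by apply: le_trans (fredholm_apx m.+1 cb bp w0 ap) _; rewrite le_max lexx.
have [h1 h2] := detps_pmx_rank1 q1 W L d0 hy.
case: m => [|m]; last by rewrite h2 pabs0 le_max w0.
(* The point x is the j-th conjugate of the lift y; reducing j modulo the degree exhibits its
   non-unit factor in the product over the orbit. *)
have jd : (j %% cp_deg P < cp_deg P)%N by rewrite ltn_mod.
rewrite h1 pabsN (bigD1 (Ordinal jd)) //=; apply: pabsMr_le; last first.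
  by apply: pabs_prod_le1 => k _; apply: g1; exact: tors_frb.
have -> : frb (q ^ (j %% cp_deg P)) y = x.
  apply: (redv_inj pp a0 hq) => //; first exact: tors_frb.
  rewrite ej !(redv_iter pp a0 hq) // [RHS](iter_mod (d := cp_deg P) j) //.
  by rewrite -(redv_iter pp a0 hq) // (tor_frb q1 d0 hy).
by rewrite le_max lexx orbT.
Qed.
End Ordinary.

(** * Series that are units at all torsion points *)

Section UnitMonomial.
Variables (RR : realType) (p q a n : nat) (Cp : padicField RR p) (K : localField Cp q).
Local Notation V := (@pabs _ _ Cp).
Local Notation laurent := (laurent Cp n).
Local Notation expo := (expo n).
Local Notation pt := 'rV[Cp]_n.
Local Notation red := (@red _ _ Cp).
Hypotheses (pp : prime p) (a0 : (0 < a)%N) (hq : q = (p ^ a)%N).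
Let q1 : (1 < q)%N := q_gt1 pp a0 hq.
Local Notation A0 := (@A0 _ _ _ _ K n).
Local Notation tors := (@tors _ _ Cp n q).
Local Notation w := (p%:R^-1 : RR).

Lemma seq_min (T : eqType) (s : seq T) (F : T -> int) x0 : x0 \in s ->
  exists2 x, x \in s & forall y, y \in s -> F x <= F y.
Proof.
elim: s x0 => [//|x s IH] x0 _.
case: s IH => [_|z s IH]; first by exists x => [|y]; rewrite inE // => /eqP ->.
have [y ys hy] := IH z (mem_head _ _).
have [h|h] := leP (F x) (F y).
  by exists x => [|t]; rewrite ?mem_head // inE => /predU1P[->//|/hy]; apply: le_trans.
exists y => [|t]; first by rewrite inE ys orbT.
by rewrite inE => /predU1P[->|/hy //]; exact: ltW.
Qed.

(** Kronecker substitution: the exponent of t in X^u on the curve X_i = t^(N^i). *)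
Definition wsum (N : nat) (u : expo) : int := \sum_(i < n) u ord0 i * N%:Z ^+ i.

Lemma wsumB N u v : wsum N (u - v) = wsum N u - wsum N v.
Proof. by rewrite /wsum -sumrB; apply: eq_bigr => i _; rewrite !mxE mulrBl. Qed.

(** A nonzero u gives a nonzero polynomial in N. The product of these polynomials has finitely many
    roots, so some N avoids them all. *)
Lemma wsum_separate (s : seq expo) : (forall u, u \in s -> u != 0) ->
  exists N, forall u, u \in s -> wsum N u != 0.
Proof.
move=> hs; pose P (u : expo) : {poly int} := \poly_(i < n) (if insub i is Some j then u ord0 j else 0).
have PE N u : (P u).[N%:Z] = wsum N u.
  by rewrite horner_poly; apply: eq_bigr => i _; rewrite valK.
have P0 u : u != 0 -> P u != 0.
  apply: contra_neq => h; apply/rowP => i; rewrite mxE.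
  by have := congr1 (fun Q : {poly int} => Q`_i) h; rewrite coef_poly ltn_ord valK coef0.
pose Q := \prod_(u <- s) P u.
have Q0 : Q != 0 by rewrite prodf_seq_neq0; apply/allP => u /hs /P0.
have [N hN] : exists N : nat, Q.[N%:Z] != 0.
  apply: contrapT => h.
  have := @max_poly_roots _ Q [seq (i%:Z : int) | i <- iota 0 (size Q)] Q0.
  rewrite size_map size_iota ltnn map_inj_uniq ?iota_uniq; last by move=> i j [].
  suff -> : all (root Q) [seq (i%:Z : int) | i <- iota 0 (size Q)] by move=> /(_ isT isT).
  apply/allP => _ /mapP[i _ ->]; rewrite /root -[_ == 0]negbK; apply/negP => hi; by apply: h; exists i.
exists N => u us; rewrite -PE; apply: contra_neq hN => h.
by rewrite /Q horner_prod (big_rem u us) /= h mul0r.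
Qed.

Definition wpt (N : nat) (z : Cp) : pt := \row_i z ^+ (N ^ i).

Lemma monom_wpt N z u : z != 0 -> monom (wpt N z) u = z ^ wsum N u.
Proof.
move=> z0; rewrite /monom /wsum.
have -> : z ^ (\sum_(i < n) u ord0 i * N%:Z ^+ i) = \prod_(i < n) z ^ (u ord0 i * N%:Z ^+ i).
  by apply: (big_morph (fun k : int => z ^ k)) => [k l|]; rewrite ?expfzDr // expr0z.
apply: eq_bigr => i _; rewrite mxE (exprnP z) exprz_exp mulrC; congr (_ ^ (_ * _)).
by rewrite -[LHS]natz natrX !natz.
Qed.

Lemma red_nat m : red m%:R = m%:R.
Proof.
rewrite -[m]card_ord -!sumr_const red_sum => [|i _]; last by rewrite pabs1.
by apply: eq_bigr => i _; rewrite red1.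
Qed.

Lemma kap_char : p \in [pchar (kap Cp)].
Proof. by rewrite inE /= pp -red_nat; apply/eqP/red_eq0; [exact: pabs_nat|exact: pabs_p]. Qed.

Lemma kap_frob_sum (I : Type) (r : seq I) (F : I -> kap Cp) :
  (\sum_(i <- r) F i) ^+ q = \sum_(i <- r) F i ^+ q.
Proof.
suff h b : (\sum_(i <- r) F i) ^+ (p ^ b) = \sum_(i <- r) F i ^+ (p ^ b) by rewrite hq h.
elim: b => [|b IH]; first by rewrite expr1; apply: eq_bigr => i _; rewrite expr1.
rewrite expnSr exprM IH; under [in RHS]eq_bigr do rewrite exprM.
rewrite -(pFrobenius_autE kap_char) rmorph_sum /=.
by apply: eq_bigr => i _; rewrite pFrobenius_autE.
Qed.

Lemma red_pow_q x : lfR K x -> V x = 1 -> red x ^+ q = red x.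
Proof.
move=> kx vx; rewrite -(ltn_predK q1) exprS -red_X ?vx //.
have -> : red (x ^+ q.-1) = 1; last by rewrite mulr1.
rewrite -[RHS](@red1 _ _ Cp); apply/red_eq; rewrite ?pabs1 ?pabsX_le1 ?vx //.
have h := residue_pow kx vx; have h' := p1 RR pp; exact: le_lt_trans h h'.
Qed.

Section Kronecker.
Variables (G : laurent) (S : {fset expo}) (e : expo -> nat) (u0 : expo).
Hypotheses (GS : forall u, u \in S -> lfR K (G u) /\ V (G u) = 1).
Hypotheses (einj : {in S &, injective e}) (u0S : u0 \in S) (e0 : e u0 = 0%N).

Definition kpoly : {poly Cp} := \sum_(u <- S) G u *: 'X^(e u).

Lemma kpoly_coef u : u \in S -> kpoly`_(e u) = G u.
Proof.
move=> uS; rewrite coef_sum (bigD1_seq u) ?fset_uniq //= coefZ coefXn eqxx mulr1.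
rewrite big1_seq ?addr0 // => v /andP[vu vS]; rewrite coefZ coefXn.
by case: eqP => [/(einj uS vS) h|_]; [rewrite h eqxx in vu|rewrite mulr0].
Qed.

Lemma kpoly_coef_or j : kpoly`_j = 0 \/ V kpoly`_j = 1.
Proof.
have [[u [uS <-]]|h] := pselect (exists u, u \in S /\ e u = j).
  by right; rewrite kpoly_coef //; case: (GS uS).
left; rewrite coef_sum big1_seq // => u /= uS; rewrite coefZ coefXn.
by case: eqP => [ej|_]; [case: h; exists u|rewrite mulr0].
Qed.

Lemma kpoly_le1 j : V kpoly`_j <= 1.
Proof. by case: (kpoly_coef_or j) => ->; rewrite ?pabs0. Qed.

(** All coefficients are 0 or units, the constant and leading ones being units. For |z| > 1 the
    leading term would dominate, for |z| < 1 the constant one, so every zero has absolute value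
    1. *)
Lemma kpoly_root v : v \in S -> e v != 0%N -> exists2 z, V z = 1 & kpoly.[z] = 0.
Proof.
move=> vS ev.
have vn : kpoly`_(e v) != 0 by rewrite kpoly_coef // -(pabs_gt0 (G v)); have [_ ->] := GS vS.
have sz : (e v < size kpoly)%N by rewrite ltnNge; apply: contra vn => h; rewrite nth_default.
have : size kpoly != 1%N by apply/eqP => h; move: sz ev; rewrite h; case: (e v).
move/closed_rootP => [z rz]; exists z; last exact/eqP.
have h0 : kpoly.[z] = 0 by exact/eqP.
have [D eD] : exists D, size kpoly = D.+2.
  by case: (size kpoly) sz ev => [//|[|D]] sz ev; [case: (e v) sz ev|exists D].
have k0 : kpoly != 0 by rewrite -size_poly_eq0 eD.
have vl : V kpoly`_D.+1 = 1.
  case: (kpoly_coef_or D.+1) => // h; move: k0.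
  by rewrite -lead_coef_eq0 /lead_coef eD /= h eqxx.
have vc : V kpoly`_0 = 1 by rewrite -e0 kpoly_coef //; case: (GS u0S).
apply/eqP; rewrite eq_le; apply/andP; split; rewrite leNgt; apply/negP => hz.
  move: h0; rewrite horner_coef eD big_ord_recr /= => /eqP; rewrite addrC addr_eq0 => /eqP h.
  have : V (kpoly`_D.+1 * z ^+ D.+1) <= V z ^+ D.
    rewrite h pabsN; apply: pabs_sum => [|i _]; first by rewrite exprn_ge0 // pabs_ge0.
    apply: pabsMl_le; first exact: kpoly_le1.
    by rewrite pabsX; apply: ler_weXn2l; [exact: ltW|rewrite -ltnS].
  rewrite pabsM vl mul1r pabsX exprS leNgt ltr_pMl ?hz // exprn_gt0 //.
  exact: lt_trans hz.
move: h0; rewrite horner_coef eD big_ord_recl /= expr0 mulr1 => /eqP; rewrite addr_eq0 => /eqP h.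
have : V kpoly`_0 <= V z.
  rewrite h pabsN; apply: pabs_sum => [|i _]; first exact: pabs_ge0.
  apply: pabsMl_le; first exact: kpoly_le1.
  rewrite /= pabsX exprS ler_piMr ?pabs_ge0 // exprn_ile1 ?pabs_ge0 // ltW //.
by rewrite vc leNgt hz.
Qed.

Definition kred (t : kap Cp) := \sum_(u <- S) red (G u) * t ^+ e u.

Lemma kred_horner z : V z <= 1 -> red kpoly.[z] = kred (red z).
Proof.
move=> hz; rewrite horner_sum.
have h u : u \in S -> V ((G u *: 'X^(e u)).[z]) <= 1 /\ red (G u *: 'X^(e u)).[z] = red (G u) * red z ^+ e u.
  move=> /GS[_ vg]; rewrite hornerZ hornerXn; split.
    by apply: pabsM_le1; rewrite ?vg ?pabsX_le1.
  by rewrite redM ?vg ?pabsX_le1 // red_X.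
rewrite /kred [in RHS]big_seq [in LHS]big_seq red_sum => [|u /h[]//].
by apply: eq_bigr => u /h[].
Qed.

(** The reduced coefficients lie in the field with q elements and are fixed by the q-th power. *)
Lemma kred_frob t : kred (t ^+ q) = kred t ^+ q.
Proof.
rewrite /kred kap_frob_sum; apply: eq_big_seq => u /GS[kg vg].
by rewrite exprMn (red_pow_q kg vg) exprAC.
Qed.

(* The zeros t^(q^k) of the reduction repeat, so some t^(q^k) lies in a finite field. *)
Lemma kred_torsion v : v \in S -> e v != 0%N ->
  exists d z, [/\ (0 < d)%N, z ^+ (q ^ d).-1 = 1 & V kpoly.[z] < 1].
Proof.
move=> vS ev; have [z z1 hz] := kpoly_root vS ev.
have zle : V z <= 1 by rewrite z1.
have r0 k : kred (red z ^+ (q ^ k)) = 0.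
  elim: k => [|k IH]; first by rewrite expr1 -kred_horner // hz red_0.
  by rewrite expnSr exprM kred_frob IH expr0n gtn_eqF // ltnW.
pose H : {poly kap Cp} := \sum_(u <- S) red (G u) *: 'X^(e u).
have HE t : H.[t] = kred t.
  by rewrite horner_sum; apply: eq_bigr => u _; rewrite hornerZ hornerXn.
have H0 : H != 0.
  apply/eqP => h; have := congr1 (fun Q : {poly kap Cp} => Q`_0) h; rewrite coef0 coef_sum.
  rewrite (bigD1_seq u0) ?fset_uniq //= coefZ coefXn e0 eqxx mulr1 big1_seq ?addr0.
    by apply/eqP; rewrite red_neq0 //; case: (GS u0S).
  move=> u /andP[uu uS]; rewrite coefZ coefXn; case: eqP => [h0|_]; last by rewrite mulr0.
  by rewrite (einj uS u0S) ?eqxx ?e0 in uu.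
have nu : ~~ uniq [seq red z ^+ (q ^ k) | k <- iota 0 (size H)].
  apply/negP => hu; have := max_poly_roots H0 _ hu; rewrite size_map size_iota ltnn.
  suff -> : all (root H) [seq red z ^+ (q ^ k) | k <- iota 0 (size H)] by move/(_ isT).
  by apply/allP => _ /mapP[k _ ->]; rewrite /root HE r0.
have [k [d [d0 hd]]] : exists k d, (0 < d)%N /\ red z ^+ (q ^ k) = red z ^+ (q ^ (k + d)).
  apply: contrapT => h; case/negP: nu; rewrite map_inj_in_uniq ?iota_uniq // => i j _ _ ij.
  case: (ltngtP i j) => // hij; case: h.
    by exists i, (j - i)%N; rewrite subn_gt0 hij subnKC // ltnW.
  by exists j, (i - j)%N; rewrite subn_gt0 hij subnKC // ltnW.
pose y := z ^+ (q ^ k).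
have y1 : V y = 1 by rewrite pabsX z1 expr1n.
have yle : V y <= 1 by rewrite y1.
have [|t t1 yt] := near_root1 pp a0 hq d0 y1.
  apply/red_eq; rewrite ?pabs1 ?pabsX_le1 // red1 red_X //.
  apply: (mulfI (red_neq0 y1)); rewrite -exprS (ltn_predK (qd_gt1 q1 d0)) mulr1.
  by rewrite /y red_X // -exprM -expnD -hd.
have tle : V t <= 1 by rewrite (root1_abs (qd_pred q1 d0) t1).
exists d, t; split=> //; apply/red_eq0.
  rewrite horner_coef; apply: pabs_sum => // i _.
  by apply: pabsM_le1; [exact: kpoly_le1|exact: pabsX_le1].
by rewrite kred_horner // -((red_eq yle tle).2 yt) /y red_X // r0.
Qed.
End Kronecker.

(** If two coefficients were units, a curve X_i = t^(N^i) separating the exponents would turn the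
    unit part into a power of t times a polynomial with at least two terms. By [kred_torsion] this
    polynomial has a non-unit value at some root of unity giving a torsion point, against the
    hypothesis. *)
Lemma unit_monomial (G : laurent) : A0 G -> (forall x, tors x -> V (leval G x) = 1) ->
  exists c v, [/\ lfR K c, V c = 1 & forall u, V (G u - lmon c v u) <= w].
Proof.
move=> hG h1; have [kG nG] := (A0P _ _).1 hG.
have w0 : 0 < w by rewrite invr_gt0 ltr0n prime_gt0.
have w1 : w < 1 := p1 RR pp.
have [F hF] := nG w w0.
pose S := [fset u in F | V (G u) == 1]%fset.
have SP u : u \in S -> lfR K (G u) /\ V (G u) = 1.
  by rewrite !inE => /andP[_ /eqP].
have SN u : u \notin S -> V (G u) <= w.
  rewrite !inE negb_and => /orP[/hF //|ne]; apply: (lfR_lt1 (kG u)).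
  by rewrite lt_neqAle ne (lfR_le1 (kG u)).
have cut x : tors x -> V (leval G x - \sum_(u <- S) G u * monom x u) <= w.
  move=> hx; apply: nasum_sub; [exact: (nul_mon q1)|exact: ltW|].
  by move=> u /SN hu; rewrite pabsM (monom_tors q1) // mulr1.
have [S0|[v vS]] := fset_0Vmem S.
  have tx : tors (\row_i 1) by exists 1%N => // i; rewrite mxE expr1n.
  by have := cut _ tx; rewrite S0 big_seq_fset0 subr0 h1 // leNgt w1.
exists (G v), v; split; [by case: (SP v vS)|by case: (SP v vS)|].
move=> u; rewrite /lmon; case: eqP => [->|uv]; first by rewrite subrr pabs0 ltW.
rewrite subr0; have [uS|/SN //] := boolP (u \in S); exfalso.
pose diffs := [seq s - t | s <- enum_fset S, t <- [seq t <- enum_fset S | s != t]].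
have [|N hN] := @wsum_separate diffs.
  by move=> d /allpairsPdep[s [t [_ + ->]]]; rewrite mem_filter subr_eq0 => /andP[].
have winj : {in S &, injective (wsum N)}.
  move=> s t sS tS est; apply/eqP; apply: contraT => nst.
  have /hN : s - t \in diffs by apply/allpairsPdep; exists s, t; rewrite mem_filter nst.
  by rewrite wsumB est subrr eqxx.
(* Subtracting the least exponent gives a polynomial with constant term at u0; the power of t taken
   out is a unit at roots of unity. *)
have [u0 u0S umin] := @seq_min _ (enum_fset S) (wsum N) v vS.
pose e s := `|wsum N s - wsum N u0|%N.
have eP s : s \in S -> (e s)%:Z = wsum N s - wsum N u0.
  by move=> sS; rewrite /e gez0_abs // subr_ge0; exact: umin.
have einj : {in S &, injective e}.
  move=> s t sS tS est; apply: winj => //; apply: (addIr (- wsum N u0)).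
  by rewrite -!eP // est.
have e0 : e u0 = 0%N by rewrite /e subrr.
have [v' [v'S ev]] : exists v', v' \in S /\ e v' != 0%N.
  apply: contrapT => h; apply: uv; apply: einj => //.
  have z s : s \in S -> e s = 0%N by move=> sS; apply/eqP; apply: contraT => hs; case: h; exists s.
  by rewrite !z.
have [d [z [d0 hz small]]] := kred_torsion SP einj u0S e0 v'S ev.
have z1 := root1_abs (qd_pred q1 d0) hz.
have z0 : z != 0 by rewrite -(pabs_gt0 z) z1.
have tx : tors (wpt N z) by exists d => // i; rewrite mxE exprAC hz expr1n.
have := cut _ tx.
have -> : \sum_(s <- S) G s * monom (wpt N z) s = z ^ wsum N u0 * (kpoly G S e).[z].
  rewrite horner_sum big_distrr /=; apply: eq_big_seq => s sS.
  rewrite hornerZ hornerXn monom_wpt // (exprnP z) eP // mulrCA -expfzDr //; congr (_ * _ ^ _).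
  by rewrite addrC subrK.
set X := z ^ _ * _ => hX; have : V (leval G (wpt N z)) < 1.
  rewrite -(subrK X (leval G _)); apply: pabsD_lt; first exact: le_lt_trans hX w1.
  by rewrite /X pabsM pabs_exprz z1 exp1rz mul1r.
by rewrite h1 // ltxx.
Qed.
End UnitMonomial.

Section WeightBounds.
Variables (RR : realType) (p : nat) (Cp : padicField RR p) (n : nat).
Local Notation V := (@pabs _ _ Cp).
Local Notation laurent := (laurent Cp n).
Local Notation expo := (expo n).
Variable W : expo -> RR.
Hypotheses (Wpos : forall u, 0 < W u) (WD : forall u v, W (u + v) <= W u * W v).
Implicit Types f g : laurent.

Definition wbd C f := forall u, V (f u) * W u <= C.

Lemma wbd_mono C C' f : C <= C' -> wbd C f -> wbd C' f.
Proof. by move=> h hf u; apply: le_trans (hf u) h. Qed.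

Lemma wbd0 C : 0 <= C -> wbd C (fun=> 0).
Proof. by move=> h u; rewrite pabs0 mul0r. Qed.

Lemma wbdP C f : wbd C f <-> forall u, V (f u) <= C / W u.
Proof. by split=> h t; have := h t; rewrite ler_pdivlMr. Qed.

Lemma wbd_sum C (I : Type) (s : seq I) (P : pred I) (F : I -> laurent) : 0 <= C ->
  (forall i, P i -> wbd C (F i)) -> wbd C (fun u => \sum_(i <- s | P i) F i u).
Proof.
move=> C0 h; apply/(wbdP _ _) => u; apply: pabs_sum => [|i Pi]; first by rewrite divr_ge0 // ltW.
by move: u; apply/(wbdP _ _); exact: h.
Qed.

Lemma wbdB C f g : wbd C f -> wbd C g -> wbd C (fun u => f u - g u).
Proof.
move=> hf hg; apply/(wbdP _ _) => u; apply: pabsB_le; move: u; exact/(wbdP _ _).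
Qed.

Lemma wbd_ge0 C f : wbd C f -> 0 <= C.
Proof. by move=> h; apply: le_trans (h 0); rewrite mulr_ge0 ?pabs_ge0 // ltW. Qed.

Lemma wbd_lmul C C' f g : nul f -> nul g -> wbd C f -> wbd C' g -> wbd (C * C') (lmul f g).
Proof.
move=> nf ng hf hg; have C0 := wbd_ge0 hf; have C0' := wbd_ge0 hg.
apply/(wbdP _ _) => w; apply: nasum_le; first by rewrite divr_ge0 ?mulr_ge0 // ltW.
  exact: lmul_null.
move=> u; rewrite ler_pdivlMr //.
have e : W w <= W u * W (w - u) by have := WD u (w - u); rewrite addrC subrK.
apply: le_trans (ler_wpM2l (pabs_ge0 _) e) _.
by rewrite pabsM mulrACA; apply: ler_pM; rewrite ?mulr_ge0 ?pabs_ge0 // ltW.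
Qed.

Lemma wbd_fin f (F : {fset expo}) : (forall u, u \notin F -> f u = 0) -> exists C, wbd C f.
Proof.
move=> h; exists (\sum_(u <- F) V (f u) * W u) => u.
have pos v : 0 <= V (f v) * W v by rewrite mulr_ge0 ?pabs_ge0 // ltW.
have [uF|/h ->] := boolP (u \in F); last by rewrite pabs0 mul0r sumr_ge0.
by rewrite (bigD1_seq u) ?fset_uniq //= lerDl sumr_ge0.
Qed.

Lemma wbd_unif r (F : nat -> laurent) : (forall j, exists C, wbd C (F j)) ->
  (forall j, (r <= j)%N -> F j = fun=> 0) -> exists C, forall j, wbd C (F j).
Proof.
move=> /choice[C hC] h; exists (\sum_(j < r) C j) => j.
have C0 i : 0 <= C i := wbd_ge0 (hC i).
have [jr|rj] := ltnP j r; last by rewrite h //; apply: wbd0; exact: sumr_ge0.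
by apply: wbd_mono (hC j); rewrite (bigD1 (Ordinal jr)) //= lerDl sumr_ge0.
Qed.
End WeightBounds.

(** * Splitting off the rank one part *)

Section NormalForm.
Variables (RR : realType) (p q a n : nat) (Cp : padicField RR p) (K : localField Cp q).
Local Notation V := (@pabs _ _ Cp).
Local Notation laurent := (laurent Cp n).
Local Notation expo := (expo n).
Local Notation pt := 'rV[Cp]_n.
Hypotheses (pp : prime p) (a0 : (0 < a)%N) (hq : q = (p ^ a)%N).
Let q1 : (1 < q)%N := q_gt1 pp a0 hq.
Local Notation A0 := (@A0 _ _ _ _ K n).
Local Notation tors := (@tors _ _ Cp n q).
Local Notation w := (p%:R^-1 : RR).
Variable W : expo -> RR.
Hypotheses (Wpos : forall u, 0 < W u) (WD : forall u v, W (u + v) <= W u * W v).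
Variables (b : bmatrix Cp n) (Cb : RR).
Hypotheses (bA : forall i j, A0 (b i j)) (bW : forall i j, wbd W Cb (b i j)).
Hypothesis bnull : forall e, 0 < e -> exists N, forall i j u, (N <= j)%N -> V (b i j u) <= e.
Variables (r : nat) (wv lam : nat -> laurent).
Hypotheses (wA : forall i, A0 (wv i)) (lA : forall j, A0 (lam j)).
Hypothesis hbw : forall i j u, V (b i j u - lmul (wv i) (lsigma q (lam j)) u) <= w.
Hypothesis hbr : forall i j u, (r <= j)%N -> V (b i j u) <= w.
Hypothesis hunit : forall x, tors x -> V (\sum_(j < r) leval (lam j) x * leval (wv j) x) = 1.

Let w0 : 0 <= w. Proof. by rewrite invr_ge0. Qed.
Let w1 : w < 1. Proof. exact: p1. Qed.
Let k1 : lfR K 1. Proof. by case: (lfR_sub K). Qed.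

Lemma A0_trunc (f : laurent) e : 0 < e -> A0 f -> exists g : laurent,
  [/\ A0 g, forall u, V (f u - g u) <= e & exists F : {fset expo}, forall u, u \notin F -> g u = 0].
Proof.
move=> e0 hf; have [kf nf] := (A0P _ _).1 hf; have [F hF] := nf e e0.
exists (fun u => if u \in F then f u else 0); split; last by exists F => u /negbTE ->.
  apply/A0P; split=> [u|]; first by case: ifP => // _; exact: kR0.
  by apply: (pnull_fin (F := F)) => u /negbTE ->.
move=> u; case: ifP => [_|/negbT /hF]; first by rewrite subrr pabs0 ltW.
by rewrite subr0.
Qed.

(** The series wv and lam arise from changes of basis and carry no weighted bound. Finite
    truncations have one, and agree with them modulo pi in the first r indices. *)
Lemma trunc_family (F : nat -> laurent) : (forall j, A0 (F j)) -> exists G : nat -> laurent,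
  [/\ forall j, A0 (G j), forall j, (r <= j)%N -> G j = fun=> 0,
      forall j u, (j < r)%N -> V (F j u - G j u) <= w
    & forall j, exists S : {fset expo}, forall u, u \notin S -> G j u = 0].
Proof.
move=> hF; have wp : 0 < w by rewrite invr_gt0 ltr0n prime_gt0.
have [G hG] := choice (fun j => A0_trunc wp (hF j)).
exists (fun j => if (j < r)%N then G j else fun=> 0); split.
- by move=> j; case: ifP => _; [case: (hG j)|exact: A0_0].
- by move=> j; rewrite leqNgt => /negbTE ->.
- by move=> j u jr; rewrite jr; case: (hG j) => _ h _; exact: h.
- by move=> j; case: ifP => _; [case: (hG j)|exists fset0].
Qed.

Lemma pt_close (f g : laurent) x : A0 f -> A0 g -> tors x -> (forall u, V (f u - g u) <= w) ->
  V (leval f x - leval g x) <= w.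
Proof.
move=> hf hg hx h; rewrite -(levalB q1 (A0_nul hf) (A0_nul hg) hx).
by apply: (leval_le q1) => //; exact: A0_nul (A0B hf hg).
Qed.

Lemma close_pt (f g : laurent) : A0 f -> A0 g ->
  (forall x, tors x -> V (leval f x - leval g x) <= w) -> forall u, V (f u - g u) <= w.
Proof.
move=> hf hg h; apply/(A0_pt_le pp a0 hq w0 (A0B hf hg)) => x hx.
by rewrite (levalB q1 (A0_nul hf) (A0_nul hg) hx); exact: h.
Qed.

Lemma lmul_ev f g x : A0 f -> A0 g -> tors x -> leval (lmul f g) x = leval f x * leval g x.
Proof. by move=> hf hg hx; rewrite (leval_lmul q1 (A0_nul hf) (A0_nul hg) hx). Qed.

Lemma lsigma_ev f x : A0 f -> tors x -> leval (lsigma q f) x = leval f (frb q x).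
Proof. by move=> hf hx; rewrite (leval_lsigma q1 (A0_nul hf) hx). Qed.

Definition lsum (s : nat) (F G : nat -> laurent) : laurent := fun u => \sum_(j < s) lmul (F j) (G j) u.

Lemma lsum_A0 s F G : (forall j, A0 (F j)) -> (forall j, A0 (G j)) -> A0 (lsum s F G).
Proof. by move=> hF hG; apply: A0_sum => j _; exact: A0_lmul. Qed.

Lemma lsum_evE s F G x : (forall j, A0 (F j)) -> (forall j, A0 (G j)) -> tors x ->
  leval (lsum s F G) x = \sum_(j < s) leval (F j) x * leval (G j) x.
Proof.
move=> hF hG hx; have h (j : 'I_s) : true -> nul (lmul (F j) (G j)) by move=> _; exact/A0_nul/A0_lmul.
have [_ ->] := leval_sum q1 (index_enum 'I_s) h hx.
by apply: eq_bigr => j _; exact: lmul_ev.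
Qed.

(* Modulo p the matrix b is the rank one matrix wv * sigma(lam).  Splitting off this part
   factors b as Wm * sigma(Lam), and c X^v Z is the swapped product Lam * Wm. *)
Theorem normal_form : exists (c : Cp) (v : expo) (Z : bmatrix Cp n),
  [/\ [/\ lfR K c, V c = 1 & forall k l, A0 (Z k l)],
      forall u, V (Z 0%N 0%N u - lmon 1 0 u) <= w,
      forall k l u, V (Z k l.+1 u) <= w,
      forall e, 0 < e -> exists N, forall k l u, (N <= l)%N -> V (Z k l u) <= e
    & (exists C, forall k l, wbd W C (Z k l)) /\
      forall d x m, (0 < d)%N -> tor q d x -> fredholm (chain q (mat_at b) d x) m =
        (c ^+ d * chi q v d x) ^+ m * fredholm (chain q (mat_at Z) d x) m].
Proof.
have [wt [wtA wtr wtc wtF]] := trunc_family wA.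
have [lt [ltA ltr ltc ltF]] := trunc_family lA.
have le1 := leval_le1 pp a0 hq (K := K).
pose g := lsum r lt wt.
have gA : A0 g by exact: lsum_A0.
have close2 (x1 y1 x2 y2 : Cp) : V x1 <= 1 -> V y2 <= 1 -> V (x1 - x2) <= w -> V (y1 - y2) <= w ->
    V (x1 * y1 - x2 * y2) <= w.
  move=> h1 h2 h3 h4; have -> : x1 * y1 - x2 * y2 = x1 * (y1 - y2) + (x1 - x2) * y2 by ring.
  by apply: pabsD_le; [exact: pabsMl_le|exact: pabsMr_le].
have g1 x : tors x -> V (leval g x) = 1.
  move=> hx; rewrite -(hunit hx) -[leval g x](subrK (\sum_(j < r) leval (lam j) x * leval (wv j) x)) addrC.
  apply: pabs_dominant; rewrite hunit //; apply: le_lt_trans w1.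
  rewrite lsum_evE // -sumrB; apply: pabs_sum => // j _.
  apply: close2; [exact: le1|exact: le1| |];
    rewrite pabsBC; apply: pt_close => // u; [exact: ltc|exact: wtc].
(* The trace g of the truncated rank one part is a unit at all torsion points, so modulo pi it is a
   monomial, which is invertible as a Laurent polynomial. *)
have [c [v [kc c1 hg]]] := unit_monomial pp a0 hq gA g1.
have c0 : c != 0 by rewrite -(pabs_gt0 c) c1.
have kV : lfR K c^-1 := lfR_V kc c1.
have vV : V c^-1 = 1 by rewrite pabsV c1 invr1.
have gx x : tors x -> V (leval g x - c * monom x v) <= w.
  by move=> hx; rewrite -leval_lmon; apply: pt_close => //; exact: A0_lmon.
pose mq := lmon c^-1 (- (v *+ q)); pose mv := lmon c^-1 (- v).
have mqA : A0 mq by exact: A0_lmon.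
have mvA : A0 mv by exact: A0_lmon.
pose sw j := lsigma q (wt j); pose sl j := lsigma q (lt j).
have swA j : A0 (sw j) by exact: (A0_lsigma pp a0 hq).
have slA j : A0 (sl j) by exact: (A0_lsigma pp a0 hq).
(* This is congruent to wv modulo pi, since b sigma(wt) is congruent to wv sigma(g), and sigma(g) to
   c X^(qv). Being a combination of columns of b, it keeps the decay of b, which wv need not
   have. *)
pose w' i := lmul mq (lsum r (b i) sw).
have w'A i : A0 (w' i) by apply: A0_lmul => //; exact: lsum_A0.
pose D i j : laurent := fun u => b i j u - lmul (w' i) (sl j) u.
have DA i j : A0 (D i j) by apply: A0B => //; exact: A0_lmul.
(* One index is added: the columns of Wm are w' followed by those of D, matching the matrix [Lam]
   that consists of the row lt above an identity matrix. *)
pose Wm : bmatrix Cp n := fun i l => if l is l'.+1 then D i l' else w' i.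
have WmA i l : A0 (Wm i l) by case: l => [|l]; [exact: w'A|exact: DA].
(* The product of [Lam] and Wm. Its corner is congruent to g, hence to c X^v, and every column after
   the first vanishes modulo pi because D does. *)
pose BB : bmatrix Cp n := fun k l => if k is k'.+1 then Wm k' l else lsum r lt (Wm^~ l).
have BBA k l : A0 (BB k l) by case: k => [|k]; [exact: lsum_A0|exact: WmA].
pose Z : bmatrix Cp n := fun k l => lmul mv (BB k l).
have ZA k l : A0 (Z k l) by exact: A0_lmul.
have mono1 x u : tors x -> V (monom x u) = 1 by move=> hx; exact: (monom_tors q1).
have tfrb x : tors x -> tors (frb q x) by move=> hx; exact: tors_frb.
have bl i j x : tors x -> V (leval (b i j) x - leval (wv i) x * leval (lt j) (frb q x)) <= w.
  move=> hx; have [jr|rj] := ltnP j r; last first.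
    rewrite ltr // leval0 mulr0 subr0; apply: (leval_le q1) => //; first exact: A0_nul (bA i j).
    by move=> u; exact: hbr.
  apply: (@pabs_chain _ _ _ (leval (wv i) x * leval (lam j) (frb q x))).
    have slamA : A0 (lsigma q (lam j)) by exact: (A0_lsigma pp a0 hq).
    rewrite -(lsigma_ev (lA j) hx) -lmul_ev //.
    by apply: pt_close => //; exact: A0_lmul.
  rewrite -mulrBr; apply: pabsMl_le; first exact: le1.
  apply: pt_close => // [|u]; [exact: tfrb|exact: ltc].
have w'x i x : tors x -> V (leval (w' i) x - leval (wv i) x) <= w.
  move=> hx; rewrite /w' lmul_ev // ?leval_lmon; last exact: lsum_A0.
  rewrite lsum_evE //; set S := \sum_(j < r) _.
  have mN : monom x (- (v *+ q)) = (monom (frb q x) v)^-1.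
    by rewrite monomN ?monom_frb //; exact: (tors_torus q1).
  have nz : monom (frb q x) v != 0 by rewrite -(pabs_gt0 (monom _ v)) mono1 //; exact: tfrb.
  have -> : c^-1 * monom x (- (v *+ q)) * S - leval (wv i) x =
      c^-1 * monom x (- (v *+ q)) * (S - leval (wv i) x * (c * monom (frb q x) v)).
    rewrite mN; field; by rewrite c0 nz.
  apply: pabsMl_le; first by rewrite pabsM vV mono1 // mulr1.
  apply: (@pabs_chain _ _ _ (leval (wv i) x * leval g (frb q x))); last first.
    by rewrite -mulrBr; apply: pabsMl_le; [exact: le1|apply: gx; exact: tfrb].
  rewrite lsum_evE //; last exact: tfrb.
  rewrite big_distrr /= -sumrB; apply: pabs_sum => // j _.
  rewrite lsigma_ev // mulrA -mulrBl; apply: pabsMr_le; first exact: bl.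
  by apply: le1 => //; exact: tfrb.
have Dx i j x : tors x -> V (leval (D i j) x) <= w.
  move=> hx; have -> : leval (D i j) x = leval (b i j) x - leval (w' i) x * leval (lt j) (frb q x).
    rewrite /D (levalB q1 (A0_nul (bA i j)) (A0_nul (A0_lmul (w'A i) (slA j))) hx).
    by rewrite lmul_ev // lsigma_ev.
  apply: (@pabs_chain _ _ _ (leval (wv i) x * leval (lt j) (frb q x))) => [|]; first exact: bl.
  rewrite -mulrBl; apply: pabsMr_le; last by apply: le1 => //; exact: tfrb.
  by rewrite pabsBC; exact: w'x.
have Zx k l x : tors x -> leval (Z k l) x = c^-1 * monom x (- v) * leval (BB k l) x.
  by move=> hx; rewrite lmul_ev // leval_lmon.
have cm1 x : tors x -> V (c^-1 * monom x (- v)) = 1.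
  by move=> hx; rewrite pabsM vV mono1 // mulr1.
have Dnull e : 0 < e -> exists N, forall l, (N <= l)%N -> forall i u, V (D i l u) <= e.
  move=> e0; have [N hN] := bnull e0; exists (maxn N r) => l; rewrite geq_max => /andP[h1 h2] i u.
  rewrite /D /sl ltr // (_ : lmul _ _ u = 0) ?subr0; first exact: hN.
  rewrite /lmul (nasum_fin (F := fset0)) ?big_seq_fset0 // => t _.
  by rewrite /lsigma; case: ifP => _; rewrite mulr0.
have lmul_le f h e : 0 <= e -> A0 f -> A0 h -> (forall u, V (h u) <= e) -> forall u, V (lmul f h u) <= e.
  move=> e0 hf hh h1 u; apply: nasum_le => //; first exact: (lmul_null _ (A0_nul hf) (A0_nul hh)).
  by move=> t; apply: pabsMl_le; [exact: A0_le1 hf t|exact: h1].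
have Wmn e : 0 < e -> exists N, forall l, (N <= l)%N -> forall i u, V (Wm i l u) <= e.
  by move=> e0; have [N hN] := Dnull e e0; exists N.+1 => -[//|l] hl i u; exact: hN.
have BBle e l : 0 <= e -> (forall i u, V (Wm i l u) <= e) -> forall k u, V (BB k l u) <= e.
  move=> e0 h [|k] u /=; last exact: h.
  by apply: pabs_sum => // j _; apply: lmul_le => //; exact: h.
exists c, v, Z; split.
- by [].
- apply: close_pt => // [|x hx]; first exact: A0_lmon.
  rewrite leval_lmon monom0 mulr1 Zx // /BB /= lsum_evE //.
  have nz : monom x v != 0 by rewrite -(pabs_gt0 (monom x v)) mono1.
  set S := \sum_(j < r) _.
  have -> : c^-1 * monom x (- v) * S - 1 = c^-1 * monom x (- v) * (S - c * monom x v).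
    rewrite monomN; last exact: (tors_torus q1).
    by field; rewrite c0 nz.
  apply: pabsMl_le; first by rewrite cm1.
  apply: (@pabs_chain _ _ _ (leval g x)); last exact: gx.
  rewrite lsum_evE // -sumrB; apply: pabs_sum => // j _; rewrite -mulrBr.
  apply: pabsMl_le; first exact: le1.
  apply: (@pabs_chain _ _ _ (leval (wv j) x)); first exact: w'x.
  by apply: pt_close => // u; exact: wtc.
- move=> k l; apply: lmul_le => //; apply: BBle => // i.
  by apply/(A0_pt_le pp a0 hq w0 (DA i l)) => x hx; exact: Dx.
- move=> e e0; have [N hN] := Wmn e e0; exists N => k l u hl.
  by apply: lmul_le => //; [exact: ltW|apply: BBle; [exact: ltW|exact: hN]].
split.
  have wfin (G : nat -> laurent) : (forall j, exists S : {fset expo}, forall u, u \notin S -> G j u = 0) ->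
      (forall j, (r <= j)%N -> G j = fun=> 0) -> exists C, forall j, wbd W C (G j).
    by move=> h1 h2; apply: (wbd_unif Wpos _ h2) => j; have [S hS] := h1 j; exact: (wbd_fin Wpos hS).
  have sfin (G : nat -> laurent) : (forall j, exists S : {fset expo}, forall u, u \notin S -> G j u = 0) ->
      forall j, exists S : {fset expo}, forall u, u \notin S -> lsigma q (G j) u = 0.
    move=> h j; have [S hS] := h j; exists [fset qmul q u | u in S]%fset => t ht.
    have [[u hu]|nu] := pselect (exists u, qmul q u = t).
      rewrite -hu (lsigma_qmul q1); apply: hS; apply: contra ht => hS'; rewrite -hu; exact: in_imfset.
    by rewrite lsigma_out // => u; apply/eqP => hu; apply: nu; exists u.
  have s0 (G : nat -> laurent) : (forall j, (r <= j)%N -> G j = fun=> 0) ->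
      forall j, (r <= j)%N -> lsigma q (G j) = fun=> 0.
    by move=> h j /h ->; apply/funext => u; rewrite /lsigma; case: ifP.
  have [Cw hCw] := wfin _ (sfin _ wtF) (s0 _ wtr).
  have [Cs hCs] := wfin _ (sfin _ ltF) (s0 _ ltr).
  have [Cl hCl] := wfin _ ltF ltr.
  have [Cq hCq] : exists C, wbd W C mq.
    by apply: (wbd_fin Wpos (F := [fset - (v *+ q)]%fset)) => u; rewrite inE /mq /lmon => /negbTE ->.
  have [Cv hCv] : exists C, wbd W C mv.
    by apply: (wbd_fin Wpos (F := [fset - v]%fset)) => u; rewrite inE /mv /lmon => /negbTE ->.
  have Cb0 : 0 <= Cb := wbd_ge0 Wpos (bW 0%N 0%N).
  have Cw0 : 0 <= Cw := wbd_ge0 Wpos (hCw 0%N).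
  have Cl0 : 0 <= Cl := wbd_ge0 Wpos (hCl 0%N).
  have mulW f h C C' : A0 f -> A0 h -> wbd W C f -> wbd W C' h -> wbd W (C * C') (lmul f h).
    by move=> hf hh; exact: (wbd_lmul Wpos WD (A0_nul hf) (A0_nul hh)).
  have sumW F G C C' : (forall j, A0 (F j)) -> (forall j, A0 (G j)) -> 0 <= C -> 0 <= C' ->
      (forall j, wbd W C (F j)) -> (forall j, wbd W C' (G j)) -> wbd W (C * C') (lsum r F G).
    move=> hF hG h1 h2 h3 h4; apply: (wbd_sum Wpos) => [|j _]; first exact: mulr_ge0.
    exact: mulW.
  pose C1 := Cq * (Cb * Cw).
  have hw' i : wbd W C1 (w' i).
    by apply: mulW => //; [exact: lsum_A0|exact: sumW].
  have C10 : 0 <= C1 := wbd_ge0 Wpos (hw' 0%N).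
  pose C2 := Num.max (Num.max Cb (C1 * Cs)) C1.
  have hWm i l : wbd W C2 (Wm i l).
    case: l => [|l]; first by apply: wbd_mono (hw' i); rewrite /C2 le_max lexx orbT.
    apply: wbdB => //; first by apply: wbd_mono (bW i l); rewrite /C2 !le_max lexx.
    by apply: (wbd_mono (C := C1 * Cs)); [rewrite /C2 !le_max lexx orbT|apply: mulW => //; exact: hCs].
  have C20 : 0 <= C2 := wbd_ge0 Wpos (hWm 0%N 0%N).
  exists (Cv * Num.max (Cl * C2) C2) => k l; apply: mulW => //.
  case: k => [|k] /=; last by apply: wbd_mono (hWm k l); rewrite le_max lexx orbT.
  apply: (wbd_mono (C := Cl * C2)); first by rewrite le_max lexx.
  by apply: sumW => // j; exact: hWm.
move=> d x m d0 hx; have tx : tors x by exists d.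
pose Lam : pt -> imx Cp := fun y k j => if k is k'.+1 then (k' == j)%:R else leval (lt j) y.
have Lr y : tors y -> rnull (Lam y).
  move=> hy; split=> [[|k] j|[|k]] /=; [exact: le1|exact: pabs_nat| |].
    apply: pnull_nat => e e0; exists r => j hj; rewrite /Lam /= ltr // leval0 pabs0; exact: ltW.
  by apply: (pnull_fin (F := [fset k]%fset)) => j; rewrite inE eq_sym /Lam => /negbTE ->.
have Wc y : tors y -> cnull (mat_at Wm y).
  move=> hy; split=> [i j|e e0]; first exact: le1.
  have [N hN] := Wmn e e0; exists N => i j hj.
  by apply: (leval_le q1) => //; [exact: ltW|exact: A0_nul (WmA i j)|exact: hN].
have BBE y : tors y -> mat_at BB y = imxmul (Lam y) (mat_at Wm y).
  move=> hy; apply/funext => -[|k]; apply/funext => l; rewrite /imxmul /mat_at /=.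
    rewrite lsum_evE // (nasum_nat_fin (N := r)) // => j hj.
    by rewrite ltr // leval0 mul0r.
  rewrite (nasum_fin (F := [fset k]%fset)) => [|j]; first by rewrite big_seq_fset1 eqxx mul1r.
  by rewrite inE eq_sym => /negbTE ->; rewrite mul0r.
have bE y : tors y -> mat_at b y = imxmul (mat_at Wm y) (Lam (frb q y)).
  move=> hy; have hy' := tfrb y hy; apply/funext => i; apply/funext => j; rewrite /imxmul.
  rewrite (nasum_nat_fin (N := j.+2)) => [|l]; last first.
    by case: l => [//|l] hl; rewrite /= gtn_eqF ?mulr0.
  rewrite big_ord_recl /= (bigD1 (Ordinal (ltnSn j))) //= big1 => [|l /eqP hl]; last first.
    rewrite /bump /= add1n /=; case: eqP => [e|_]; last by rewrite mulr0.
    by case: hl; apply: val_inj.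
  rewrite /bump /= add1n /= eqxx mulr1 addr0 /mat_at /= /D.
  rewrite (levalB q1 (A0_nul (bA i j)) (A0_nul (A0_lmul (w'A i) (slA j))) hy) lmul_ev // lsigma_ev //.
  by rewrite addrC subrK.
have Zr y : tors y -> rnull (mat_at Z y).
  move=> hy; apply: cnull_rnull; split=> [i j|e e0]; first exact: le1.
  have [N hN] := Wmn e e0; exists N => k l hl; rewrite /mat_at Zx //; apply: pabsMl_le; first by rewrite cm1.
  by apply: (leval_le q1) => //; [exact: ltW|exact: A0_nul (BBA k l)|apply: BBle; [exact: ltW|exact: hN]].
rewrite -(chain_swap q1 (F := Lam) (Y := mat_at Wm) (A := mat_at BB) Lr Wc BBE bE d0 hx).
have BBZ y : tors y -> mat_at BB y = fun i j => (c * monom y v) * mat_at Z y i j.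
  move=> hy; apply/funext => i; apply/funext => j; rewrite /mat_at Zx // monomN; last exact: (tors_torus q1).
  have nz : monom y v != 0 by rewrite -(pabs_gt0 (monom y v)) mono1.
  by field; rewrite c0 nz.
have chE e y : tors y -> chain q (mat_at BB) e y = chain q (fun y i j => (c * monom y v) * mat_at Z y i j) e y.
  by elim: e y => [//|e IH] y hy /=; rewrite BBZ // IH //; exact: tfrb.
rewrite chE // (chain_scale (c := fun y => c * monom y v)) //; last first.
  by move=> y hy; rewrite pabsM c1 mono1 // mulr1.
rewrite fredholm_scale.
- by rewrite big_split /= prodr_const card_ord.
- apply: chain_cnull => // y hy; split=> [i j|e e0]; first exact: le1.
  have [N hN] := Wmn e e0; exists N => k l hl; rewrite /mat_at Zx //; apply: pabsMl_le; first by rewrite cm1.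
  by apply: (leval_le q1) => //; [exact: ltW|exact: A0_nul (BBA k l)|apply: BBle; [exact: ltW|exact: hN]].
- by apply: pabs_prod_le1 => j _; rewrite pabsM c1 mono1 ?mulr1 //; exact: tors_frb.
Qed.
End NormalForm.

(** * Logarithmic weights *)

Section PolynomialWeights.
Variables (RR : realType) (n : nat).
Local Notation expo := (expo n).
Implicit Types (u v : expo) (de ka : RR).

Lemma usizeD u v : (usize (u + v)%R <= usize u + usize v)%N.
Proof.
rewrite /usize -big_split /=; apply: leq_sum => i _.
have -> : (u + v : expo)%R ord0 i = u ord0 i + v ord0 i by rewrite !mxE.
by lia.
Qed.

Lemma usize_mul q u : usize (u *+ q)%R = (usize u * q)%N.
Proof.
rewrite /usize big_distrl; apply: eq_bigr => i _.
by rewrite -[(u *+ q)%R]/(qmul q u) qmulE abszM.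
Qed.

Definition pwt de ka u : RR := (1 + de * (usize u)%:R) `^ ka.

Lemma pwt_base de u : 0 <= de -> 1 <= 1 + de * (usize u)%:R.
Proof. by move=> d0; rewrite lerDl mulr_ge0. Qed.

Lemma pwt0 de ka : pwt de ka 0 = 1.
Proof.
rewrite /pwt (_ : usize (0 : expo) = 0%N) ?mulr0 ?addr0 ?powR1 //.
by apply: big1 => i _; rewrite mxE.
Qed.

Lemma pwt_gt0 de ka u : 0 <= de -> 0 < pwt de ka u.
Proof. by move=> d0; rewrite powR_gt0 // (lt_le_trans ltr01) // pwt_base. Qed.

Lemma pwt_le de ka u (x : RR) : 0 <= ka -> 0 <= de -> 1 + de * (usize u)%:R <= x -> pwt de ka u <= x `^ ka.
Proof.
move=> k0 d0 h; have b := pwt_base u d0; apply: ge0_ler_powR => //.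
  by rewrite nnegrE (le_trans _ b).
by rewrite nnegrE (le_trans _ (le_trans b h)).
Qed.

Lemma pwtD de ka u v : 0 <= ka -> 0 <= de -> pwt de ka (u + v) <= pwt de ka u * pwt de ka v.
Proof.
move=> k0 d0; have b1 := pwt_base u d0; have b2 := pwt_base v d0.
rewrite /pwt -powRM ?(le_trans ler01) //; apply: pwt_le => //.
have h : ((usize (u + v)%R)%:R : RR) <= (usize u)%:R + (usize v)%:R by rewrite -natrD ler_nat usizeD.
have := ler_wpM2l d0 h; have := mulr_ge0 (mulr_ge0 d0 (ler0n RR (usize u))) (mulr_ge0 d0 (ler0n RR (usize v))).
by rewrite mulrDr mulrDl mul1r mulrDr mulr1; lra.
Qed.

(** The ratio tends to q^(-ka) as |u| grows; taking mu above 1/q leaves room for the shift by v. *)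
Lemma pwt_scale de ka q u v mu : 0 < ka -> 0 < de -> 1 < mu * q%:R -> 0 < mu ->
  1 + de * (usize v)%:R <= de * (usize u)%:R * (mu * q%:R - 1) ->
  pwt de ka (u + v) / pwt de ka (u *+ q) <= mu `^ ka.
Proof.
move=> k0 d0 h mu0 hu; rewrite ler_pdivrMr ?pwt_gt0 ?(ltW d0) //.
rewrite [X in _ * X]/pwt -powRM ?(ltW mu0) ?(le_trans ler01 (pwt_base _ (ltW d0))) //.
apply: pwt_le; rewrite ?(ltW k0) ?(ltW d0) //.
have hs : ((usize (u + v)%R)%:R : RR) <= (usize u)%:R + (usize v)%:R by rewrite -natrD ler_nat usizeD.
have := ler_wpM2l (ltW d0) hs; rewrite usize_mul natrM => h1.
move: hu; rewrite !mulrDr !mulr1 mulrN1 => hu.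
have -> : mu * (de * ((usize u)%:R * q%:R)) = de * (usize u)%:R * (mu * q%:R) by ring.
by move: h1; rewrite mulrDr; lra.
Qed.

Lemma nat_large (x y : RR) : 0 < y -> exists N : nat, forall m : nat, (N <= m)%N -> x <= y * m%:R.
Proof.
move=> y0; exists (Num.truncn (x / y)).+1 => m hm; rewrite mulrC -ler_pdivrMr //.
by apply: le_trans (ltW (truncnS_gt _)) _; rewrite ler_nat.
Qed.

Lemma pwt_decay de ka q mu : 0 < ka -> 0 < de -> 1 < mu * q%:R -> 0 < mu ->
  forall v, exists s : seq expo, forall u, u \notin s -> pwt de ka (u + v) / pwt de ka (u *+ q) <= mu `^ ka.
Proof.
move=> k0 d0 h mu0 v; have h' : 0 < de * (mu * q%:R - 1) by rewrite mulr_gt0 // subr_gt0.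
have [N hN] := nat_large (1 + de * (usize v)%:R) h'.
have [F hF] := usize_small n N; exists (enum_fset F) => u hu.
apply: pwt_scale => //; have -> : de * (usize u)%:R * (mu * q%:R - 1) = de * (mu * q%:R - 1) * (usize u)%:R by ring.
by apply: hN; rewrite leqNgt; apply: contra hu => /hF.
Qed.

Lemma powR_small (be e : RR) : 0 < be -> 0 < e -> exists N : nat, forall m : nat, (N <= m)%N -> (1 + m%:R) `^ (- be) <= e.
Proof.
move=> b0 e0; have [N hN] := nat_large (e^-1 `^ be^-1) ltr01; exists N => m hm.
have x0 : 0 <= e^-1 `^ be^-1 by exact: powR_ge0.
have h : e^-1 `^ be^-1 <= 1 + m%:R by have := hN m hm; lra.
have m0 : 0 < 1 + m%:R :> RR by rewrite ltr_pwDl.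
rewrite powRN -[leRHS]invrK lef_pV2 ?posrE ?invr_gt0 ?powR_gt0 //.
have e2 : e^-1 = (e^-1 `^ be^-1) `^ be.
  by rewrite -powRrM mulVf ?lt0r_neq0 // powRr1 // invr_ge0 ltW.
rewrite e2; apply: ge0_ler_powR => //; first exact: ltW.
by rewrite nnegrE ltW.
Qed.

(** Passing to a smaller exponent turns boundedness into decay, as (1 + |u|)^(ka - ka0) tends to
    0. *)
Lemma pwt_tail ka ka0 C e : 0 < ka -> ka < ka0 -> 0 < e -> exists L, forall u (x : RR), (L <= usize u)%N ->
  x * pwt 1 ka0 u <= C -> x * pwt 1 ka u <= e.
Proof.
move=> k0 kk e0; pose C' := Num.max C 1; have C0 : 0 < C' by rewrite lt_max ltr01 orbT.
have be0 : 0 < ka0 - ka by rewrite subr_gt0.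
have [L hL] := powR_small be0 (divr_gt0 e0 C0).
exists L => u x hu hx; have p0 := pwt_gt0 ka0 u (@ler01 RR).
have := hL _ hu; rewrite opprB.
have b : 1 + (usize u)%:R != 0 :> RR by rewrite gt_eqF // ltr_pwDl.
rewrite powRD ?b ?implybT // powRN.
have e1 : forall k, (1 + (usize u)%:R) `^ k = pwt 1 k u by move=> k; rewrite /pwt mul1r.
rewrite !e1 ler_pdivlMr // => h.
have hx' : x <= C' / pwt 1 ka0 u by rewrite ler_pdivlMr // (le_trans hx) // le_max lexx.
apply: le_trans (ler_wpM2r (ltW (pwt_gt0 ka u ler01)) hx') _.
by apply: le_trans h; rewrite [leRHS]mulrC mulrA mulrAC.
Qed.

Lemma pwt_dom de ka u : 0 <= ka -> 0 <= de -> de <= 1 -> pwt de ka u <= pwt 1 ka u.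
Proof.
by move=> k0 d0 d1; rewrite [leRHS]/pwt; apply: pwt_le => //; rewrite lerD2l ler_wpM2r.
Qed.

(** The size L is fixed before de, so that de can be taken small enough to make the weight nearly 1
    up to L. The decay rate under multiplication by q does not involve de. *)
Lemma pwt_flat ka (L : nat) (t : RR) : 0 < ka -> 1 < t -> exists de, [/\ 0 < de, de <= 1
  & forall u, (usize u <= L)%N -> pwt de ka u <= t].
Proof.
move=> k0 t1; have t0 : 0 < t := lt_trans ltr01 t1.
pose s := t `^ ka^-1; have s1 : 1 < s.
  have := gt0_ltr_powR (r := ka^-1); rewrite invr_gt0 => /(_ k0 1 t).
  by rewrite powR1 !nnegrE ler01 (ltW t0) => /(_ isT isT t1).
have L0 : (0 : RR) < L.+1%:R by [].
exists (Num.min 1 ((s - 1) / L.+1%:R)); split.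
- by rewrite lt_min ltr01 divr_gt0 // subr_gt0.
- by rewrite ge_min lexx.
move=> u hu; have m0 : 0 <= Num.min 1 ((s - 1) / L.+1%:R) by rewrite le_min ler01 divr_ge0 // subr_ge0 ltW.
have -> : t = s `^ ka by rewrite -powRrM mulVf ?gt_eqF // powRr1 // ltW.
apply: pwt_le => //; first exact: ltW.
have h : Num.min 1 ((s - 1) / L.+1%:R) <= (s - 1) / L.+1%:R by rewrite ge_min lexx orbT.
have h1 : ((usize u)%:R : RR) <= L.+1%:R by rewrite ler_nat ltnW.
have := ler_pM m0 (ler0n RR _) h h1; rewrite divfK ?gt_eqF //; lra.
Qed.
End PolynomialWeights.

(** * Weights adapted to the normal form *)

Section Approximation.
Variables (RR : realType) (p q a n : nat) (Cp : padicField RR p) (K : localField Cp q).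
Local Notation V := (@pabs _ _ Cp).
Local Notation laurent := (laurent Cp n).
Local Notation expo := (expo n).
Local Notation pt := 'rV[Cp]_n.
Hypotheses (pp : prime p) (a0 : (0 < a)%N) (hq : q = (p ^ a)%N).
Let q1 : (1 < q)%N := q_gt1 pp a0 hq.
Local Notation A0 := (@A0 _ _ _ _ K n).
Local Notation tors := (@tors _ _ Cp n q).
Local Notation w := (p%:R^-1 : RR).
Variables (ka ka0 C : RR) (Z : bmatrix Cp n).
Hypotheses (k0 : 0 < ka) (kk : ka < ka0).
Hypotheses (ZA : forall k l, A0 (Z k l)) (ZW : forall k l, wbd (@pwt RR n 1 ka0) C (Z k l)).
Hypothesis Z00 : forall u, V (Z 0%N 0%N u - lmon 1 0 u) <= w.
Hypothesis Zl : forall k l u, V (Z k l.+1 u) <= w.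
Hypothesis Zn : forall e, 0 < e -> exists N, forall k l u, (N <= l)%N -> V (Z k l u) <= e.

Let w0 : 0 <= w. Proof. by rewrite invr_ge0. Qed.
Let w2 : w <= 2^-1.
Proof. by rewrite lef_pV2 ?posrE ?ltr0n ?prime_gt0 // ler_nat prime_gt1. Qed.

(** Below the corner the first column is only bounded by 5/4. Giving the rows after the first the
    weight 5/4 restores the value 1 for [theta_] at 0, at the price of a factor 5/4 in [theta_] for
    the other columns. *)
Definition rho_ (i : nat) : RR := if i == 0%N then 1 else 5 / 4.

Definition thsup de j : RR := sup (range (fun ku : nat * expo => V (Z ku.1 j ku.2) * pwt de ka ku.2)).

Definition theta_ de (j : nat) : RR := if j == 0%N then 1 else 5 / 4 * thsup de j.

Lemma Z_tail e : 0 < e -> exists L, forall k l u, (L <= usize u)%N -> V (Z k l u) * pwt 1 ka u <= e.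
Proof.
move=> e0; have [L hL] := @pwt_tail RR n ka ka0 C e k0 kk e0; exists L => k l u hu.
by apply: hL => //; exact: ZW.
Qed.

(** Coefficients of size beyond L have weighted size at most 3/5, and up to L the weight is at most
    6/5. As w <= 1/2, coefficients divisible by pi get at most 1/2 * 6/5 = 3/5, the others at most
    6/5 <= 5/4. The weight of the exponent 0 is exactly 1, which keeps the corner at 1. With the
    factor from [rho_] the later columns reach 5/4 * 3/5 = 3/4 < 1. *)
Lemma Z_flat : exists de, [/\ 0 < de, de <= 1, forall k u, V (Z k 0%N u) * pwt de ka u <= 5 / 4,
  forall u, V (Z 0%N 0%N u) * pwt de ka u <= 1 & forall k l u, V (Z k l.+1 u) * pwt de ka u <= 3 / 5].
Proof.
have [|L hL] := @Z_tail (3 / 5); first by lra.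
have [|de [d0 d1 hd]] := @pwt_flat RR n ka L (6 / 5) k0; first by lra.
exists de; have big k l u : (L <= usize u)%N -> V (Z k l u) * pwt de ka u <= 3 / 5.
  move=> hu; apply: le_trans (hL k l u hu); apply: ler_wpM2l; first exact: pabs_ge0.
  by apply: pwt_dom => //; exact: ltW.
have small k l u c : 0 <= c -> V (Z k l u) <= c -> (usize u < L)%N -> V (Z k l u) * pwt de ka u <= c * (6 / 5).
  move=> c0 hc hu; apply: ler_pM => //; [exact: pabs_ge0|by rewrite ltW // pwt_gt0 // ltW|].
  by apply: hd; exact: ltnW.
have sm w' : w' <= w -> w' * (6 / 5) <= 3 / 5 by have := w2; lra.
split=> // [k u|u|k l u].
- have [hu|hu] := leqP L (usize u); first by apply: le_trans (big _ _ _ hu) _; lra.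
  by apply: le_trans (small _ _ _ 1 ler01 (A0_le1 (ZA _ _) _) hu) _; lra.
- have [->|u0] := eqVneq u 0; first by rewrite pwt0 mulr1 (A0_le1 (ZA _ _)).
  have [hu|hu] := leqP L (usize u); first by apply: le_trans (big _ _ _ hu) _; lra.
  have h : V (Z 0%N 0%N u) <= w by have := Z00 u; rewrite /lmon (negbTE u0) subr0.
  by apply: le_trans (small _ _ _ _ w0 h hu) _; have := sm w (lexx _); lra.
have [hu|hu] := leqP L (usize u); first exact: big.
by apply: le_trans (small _ _ _ _ w0 (Zl k l u) hu) _; exact: sm.
Qed.

Section Theta.
Variable de : RR.
Hypotheses (d0 : 0 < de) (d1 : de <= 1).
Hypothesis hZ0 : forall k u, V (Z k 0%N u) * pwt de ka u <= 5 / 4.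
Hypothesis hZ00 : forall u, V (Z 0%N 0%N u) * pwt de ka u <= 1.
Hypothesis hZl : forall k l u, V (Z k l.+1 u) * pwt de ka u <= 3 / 5.

Lemma thsup_le j e : (forall k u, V (Z k j u) * pwt de ka u <= e) -> thsup de j <= e.
Proof.
move=> h; apply: ge_sup; first by exists (V (Z 0%N j (0 : expo)) * pwt de ka (0 : expo)), (0%N, 0).
by move=> _ [[k u] _ <-]; exact: h.
Qed.

Lemma thsup_ge j k u : V (Z k j.+1 u) * pwt de ka u <= thsup de j.+1.
Proof. by apply: ub_le_sup; [exists (3 / 5) => _ [[? ?] _ <-]; exact: hZl|exists (k, u)]. Qed.

Lemma thsup_ge0 j : 0 <= thsup de j.+1.
Proof.
by apply: le_trans (thsup_ge j 0%N 0); rewrite mulr_ge0 ?pabs_ge0 // ltW // pwt_gt0 // ltW.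
Qed.

Lemma theta_S j : theta_ de j.+1 <= 3 / 4.
Proof. by have := @thsup_le j.+1 (3 / 5) (fun k u => hZl k j u); rewrite /theta_ /=; lra. Qed.

Lemma theta_ge0 j : 0 <= theta_ de j.
Proof. by case: j => [|j]; rewrite /theta_ //= mulr_ge0 ?thsup_ge0 //; lra. Qed.

Lemma theta_lim mu : 0 < mu -> exists J, forall j, (J <= j)%N -> theta_ de j <= mu.
Proof.
move=> mu0; have e0 : 0 < 4 / 5 * mu by rewrite mulr_gt0 //; lra.
have [L hL] := Z_tail e0.
have P0 : 0 < (1 + L%:R : RR) `^ ka by rewrite powR_gt0 // ltr_pwDl.
have [J hJ] := Zn (divr_gt0 e0 P0); exists J.+1 => -[//|j] hj; rewrite /theta_ /=.
suff h : thsup de j.+1 <= 4 / 5 * mu by move: h; lra.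
apply: thsup_le => k u; have dom := pwt_dom u (ltW k0) (ltW d0) d1.
apply: le_trans (ler_wpM2l (pabs_ge0 _) dom) _.
have [hu|hu] := leqP L (usize u); first exact: hL.
have h1 : V (Z k j.+1 u) <= 4 / 5 * mu / (1 + L%:R) `^ ka by apply: hJ; exact: leq_trans hj.
have h2 : pwt 1 ka u <= (1 + L%:R) `^ ka.
  by apply: pwt_le => //; [exact: ltW|rewrite mul1r lerD2l ler_nat ltnW].
apply: le_trans (ler_pM (pabs_ge0 _) (ltW (pwt_gt0 _ _ ler01)) h1 h2) _.
by rewrite divfK // gt_eqF.
Qed.

Lemma Z_theta k l u : V (Z k l u) * pwt de ka u <= rho_ k / rho_ l * theta_ de l.
Proof.
case: l => [|l]; rewrite /theta_ /rho_ /=.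
  by rewrite divr1 mulr1; case: eqP => [->|_]; [exact: hZ00|exact: hZ0].
have := thsup_ge l k u; have := thsup_ge0 l; case: eqP => _ h1 h2.
  by apply: le_trans h2 _; rewrite div1r mulrA mulVf ?mul1r //; lra.
by rewrite divff ?mul1r; lra.
Qed.

(** Indices and exponents are both truncated. Truncation preserves the weighted bounds term by term,
    and the error at torsion points is at most e for every number of factors along the orbit. *)
Lemma Z_approximable : approximable q w (lfR K) (@pwt RR n de ka) (theta_ de) rho_
  (fun x d => fredholm (chain q (mat_at Z) d x)).
Proof.
move=> D0 N e e0; have [r hr] := Zn e0.
(* The value [maxn L 1] puts the exponent 0 in F0, where the corner has its term congruent to 1. *)
have [L hL] := Z_tail e0; have [F0 hF0] := usize_small n (maxn L 1).
have Zu k l u : u \notin F0 -> V (Z k l u) <= e.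
  move=> hu; have hs : (L <= usize u)%N.
    by rewrite leqNgt; apply: contra hu => h; apply: hF0; rewrite leq_max h.
  apply: le_trans (hL k l u hs); rewrite ler_peMr ?pabs_ge0 //.
  rewrite /pwt -[leLHS](powRr0 (1 + 1 * (usize u)%:R)); apply: ler_powR; first exact: pwt_base.
  exact: ltW.
have F00 : 0 \in F0.
  by apply: hF0; rewrite (_ : usize (0 : expo) = 0%N) ?leq_max ?orbT // /usize big1 // => i _; rewrite mxE.
pose Z' (x : pt) : 'M[Cp]_r.+1 := \matrix_(k, l) \sum_(u <- F0) Z k l u * monom x u.
have Z1 x : tors x -> forall k l, V (Z' x k l) <= 1.
  move=> hx k l; rewrite mxE; apply: pabs_sum => // u _; rewrite pabsM (monom_tors q1) // mulr1.
  exact: A0_le1 (ZA k l) u.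
exists r, Z'; split; last first.
  move=> d x m /andP[d0' _] hx _; have tx : tors x by exists d.
  have mA y : tors y -> cnull (mat_at Z y).
    move=> hy; split=> [i j|e' e0']; first by apply: (leval_le1 pp a0 hq).
    have [N' hN] := Zn e0'; exists N' => i j hj.
    by apply: (leval_le q1) => //; [exact: ltW|exact: A0_nul (ZA i j)|move=> u; exact: hN].
  have ap y : tors y -> apx e (mat_at Z y) (Z' y).
    move=> hy; split=> [i j|i j hj].
      rewrite mxE; apply: nasum_sub; [exact: (nul_mon q1 (A0_nul (ZA i j)))|exact: ltW|].
      by move=> u hu; rewrite pabsM (monom_tors q1) // mulr1; exact: Zu.
    apply: (leval_le q1) => //; [exact: ltW|exact: A0_nul (ZA i j)|].
    by move=> u; apply: hr; exact: ltnW.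
  rewrite pabsBC; rewrite -(prednK d0').
  have [h1 h2] := chain_apx d.-1 (ltW e0) (fun y hy => cnull_rnull (mA y hy)) Z1 ap tx.
  rewrite pabsBC; rewrite pabsBC; apply: fredholm_apx => //; last exact: ltW.
  by apply: chain_cnull.
split=> [k l|d x d0' hx]; last first.
  have tx : tors x by exists d.
  split=> [||k l l0]; first exact: Z1.
    have -> : Z' x 0 0 - 1 = \sum_(u <- F0) (Z 0%N 0%N u - lmon 1 0 u) * monom x u.
      under eq_bigr do rewrite mulrBl; rewrite sumrB mxE; congr (_ - _).
      rewrite (bigD1_seq 0) ?fset_uniq //= /lmon eqxx mul1r monom0 big1 ?addr0 // => u /negbTE ->.
      by rewrite mul0r.
    apply: pabs_sum => // u _; rewrite pabsM (monom_tors q1) // mulr1; exact: Z00.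
  rewrite mxE; apply: pabs_sum => // u _; rewrite pabsM (monom_tors q1) // mulr1.
  by case: l l0 => [[|l] hl] //= _; exact: Zl.
exists [seq (Z k l u, u) | u <- enum_fset F0] => [t /mapP[u _ ->]|x hx] /=.
  by split; [have [h _] := (A0P _ _).1 (ZA k l)|exact: Z_theta].
by rewrite /lev big_map mxE.
Qed.
End Theta.

Variables (c : Cp) (v : expo) (r0 : int) (mu : RR).
Hypotheses (kc : lfR K c) (c1 : V c = 1) (mu0 : 0 < mu) (mq : 1 < mu * q%:R).

Theorem normal_family : let D := fun x d => fredholm (chain q (mat_at Z) d x) in
  let L := Lser q w c v D in
  (exists W theta rho, approximable q w (lfR K) W theta rho D) /\ exists f2 : int -> ps Cp,
  [/\ forall k, f2 k 0%N = 1, tame q (lfR K) r0 (mu `^ ka) f2, ucont q r0 f2,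
      tame q (lfR K) r0 (mu `^ ka) (fun k => psmul (L k) (f2 k)) & ucont q r0 (fun k => psmul (L k) (f2 k))].
Proof.
have [de [d0 d1 h1 h2 h3]] := Z_flat.
have c0 : c != 0 by rewrite -(pabs_gt0 c) c1.
have vth1 : (3 / 4 : RR) < 1 by lra.
have rho0 i : 0 < rho_ i by rewrite /rho_; case: ifP => _; lra.
split; first by exists (pwt de ka), (theta_ de), rho_; exact: (Z_approximable d0 h1 h2 h3).
exact: (core_family pp a0 hq w0 (p1 RR pp) (lfR_sub K) (@lfR_le1 _ _ _ _ K) (@lfR_closed _ _ _ _ K) v r0
  kc (lfR_V kc c1) c0 (residue_pow kc c1) (pwt0 n de ka) (fun u => pwt_gt0 ka u (ltW d0))
  (fun u u' => pwtD u u' (ltW k0) (ltW d0)) (erefl : theta_ de 0 = 1) (theta_ge0 d0 h3) vth1 (theta_S h3)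
  (theta_lim d0 d1) rho0 (powR_gt0 ka mu0) (pwt_decay k0 d0 mq mu0) (Z_approximable d0 h1 h2 h3)).
Qed.
End Approximation.

(** * The Euler product *)

Section EulerProduct.
Variables (RR : realType) (p q a n : nat) (Cp : padicField RR p) (K : localField Cp q).
Local Notation V := (@pabs _ _ Cp).
Local Notation laurent := (laurent Cp n).
Local Notation expo := (expo n).
Local Notation pt := 'rV[Cp]_n.
Local Notation kpt := 'rV[kap Cp]_n.
Hypotheses (pp : prime p) (a0 : (0 < a)%N) (hq : q = (p ^ a)%N).
Let q1 : (1 < q)%N := q_gt1 pp a0 hq.
Local Notation tors := (@tors _ _ Cp n q).
Local Notation w := (p%:R^-1 : RR).
Variable M : sigmaModule K n.
Local Notation std := (std_matrix M).
Variables (c : Cp) (v : expo) (D : pt -> nat -> ps Cp).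
Variables (W : expo -> RR) (theta rho : nat -> RR).
Hypotheses (kc : lfR K c) (c1 : V c = 1).
Hypothesis happ : approximable q w (lfR K) W theta rho D.
Hypothesis hstd : forall d x m, (0 < d)%N -> tor q d x ->
  fredholm (chain q (mat_at std) d x) m = (c ^+ d * chi q v d x) ^+ m * D x d m.
Hypothesis hone : forall P, closed_point q P -> exists2 s, unit_rzeros (det_point q std P) s & size s = 1%N.

Let w0 : 0 <= w. Proof. by rewrite invr_ge0. Qed.
Let w1 : w < 1. Proof. exact: p1. Qed.
Local Notation rt := (uroot q w c v D).
Local Notation cps := (@cpset RR p q n Cp).
Local Notation R P := (rt (teich q P) (cp_deg P)).

(** The determinant of M is D with T scaled by c^d chi(x), and the unit reciprocal zeros are scaled
    accordingly. *)
Lemma std_zero d x y : (0 < d)%N -> tor q d x -> V y = 1 ->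
  ps_val (fredholm (chain q (mat_at std) d x)) y^-1 = 0 -> y = rt x d.
Proof.
move=> d0 hx y1; set be := c ^+ d * chi q v d x.
have be1 : V be = 1.
  by rewrite /be pabsM pabsX c1 expr1n mul1r (chi_abs pp a0 hq v d0 hx).
have be0 : be != 0 by rewrite -(pabs_gt0 be) be1.
have y0 : y != 0 by rewrite -(pabs_gt0 y) y1.
have -> : ps_val (fredholm (chain q (mat_at std) d x)) y^-1 = ps_val (D x d) (y / be)^-1.
  rewrite /ps_val; apply: eq_nasum => m; rewrite hstd // -/be invf_div.
  have -> : (be / y) ^+ m = be ^+ m * y^-1 ^+ m by exact: exprMn.
  by rewrite mulrA [D x d m * _]mulrC.
have yb : V (y / be) = 1 by rewrite pabsM pabsV be1 invr1 mulr1.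
by move/(al_unique w0 w1 happ d0 hx yb); rewrite /uroot -/be => <-; rewrite mulrC divfK.
Qed.

(** Every entry of the list equals the root by [std_zero]; ordinarity provides a list in which its
    multiplicity is one, and multiplicities are unique. *)
Lemma rzeros_uniq P s : closed_point q P -> unit_rzeros (det_point q std P) s -> s = [:: R P].
Proof.
move=> hP; have [t tt _ d0] := teichP pp a0 hq hP.
have zero y k : V y = 1 -> rzero_mult (det_point q std P) y k.+1 -> y = R P.
  move=> y1 h; have y0 : y != 0 by rewrite -(pabs_gt0 y) y1.
  by have := rzero_val y0 h; rewrite det_pointE; exact: std_zero.
have only s' y : unit_rzeros (det_point q std P) s' -> y \in s' -> y = R P.
  move=> [h1 h2] ys; have := h2 y (h1 y ys); have : (0 < count_mem y s')%N by rewrite -has_count has_pred1.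
  by case: (count_mem y s') => // k _ h; exact: zero (h1 y ys) h.
have [s0 hs0 sz] := hone hP; case: s0 sz hs0 => [|r0 [|]] // _ hs0.
have r1 : V r0 = 1 by case: hs0 => h _; apply: h; rewrite inE.
have m1 : rzero_mult (det_point q std P) r0 1.
  by case: hs0 => _ h2; have := h2 r0 r1; rewrite /= eqxx.
have e0 : r0 = R P by apply: (only _ _ hs0); rewrite inE.
move=> hs; have r0' : r0 != 0 by rewrite -(pabs_gt0 r0) r1.
have cnt : count_mem r0 s = 1%N.
  by case: (hs) => _ h2; exact: (rzero_mult_uniq r0' (h2 r0 r1) m1).
have alls : all (pred1 r0) s by apply/allP => y ys /=; rewrite e0; apply/eqP; exact: only hs ys.
move: cnt; rewrite (all_pred1P _ _ alls) count_nseq /= eqxx mul1n => ->.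
by rewrite e0.
Qed.

Lemma unit_rootsE P : closed_point q P -> unit_roots M P = [:: R P].
Proof.
move=> hP; rewrite /unit_roots; case: xgetP => [s _ hs|h]; first exact: rzeros_uniq.
by have [s hs _] := hone hP; case: (h s).
Qed.

(** The power sums whose exponential is the Euler factor at P, as in [geomT_pexp]; sets that are not
    closed points contribute the trivial factor. *)
Definition locps k (P : set kpt) : nat -> Cp := fun m =>
  if pselect (closed_point q P) then
    if (cp_deg P %| m)%N then (cp_deg P)%:R * (R P ^ k) ^+ (m %/ cp_deg P) else 0
  else 0.

Lemma eulerE k P : euler M k P = pexp (locps k P).
Proof.
rewrite /euler /locps; case: pselect => hP; last by rewrite pexp0.
have [_ _ _ d0] := teichP pp a0 hq hP.
by rewrite unit_rootsE // big_seq1 geomT_pexp.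
Qed.

(** At a torsion point whose degree divides j, the root for j is the power of exponent j / degree of
    the root at its closed point, and the closed point is counted with its degree. *)
Lemma powsum_locps k j (F : {fset set kpt}) : (0 < j)%N -> (cps j `<=` F)%fset ->
  \sum_(P <- F) locps k P j = powsum q w c v D k j.
Proof.
move=> j0 hF.
have hf x : tor q j x -> rt (frb q x) j ^ k = rt x j ^ k.
  by move=> hx; rewrite (uroot_frb pp a0 hq c v happ).
rewrite /powsum (tsum_orbits pp a0 hq j0 hf) -(big_fset_incl _ hF) /=; last first.
  move=> P _ nP; rewrite /locps; case: pselect => // hP; case: ifP => // dP.
  by case/negP: nP; apply/(cpsetP pp a0 hq _ j0).
apply: eq_big_seq => P /(cpsetP pp a0 hq _ j0)[hP dP]; rewrite /locps; case: pselect => // hP'.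
have [_ ht _ d0] := teichP pp a0 hq hP; rewrite dP; congr (_ * _).
have j1 : (0 < j %/ cp_deg P)%N by rewrite divn_gt0 // dvdn_leq.
rewrite -{2}(divnK dP) mulnC (uroot_pow pp a0 hq w0 w1 c v happ) //.
by rewrite !exprnP !exprz_exp mulrC.
Qed.

(** The coefficient of T^m involves only closed points of degree at most m, so it is constant once F
    contains these. A common enlargement of two finite sets shows that the chosen limit is the right
    one. *)
Lemma unit_root_zetaE k : unit_root_zeta M k = Lser q w c v D k.
Proof.
apply/funext => m; pose G : {fset set kpt} := (\bigcup_(j <- iota 1 m) cps j)%fset.
have hG (F : {fset set kpt}) : (G `<=` F)%fset -> (\big[@psmul _ _ Cp/@ps1 _ _ Cp]_(P <- F) euler M k P) m = Lser q w c v D k m.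
  move=> GF; under eq_bigr do rewrite eulerE; rewrite -pexp_sum; apply: eq_pexp_le => j /andP[j0 jm].
  apply: powsum_locps => //; apply: fsubset_trans GF; apply: bigfcup_sup => //.
  by rewrite mem_iota j0 add1n ltnS.
rewrite /unit_root_zeta; case: xgetP => [l _ [F _ hF]|h].
  have := hF (F `|` G)%fset; rewrite /= fsubsetUl => /(_ isT) <-.
  by rewrite hG // fsubsetUr.
by case: (h (Lser q w c v D k m)); exists G.
Qed.
End EulerProduct.

Section MatrixDecay.
Variables (RR : realType) (p q a n : nat) (Cp : padicField RR p) (K : localField Cp q).
Local Notation V := (@pabs _ _ Cp).
Hypotheses (pp : prime p) (a0 : (0 < a)%N) (hq : q = (p ^ a)%N).
Let q1 : (1 < q)%N := q_gt1 pp a0 hq.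
Variable M : sigmaModule K n.
Variables (J : set nat) (f : nat -> vec Cp n) (b : bmatrix Cp n).
Hypotheses (hB : is_basis M J f) (hb : is_matrix M J f b).

(** The vectors phi(f_j) tend to 0 in norm: the standard columns are small beyond some L, and for
    the finitely many l < L the entries F_lj tend to 0 with j. The isometry of the basis transfers
    this to coordinates. *)
Lemma bmatrix_null e : 0 < e -> exists N, forall i j u, (N <= j)%N -> V (b i j u) <= e.
Proof.
move=> e0; have e0' := ltW e0; have [L hL] := std_null M e0.
have [N hN] : exists N, forall l, (l < L)%N -> forall j, (N <= j)%N -> forall x, tors q x -> V (bmat J f x l j) <= e.
  elim: L {hL} => [|L [N IH]]; first by exists 0%N.
  have [N' hN'] := bmat_null pp a0 hq hB L e0; exists (maxn N N') => l.
  rewrite ltnS leq_eqVlt => /predU1P[->|hl] j; rewrite geq_max => /andP[h1 h2]; first exact: hN'.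
  exact: IH.
exists N => i j u hj; have [hJ|hJ] := pselect (J j); last first.
  by have [_ h] := hb; rewrite h // pabs0.
have pf := smphi_M (f_formal hB hJ); have pA := formal_A0 pf.
apply: (coord_iso pp a0 hq hB e0' (bmat_formal hb j) pf (b_coord pp a0 hq hB hb hJ)) => k.
apply/(A0_pt_le pp a0 hq e0' (pA k)) => x hx; have hx' : tors q (frb q x) by exact: tors_frb.
have fA := formal_A0 (f_formal hB hJ).
rewrite (phi_eval pp a0 hq) //; last exact: (f_formal hB hJ).
apply: nasum_le => //.
  apply: (@mul_null _ _ _ (mat_at (std_matrix M) x) (fun l _ => leval (f j l) (frb q x)) k 0%N).
    exact/cnull_rnull/(std_cnull pp a0 hq).
  by move=> ? ?; exact: (leval_le1 pp a0 hq).
move=> l; have [lL|Ll] := ltnP l L.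
  apply: pabsMl_le; first by apply: (leval_le1 pp a0 hq) => //; exact: std_A0.
  by have := hN l lL j hj _ hx'; rewrite /bmat basE.
apply: pabsMr_le; last exact: (leval_le1 pp a0 hq).
apply: (leval_le q1) => //; first exact: A0_nul (std_A0 M k l).
exact: hL.
Qed.
End MatrixDecay.

(** * Logarithmic decay and analyticity *)

Section LogBounds.
Variables (RR : realType) (p q n : nat) (Cp : padicField RR p).
Local Notation V := (@pabs _ _ Cp).
Hypotheses (pp : prime p) (q1 : (1 < q)%N).

Lemma lnp_gt0 : 0 < ln (p%:R : RR).
Proof. by rewrite ln_gt0 // ltr1n prime_gt1. Qed.

Lemma lnq_gt0 : 0 < ln (q%:R : RR).
Proof. by rewrite ln_gt0 // ltr1n. Qed.

Lemma ordpi_le_pabs (x : Cp) (t : RR) : (t%:E <= ordpi x)%E -> V x <= p%:R `^ (- t).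
Proof.
rewrite /ordpi; case: eqP => [-> _|/eqP x0]; first by rewrite pabs0 powR_ge0.
have vx : 0 < V x by rewrite pabs_gt0.
rewrite lee_fin -mulNr ler_pdivlMr ?lnp_gt0 // => h.
have pr : 0 < p%:R `^ (- t) :> RR by rewrite powR_gt0 // ltr0n prime_gt0.
by rewrite -ler_ln ?posrE // ln_powR mulNr lerNr.
Qed.

Lemma pabs_ordpi_ge (x : Cp) (t : RR) : V x <= p%:R `^ (- t) -> (t%:E <= ordpi x)%E.
Proof.
rewrite /ordpi; case: eqP => [-> _|/eqP x0]; first by rewrite leey.
have vx : 0 < V x by rewrite pabs_gt0.
have pr : 0 < p%:R `^ (- t) :> RR by rewrite powR_gt0 // ltr0n prime_gt0.
by rewrite -ler_ln ?posrE // ln_powR mulNr lerNr lee_fin -mulNr ler_pdivlMr ?lnp_gt0.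
Qed.

Lemma log_bound (b : bmatrix Cp n) (c c' : RR) : (forall i j u, V (b i j u) <= 1) -> 0 < c' -> c' < c ->
  (c%:E <= limf_einf (fun u : discrete_topology (expo n) =>
         ord_coef b u * ((ln (usize u)%:R / ln q%:R)^-1)%:E) (@usize_oo n))%E ->
  exists C, forall i j, wbd (@pwt RR n 1 (c' * (ln p%:R / ln q%:R))) C (b i j).
Proof.
move=> b1 c0 cc; rewrite limf_einfE => h.
have cE : (c'%:E < c%:E)%E by rewrite lte_fin.
have [_ [U [N _ hU] <-] hinf] := ereal_sup_gt (lt_le_trans cE h).
(* Size at least 2 makes ln |u| positive, so that the quotient can be cleared. *)
pose ka0 := c' * (ln p%:R / ln q%:R); pose N0 := maxn N 2.
have k0 : 0 < ka0 by rewrite mulr_gt0 // divr_gt0 ?lnp_gt0 ?lnq_gt0.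
exists (Num.max (2 `^ ka0) ((1 + N0%:R) `^ ka0)) => i j u.
have [hu|hu] := leqP N0 (usize u); last first.
  apply: le_trans (ler_pM (pabs_ge0 _) (ltW (pwt_gt0 _ _ ler01)) (b1 i j u) (_ : _ <= (1 + N0%:R) `^ ka0)) _.
    by apply: pwt_le => //; [exact: ltW|rewrite mul1r lerD2l ler_nat ltnW].
  by rewrite mul1r le_max lexx orbT.
have [uN u2] : (N <= usize u)%N /\ (2 <= usize u)%N by move: hu; rewrite geq_max => /andP[].
have x1 : 1 < (usize u)%:R :> RR by rewrite ltr1n.
have x0 : 0 < (usize u)%:R :> RR by exact: lt_trans x1.
have lg : 0 < ln (usize u)%:R / ln q%:R :> RR by rewrite divr_gt0 ?lnq_gt0 // ln_gt0.
have h1 : (c'%:E <= ord_coef b u * ((ln (usize u)%:R / ln q%:R)^-1)%:E)%E.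
  by apply: le_trans (ltW hinf) _; apply: ge_ereal_inf; exists (ord_coef b u * ((ln (usize u)%:R / ln q%:R)^-1)%:E)%E => //; exists u => //; exact: hU.
rewrite lee_pdivlMr // in h1.
have h2 : ((c' * (ln (usize u)%:R / ln q%:R))%:E <= ordpi (b i j u))%E.
  rewrite EFinM; apply: le_trans h1 _; apply: ge_ereal_inf; exists (ordpi (b i j u)) => //.
  by exists (i, j).
have h3 := ordpi_le_pabs h2.
have e1 : p%:R `^ (- (c' * (ln (usize u)%:R / ln q%:R))) = (usize u)%:R `^ (- ka0) :> RR.
  have P1 : 0 < p%:R `^ (- (c' * (ln (usize u)%:R / ln q%:R))) :> RR by rewrite powR_gt0 // ltr0n prime_gt0.
  have P2 : 0 < (usize u)%:R `^ (- ka0) :> RR by rewrite powR_gt0.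
  apply: ln_inj; rewrite ?posrE // !ln_powR /ka0; field.
  by rewrite gt_eqF // lnq_gt0.
rewrite e1 in h3.
have h4 : pwt 1 ka0 u <= (2 * (usize u)%:R) `^ ka0.
  by apply: pwt_le => //; [exact: ltW|rewrite mul1r; move: x1; lra].
apply: le_trans (ler_pM (pabs_ge0 _) (ltW (pwt_gt0 _ _ ler01)) h3 h4) _.
rewrite powRM ?(ltW x0) // powRN mulrCA mulVf ?mulr1 ?le_max ?lexx //.
by rewrite gt_eqF // powR_gt0.
Qed.

(** The constant C lowers the order per degree by ln C / (m ln p), which the gap c2 - c1 absorbs for
    large m. *)
Lemma tame_analytic (K : localField Cp q) (S : set int) (f : int -> ps Cp) (c1 c2 C lam : RR) :
  c1 < c2 -> lam = p%:R `^ (- c2) -> (forall k m, S k -> V (f k m) <= C * lam ^+ m) ->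
  uniformly_analytic S c1 f.
Proof.
move=> cc hl hC; pose C' := Num.max C 1; have C1 : 1 <= C' by rewrite le_max lexx orbT.
have C0 : 0 < C' := lt_le_trans ltr01 C1.
have p0 : 0 < p%:R :> RR by rewrite ltr0n prime_gt0.
have g0 : 0 < (c2 - c1) * ln p%:R by rewrite mulr_gt0 ?lnp_gt0 // subr_gt0.
have [N hN] := nat_large (ln C') g0.
rewrite /uniformly_analytic -[limn_einf _]/(limf_einf _ \oo) limf_einfE.
apply: le_ereal_sup_tmp; eexists; first by exists [set m | (N.+1 <= m)%N] => //; exists N.+1.
apply: le_ereal_inf_tmp => _ [m /= hm <-].
have m0 : 0 < m%:R :> RR by rewrite ltr0n; case: m hm.
rewrite lee_pdivlMr //; apply: le_ereal_inf_tmp => _ [k hk <-].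
rewrite -EFinM; apply: pabs_ordpi_ge; apply: le_trans (hC k m hk) _.
have lam0 : 0 < lam by rewrite hl powR_gt0.
apply: le_trans (_ : C' * lam ^+ m <= _).
  by apply: ler_wpM2r; [rewrite exprn_ge0 // ltW|rewrite le_max lexx].
rewrite -ler_ln ?posrE ?powR_gt0 ?mulr_gt0 ?exprn_gt0 //.
rewrite lnM ?posrE ?exprn_gt0 // lnXn // hl !ln_powR.
have := hN m (ltnW hm); rewrite -mulr_natr; lra.
Qed.
End LogBounds.

Section PadicInt.
Variables (RR : realType) (p : nat).
Hypothesis pp : prime p.

Lemma padic_int_dvd (z : int) N : padic_int RR p z < p%:R ^- N -> ((p ^ N)%:Z %| z)%Z.
Proof.
rewrite /padic_int; case: eqP => [->|/eqP z0]; first by rewrite dvdz0.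
have p1 : 1 < p%:R :> RR by rewrite ltr1n prime_gt1.
have p0 : 0 < p%:R :> RR by apply: lt_trans p1.
rewrite ltf_pV2 ?posrE ?exprn_gt0 // ltr_eXn2l // => h.
by rewrite dvdzE absz_nat pfactor_dvdn ?(ltnW h) // absz_gt0.
Qed.
End PadicInt.

Theorem theorem6p1 (RR : realType) (p q a n : nat) (hp : prime p)
    (ha : (0 < a)%N) (hq : q = (p ^ a)%N) (hn : (0 < n)%N)
    (Cp : padicField RR p) (K : localField Cp q)
    (M : sigmaModule K n) (c : RR) (hc : 0 < c)
    (hlog : log_convergent M c) (hord : ordinary M 1)
    (eps : RR) (heps : 0 < eps) (r : int) :
  strong_family K (residue_class q r) (c - eps) (unit_root_zeta M).
Proof.
have q1 := q_gt1 hp ha hq.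
have [J [f [b [hB hb hlc]]]] := hlog.
have [Jo [fo [bo [hBo hbo [hphi _] hrz]]]] := hord.
(* Each stage loses a little: c - t for the decay of the matrix, c - 2t for the exponent of the
   weight, c - 3t for the growth of the determinants. Dividing the minimum of eps and c by 4 keeps
   these positive and above c - eps. *)
pose t := Num.min eps c / 4.
have m0 : 0 < Num.min eps c by rewrite lt_min heps.
have t0 : 0 < t by rewrite divr_gt0.
have te : 4 * t <= eps by rewrite /t mulrC divfK // ge_min lexx.
have tc : 4 * t <= c by rewrite /t mulrC divfK // ge_min lexx orbT.
(* This factor converts orders relative to log_q |u| into exponents of |u|. *)
pose s : RR := ln p%:R / ln q%:R.
have s0 : 0 < s by rewrite divr_gt0 ?(lnp_gt0 RR hp) ?(lnq_gt0 RR q1).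
pose ka := (c - 2 * t) * s; pose ka0 := (c - t) * s.
have k0 : 0 < ka by rewrite mulr_gt0 //; lra.
have kk : ka < ka0 by rewrite ltr_pM2r //; lra.
have bA i j : A0 K (b i j) := b_A0 hb i j.
have b1 i j u : pabs (b i j u) <= 1 := A0_le1 (bA i j) u.
have [Cb hCb] : exists C, forall i j, wbd (@pwt RR n 1 ka0) C (b i j).
  by apply: (log_bound hp q1 b1 _ _ hlc); lra.
have [wv [lam [wA lA hbw]]] := b_rank1 hp ha hq hB hb hBo hphi.
have w0 : 0 < p%:R^-1 :> RR by rewrite invr_gt0 ltr0n prime_gt0.
have bn := bmatrix_null hp ha hq hB hb; have [r1 hr1] := bn _ w0.
have hu := ordinary_unit hp ha hq hB hb hBo hbo hrz wA lA hbw hr1.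
have k00 : 0 < ka0 := lt_trans k0 kk.
have [g [v [Z [[kg g1 ZA] z00 zl zn [[Cz zW] hZ]]]]] :=
  normal_form hp ha hq (fun u => pwt_gt0 ka0 u ler01) (fun u u' => pwtD u u' (ltW k00) ler01)
    bA hCb bn wA lA hbw hr1 hu.
(* Since nu < 1, the number mu = q^(-nu) exceeds 1/q, and nu is chosen so that mu^ka = p^(-(c -
   3t)). *)
pose nu := (c - 3 * t) / (c - 2 * t).
have c2 : 0 < c - 2 * t by lra.
have nu1 : nu < 1 by rewrite ltr_pdivrMr //; lra.
have qr : 1 < q%:R :> RR by rewrite ltr1n.
have q0 : 0 < q%:R :> RR by apply: lt_trans qr.
pose mu : RR := q%:R `^ (- nu).
have mu0 : 0 < mu by exact: powR_gt0.
have mq : 1 < mu * q%:R.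
  have -> : mu * q%:R = q%:R `^ (1 - nu).
    by rewrite addrC powRD ?(lt0r_neq0 q0) ?implybT // powRr1 // ltW.
  by rewrite -ltr_ln ?posrE ?powR_gt0 // ln1 ln_powR mulr_gt0 ?ln_gt0 // subr_gt0.
have [[W [th [rh happ]]] [f2 [f20 tf2 uf2 tf1 uf1]]] :=
  normal_family hp ha hq k0 kk ZA zW z00 zl zn v r kg g1 mu0 mq.
set D := (fun x d => fredholm (chain q (mat_at Z) d x)) in happ tf1 uf1.
have hstd d x m : (0 < d)%N -> tor q d x ->
    fredholm (chain q (mat_at (std_matrix M)) d x) m = (g ^+ d * chi q v d x) ^+ m * D x d m.
  by move=> d0 hx; rewrite (fredholm_basis hp ha hq hB hb d0 hx) hZ.
have hone P : closed_point q P -> exists2 s, unit_rzeros (det_point q (std_matrix M) P) s & size s = 1%N.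
  move=> hP; have [_ hx _ d0] := teichP hp ha hq hP; have [ss h1 h2] := hrz P hP.
  have e : det_point q (std_matrix M) P = det_point q bo P.
    by rewrite [LHS]det_pointE [RHS]det_pointE (fredholm_basis hp ha hq hBo hbo d0 hx).
  by exists ss; rewrite ?e.
have zE k : unit_root_zeta M k = Lser q p%:R^-1 g v D k.
  exact: (unit_root_zetaE hp ha hq g1 happ hstd hone).
have hres k : residue_class q r k -> res q r k.
  rewrite /residue_class /= => /eqP; rewrite eqz_mod_dvd => /dvdzP[z ez]; exists z.
  have -> : (q.-1)%:Z = q%:Z - 1 by rewrite -subn1 -subzn // ltnW.
  by rewrite mulrC -ez addrC subrK.
have ue (F : int -> ps Cp) : ucont q r F -> uniformly_continuous (residue_class q r) F.
  move=> hF m e e0; have [N hN] := hF m (e / 2) (divr_gt0 e0 (ltr0Sn _ 1)).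
  exists (p%:R ^- N) => [|k1 k2 hk1 hk2 hd]; first by rewrite invr_gt0 exprn_gt0 // ltr0n prime_gt0.
  have := hN k1 k2 (hres _ hk1) (hres _ hk2) (padic_int_dvd hp hd).
  by move/le_lt_trans; apply; move: e0; lra.
have hlam : mu `^ ka = p%:R `^ (- (c - 3 * t)).
  have P1 : 0 < mu `^ ka by exact: powR_gt0.
  have P2 : 0 < p%:R `^ (- (c - 3 * t)) :> RR by rewrite powR_gt0 // ltr0n prime_gt0.
  apply: ln_inj; rewrite ?posrE // !ln_powR /ka /nu /s; field.
  by rewrite !gt_eqF ?(lnq_gt0 RR q1).
have ta (F : int -> ps Cp) : tame q (lfR K) r (mu `^ ka) F -> uniformly_analytic (residue_class q r) (c - eps) F.
  move=> [C C0 h]; apply: (tame_analytic hp K (c2 := c - 3 * t) (C := C) _ hlam) => [|k m hk]; first by lra.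
  by case: (h k m (hres k hk)).
have tp (F : int -> ps Cp) : (forall k, F k 0%N = 1) -> tame q (lfR K) r (mu `^ ka) F -> ps_family K (residue_class q r) F.
  by move=> F0 [C C0 h] k hk; split=> // m; case: (h k m (hres k hk)).
exists (fun k => psmul (Lser q p%:R^-1 g v D k) (f2 k)), f2; split.
- split; [apply: tp => // k|exact: ue|exact: ta].
  by rewrite psmul0 f20 mulr1 /Lser pexp_0.
- by split; [exact: tp|exact: ue|exact: ta].
by move=> k _; rewrite zE.
Qed.
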